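(* Every topological parallelism or oriented topological parallelism of $\mathrm{PG}(3,\mathbb{R})$ that admits a reducible $\mathrm{SO}_3\mathbb{R}$-action is isomorphic to one of the following examples. (1) The topological (non-oriented) parallelisms $\Omega(\mathcal{C})=\{\omega(\mathcal{C})\mid\omega\in\Omega\}$, where $\mathcal{C}$ is an $\mathrm{O}_2\mathbb{R}$-rotational spread and $\Omega\le\mathrm{AGL}_3\mathbb{R}$, $\Omega\cong\mathrm{SO}_3\mathbb{R}$, is $\mathrm{O}_2\mathbb{R}$-admissible for $\mathcal{C}$. (2) The oriented topological parallelisms $\Omega(\mathcal{C}^+)=\{\omega(\mathcal{C}^+)\mid\omega\in\Omega\}$, where $\mathcal{C}^+$ is one of the two oriented spreads obtained from an $\mathrm{SO}_2\mathbb{R}$-rotational spread $\mathcal{C}$, where $\Omega\le\mathrm{AGL}_3\mathbb{R}$, $\Omega\cong\mathrm{SO}_3\mathbb{R}$, is $\mathrm{SO}_2\mathbb{R}$-admissible for $\mathcal{C}$, and where $\mathcal{C}$ is not $\mathrm{O}_2\mathbb{R}$-rotational or $\Omega$ is not $\mathrm{O}_2\mathbb{R}$-admissible for $\mathcal{C}$.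
   Context: Spreads and orientation. $\mathcal{L}$ is the space of lines of $\mathrm{PG}(3,\mathbb{R})$ (2-dimensional subspaces of $\mathbb{R}^4$) and $\mathcal{L}^+$ the space of oriented lines (2-dimensional subspaces with a vector space orientation), both topologized as coset spaces of $\mathrm{PGL}(4,\mathbb{R})$; forgetting orientation gives a twofold covering $\mathcal{L}^+\to\mathcal{L}$. A compact spread is a compact set of pairwise disjoint lines covering the point set of $\mathrm{PG}(3,\mathbb{R})$; ''spread'' always means compact spread. A spread $\mathcal{C}$ is homeomorphic to the 2-sphere, and its inverse image in $\mathcal{L}^+$ is a disjoint union of two 2-spheres, each mapped homeomorphically onto $\mathcal{C}$; each of these is called an oriented spread (obtained from $\mathcal{C}$). Parallelisms. A topological parallelism is a set of pairwise disjoint compact spreads covering $\mathcal{L}$ that is a compact subset of the hyperspace of compact subsets of $\mathcal{L}$ (Hausdorff topology). An oriented topological parallelism is a compact set (in the corresponding hyperspace for $\mathcal{L}^+$) of pairwise disjoint oriented spreads covering $\mathcal{L}^+$. An isomorphism of parallelisms, of oriented parallelisms, or of spreads is a collineation of $\mathrm{PG}(3,\mathbb{R})$ (element of $\mathrm{PGL}_4\mathbb{R}$) mapping one onto the other. A parallelism or oriented parallelism admits a reducible $\mathrm{SO}_3\mathbb{R}$-action if some subgroup of $\mathrm{PGL}_4\mathbb{R}$ isomorphic to $\mathrm{SO}_3\mathbb{R}$ leaves it invariant and the lifted action (of $\mathrm{Spin}_3$) on $\mathbb{R}^4$ is reducible; equivalently, the lifted action is equivalent to the action $q\mapsto aqa^{-1}$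 of the unit quaternions $a$ on $\mathbb{H}=\mathbb{R}^4$. Rotational spreads. View $\mathbb{R}^3$ as the affine complement of a plane of $\mathrm{PG}(3,\mathbb{R})$. Let $Z$ be the (projective closure of the) $z$-axis and $V$ the line at infinity of the $xy$-plane. For functions $a:(0,\infty)\to(0,\infty)$, $b:(0,\infty)\to\mathbb{R}$ and $r>0$ let $\mathcal{R}_r$ be the right-screwed regulus carried by the hyperboloid $x^2+y^2-(z-b(r))^2/a(r)^2=r^2$, i.e. the set of all images of the line $\{(r,t,b(r)+a(r)t) \mid t\in\mathbb{R}\}$ (projectively closed) under rotations about the $z$-axis. A compact spread is $\mathrm{SO}_2\mathbb{R}$-rotational if it is isomorphic to a compact spread of the form $\{Z,V\}\cup\bigcup_{r>0}\mathcal{R}_r$ for some $a,b$; it is $\mathrm{O}_2\mathbb{R}$-rotational if this is possible with $b$ constant. Admissibility. $\mathrm{AGL}_3\mathbb{R}\le\mathrm{PGL}_4\mathbb{R}$ is the group of affine transformations of $\mathbb{R}^3$. For $\Omega\le\mathrm{AGL}_3\mathbb{R}$ with $\Omega\cong\mathrm{SO}_3\mathbb{R}$ and a spread $\mathcal{C}$, $\Omega$ is called $\Gamma$-admissible for $\mathcal{C}$ (where $\Gamma$ is $\mathrm{SO}_2\mathbb{R}$ or $\mathrm{O}_2\mathbb{R}$) if $\Omega$ contains a subgroup isomorphic to $\Gamma$ under which $\mathcal{C}$ is invariant. Isomorphisms of groups are isomorphisms of topological groups.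
   Formalization: An oriented parallelism may also be isomorphic to the inverse image in the space of oriented lines of an example of type (1); read literally, such inverse images (e.g. of the Clifford parallelism) would be isomorphic to neither (1) nor (2). *)

(* Defs.v *)
From HB Require Import structures.
From mathcomp Require Import all_boot all_order all_algebra generic_quotient.
From mathcomp Require Import all_classical all_reals all_analysis.

Set Implicit Arguments.
Unset Strict Implicit.
Unset Printing Implicit Defensive.

Import Order.TTheory GRing.Theory Num.Theory.
Import numFieldNormedType.Exports.

Local Open Scope classical_set_scope.
Local Open Scope quotient_scope.
Local Open Scope ring_scope.

Definition homeomorphism_on (T U : topologicalType) (A : set T) (B : set U)
    (f : T -> U) : Prop :=
  exists g : U -> T,
    [/\ set_bij A B f, {within A, continuous f},
        {in A, cancel f g} & {within B, continuous g}].

(* The hyperspace of compact subsets of T with the Hausdorff topology. It is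
   expressed without choosing a metric: the entourages {d(x,y) < e} are replaced
   by the neighbourhoods W of the diagonal of T x T. On a compact metrizable
   space (such as both spaces of lines below) these generate the uniformity of
   every compatible metric, so the topology is that of the Hausdorff distance
   for any such metric. *)
Record hyperspace (T : topologicalType) := Hyper {
  hyper_set : set T;
  hyper_compact : compact hyper_set }.

HB.instance Definition _ (T : topologicalType) := gen_eqMixin (hyperspace T).
HB.instance Definition _ (T : topologicalType) := gen_choiceMixin (hyperspace T).

Section Hyperspace.
Variable T : topologicalType.
Implicit Types K : hyperspace T.

Definition hausdorff_close (W : set (T * T)) K : set (hyperspace T) :=
  [set K' | (forall x, hyper_set K x -> exists2 y, hyper_set K' y & W (x, y)) /\
            (forall y, hyper_set K' y -> exists2 x, hyper_set K x & W (x, y))].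

Definition hausdorff_open (U : set (hyperspace T)) : Prop :=
  forall K, U K ->
    exists2 W : set (T * T), (forall x : T, nbhs (x, x) W) & hausdorff_close W K `<=` U.

Lemma hausdorff_closeS (W W' : set (T * T)) K :
  W `<=` W' -> hausdorff_close W K `<=` hausdorff_close W' K.
Proof.
move=> WW' K' [h1 h2]; split=> x /[dup] Kx.
  by move=> /h1[y K'y /WW' ?]; exists y.
by move=> /h2[y Ky /WW' ?]; exists y.
Qed.

Lemma hausdorff_openT : hausdorff_open setT.
Proof. by move=> K _; exists setT => // x; exact: filterT. Qed.

Lemma hausdorff_openI : setI_closed hausdorff_open.
Proof.
move=> U V oU oV K [/oU[W nW WU] /oV[W' nW' WV]].
exists (W `&` W'); first by move=> x; exact: filterI.
move=> K' K'W; split.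
- by apply: WU; exact: (hausdorff_closeS (@subIsetl _ W W') K'W).
- by apply: WV; exact: (hausdorff_closeS (@subIsetr _ W W') K'W).
Qed.

Lemma hausdorff_open_bigU (I : Type) (F : I -> set (hyperspace T)) :
  (forall i, hausdorff_open (F i)) -> hausdorff_open (\bigcup_i F i).
Proof.
move=> oF K [i _ /oF[W nW WF]]; exists W => // K' /WF FK'; by exists i.
Qed.

HB.instance Definition _ := isOpenTopological.Build (hyperspace T)
  hausdorff_openT hausdorff_openI hausdorff_open_bigU.

Definition hyper_compact_family (P : set (set T)) : Prop :=
  P `<=` compact /\ compact [set K : hyperspace T | P (hyper_set K)].

End Hyperspace.

Section ProjectiveGroup.
Variable R : realType.

Record gl4 := GL4 { gl4_mx :> 'M[R]_4; gl4_unit : gl4_mx \in unitmx }.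

HB.instance Definition _ := [isSub for gl4_mx].
HB.instance Definition _ := [Choice of gl4 by <:].
HB.instance Definition _ := Topological.copy gl4 (initial_topology gl4_mx).

Lemma gl4_mul_unit (A B : gl4) : (A *m B) \in unitmx.
Proof. by rewrite unitmx_mul !gl4_unit. Qed.

Lemma gl4_inv_unit (A : gl4) : invmx A \in unitmx.
Proof. by rewrite unitmx_inv gl4_unit. Qed.

Definition gl4_mul (A B : gl4) := GL4 (gl4_mul_unit A B).
Definition gl4_one := GL4 (unitmx1 R 4).
Definition gl4_inv (A : gl4) := GL4 (gl4_inv_unit A).

Definition gl4_prop (A B : gl4) : bool :=
  `[< exists2 c : R, c != 0 & gl4_mx A = c *: gl4_mx B >].

Lemma gl4_propxx : reflexive gl4_prop.
Proof. by move=> A; apply/asboolP; exists 1; rewrite ?oner_eq0 ?scale1r. Qed.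

Lemma gl4_prop_sym : symmetric gl4_prop.
Proof.
suff h A B : gl4_prop A B -> gl4_prop B A by move=> A B; apply/idP/idP; exact: h.
move=> /asboolP[c c0 AB]; apply/asboolP; exists c^-1; first by rewrite invr_eq0.
by rewrite AB scalerA mulVf// scale1r.
Qed.

Lemma gl4_prop_trans : transitive gl4_prop.
Proof.
move=> B A C /asboolP[c c0 AB] /asboolP[d d0 BC]; apply/asboolP.
by exists (c * d); rewrite ?mulf_neq0// AB BC scalerA.
Qed.

Canonical gl4_prop_equiv :=
  EquivRel gl4_prop gl4_propxx gl4_prop_sym gl4_prop_trans.

Definition pgl4 := quotient_topology {eq_quot gl4_prop_equiv}.

HB.instance Definition _ := Topological.on pgl4.
HB.instance Definition _ := Quotient.on pgl4.

Definition pgl (A : gl4) : pgl4 := \pi_{eq_quot gl4_prop_equiv} A.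
Definition pgl_repr (g : pgl4) : gl4 := repr (g : {eq_quot gl4_prop_equiv}).

Lemma pgl_reprK : cancel pgl_repr pgl.
Proof. by move=> g; rewrite /pgl /pgl_repr reprK. Qed.

Lemma pgl_eqP (A B : gl4) :
  pgl A = pgl B <-> exists2 c : R, c != 0 & gl4_mx A = c *: gl4_mx B.
Proof.
split; first by move=> /eqmodP/asboolP.
by move=> h; apply/eqmodP/asboolP.
Qed.

Lemma pgl_ind (Q : pgl4 -> Prop) : (forall A, Q (pgl A)) -> forall g, Q g.
Proof. by move=> h g; rewrite -(pgl_reprK g). Qed.

Definition pgl_mul (g h : pgl4) : pgl4 := pgl (gl4_mul (pgl_repr g) (pgl_repr h)).
Definition pgl_one : pgl4 := pgl gl4_one.
Definition pgl_inv (g : pgl4) : pgl4 := pgl (gl4_inv (pgl_repr g)).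

Lemma pgl_mulE (A B : gl4) : pgl_mul (pgl A) (pgl B) = pgl (gl4_mul A B).
Proof.
have /pgl_eqP[c c0 cE] := pgl_reprK (pgl A).
have /pgl_eqP[d d0 dE] := pgl_reprK (pgl B).
apply/pgl_eqP; exists (c * d); first by rewrite mulf_neq0.
by rewrite /= cE dE -scalemxAl -scalemxAr scalerA.
Qed.

Lemma pgl_invE (A : gl4) : pgl_inv (pgl A) = pgl (gl4_inv A).
Proof.
have /pgl_eqP[c c0 cE] := pgl_reprK (pgl A).
apply/pgl_eqP; exists c^-1; first by rewrite invr_eq0.
by rewrite /= cE invmxZ// -cE gl4_unit.
Qed.

Lemma pgl_mulA : associative pgl_mul.
Proof.
elim/pgl_ind => A; elim/pgl_ind => B; elim/pgl_ind => C.
by rewrite !pgl_mulE; congr pgl; apply: val_inj; rewrite /= mulmxA.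
Qed.

Lemma pgl_mul1 : left_id pgl_one pgl_mul.
Proof.
elim/pgl_ind => A; rewrite pgl_mulE; congr pgl.
by apply: val_inj; rewrite /= mul1mx.
Qed.

Lemma pgl_1mul : right_id pgl_one pgl_mul.
Proof.
elim/pgl_ind => A; rewrite pgl_mulE; congr pgl.
by apply: val_inj; rewrite /= mulmx1.
Qed.

Lemma pgl_mulV : left_inverse pgl_one pgl_inv pgl_mul.
Proof.
elim/pgl_ind => A; rewrite pgl_invE pgl_mulE; congr pgl.
by apply: val_inj; rewrite /= mulVmx// gl4_unit.
Qed.

Lemma pgl_Vmul : right_inverse pgl_one pgl_inv pgl_mul.
Proof.
elim/pgl_ind => A; rewrite pgl_invE pgl_mulE; congr pgl.
by apply: val_inj; rewrite /= mulmxV// gl4_unit.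
Qed.

HB.instance Definition _ := isGroup.Build pgl4
  pgl_mulA pgl_mul1 pgl_1mul pgl_mulV pgl_Vmul.

Definition pgl_subgroup (H : set pgl4) : Prop :=
  [/\ H 1%g, (forall g h, H g -> H h -> H (g * h)%g) & forall g, H g -> H (g^-1)%g].

(* For a group G of n x n matrices: f is an isomorphism of topological groups
   of G onto the subgroup H of PGL(4,R). *)
Definition top_group_iso n (G : set 'M[R]_n) (H : set pgl4)
    (f : 'M[R]_n -> pgl4) : Prop :=
  homeomorphism_on G H f /\
  forall A B, G A -> G B -> f (A *m B) = (f A * f B)%g.

Definition pgl_subgroup_isog n (G : set 'M[R]_n) (H : set pgl4) : Prop :=
  pgl_subgroup H /\ exists f, top_group_iso G H f.

Definition orthogonal_group n : set 'M[R]_n := [set A | A^T *m A = 1%:M].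
Definition special_orthogonal_group n : set 'M[R]_n :=
  [set A | A^T *m A = 1%:M /\ \det A = 1].

Definition vec4 (s : seq R) : 'cV[R]_4 := \col_(i < 4) nth 0 s i.

(* Quaternions a0 + a1 i + a2 j + a3 k as columns (a0, a1, a2, a3). *)
Definition quat_mul (a b : 'cV[R]_4) : 'cV[R]_4 :=
  let a0 := a 0 0 in let a1 := a 1 0 in let a2 := a 2 0 in let a3 := a 3 0 in
  let b0 := b 0 0 in let b1 := b 1 0 in let b2 := b 2 0 in let b3 := b 3 0 in
  vec4 [:: a0 * b0 - a1 * b1 - a2 * b2 - a3 * b3;
           a0 * b1 + a1 * b0 + a2 * b3 - a3 * b2;
           a0 * b2 - a1 * b3 + a2 * b0 + a3 * b1;
           a0 * b3 + a1 * b2 - a2 * b1 + a3 * b0].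

Definition quat_conj (a : 'cV[R]_4) : 'cV[R]_4 :=
  vec4 [:: a 0 0; - a 1 0; - a 2 0; - a 3 0].

Definition spin3 : set 'cV[R]_4 := [set a | \sum_i a i 0 ^+ 2 = 1].

(* The covering Spin_3 -> SO_3: the matrix of q |-> a q a^-1 on the span of
   i, j, k; for a unit quaternion, a^-1 is the conjugate. *)
Definition spin3_cover (a : 'cV[R]_4) : 'M[R]_3 :=
  \matrix_(i, j)
    quat_mul (quat_mul a (delta_mx (lift 0 j) 0)) (quat_conj a) (lift 0 i) 0.

Definition hom4 m n (A : 'M[R]_(m, n)) : 'Hom('cV[R]_n, 'cV[R]_m) :=
  linfun (mulmx A).

(* rho is the lift to Spin_3 -> GL(4,R) of the isomorphism f : SO_3 -> Omega. *)
Definition spin_lift (f : 'M[R]_3 -> pgl4) (rho : 'cV[R]_4 -> gl4) : Prop :=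
  [/\ {within spin3, continuous rho},
      forall a b, spin3 a -> spin3 b ->
        rho (quat_mul a b) = gl4_mul (rho a) (rho b)
    & forall a, spin3 a -> pgl (rho a) = f (spin3_cover a)].

Definition reducible_on (S : set 'cV[R]_4) (rho : 'cV[R]_4 -> gl4) : Prop :=
  exists V : {vspace 'cV[R]_4},
    (0 < \dim V < 4)%N /\ forall a, S a -> (hom4 (rho a) @: V <= V)%VS.

Definition reducible_SO3 (Omega : set pgl4) : Prop :=
  pgl_subgroup Omega /\
  exists f rho, [/\ top_group_iso (special_orthogonal_group (n := 3)) Omega f,
    spin_lift f rho & reducible_on spin3 rho].

(* The affine point p of R^3 is the projective point spanned by (p, 1), so the
   plane at infinity is spanned by the first three unit vectors. *)
Definition affine_mx (A : 'M[R]_3) (t : 'cV[R]_3) : 'M[R]_4 :=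
  block_mx A t 0 1%:M : 'M[R]_(3 + 1).

Definition affine_group : set pgl4 :=
  [set g | exists B : gl4, pgl B = g /\
     exists A t, gl4_mx B = affine_mx A t].

End ProjectiveGroup.

Section Lines.
Variable R : realType.
Local Notation V4 := 'cV[R]_4.

Record line := Line {
  line_space :> {vspace V4};
  line_dim : \dim line_space = 2 }.

HB.instance Definition _ := gen_eqMixin line.
HB.instance Definition _ := gen_choiceMixin line.

(* An orientation of a 2-dimensional space is a class of ordered bases (the
   positive ones) modulo base changes of positive determinant; an ordered basis
   is the pair of columns of a 4 x 2 matrix. *)
Record oline := OLine {
  unoriented : line;
  positive_bases : set 'M[R]_(4, 2);
  olineP : exists2 B : 'M[R]_(4, 2), limg (hom4 B) = unoriented :> {vspace V4} &
    positive_bases = [set B *m P | P in [set P : 'M[R]_2 | 0 < \det P]] }.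

HB.instance Definition _ := gen_eqMixin oline.
HB.instance Definition _ := gen_choiceMixin oline.

Lemma hom4_dim (A : gl4 R) (V : {vspace V4}) : \dim (hom4 A @: V) = \dim V.
Proof.
apply: limg_dim_eq; apply/eqP; rewrite -subv0; apply/subvP => v.
rewrite memv_cap => /andP[_]; rewrite memv_ker lfunE /= => /eqP Av.
rewrite memv0; apply/eqP.
by rewrite -(mul1mx v) -(mulVmx (gl4_unit A)) -mulmxA Av mulmx0.
Qed.

Definition gl4_line (A : gl4 R) (l : line) : line :=
  Line (etrans (hom4_dim A l) (line_dim l)).

Lemma gl4_olineP (A : gl4 R) (l : oline) :
  exists2 B : 'M[R]_(4, 2),
    limg (hom4 B) = gl4_line A (unoriented l) :> {vspace V4} &
    [set A *m B | B in positive_bases l] =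
      [set B *m P | P in [set P : 'M[R]_2 | 0 < \det P]].
Proof.
have [B BE pE] := olineP l; exists (A *m B).
  rewrite /= -BE -limg_comp; congr (limg _); apply/lfunP => v.
  by rewrite comp_lfunE !lfunE /= mulmxA.
rewrite pE; apply/seteqP; split=> x /=.
  by move=> [_ [P P0 <-] <-]; exists P; rewrite // mulmxA.
by move=> [P P0 <-]; exists (B *m P); [exists P|rewrite mulmxA].
Qed.

Definition gl4_oline (A : gl4 R) (l : oline) : oline := OLine (gl4_olineP A l).

(* The actions of PGL(4,R); they do not depend on the representing matrices. *)
Definition pgl_line (g : pgl4 R) (l : line) : line := gl4_line (pgl_repr g) l.
Definition pgl_oline (g : pgl4 R) (l : oline) : oline := gl4_oline (pgl_repr g) l.

Lemma line_inj (l m : line) : line_space l = line_space m -> l = m.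
Proof.
case: l m => [V dV] [W dW] /= VW; move: dV; rewrite VW => dV.
by rewrite (Prop_irrelevance dV dW).
Qed.

Lemma oline_inj (l m : oline) : unoriented l = unoriented m ->
  positive_bases l = positive_bases m -> l = m.
Proof.
case: l m => [l p hl] [m q hm] /= lm pq; move: hl; rewrite lm pq => hl.
by rewrite (Prop_irrelevance hl hm).
Qed.

Lemma pgl_lineE (A : gl4 R) l : pgl_line (pgl A) l = gl4_line A l.
Proof.
have /pgl_eqP[c c0 cE] := pgl_reprK (pgl A).
apply: line_inj => /=; apply/vspaceP => v; apply/memv_imgP/memv_imgP.
  move=> [u ul ->]; exists (c *: u); first exact: memvZ.
  by rewrite !lfunE /= cE -scalemxAl -scalemxAr.
move=> [u ul ->]; exists (c^-1 *: u); first exact: memvZ.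
by rewrite !lfunE /= cE -scalemxAl -scalemxAr scalerA divff// scale1r.
Qed.

Lemma pgl_olineE (A : gl4 R) l : pgl_oline (pgl A) l = gl4_oline A l.
Proof.
have /pgl_eqP[c c0 cE] := pgl_reprK (pgl A).
apply: oline_inj; first exact: pgl_lineE.
have [B _ pE] := olineP l.
have scaled (d : R) x : d != 0 -> positive_bases l x -> positive_bases l (d *: x).
  move=> d0; rewrite pE /= => -[P P0 <-]; exists (d *: P); last by rewrite scalemxAr.
  by rewrite /= detZ mulr_gt0// exprn_even_gt0.
apply/seteqP; split=> x /= [y ly <-].
  by exists (c *: y); [exact: scaled|rewrite cE -scalemxAl -scalemxAr].
exists (c^-1 *: y); first by apply: scaled; rewrite ?invr_eq0.
by rewrite cE -scalemxAl -scalemxAr scalerA divff// scale1r.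
Qed.

(* The line at infinity of the xy-plane and an orientation of it; they serve as
   base points of the coset space topologies. *)
Definition xy_basis : 'M[R]_(4, 2) := \matrix_(i, j) (i == j :> nat)%:R.

Lemma xy_dim : \dim (limg (hom4 xy_basis)) = 2.
Proof.
rewrite limg_dim_eq; first by rewrite dimvf /dim /= muln1.
apply/eqP; rewrite -subv0; apply/subvP => v.
rewrite memv_cap => /andP[_]; rewrite memv_ker lfunE /= => /eqP Av.
rewrite memv0; apply/eqP/matrixP => i j; rewrite mxE.
have /matrixP/(_ (widen_ord (isT : 2 <= 4)%N i) j) := Av.
rewrite !mxE (bigD1 i)//= mxE eqxx mul1r big1 ?addr0// => k ki.
by rewrite mxE /= eq_sym (negbTE (ki : (k : nat) != i)) mul0r.
Qed.

Definition base_line : line := Line xy_dim.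
Definition base_oline : oline := OLine (ex_intro2 _ _ xy_basis
  (erefl (line_space base_line))
  (erefl [set xy_basis *m P | P in [set P : 'M[R]_2 | 0 < \det P]])).

(* The topology of the coset space PGL(4,R) / Stab(base point), that is, the
   quotient topology of the orbit map. *)
Definition coset_open (T : Type) (orbit : pgl4 R -> T) (U : set T) : Prop :=
  open (orbit @^-1` U).

Section CosetOpen.
Variables (T : Type) (orbit : pgl4 R -> T).

Lemma coset_openT : coset_open orbit setT.
Proof. by rewrite /coset_open preimage_setT; exact: openT. Qed.

Lemma coset_openI : setI_closed (coset_open orbit).
Proof. by move=> U V; exact: openI. Qed.

Lemma coset_open_bigU (I : Type) (F : I -> set T) :
  (forall i, coset_open orbit (F i)) -> coset_open orbit (\bigcup_i F i).
Proof. by move=> oF; apply: bigcup_open => i _; exact: oF. Qed.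

End CosetOpen.

Definition line_orbit : pgl4 R -> line := pgl_line^~ base_line.
Definition oline_orbit : pgl4 R -> oline := pgl_oline^~ base_oline.

HB.instance Definition _ := isOpenTopological.Build line
  (coset_openT line_orbit) (@coset_openI _ line_orbit)
  (@coset_open_bigU _ line_orbit).

HB.instance Definition _ := isOpenTopological.Build oline
  (coset_openT oline_orbit) (@coset_openI _ oline_orbit)
  (@coset_open_bigU _ oline_orbit).

Definition compact_spread (C : set line) : Prop :=
  [/\ compact C,
      forall l m, C l -> C m -> l <> m -> (l :&: m)%VS = 0%VS
    & forall v : V4, v != 0 -> exists2 l, C l & v \in line_space l].

(* S is one of the two sheets of the inverse image of the spread C. *)
Definition oriented_spread_from (C : set line) (S : set oline) : Prop :=
  compact_spread C /\ exists S' : set oline,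
    [/\ S `|` S' = unoriented @^-1` C, S `&` S' = set0,
        homeomorphism_on S C unoriented & homeomorphism_on S' C unoriented].

Definition oriented_spread (S : set oline) : Prop :=
  exists C, oriented_spread_from C S.

Definition topological_parallelism (P : set (set line)) : Prop :=
  [/\ P `<=` compact_spread, trivIset P id, \bigcup_(C in P) C = setT
    & hyper_compact_family P].

Definition oriented_topological_parallelism (P : set (set oline)) : Prop :=
  [/\ P `<=` oriented_spread, trivIset P id, \bigcup_(S in P) S = setT
    & hyper_compact_family P].

Definition pgl_spread (g : pgl4 R) (C : set line) := pgl_line g @` C.
Definition pgl_ospread (g : pgl4 R) (S : set oline) := pgl_oline g @` S.
Definition pgl_parallelism (g : pgl4 R) (P : set (set line)) := pgl_spread g @` P.
Definition pgl_oparallelism (g : pgl4 R) (P : set (set oline)) :=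
  pgl_ospread g @` P.

Definition spread_iso (C D : set line) := exists g, pgl_spread g C = D.
Definition parallelism_iso (P Q : set (set line)) :=
  exists g, pgl_parallelism g P = Q.
Definition oparallelism_iso (P Q : set (set oline)) :=
  exists g, pgl_oparallelism g P = Q.

Definition admits_reducible_SO3 (P : set (set line)) : Prop :=
  exists2 Omega, reducible_SO3 Omega &
    forall g, Omega g -> pgl_parallelism g P = P.

Definition oriented_admits_reducible_SO3 (P : set (set oline)) : Prop :=
  exists2 Omega, reducible_SO3 Omega &
    forall g, Omega g -> pgl_oparallelism g P = P.

(* An ordinary parallelism regarded as a parallelism of oriented lines: all
   oriented spreads obtained from its members. *)
Definition oriented_cover (P : set (set line)) : set (set oline) :=
  [set S | exists2 C, P C & oriented_spread_from C S].

Definition z_rotation (A : 'M[R]_2) : 'M[R]_4 :=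
  block_mx A 0 0 1%:M : 'M[R]_(2 + 2).

(* (r, 0, b) is the point for t = 0 and (0, 1, a) the direction of the affine
   line {(r, t, b + a t)}. *)
Definition screw_line (r a b : R) : {vspace V4} :=
  <<[:: vec4 [:: r; 0; b; 1]%R; vec4 [:: 0; 1; a; 0]%R]>>%VS.

Definition regulus (r a b : R) : set line :=
  [set l | exists2 A, special_orthogonal_group A &
     line_space l = (hom4 (z_rotation A) @: screw_line r a b)%VS].

Definition z_axis : {vspace V4} :=
  <<[:: vec4 [:: 0; 0; 1; 0]%R; vec4 [:: 0; 0; 0; 1]%R]>>%VS.
Definition xy_infinity : {vspace V4} :=
  <<[:: vec4 [:: 1; 0; 0; 0]%R; vec4 [:: 0; 1; 0; 0]%R]>>%VS.

(* Only the values of a and b on (0, oo) matter. *)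
Definition rotational_form (a b : R -> R) : set line :=
  [set l | line_space l = z_axis \/ line_space l = xy_infinity] `|`
  \bigcup_(r in [set r : R | 0 < r]) regulus r (a r) (b r).

Definition SO2_rotational (C : set line) : Prop :=
  compact_spread C /\
  exists a b : R -> R,
    [/\ forall r, 0 < r -> 0 < a r, compact_spread (rotational_form a b)
      & spread_iso C (rotational_form a b)].

Definition O2_rotational (C : set line) : Prop :=
  compact_spread C /\
  exists (a b : R -> R) (b0 : R),
    [/\ forall r, 0 < r -> 0 < a r, forall r, 0 < r -> b r = b0,
        compact_spread (rotational_form a b)
      & spread_iso C (rotational_form a b)].

Definition admissible n (Gamma : set 'M[R]_n) (Omega : set (pgl4 R))
    (C : set line) : Prop :=
  exists H : set (pgl4 R), [/\ H `<=` Omega, pgl_subgroup_isog Gamma H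
    & forall g, H g -> pgl_spread g C = C].

Definition SO2_admissible := admissible (special_orthogonal_group (n := 2)).
Definition O2_admissible := admissible (orthogonal_group (n := 2)).

Definition affine_SO3 (Omega : set (pgl4 R)) : Prop :=
  Omega `<=` affine_group (R := R) /\
  pgl_subgroup_isog (special_orthogonal_group (n := 3)) Omega.

Definition spread_orbit (Omega : set (pgl4 R)) (C : set line) :
  set (set line) := [set pgl_spread g C | g in Omega].
Definition ospread_orbit (Omega : set (pgl4 R)) (S : set oline) :
  set (set oline) := [set pgl_ospread g S | g in Omega].

Definition ordinary_example (P : set (set line)) : Prop :=
  exists C Omega, [/\ O2_rotational C, affine_SO3 Omega,
    O2_admissible Omega C & P = spread_orbit Omega C].

Definition oriented_example (P : set (set oline)) : Prop :=
  exists C S Omega,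
    [/\ SO2_rotational C /\ oriented_spread_from C S,
        affine_SO3 Omega, SO2_admissible Omega C,
        ~ O2_rotational C \/ ~ O2_admissible Omega C
      & P = ospread_orbit Omega S].

End Lines.

(* Main.v *)
(* SO_3 acts on the oriented lines at distance d > 0 from the origin simply
   transitively (on unoriented lines with stabilisers generated by a half turn),
   and transitively on the lines through the origin and on those at infinity.
   A compact spread C that is invariant under the rotations about the z-axis
   contains the z-axis and its polar line at infinity; a connectedness argument
   along a path of points shows that it has lines at every distance from the
   origin, and those at a given distance form one orbit of rotations.  Hence the
   SO_3-images of C, or of one of its orientations, form a partition of the space
   of (oriented) lines.  Conversely, a reducible group is conjugate in PGL_4 to
   the standard SO_3, and the member of an invariant parallelism containing the
   z-axis is invariant under its stabiliser, so it is rotational and its orbit is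
   the whole parallelism.  If the underlying spread of an oriented member also
   admits O_2, a symmetry reversing the z-axis exchanges its two orientations and
   the oriented parallelism is the double cover of an ordinary one. *)
Require Import Defs.
From mathcomp Require Import all_boot all_order all_algebra perm ring lra.
From mathcomp Require Import all_classical all_reals all_analysis.
Set Implicit Arguments.
Unset Strict Implicit.
Unset Printing Implicit Defensive.
Import Order.TTheory GRing.Theory Num.Theory.
Import numFieldNormedType.Exports.
Local Open Scope classical_set_scope.
Local Open Scope ring_scope.

(** The representation theory behind the conjugacy step is replaced by elementary arguments.
    Invariant complements and inner products come from a fixed point theorem for bounded groups, in
    place of a Haar average. An invariant plane in R^4 is excluded with finitely many unit
    quaternions, as the quaternion relations have no solution in real 2 x 2 matrices. What remains
    is a continuous injective endomorphism of SO_3; it is onto because, by the intermediate value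
    theorem, circles of rotations are mapped onto such circles.

    On the geometric side, a quadratic form in Plücker coordinates has a well-defined sign on each
    line. Distance from the origin, radius about the axis and sense of the screw are all tested by
    such forms. Each point lies on exactly one line of a spread, so a form that changes sign along a
    segment of points vanishes on some line of the spread met on the way. This produces a line at
    every distance and a regulus of every radius, and forces all reguli to be screwed in the same
    sense. If that sense is the left one, the reflection in the xy-plane, itself a collineation,
    restores the required form. *)

Lemma ord4P (P : 'I_4 -> Prop) : P 0 -> P 1 -> P 2 -> P 3 -> forall i, P i.
Proof.
move=> P0 P1 P2 P3 [[|[|[|[|//]]]] h].
- by rewrite (_ : Ordinal h = 0)//; exact: val_inj.
- by rewrite (_ : Ordinal h = 1)//; exact: val_inj.
- by rewrite (_ : Ordinal h = 2)//; exact: val_inj.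
- by rewrite (_ : Ordinal h = 3)//; exact: val_inj.
Qed.

Lemma ord3P (P : 'I_3 -> Prop) : P 0 -> P 1 -> P 2 -> forall i, P i.
Proof.
move=> P0 P1 P2 [[|[|[|//]]] h].
- by rewrite (_ : Ordinal h = 0)//; exact: val_inj.
- by rewrite (_ : Ordinal h = 1)//; exact: val_inj.
- by rewrite (_ : Ordinal h = 2)//; exact: val_inj.
Qed.

Lemma ord2P (P : 'I_2 -> Prop) : P 0 -> P 1 -> forall i, P i.
Proof.
move=> P0 P1 [[|[|//]] h].
- by rewrite (_ : Ordinal h = 0)//; exact: val_inj.
- by rewrite (_ : Ordinal h = 1)//; exact: val_inj.
Qed.

Section Sums.
Variables (R : nmodType).
Lemma sum4 (F : 'I_4 -> R) : \sum_i F i = F 0 + F 1 + F 2 + F 3.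
Proof.
rewrite !big_ord_recl big_ord0 addr0 !addrA.
by congr (F _ + F _ + F _ + F _); exact: val_inj.
Qed.
Lemma sum3 (F : 'I_3 -> R) : \sum_i F i = F 0 + F 1 + F 2.
Proof.
rewrite !big_ord_recl big_ord0 addr0 !addrA.
by congr (F _ + F _ + F _); exact: val_inj.
Qed.
Lemma sum2 (F : 'I_2 -> R) : \sum_i F i = F 0 + F 1.
Proof.
rewrite !big_ord_recl big_ord0 addr0.
by congr (F _ + F _); exact: val_inj.
Qed.
End Sums.

Definition mxs (R : pzRingType) m n (s : seq (seq R)) : 'M[R]_(m,n) :=
  \matrix_(i, j) nth 0 (nth [::] s i) j.

(** * Rotations of three-space *)

Section Rotations.
Variable R : realType.
Implicit Types (A B : 'M[R]_3).

Lemma det2 (A : 'M[R]_2) : \det A = A 0 0 * A 1 1 - A 0 1 * A 1 0.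
Proof.
rewrite (expand_det_row _ 0) sum2 /cofactor !det_mx11 !mxE /=.
have l00 : lift (0 : 'I_2) (0 : 'I_1) = 1 by exact: val_inj.
have l10 : lift (1 : 'I_2) (0 : 'I_1) = 0 by exact: val_inj.
by rewrite l00 l10 (_ : (0 + 0)%N = 0%N)// (_ : (0 + 1)%N = 1%N)// expr0 expr1; ring.
Qed.

Lemma det3 A : \det A = A 0 0 * (A 1 1 * A 2 2 - A 1 2 * A 2 1)
  - A 0 1 * (A 1 0 * A 2 2 - A 1 2 * A 2 0)
  + A 0 2 * (A 1 0 * A 2 1 - A 1 1 * A 2 0).
Proof.
rewrite (expand_det_row _ 0) sum3 /cofactor !det2 !mxE /=.
have l00 : lift (0 : 'I_3) (0 : 'I_2) = 1 by exact: val_inj.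
have l01 : lift (0 : 'I_3) (1 : 'I_2) = 2 by exact: val_inj.
have l10 : lift (1 : 'I_3) (0 : 'I_2) = 0 by exact: val_inj.
have l11 : lift (1 : 'I_3) (1 : 'I_2) = 2 by exact: val_inj.
have l20 : lift (2 : 'I_3) (0 : 'I_2) = 0 by exact: val_inj.
have l21 : lift (2 : 'I_3) (1 : 'I_2) = 1 by exact: val_inj.
rewrite l00 l01 l10 l11 l20 l21.
rewrite -[(0 + (0%R : 'I_3))%N]/0%N -[(0 + (1%R : 'I_3))%N]/1%N -[(0 + (2%R : 'I_3))%N]/2%N.
by rewrite expr0 expr1 sqrrN expr1n; ring.
Qed.

Local Notation SO n := (@special_orthogonal_group R n).

Lemma so_mul n (A B : 'M[R]_n) : SO n A -> SO n B -> SO n (A *m B).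
Proof.
move=> [A1 A2] [B1 B2]; split; last by rewrite det_mulmx A2 B2 mulr1.
by rewrite trmx_mul mulmxA -(mulmxA B^T) A1 mulmx1 B1.
Qed.

Lemma so_tr n (A : 'M[R]_n) : SO n A -> SO n A^T.
Proof.
by move=> [A1 A2]; split; [rewrite trmxK; exact: mulmx1C|rewrite det_tr].
Qed.

Lemma so_1 n : SO n (1%:M : 'M[R]_n).
Proof. by split; rewrite ?trmx1 ?mulmx1// det1. Qed.

Lemma so_mulVmx n (A : 'M[R]_n) : SO n A -> A^T *m A = 1%:M.
Proof. by case. Qed.

Lemma so_mulmxV n (A : 'M[R]_n) : SO n A -> A *m A^T = 1%:M.
Proof. by case=> /mulmx1C. Qed.

Definition rot2 (c s : R) : 'M[R]_2 := mxs 2 2 [:: [:: c; - s]; [:: s; c]].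

Lemma so2P (A : 'M[R]_2) :
  SO 2 A <-> exists c s : R, c ^+ 2 + s ^+ 2 = 1 /\ A = rot2 c s.
Proof.
split=> [[AA dA]|[c [s [cs ->]]]].
  exists (A 0 0), (A 1 0).
  have := congr1 (fun M : 'M[R]_2 => M 0 0) AA.
  have := congr1 (fun M : 'M[R]_2 => M 1 1) AA.
  have := congr1 (fun M : 'M[R]_2 => M 0 1) AA.
  rewrite !mxE !sum2 !mxE /=.
  rewrite det2 in dA.
  move: dA; set a := A 0 0; set b := A 0 1; set c := A 1 0; set d := A 1 1.
  move=> dA h1 h2 h3.
  (* The sum of the squares of all entries, which is 2, minus twice the determinant. *)
  have : (a - d) ^+ 2 + (b + c) ^+ 2 = 0 by nra.
  move=> /eqP; rewrite paddr_eq0 ?sqr_ge0// !sqrf_eq0 subr_eq0 addr_eq0 => /andP[/eqP ad /eqP bc].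
  split; first by lra.
  apply/matrixP; apply: ord2P; apply: ord2P; rewrite !mxE //=.
split; last by rewrite det2 !mxE /= -[RHS]cs; ring.
by apply/matrixP; apply: ord2P; apply: ord2P; rewrite !mxE !sum2 !mxE /= ?(mulr1n, mulr0n); try ring; rewrite -[RHS]cs; ring.
Qed.

Definition rz (c s : R) : 'M[R]_3 :=
  mxs 3 3 [:: [:: c; - s; 0]; [:: s; c; 0]; [:: 0; 0; 1]].
Definition rx (c s : R) : 'M[R]_3 :=
  mxs 3 3 [:: [:: 1; 0; 0]; [:: 0; c; - s]; [:: 0; s; c]].
Definition flip : 'M[R]_3 :=
  mxs 3 3 [:: [:: 1; 0; 0]; [:: 0; -1; 0]; [:: 0; 0; -1]].

Lemma so_rz c s : c ^+ 2 + s ^+ 2 = 1 -> SO 3 (rz c s).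
Proof.
move=> cs; split; last by rewrite det3 !mxE /= -[RHS]cs; ring.
by apply/matrixP; apply: ord3P; apply: ord3P; rewrite !mxE !sum3 !mxE /= ?(mulr1n, mulr0n); try ring; rewrite -[RHS]cs; ring.
Qed.

Lemma so_rx c s : c ^+ 2 + s ^+ 2 = 1 -> SO 3 (rx c s).
Proof.
move=> cs; split; last by rewrite det3 !mxE /= -[RHS]cs; ring.
by apply/matrixP; apply: ord3P; apply: ord3P; rewrite !mxE !sum3 !mxE /= ?(mulr1n, mulr0n); try ring; rewrite -[RHS]cs; ring.
Qed.

Lemma so_flip : SO 3 flip.
Proof.
split; last by rewrite det3 !mxE /=; ring.
by apply/matrixP; apply: ord3P; apply: ord3P; rewrite !mxE !sum3 !mxE /= ?(mulr1n, mulr0n); ring.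
Qed.

(** The third column is the cross product of [x] and [y]. *)
Definition frame (x y : 'cV[R]_3) : 'M[R]_3 :=
  let x0 := x 0 0 in let x1 := x 1 0 in let x2 := x 2 0 in
  let y0 := y 0 0 in let y1 := y 1 0 in let y2 := y 2 0 in
  mxs 3 3 [:: [:: x0; y0; x1 * y2 - x2 * y1];
          [:: x1; y1; x2 * y0 - x0 * y2]; [:: x2; y2; x0 * y1 - x1 * y0]].

Definition dot (x y : 'cV[R]_3) : R := x 0 0 * y 0 0 + x 1 0 * y 1 0 + x 2 0 * y 2 0.

Lemma so_frame x y : dot x x = 1 -> dot y y = 1 -> dot x y = 0 -> SO 3 (frame x y).
Proof.
rewrite /dot; set x0 := x 0 0; set x1 := x 1 0; set x2 := x 2 0.
set y0 := y 0 0; set y1 := y 1 0; set y2 := y 2 0 => xx yy xy.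
(* Lagrange's identity for the length of a cross product. *)
have lag : (x1 * y2 - x2 * y1) ^+ 2 + (x2 * y0 - x0 * y2) ^+ 2 + (x0 * y1 - x1 * y0) ^+ 2 = 1.
  have -> : 1 = (x0 * x0 + x1 * x1 + x2 * x2) * (y0 * y0 + y1 * y1 + y2 * y2) -
    (x0 * y0 + x1 * y1 + x2 * y2) ^+ 2 by rewrite xx yy xy; ring.
  by ring.
split; last by rewrite det3 !mxE /= -/x0 -/x1 -/x2 -/y0 -/y1 -/y2 -[RHS]lag; ring.
apply/matrixP; apply: ord3P; apply: ord3P;
  rewrite !mxE !sum3 !mxE /= -/x0 -/x1 -/x2 -/y0 -/y1 -/y2 ?(mulr1n, mulr0n) //;
  first [ring | rewrite -[RHS]xx; ring | rewrite -[RHS]yy; ring | rewrite -[RHS]xy; ring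
        | rewrite -[RHS]lag; ring].
Qed.

Lemma so3_dot A x y : SO 3 A -> dot (A *m x) (A *m y) = dot x y.
Proof.
move=> [AA _].
have dotE u v : dot u v = (u^T *m v) 0 0 by rewrite mxE sum3 !mxE.
by rewrite !dotE trmx_mul mulmxA -(mulmxA x^T) AA mulmx1.
Qed.

(** A quarter turn of the horizontal part of [x], normalised; if that part vanishes, the first basis
    vector does. *)
Lemma orthogonal_unit_exists x : dot x x = 1 -> exists y, dot y y = 1 /\ dot x y = 0.
Proof.
rewrite /dot; set x0 := x 0 0; set x1 := x 1 0; set x2 := x 2 0 => xx.
have [/eqP e|e] := eqVneq (x0 ^+ 2 + x1 ^+ 2) 0.
  have [x00 x10] : x0 = 0 /\ x1 = 0.
    by move: e; rewrite paddr_eq0 ?sqr_ge0// !sqrf_eq0 => /andP[/eqP -> /eqP ->].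
  exists (\col_i (i == 0)%:R); rewrite !mxE /= -/x0 -/x1 -/x2 x00 x10; split; ring.
have e0 : 0 < x0 ^+ 2 + x1 ^+ 2 by rewrite lt0r e addr_ge0 ?sqr_ge0.
pose k := Num.sqrt (x0 ^+ 2 + x1 ^+ 2).
have k0 : k != 0 by rewrite gt_eqF// sqrtr_gt0.
have kk : k ^+ 2 = x0 ^+ 2 + x1 ^+ 2 by rewrite sqr_sqrtr// ltW.
exists (mxs 3 1 [:: [:: - x1 / k]; [:: x0 / k]; [:: 0]]); rewrite !mxE /= -/x0 -/x1 -/x2; split.
  have -> : 1 = (x0 ^+ 2 + x1 ^+ 2) / k ^+ 2 by rewrite kk divff.
  by field.
by field.
Qed.

Definition e_ (i : 'I_3) : 'cV[R]_3 := delta_mx i 0.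

Lemma mul_e A i : A *m e_ i = col i A.
Proof. by rewrite /e_ colE. Qed.

Lemma colP' (x y : 'cV[R]_3) : x 0 0 = y 0 0 -> x 1 0 = y 1 0 -> x 2 0 = y 2 0 -> x = y.
Proof. by move=> ? ? ?; apply/colP; apply: ord3P. Qed.

Lemma so3_frame x y : dot x x = 1 -> dot y y = 1 -> dot x y = 0 ->
  exists A, [/\ SO 3 A, A *m e_ 0 = x & A *m e_ 1 = y].
Proof.
move=> xx yy xy; exists (frame x y); split; first exact: so_frame.
  by rewrite mul_e; apply: colP'; rewrite !mxE.
by rewrite mul_e; apply: colP'; rewrite !mxE.
Qed.

Lemma rx_cyc : exists P, [/\ SO 3 P, P *m e_ 0 = e_ 1 & P *m e_ 1 = e_ 2].
Proof. by apply: so3_frame; rewrite /dot !mxE /=; ring. Qed.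

Lemma so3_stab_e2 A : SO 3 A -> A *m e_ 2 = e_ 2 ->
  exists c s, c ^+ 2 + s ^+ 2 = 1 /\ A = rz c s.
Proof.
move=> [AA dA]; rewrite mul_e => /colP Ae.
have := Ae 0; have := Ae 1; have := Ae 2; rewrite !mxE /= => A22 A12 A02.
have E i j := congr1 (fun M : 'M[R]_3 => M i j) AA.
have := E 2 0; have := E 2 1; have := E 0 0; have := E 1 1; have := E 0 1.
rewrite !mxE !sum3 !mxE /= A22 A12 A02 => h01 h11 h00 h21 h20.
rewrite det3 A22 A12 A02 in dA.
have A20 : A 2 0 = 0 by move: h20; lra.
have A21 : A 2 1 = 0 by move: h21; lra.
rewrite A20 A21 in h01 h11 h00 dA.
move: dA h01 h11 h00; set a := A 0 0; set b := A 0 1; set c := A 1 0; set d := A 1 1.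
move=> dA h01 h11 h00.
have : (a - d) ^+ 2 + (b + c) ^+ 2 = 0 by nra.
move=> /eqP; rewrite paddr_eq0 ?sqr_ge0// !sqrf_eq0 subr_eq0 addr_eq0 => /andP[/eqP ad /eqP bc].
exists a, c; split; first by lra.
by apply/matrixP; apply: ord3P; apply: ord3P; rewrite !mxE /= ?A20 ?A21 ?A22 ?A12 ?A02.
Qed.

Lemma so3_flip_e2 A : SO 3 A -> A *m e_ 2 = - e_ 2 ->
  exists c s, c ^+ 2 + s ^+ 2 = 1 /\ A = rz c s *m flip.
Proof.
move=> SA Ae.
have ff : flip *m flip = 1%:M.
  by apply/matrixP; apply: ord3P; apply: ord3P; rewrite !mxE !sum3 !mxE /= ?(mulr1n, mulr0n); ring.
have [|c [s [cs AE]]] := so3_stab_e2 (so_mul SA so_flip).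
  rewrite -mulmxA (_ : flip *m e_ 2 = - e_ 2) ?mulmxN ?Ae ?opprK//.
  by rewrite mul_e; apply: colP'; rewrite !mxE /=; ring.
by exists c, s; split=> //; rewrite -AE -mulmxA ff mulmx1.
Qed.

Lemma so3_fix01 A : SO 3 A -> A *m e_ 0 = e_ 0 -> A *m e_ 1 = e_ 1 -> A = 1%:M.
Proof.
move=> [AA dA]; rewrite !mul_e => /colP A0 /colP A1.
have := A0 0; have := A0 1; have := A0 2; have := A1 0; have := A1 1; have := A1 2.
rewrite !mxE /= => A21 A11 A01 A20 A10 A00.
have E i j := congr1 (fun M : 'M[R]_3 => M i j) AA.
have := E 0 2; have := E 1 2.
rewrite !mxE !sum3 !mxE /= A21 A11 A01 A20 A10 A00 => h12 h02.
rewrite det3 A21 A11 A01 A20 A10 A00 in dA.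
by apply/matrixP; apply: ord3P; apply: ord3P; rewrite !mxE //=; lra.
Qed.

(** Euler angles: a rotation about the x-axis followed by one about the z-axis carries [e_ 2] to
    [A *m e_ 2], and what remains fixes [e_ 2]. This serves as an induction principle, so that
    closed properties need checking only on rotations about two axes. *)
Lemma so3_gen (X : set 'M[R]_3) : (forall A B, SO 3 A -> SO 3 B -> X A -> X B -> X (A *m B)) ->
  (forall c s, c ^+ 2 + s ^+ 2 = 1 -> X (rz c s)) ->
  (forall c s, c ^+ 2 + s ^+ 2 = 1 -> X (rx c s)) -> SO 3 `<=` X.
Proof.
move=> XM Xz Xx A SA.
pose x := A *m e_ 2.
have xx : dot x x = 1 by rewrite so3_dot// /dot !mxE /=; ring.
move: (xx); rewrite /dot; set x0 := x 0 0; set x1 := x 1 0; set x2 := x 2 0 => xx'.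
have s0 : 0 <= 1 - x2 ^+ 2 by rewrite -xx'; nra.
pose s := Num.sqrt (1 - x2 ^+ 2).
have ss : s ^+ 2 = 1 - x2 ^+ 2 by rewrite sqr_sqrtr.
(* Spherical coordinates of [x], with [s] the sine of the polar angle; at the poles [s] vanishes and
   any azimuth will do. *)
have [c' [s' [cs' e0 e1]]] : exists c' s', [/\ c' ^+ 2 + s' ^+ 2 = 1, s * s' = x0 & - s * c' = x1].
  have [s00|sn0] := eqVneq s 0.
    have : x0 ^+ 2 + x1 ^+ 2 = 0 by rewrite s00 in ss; nra.
    move=> /eqP; rewrite paddr_eq0 ?sqr_ge0// !sqrf_eq0 => /andP[/eqP -> /eqP ->].
    by exists 1, 0; split; rewrite ?s00; ring.
  exists (- x1 / s), (x0 / s); split; [|by field..].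
  have -> : 1 = (x0 ^+ 2 + x1 ^+ 2) / s ^+ 2.
    have -> : x0 ^+ 2 + x1 ^+ 2 = s ^+ 2 by rewrite ss; nra.
    by rewrite divff// sqrf_eq0.
  by field.
have cs : x2 ^+ 2 + s ^+ 2 = 1 by rewrite ss; ring.
pose B := rz c' s' *m rx x2 s.
have SB : SO 3 B by apply: so_mul; [exact: so_rz|exact: so_rx].
have Be : B *m e_ 2 = x.
  rewrite mul_e; apply: colP'; rewrite -/x0 -/x1 -/x2 !mxE !sum3 !mxE /=.
  - by rewrite -e0; ring.
  - by rewrite -e1; ring.
  - by ring.
have SBA : SO 3 (B^T *m A) by apply: so_mul => //; exact: so_tr.
have [|c'' [s'' [cs'' E]]] := so3_stab_e2 SBA.
  by rewrite -mulmxA -/x -Be mulmxA so_mulVmx// mul1mx.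
have -> : A = B *m rz c'' s'' by rewrite -E mulmxA so_mulmxV// mul1mx.
apply: (XM B) => //; [exact: so_rz| |exact: Xz].
by apply: XM; [exact: so_rz|exact: so_rx|exact: Xz|exact: Xx].
Qed.

(** With theta the angle of (c, s), the root [k] is 2 |cos(theta/2)|; the angle pi, where it
    vanishes, is treated apart. Square roots of rotations are used throughout to remove signs: what
    is determined up to a sign on all rotations about an axis has the sign + on squares, hence
    everywhere. *)
Lemma half_angle (c s : R) : c ^+ 2 + s ^+ 2 = 1 ->
  exists c' s', [/\ c' ^+ 2 + s' ^+ 2 = 1, c = c' ^+ 2 - s' ^+ 2 & s = 2 * c' * s'].
Proof.
move=> cs.
have [c1|c1] := eqVneq c (-1).
  have s0 : s = 0 by apply/eqP; rewrite -sqrf_eq0; apply/eqP; rewrite c1 in cs; lra.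
  by exists 0, 1; split; rewrite ?c1 ?s0; ring.
have c10 : 0 < 2 * (1 + c).
  rewrite mulr_gt0// lt0r addrC addr_eq0 c1 /=; have := sqr_ge0 s; nra.
pose k := Num.sqrt (2 * (1 + c)).
have k0 : k != 0 by rewrite gt_eqF// sqrtr_gt0.
have kk : k ^+ 2 = 2 * (1 + c) by rewrite sqr_sqrtr// ltW.
have h1 : 1 + c != 0 by rewrite addrC addr_eq0.
exists ((1 + c) / k), (s / k); rewrite !expr_div_n kk.
have -> : 2 * ((1 + c) / k) * (s / k) = 2 * (1 + c) * s / k ^+ 2 by field.
have -> : s ^+ 2 = 1 - c ^+ 2 by lra.
by rewrite kk; split; field.
Qed.

Lemma rz_mul (c s c' s' : R) : rz c s *m rz c' s' = rz (c * c' - s * s') (s * c' + c * s').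
Proof.
by apply/matrixP; apply: ord3P; apply: ord3P; rewrite !mxE !sum3 !mxE /=; ring.
Qed.

Lemma rx_mul (c s c' s' : R) : rx c s *m rx c' s' = rx (c * c' - s * s') (s * c' + c * s').
Proof.
by apply/matrixP; apply: ord3P; apply: ord3P; rewrite !mxE !sum3 !mxE /=; ring.
Qed.

Lemma rot2_mul (c s c' s' : R) : rot2 c s *m rot2 c' s' = rot2 (c * c' - s * s') (s * c' + c * s').
Proof.
by apply/matrixP; apply: ord2P; apply: ord2P; rewrite !mxE !sum2 !mxE /=; ring.
Qed.

Lemma rz_sqrt (c s : R) : c ^+ 2 + s ^+ 2 = 1 ->
  exists c' s', c' ^+ 2 + s' ^+ 2 = 1 /\ rz c s = rz c' s' *m rz c' s'.
Proof.
move=> /half_angle[c' [s' [cs -> ->]]]; exists c', s'; split=> //.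
by rewrite rz_mul; congr rz; ring.
Qed.

Lemma rx_sqrt (c s : R) : c ^+ 2 + s ^+ 2 = 1 ->
  exists c' s', c' ^+ 2 + s' ^+ 2 = 1 /\ rx c s = rx c' s' *m rx c' s'.
Proof.
move=> /half_angle[c' [s' [cs -> ->]]]; exists c', s'; split=> //.
by rewrite rx_mul; congr rx; ring.
Qed.

Lemma rot2_sqrt (c s : R) : c ^+ 2 + s ^+ 2 = 1 ->
  exists c' s', c' ^+ 2 + s' ^+ 2 = 1 /\ rot2 c s = rot2 c' s' *m rot2 c' s'.
Proof.
move=> /half_angle[c' [s' [cs -> ->]]]; exists c', s'; split=> //.
by rewrite rot2_mul; congr rot2; ring.
Qed.

End Rotations.

(** * Limits of matrices *)

Section MatrixLimits.
Variables (R : realType) (T : Type) (F : set_system T).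
Hypothesis FF : Filter F.

Lemma cvg_mxP (U : topologicalType) m n (f : T -> 'M[U]_(m, n)) (l : 'M[U]_(m, n)) :
  f @ F --> l <-> forall i j, f t i j @[t --> F] --> l i j.
Proof.
split=> [fl i j A nA|fl A [P nP PA]].
  rewrite nbhs_simpl; apply: (fl [set M : 'M[U]_(m, n) | A (M i j)]).
  exists (fun i' j' => [set x | i' = i -> j' = j -> A x]).
    move=> i' j'; have [->|ni] := pselect (i' = i); last first.
      by apply: filterS filterT => x _ /ni.
    have [->|nj] := pselect (j' = j); last by apply: filterS filterT => x _ _ /nj.
    by apply: filterS nA => x Ax _ _.
  by move=> M /(_ i j) /=; exact.
rewrite nbhs_simpl.
have : \forall t \near F, forall ij : 'I_m * 'I_n, P ij.1 ij.2 (f t ij.1 ij.2).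
  by apply: filter_forall => -[i j]; exact: fl.
by apply: filterS => t h; apply: PA => i j; exact: (h (i, j)).
Qed.

Lemma cvg_coord (U : topologicalType) m n (f : T -> 'M[U]_(m, n)) (l : 'M[U]_(m, n)) i j :
  f @ F --> l -> f t i j @[t --> F] --> l i j.
Proof. by move/cvg_mxP. Qed.

Lemma cvg_mx (U : topologicalType) m n (f : T -> 'M[U]_(m, n)) (l : 'M[U]_(m, n)) :
  (forall i j, f t i j @[t --> F] --> l i j) -> f @ F --> l.
Proof. by move/cvg_mxP. Qed.

Lemma cvg_bigsum (V : normedModType R) I (r : seq I) (P : pred I) (f : I -> T -> V) (l : I -> V) :
  (forall i, P i -> f i @ F --> l i) ->
  \sum_(i <- r | P i) f i t @[t --> F] --> \sum_(i <- r | P i) l i.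
Proof.
move=> fl; elim: r => [|i r IH].
  by rewrite big_nil; under eq_fun do rewrite big_nil; exact: cvg_cst.
rewrite big_cons; under eq_fun do rewrite big_cons.
by case: ifPn => // Pi; apply: cvgD => //; exact: fl.
Qed.

Lemma cvg_bigprod I (r : seq I) (P : pred I) (f : I -> T -> R) (l : I -> R) :
  (forall i, P i -> f i @ F --> l i) ->
  \prod_(i <- r | P i) f i t @[t --> F] --> \prod_(i <- r | P i) l i.
Proof.
move=> fl; elim: r => [|i r IH].
  by rewrite big_nil; under eq_fun do rewrite big_nil; exact: cvg_cst.
rewrite big_cons; under eq_fun do rewrite big_cons.
by case: ifPn => // Pi; apply: cvgM => //; exact: fl.
Qed.

Lemma cvg_mulmx m n p (f : T -> 'M[R]_(m, n)) (g : T -> 'M[R]_(n, p)) (A : 'M[R]_(m, n)) (B : 'M[R]_(n, p)) :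
  f @ F --> A -> g @ F --> B -> f t *m g t @[t --> F] --> A *m B.
Proof.
move=> /cvg_mxP fA /cvg_mxP gB; apply/cvg_mxP => i j.
under eq_fun do rewrite mxE; rewrite mxE.
by apply: cvg_bigsum => k _; exact: cvgM.
Qed.

Lemma cvg_trmx m n (f : T -> 'M[R]_(m, n)) (A : 'M[R]_(m, n)) : f @ F --> A -> (f t)^T @[t --> F] --> A^T.
Proof.
move=> /cvg_mxP fA; apply/cvg_mxP => i j; under eq_fun do rewrite mxE.
by rewrite mxE; exact: fA.
Qed.

Lemma cvg_scalemx m n (c : T -> R) (f : T -> 'M[R]_(m, n)) (a : R) (A : 'M[R]_(m, n)) :
  c @ F --> a -> f @ F --> A -> c t *: f t @[t --> F] --> a *: A.
Proof.
move=> ca /cvg_mxP fA; apply/cvg_mxP => i j; under eq_fun do rewrite mxE.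
by rewrite mxE; apply: cvgM => //; exact: fA.
Qed.

Lemma cvg_det n (f : T -> 'M[R]_n) (A : 'M[R]_n) : f @ F --> A -> \det (f t) @[t --> F] --> \det A.
Proof.
move=> /cvg_mxP fA; rewrite /determinant.
apply: cvg_bigsum => s _; apply: cvgM; first exact: cvg_cst.
by apply: cvg_bigprod => i _; exact: fA.
Qed.

Lemma cvg_adj n (f : T -> 'M[R]_n) (A : 'M[R]_n) : f @ F --> A -> \adj (f t) @[t --> F] --> \adj A.
Proof.
move=> fA; apply/cvg_mxP => i j; under eq_fun do rewrite mxE; rewrite mxE.
rewrite /cofactor; apply: cvgM; first exact: cvg_cst.
apply: cvg_det; apply/cvg_mxP => k l; under eq_fun do rewrite !mxE; rewrite !mxE.
by move/cvg_mxP : fA; apply.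
Qed.

Lemma near_unitmx n (f : T -> 'M[R]_n) (A : 'M[R]_n) : f @ F --> A -> A \in unitmx ->
  \forall t \near F, f t \in unitmx.
Proof.
move=> /cvg_det dA uA; have dA0 : \det A != 0 by rewrite unitmxE unitfE in uA.
have : \forall t \near F, \det (f t) != 0.
  apply: (dA [set x | x != 0]).
  by apply: open_nbhs_nbhs; split=> //; exact: open_neq.
by apply: filterS => t; rewrite unitmxE unitfE.
Qed.

Lemma cvg_invmx n (f : T -> 'M[R]_n) (A : 'M[R]_n) : f @ F --> A -> A \in unitmx ->
  invmx (f t) @[t --> F] --> invmx A.
Proof.
move=> fA uA; have uf := near_unitmx fA uA.
have dA0 : \det A != 0 by rewrite unitmxE unitfE in uA.
have -> : invmx A = (\det A)^-1 *: \adj A by rewrite /invmx uA.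
apply: (@cvg_trans _ ((\det (f t))^-1 *: \adj (f t) @[t --> F])).
  by apply: near_eq_cvg; apply: filterS uf => t uft; rewrite /invmx uft.
apply: cvg_scalemx; last exact: cvg_adj.
by apply: cvgV => //; exact: cvg_det.
Qed.

End MatrixLimits.

(** * Compact matrix groups preserve a quadratic form *)

Section FixedPoint.
Variables (R : realType) (n : nat).
Implicit Types x y : 'rV[R]_n.

Definition nrm2 x : R := \sum_j x 0 j ^+ 2.

Lemma nrm2_ge0 x : 0 <= nrm2 x.
Proof. by apply: sumr_ge0 => j _; exact: sqr_ge0. Qed.

Lemma nrm2_coord x j : x 0 j ^+ 2 <= nrm2 x.
Proof.
by rewrite /nrm2 (bigD1 j)//= lerDl; apply: sumr_ge0 => k _; exact: sqr_ge0.
Qed.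

Lemma nrm2_eq0 x : nrm2 x <= 0 -> x = 0.
Proof.
move=> x0; apply/rowP => j; rewrite mxE; apply/eqP; rewrite -sqrf_eq0 eq_le sqr_ge0 andbT.
exact: le_trans (nrm2_coord x j) x0.
Qed.

Lemma nrm2_mid x y :
  nrm2 (2^-1 *: (x + y)) = 2^-1 * nrm2 x + 2^-1 * nrm2 y - 4^-1 * nrm2 (x - y).
Proof.
rewrite /nrm2 !mulr_sumr -big_split /= -sumrB; apply: eq_bigr => j _ /=.
by rewrite !mxE; field.
Qed.

Lemma continuous_nrm2 (T : topologicalType) (f : T -> 'rV[R]_n) :
  continuous f -> continuous (fun t => nrm2 (f t)).
Proof.
move=> cf t; apply: (@cvg_bigsum R _ (nbhs t)) => j _.
have /cvg_mxP/(_ 0 j) cj := cf t.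
by rewrite expr2; under eq_fun do rewrite expr2; exact: cvgM.
Qed.

Lemma compact_nrm2 (K : set 'rV[R]_n) (c : R) :
  closed K -> (forall x, K x -> nrm2 x <= c) -> compact K.
Proof.
move=> clK bK.
have -> : K = [set x : 'rV[R]_n | forall i, `[- (1 + c), 1 + c]%classic (x ord0 i)] `&` K.
  apply/seteqP; split=> [x Kx|x []//]; split=> // i /=.
  rewrite in_itv /= -ler_norml.
  have := le_trans (nrm2_coord x i) (bK x Kx).
  rewrite (_ : x ord0 i ^+ 2 = `|x ord0 i| ^+ 2); last by rewrite real_normK ?num_real.
  by have := normr_ge0 (x ord0 i); nra.
apply: compact_closedI => //.
by apply: (@rV_compact R n (fun=> `[- (1 + c), 1 + c]%classic)) => i; exact: segment_compact.
Qed.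

(* The point of K minimising sup_T |T x|^2 is unique by the parallelogram law,
   hence fixed. *)
Lemma bounded_group_fixpoint (K : set 'rV[R]_n) (G : set ('rV[R]_n -> 'rV[R]_n)) (M : R) :
  closed K -> K !=set0 ->
  (forall x y, K x -> K y -> K (2^-1 *: (x + y))) ->
  (forall T x, G T -> K x -> K (T x)) ->
  (forall T, G T -> continuous T) ->
  (forall T x y, G T -> T (x + y) = T x + T y) ->
  (forall T a x, G T -> T (a *: x) = a *: T x) ->
  G id -> (forall S T, G S -> G T -> G (S \o T)) ->
  (forall T, G T -> exists2 T', G T' & cancel T T') ->
  (forall T x, G T -> nrm2 (T x) <= M * nrm2 x) ->
  exists2 x, K x & forall T, G T -> T x = x.
Proof.
move=> clK [x0 Kx0] Kmid GK Gc GD GZ G1 GM GV Gb.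
(* Sublevel sets of the supremum of [nrm2] over the orbit; they are bounded because [G] contains the
   identity. *)
pose D (c : R) := [set x | K x /\ forall T, G T -> nrm2 (T x) <= c].
have clD c : closed (D c).
  have -> : D c = K `&` \bigcap_(T in G) [set x | nrm2 (T x) <= c].
    by apply/seteqP; split=> [x [Kx h]|x [Kx h]]; split=> // T GT; exact: (h T).
  apply: closedI => //; apply: closed_bigI => T GT.
  apply: (@preimage_closed _ _ (fun x => nrm2 (T x)) [set r | r <= c]); last exact: closed_le.
  by move=> x _; apply: continuous_nrm2; exact: Gc.
have cD c : compact (D c).
  by apply: (@compact_nrm2 _ c (clD c)) => x [_ /(_ id G1)].
pose E := [set c | D c !=set0].
have E0 : E !=set0 by exists (M * nrm2 x0); exists x0; split=> // T; exact: Gb.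
have Elb : lbound E 0.
  by move=> c [x [_ /(_ id G1)]]; apply: le_trans; exact: nrm2_ge0.
have infE : has_inf E by split=> //; exists 0.
pose mu := inf E.
have Dmu e : 0 < e -> D (mu + e) !=set0.
  move=> e0; have [c [x [Kx xc]] cmu] := inf_adherent e0 infE.
  by exists x; split=> // T GT; exact: le_trans (xc T GT) (ltW cmu).
have [x Dx] : D mu !=set0.
  (* The infimum is attained: the nested compact sets [D (mu + e)] generate a proper filter, and a
     cluster point lies in all of them. *)
  pose F := filter_from [set e : R | 0 < e] (fun e => D (mu + e)).
  have FF : ProperFilter F.
    apply: filter_from_proper; last by move=> e /Dmu.
    apply: filter_from_filter; first by exists 1 => /=; exact: ltr01.
    move=> e e' e0 e'0; exists (Num.min e e'); first by rewrite /= lt_min e0.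
    move=> y [Ky h]; split; split=> // T /h /le_trans; apply.
      by rewrite lerD2l ge_min lexx.
    by rewrite lerD2l ge_min lexx orbT.
  have F1 : F (D (mu + 1)) by exists 1 => //=; exact: ltr01.
  have [x [_ clx]] := cD (mu + 1) F FF F1.
  exists x.
  have Dxe e : 0 < e -> D (mu + e) x.
    move=> e0; apply: clD => B nB; apply: clx => //.
    by exists e.
  split; first by have [] := Dxe _ ltr01.
  move=> T GT; apply/ler_addgt0Pr => e /Dxe[_]; exact.
have [Kx xmu] := Dx.
(* The factor 4 comes from the parallelogram law. The inverse of [T] enlarges [nrm2] at most by the
   factor M, so [T] shrinks it at most by 1 + |M|, a bound that is certainly positive. *)
have M0 : 0 < 4 * (1 + `|M|) by rewrite mulr_gt0// ltr_wpDr.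
exists x => // S GS; apply/esym/eqP; rewrite -subr_eq0; apply/eqP/nrm2_eq0.
set y := S x.
pose z := 2^-1 *: (x + y).
(* If [S] moved [x], the midpoint of [x] and [S x] would lie in a sublevel set below the infimum. *)
have Dz : D (mu - nrm2 (x - y) / (4 * (1 + `|M|))) z.
  split; first by apply: Kmid => //; exact: GK.
  move=> T GT; rewrite /z GZ// GD// nrm2_mid.
  have h1 := xmu _ GT.
  have h2 := xmu _ (GM _ _ GT GS).
  rewrite /= -/y in h2.
  have [T' GT' TK] := GV _ GT.
  have h3 : nrm2 (x - y) <= (1 + `|M|) * nrm2 (T x - T y).
    have -> : T x - T y = T (x - y) by rewrite -(scaleN1r y) GD// GZ// scaleN1r.
    rewrite -{1}(TK (x - y)); apply: le_trans (Gb _ _ GT') _.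
    apply: ler_wpM2r; first exact: nrm2_ge0.
    by apply: le_trans (ler_norm _) _; rewrite lerDr.
  have h4 : nrm2 (x - y) / (4 * (1 + `|M|)) <= 4^-1 * nrm2 (T x - T y).
    by rewrite ler_pdivrMr//; apply: le_trans h3 _; rewrite le_eqVlt; apply/orP; left; apply/eqP; field.
  by move: h1 h2 h4; lra.
have : mu <= mu - nrm2 (x - y) / (4 * (1 + `|M|)).
  by apply: ge_inf; [exists 0|exists z].
rewrite lerBrDl gerDr.
by rewrite pmulr_lle0// invr_gt0.
Qed.

End FixedPoint.

(** * Invariant complements and invariant inner products *)

Section UnitaryTrick.
Variable R : realType.

Definition qf n (Q : 'M[R]_n) (v : 'cV[R]_n) : R := (v^T *m Q *m v) 0 0.

(** Symmetric elimination: [M1] clears the first row and column and leaves the Schur complement [S],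
    which is again symmetric and positive definite; the positive pivot is scaled to 1 by its square
    root. *)
Lemma cholesky n (Q : 'M[R]_n) : Q^T = Q -> (forall v, v != 0 -> 0 < qf Q v) ->
  exists2 M, M \in unitmx & M^T *m Q *m M = 1%:M.
Proof.
elim: n Q => [|n IH] Q Qs Qp.
  by exists 1%:M; rewrite ?unitmx1//; apply/matrixP => -[].
rewrite -[n.+1]/(1 + n)%N in Q Qs Qp *.
pose q := ulsubmx Q; pose w := ursubmx Q; pose Q' := drsubmx Q.
have QE : Q = block_mx q w w^T Q' by rewrite -[LHS]submxK trmx_ursub Qs.
have q's : Q'^T = Q' by rewrite /Q' trmx_drsub Qs.
have q0 : 0 < q 0 0.
  have := Qp (col_mx 1%:M 0); rewrite /qf tr_col_mx trmx0 trmx1 QE mul_row_block mul_row_col.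
  rewrite !mul0mx !addr0 mul1mx mulmx1 mulmx0 addr0; apply.
  apply/eqP => /(congr1 usubmx); rewrite col_mxKu => /matrixP/(_ 0 0).
  by rewrite !mxE; apply/eqP; rewrite oner_eq0.
have qE : q = (q 0 0)%:M by rewrite [LHS]mx11_scalar.
set k := q 0 0 in q0 qE.
pose M1 : 'M[R]_(1 + n) := block_mx 1%:M (- (k^-1 *: w)) 0 1%:M.
pose S := Q' - k^-1 *: (w^T *m w).
have k0 : k != 0 by rewrite gt_eqF.
have M1E : M1^T *m Q *m M1 = block_mx q 0 0 S.
  have E1 : (- (k^-1 *: w))^T *m k%:M + w^T = 0.
    by rewrite linearN linearZ /= mulNmx mul_mx_scalar scalerA divff// scale1r addNr.
  have E2 : k%:M *m (- (k^-1 *: w)) + w = 0.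
    by rewrite mulmxN mul_scalar_mx scalerA divff// scale1r addNr.
  rewrite /M1 QE tr_block_mx !mulmx_block !trmx1 !trmx0 !mul1mx !mul0mx !mulmx1 !mulmx0 !addr0.
  rewrite qE E1 E2 mul0mx add0r; congr block_mx.
  by rewrite /S linearN linearZ /= mulNmx -scalemxAl addrC.
have Ss : S^T = S by rewrite /S linearB /= linearZ /= trmx_mul trmxK q's.
have Sp v : v != 0 -> 0 < qf S v.
  move=> v0; have := Qp (M1 *m col_mx 0 v).
  rewrite /qf trmx_mul !mulmxA -(mulmxA _ M1^T) -(mulmxA _ _ M1) M1E tr_col_mx mul_row_block mul_row_col.
  rewrite trmx0 !mul0mx !mulmx0 !add0r; apply.
  apply: contra_neq v0 => /(congr1 dsubmx).
  by rewrite /M1 mul_block_col col_mxKd mul0mx mul1mx add0r => ->; rewrite linear0.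
have [M' uM' M'E] := IH _ Ss Sp.
pose M2 : 'M[R]_(1 + n) := block_mx ((Num.sqrt k)^-1)%:M 0 0 M'.
have sk0 : Num.sqrt k != 0 by rewrite gt_eqF// sqrtr_gt0.
exists (M1 *m M2).
  rewrite unitmx_mul !unitmxE /M1 /M2 !det_ublock !det1 !mulr1 unitr1 /=.
  by rewrite det_scalar1 unitrM unitrV unitfE sk0 /= -unitmxE.
rewrite trmx_mul !mulmxA -(mulmxA _ M1^T) -(mulmxA _ _ M1) M1E /M2 tr_block_mx !mulmx_block.
rewrite !trmx0 !mul0mx !mulmx0 !addr0 !add0r M'E tr_scalar_mx qE -!scalar_mxM.
rewrite [RHS](@scalar_mx_block _ 1 n 1); congr block_mx; rewrite ?mul0mx//; congr (_%:M).
by rewrite mulrAC -invfM -expr2 sqr_sqrtr ?ltW// mulVf.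
Qed.

Lemma nrm2_bound m n (x : 'rV[R]_m) (y : 'rV[R]_n) (c : R) :
  (forall j, `|y 0 j| <= c * Num.sqrt (nrm2 x)) -> nrm2 y <= n%:R * c ^+ 2 * nrm2 x.
Proof.
move=> h; rewrite /nrm2 -/(nrm2 x) (le_trans (y := \sum_(j < n) c ^+ 2 * nrm2 x))//.
  apply: ler_sum => j _; rewrite -(sqr_sqrtr (nrm2_ge0 x)) -exprMn.
  rewrite -[leLHS]real_normK ?num_real//.
  by rewrite lerXn2r ?nnegrE ?normr_ge0// (le_trans _ (h j)).
by rewrite sumr_const card_ord -[leLHS]mulr_natl mulrA.
Qed.

Lemma coord_sqrt_nrm2 n (x : 'rV[R]_n) j : `|x 0 j| <= Num.sqrt (nrm2 x).
Proof.
rewrite -sqrtr_sqr ler_sqrt ?nrm2_coord//.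
exact: nrm2_ge0.
Qed.

Lemma ler_norm_mulmx m n p (A : 'M[R]_(m, n)) (B : 'M[R]_(n, p)) a b :
  (forall i j, `|A i j| <= a) -> (forall i j, `|B i j| <= b) ->
  forall i j, `|(A *m B) i j| <= n%:R * (a * b).
Proof.
move=> hA hB i j; rewrite mxE; apply: le_trans (ler_norm_sum _ _ _) _.
rewrite (le_trans (y := \sum_(k < n) a * b))//.
  by apply: ler_sum => k _; rewrite normrM ler_pM.
by rewrite sumr_const card_ord -[leLHS]mulr_natl.
Qed.

(** What compactness of SO_3 leaves to its linear images: a group with a uniform bound on the matrix
    entries. *)
Record bounded_group n (G : set 'M[R]_n) (c : R) : Prop := BoundedGroup {
  bg1 : G 1%:M;
  bgM : forall A B, G A -> G B -> G (A *m B);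
  bgV : forall A, G A -> exists2 B, G B & B *m A = 1%:M;
  bg_le : forall A, G A -> forall i j, `|A i j| <= c }.

Lemma bounded_group_tr n (G : set 'M[R]_n) c : bounded_group G c ->
  bounded_group [set A^T | A in G] c.
Proof.
move=> [G1 GM GV Gc]; split.
- by exists 1%:M => //; rewrite trmx1.
- by move=> _ _ [A GA <-] [B GB <-]; exists (B *m A); rewrite ?trmx_mul//; exact: GM.
- move=> _ [A GA <-]; have [B GB BA] := GV _ GA; exists B^T; first by exists B.
  by rewrite -trmx_mul (mulmx1C BA) trmx1.
- by move=> _ [A GA <-] i j; rewrite mxE; exact: Gc.
Qed.

Lemma bounded_group_inv n (G : set 'M[R]_n) c A : bounded_group G c -> G A ->
  exists B, [/\ G B, A *m B = 1%:M & B *m A = 1%:M].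
Proof. by move=> bG GA; have [B GB BA] := bgV bG GA; exists B; rewrite BA (mulmx1C BA). Qed.

(** Since [G] fixes [x], right multiplication preserves the affine space of rows taking the value 1
    at [x]. A fixed row has as its kernel an invariant complement of the line spanned by [x]. *)
Lemma affine_fixpoint n (G : set 'M[R]_n) c (x : 'cV[R]_n) (w : 'rV[R]_n) :
  bounded_group G c -> (forall A, G A -> A *m x = x) -> w *m x = 1%:M ->
  exists w' : 'rV[R]_n, w' *m x = 1%:M /\ forall A, G A -> w' *m A = w'.
Proof.
move=> bG Gx wx; have [G1 GM GV Gc] := bG.
pose K := [set v : 'rV[R]_n | v *m x = 1%:M].
pose TG := [set T | exists2 A, G A & T = (fun v : 'rV[R]_n => v *m A)].
have cm m n' (B : 'M[R]_(n, n')) : continuous (fun v : 'M[R]_(m, n) => v *m B).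
  move=> v; apply: (@cvg_mulmx _ _ (nbhs v) _ _ _ _ id (fun=> B)); last exact: cvg_cst. by [].
have [|||||||||||w' Kw' w'T] := @bounded_group_fixpoint R n K TG (n%:R * (n%:R * c) ^+ 2).
- have -> : K = [set v : 'rV[R]_n | (v *m x) 0 0 = 1].
    apply/seteqP; split=> v /=; first by rewrite /K /= => ->; rewrite mxE.
    by move=> vx; rewrite /K /= [LHS]mx11_scalar vx.
  apply: (@preimage_closed _ _ (fun v : 'rV[R]_n => (v *m x) 0 0) [set r : R | r = 1]).
    by move=> v _; move: (cm _ _ x v) => /cvg_mxP; apply.
  exact: closed_eq.
- by exists w.
- move=> u v; rewrite /K /= => ux vx; rewrite -scalemxAl mulmxDl ux vx.
  by rewrite scalerDr -scalerDl (_ : 2^-1 + 2^-1 = 1) ?scale1r//; field.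
- by move=> _ v [A GA ->]; rewrite /K /= -mulmxA Gx.
- by move=> _ [A GA ->]; exact: cm.
- by move=> _ u v [A GA ->]; rewrite mulmxDl.
- by move=> _ a u [A GA ->]; rewrite scalemxAl.
- by exists 1%:M => //; apply/funext => v; rewrite mulmx1.
- move=> _ _ [A GA ->] [B GB ->]; exists (B *m A); first exact: GM.
  by apply/funext => v /=; rewrite mulmxA.
- move=> _ [A GA ->]; have [B [GB AB BA]] := bounded_group_inv bG GA.
  by exists (fun v => v *m B); [exists B|move=> v; rewrite -mulmxA AB mulmx1].
- move=> _ v [A GA ->]; apply: nrm2_bound => j.
  apply: le_trans (ler_norm_mulmx (a := Num.sqrt (nrm2 v)) (b := c) _ _ 0 j) _.
  + by move=> i k; rewrite ord1; exact: coord_sqrt_nrm2.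
  + exact: Gc.
  + by rewrite (mulrC _ c) mulrA.
exists w'; split=> // A GA.
by apply: (w'T (fun v => v *m A)); exists A.
Qed.

(** Weyl's unitary trick. The group acts on vectorised matrices by [A^T *m q *m A]; a fixed point
    among suitably positive matrices yields an invariant inner product, which [cholesky] turns into
    the standard one. *)
Lemma unitary_trick n (G : set 'M[R]_n) c : bounded_group G c ->
  exists2 M, M \in unitmx &
    forall A, G A -> (invmx M *m A *m M)^T *m (invmx M *m A *m M) = 1%:M.
Proof.
move=> bG; have [G1 GM GV Gc] := bG.
pose act (A : 'M[R]_n) (q : 'rV[R]_(n * n)) := mxvec (A^T *m vec_mx q *m A).
(* A bound for the factor by which inverses of group elements enlarge [nrm2], plus 1 to keep it
   positive. *)
pose d : R := n%:R * (n%:R * c) ^+ 2 + 1.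
have d0 : 0 < d by rewrite ltr_wpDl// mulr_ge0// sqr_ge0.
(* Testing the form at [A *m v] for all [A] makes [K] stable under the group. The uniform lower
   bound makes [K] closed while all its members stay positive definite; a strict inequality would do
   only the latter. *)
pose K := [set q : 'rV[R]_(n * n) |
  forall A v, G A -> nrm2 v^T <= d * qf (vec_mx q) (A *m v)].
pose TG := [set T | exists2 A, G A & T = act A].
have cact A : continuous (act A).
  move=> q; apply: (@cvg_mx _ (nbhs q)) => i j.
  rewrite ord1; case/mxvec_indexP : j => k l.
  under eq_fun do rewrite mxvecE; rewrite mxvecE.
  apply: (@cvg_coord _ (nbhs q) _ _ _ _ (fun t => A^T *m vec_mx t *m A) (A^T *m vec_mx q *m A)).
  apply: cvg_mulmx; last exact: cvg_cst.
  apply: cvg_mulmx; first exact: cvg_cst.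
  apply: (@cvg_mx _ (nbhs q)) => k' l'; under eq_fun do rewrite mxE; rewrite mxE.
  exact: coord_continuous.
have qfE v w' : qf v w' = (w'^T *m v *m w') 0 0 by [].
have clK : closed K.
  have -> : K = \bigcap_(Av in [set Av : 'M[R]_n * 'cV[R]_n | G Av.1])
      [set q | nrm2 (Av.2)^T <= d * qf (vec_mx q) (Av.1 *m Av.2)].
    apply/seteqP; split=> q h; first by move=> [A v] /= GA; exact: h.
    by move=> A v GA; exact: (h (A, v)).
  apply: closed_bigI => -[A v] _ /=.
  apply: (@preimage_closed _ _ (fun q => d * qf (vec_mx q) (A *m v)) [set r | nrm2 v^T <= r]).
    move=> q _; apply: (@continuousM _ _ (fun=> d) (fun q => qf (vec_mx q) (A *m v))); [exact: cst_continuous|].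
    apply: (@cvg_coord _ (nbhs q) _ _ _ _ (fun t => (A *m v)^T *m vec_mx t *m (A *m v))
      ((A *m v)^T *m vec_mx q *m (A *m v))).
    apply: cvg_mulmx; last exact: cvg_cst.
    apply: cvg_mulmx; first exact: cvg_cst.
    apply: cvg_mx => k' l'; under eq_fun do rewrite mxE; rewrite mxE.
    exact: coord_continuous.
  exact: closed_ge.
have K1 : K (mxvec 1%:M).
  move=> A v GA; rewrite /qf mxvecK mulmx1.
  have [B [GB AB BA]] := bounded_group_inv bG GA.
  have -> : ((A *m v)^T *m (A *m v)) 0 0 = nrm2 (A *m v)^T.
    by rewrite mxE /nrm2; apply: eq_bigr => i _; rewrite !mxE expr2.
  have -> : v^T = (A *m v)^T *m B^T by rewrite -trmx_mul mulmxA BA mul1mx.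
  have : nrm2 ((A *m v)^T *m B^T) <= n%:R * (n%:R * c) ^+ 2 * nrm2 (A *m v)^T.
    apply: nrm2_bound => j.
    apply: le_trans (ler_norm_mulmx (a := Num.sqrt (nrm2 (A *m v)^T)) (b := c) _ _ 0 j) _.
    + by move=> i k; rewrite ord1; exact: coord_sqrt_nrm2.
    + by move=> i k; rewrite mxE; exact: Gc.
    + by rewrite (mulrC _ c) mulrA.
  by move=> /le_trans; apply; rewrite /d mulrDl mul1r lerDl nrm2_ge0.
have [||||||||||q Kq qT] := @bounded_group_fixpoint R _ K TG
    ((n * n)%:R * (n%:R * (n%:R * c) * c) ^+ 2) clK.
- by exists (mxvec 1%:M).
- move=> p q Kp Kq A v GA; have := Kp _ v GA; have := Kq _ v GA.
  rewrite linearZ linearD /= /qf -scalemxAr -scalemxAl mulmxDr mulmxDl !mxE.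
  by move=> ? ?; lra.
- move=> _ q [A GA ->] Kq B v GB.
  rewrite /act /qf mxvecK !mulmxA -trmx_mul -!mulmxA !(mulmxA _ _ v) -/(qf _ _) !mulmxA.
  have := Kq _ v (GM _ _ GA GB).
  by rewrite /qf !mulmxA !trmx_mul !mulmxA.
- by move=> _ [A GA ->]; exact: cact.
- by move=> _ p q [A GA ->]; rewrite /act linearD /= mulmxDr mulmxDl linearD.
- by move=> _ a p [A GA ->]; rewrite /act linearZ /= -scalemxAr -scalemxAl linearZ.
- by exists 1%:M => //; apply/funext => q; rewrite /act trmx1 mul1mx mulmx1 vec_mxK.
- move=> _ _ [A GA ->] [B GB ->]; exists (B *m A); first exact: GM.
  by apply/funext => q; rewrite /act /= mxvecK trmx_mul !mulmxA.
- move=> _ [A GA ->]; have [B [GB AB BA]] := bounded_group_inv bG GA.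
  exists (act B); first by exists B.
  move=> q; rewrite /act mxvecK !mulmxA -trmx_mul AB trmx1 mul1mx -mulmxA AB mulmx1.
  by rewrite vec_mxK.
- move=> _ q [A GA ->]; apply: nrm2_bound => j.
  case/mxvec_indexP : j => k l; rewrite mxvecE.
  apply: le_trans (ler_norm_mulmx (a := n%:R * (c * Num.sqrt (nrm2 q))) (b := c) _ _ k l) _.
  + apply: ler_norm_mulmx => i j; first by rewrite mxE; exact: Gc.
    by rewrite mxE; exact: coord_sqrt_nrm2.
  + exact: Gc.
  + by rewrite le_eqVlt; apply/orP; left; apply/eqP; ring.
pose Q := vec_mx q.
have QA A : G A -> A^T *m Q *m A = Q.
  by move=> GA; have /(congr1 vec_mx) := qT (act A) (ex_intro2 _ _ A GA erefl); rewrite /act mxvecK.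
have Qp (v : 'cV[R]_n) : v != 0 -> 0 < qf Q v.
  move=> v0; have := Kq 1%:M v G1; rewrite mul1mx => h.
  rewrite -(pmulr_rgt0 _ d0); apply: lt_le_trans h.
  rewrite lt_def nrm2_ge0 andbT; apply: contra_neq v0 => v0.
  by rewrite -[v]trmxK [v^T]nrm2_eq0 ?v0// trmx0.
(* Members of [K] need not be symmetric, so the fixed one is symmetrised. *)
pose S := Q + Q^T.
have [||M uM MS] := @cholesky n S.
- by rewrite /S linearD /= trmxK addrC.
- move=> v /Qp Qv.
  have E : qf Q^T v = qf Q v.
    by rewrite /qf -[in RHS](trmxK (v^T *m Q *m v)) [RHS]mxE !trmx_mul trmxK mulmxA.
  have -> : qf S v = qf Q v + qf Q^T v by rewrite /qf mulmxDr mulmxDl [LHS]mxE.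
  by rewrite E addr_gt0.
exists M => // A GA.
have SA : A^T *m S *m A = S.
  rewrite /S mulmxDr mulmxDl QA//; congr (_ + _).
  by rewrite -{2}(QA _ GA) !trmx_mul trmxK mulmxA.
have uMt : M^T \in unitmx by rewrite unitmx_tr.
have SE : S = invmx M^T *m invmx M.
  by rewrite -[S](mulKmx uMt) -[M^T *m S](mulmxK uM) MS mul1mx.
have -> : (invmx M *m A *m M)^T *m (invmx M *m A *m M) =
    M^T *m (A^T *m (invmx M^T *m invmx M) *m A) *m M.
  by rewrite !trmx_mul trmx_inv !mulmxA.
by rewrite -SE SA MS.
Qed.

End UnitaryTrick.

(** * Homomorphisms into the rotation group *)

Section Homs.
Variable R : realType.
Local Notation SO n := (@special_orthogonal_group R n).

Lemma within_cvg (T U : topologicalType) (A : set T) (f : T -> U) :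
  {within A, continuous f} <-> forall x, A x -> f y @[y --> within A (nbhs x)] --> f x.
Proof. exact: subspace_continuousP. Qed.

Lemma cvg_into_within (S : Type) (F : set_system S) (T : topologicalType) (A : set T) (p : S -> T) (x : T) :
  Filter F -> p @ F --> x -> (\forall s \near F, A (p s)) -> p @ F --> within A (nbhs x).
Proof.
move=> FF px pA B nB; have h := px [set y | A y -> B y] nB.
by apply: filterS2 pA h => s As; exact.
Qed.

Lemma within_comp (S T U : topologicalType) (D : set S) (A : set T) (p : S -> T) (f : T -> U) :
  {within D, continuous p} -> (forall s, D s -> A (p s)) -> {within A, continuous f} ->
  {within D, continuous (f \o p)}.
Proof.
move=> /within_cvg cp pA /within_cvg cf; apply/within_cvg => s Ds.
apply: (@cvg_comp _ _ _ p f _ (within A (nbhs (p s)))); last exact: cf (pA _ Ds).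
apply: cvg_into_within; first exact: cp.
by rewrite near_withinE; apply: filterS filterT => t _; exact: pA.
Qed.

(** A half circle parametrised by the cosine, from the half turn at -1 to the identity at 1. *)
Definition so2_path (t : R) : 'M[R]_2 := rot2 t (Num.sqrt (1 - t ^+ 2)).

Lemma so2_pathP (t : R) : `[-1, 1]%classic t -> t ^+ 2 + Num.sqrt (1 - t ^+ 2) ^+ 2 = 1.
Proof.
rewrite /= in_itv /= => /andP[t1 t2]; rewrite sqr_sqrtr; first by ring.
by nra.
Qed.

Lemma so2_path_so (t : R) : `[-1, 1]%classic t -> SO 2 (so2_path t).
Proof. by move=> /so2_pathP ht; apply/so2P; exists t, (Num.sqrt (1 - t ^+ 2)). Qed.

Lemma continuous_so2_path : continuous so2_path.
Proof.
have cs : continuous (fun t : R => Num.sqrt (1 - t ^+ 2)).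
  move=> t; apply: (@cvg_comp _ _ _ (fun t : R => 1 - t ^+ 2) Num.sqrt (nbhs t) (nbhs (1 - t ^+ 2)));
    last exact: sqrt_continuous.
  by apply: cvgB; [exact: cvg_cst|exact: exprn_continuous].
move=> t; apply: (@cvg_mx _ (nbhs t)); apply: ord2P; apply: ord2P;
  under eq_fun do rewrite mxE /=; rewrite mxE /=.
- exact: cvg_id.
- by apply: cvgN; exact: cs.
- exact: cs.
- exact: cvg_id.
Qed.

Definition hom_on m n (G : set 'M[R]_m) (f : 'M[R]_m -> 'M[R]_n) : Prop :=
  forall A B, G A -> G B -> f (A *m B) = f A *m f B.

(** What commutes with the half turn about the z-axis preserves its eigenspace for the eigenvalue 1,
    which is that axis. *)
Lemma commute_rzpi (A : 'M[R]_3) : SO 3 A -> A *m rz (-1) 0 = rz (-1) 0 *m A ->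
  A *m e_ R 2 = e_ R 2 \/ A *m e_ R 2 = - e_ R 2.
Proof.
move=> SA AD.
have De : rz (-1) 0 *m e_ R 2 = e_ R 2.
  by rewrite mul_e; apply: colP'; rewrite !mxE.
have := congr1 (fun M => M *m e_ R 2) AD; rewrite -!mulmxA De mul_e => /colP hh.
have := hh 0; have := hh 1; rewrite !mxE !sum3 !mxE /= => h1 h0.
have {}h0 : A 0 2 = 0 by lra.
have {}h1 : A 1 2 = 0 by lra.
have := so3_dot (e_ R 2) (e_ R 2) SA; rewrite mul_e /dot !mxE /= h0 h1 => h2.
have : (A 2 2 - 1) * (A 2 2 + 1) = 0 by move: h2; lra.
move=> /eqP; rewrite mulf_eq0 subr_eq0 addr_eq0 => /orP[/eqP h|/eqP h]; [left|right];
  by apply: colP'; rewrite !mxE ?h0 ?h1 ?h /=; lra.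
Qed.

(** All images commute with the half turn, hence preserve or reverse the z-axis; a square fixes
    [e_ 2], and every plane rotation is a square. For surjectivity, the cosine of the image runs
    along [so2_path] through all values between -1 and 1, and passing to the inverse corrects the
    sign of the sine. *)
Lemma circle_hom (f : 'M[R]_2 -> 'M[R]_3) :
  {within SO 2, continuous f} -> hom_on (SO 2) f -> (forall A, SO 2 A -> SO 3 (f A)) ->
  f (rot2 (-1) 0) = rz (-1) 0 ->
  (forall A, SO 2 A -> exists c s, c ^+ 2 + s ^+ 2 = 1 /\ f A = rz c s) /\
  (forall c s, c ^+ 2 + s ^+ 2 = 1 -> exists2 A, SO 2 A & f A = rz c s).
Proof.
move=> cf fM fS fpi.
have Spi : SO 2 (rot2 (-1) 0) by apply/so2P; exists (-1), 0; split=> //; ring.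
have f1 : f 1%:M = 1%:M.
  have := fM _ _ (so_1 R 2) (so_1 R 2); rewrite mulmx1 => h.
  have := congr1 (mulmx (f 1%:M)^T) h.
  by rewrite mulmxA so_mulVmx ?mul1mx// ; apply: fS; exact: so_1.
have fz A : SO 2 A -> exists c s, c ^+ 2 + s ^+ 2 = 1 /\ f A = rz c s.
  move=> /[dup] SA /so2P[c [s [cs AE]]].
  have [c' [s' [cs' E]]] := rot2_sqrt cs.
  have SB : SO 2 (rot2 c' s') by apply/so2P; exists c', s'.
  rewrite AE E fM//; apply: so3_stab_e2; first by apply: so_mul; exact: fS.
  have /(_ _)[|h|h] := @commute_rzpi (f (rot2 c' s')) (fS _ SB).
  - by rewrite -fpi -!fM// !rot2_mul; congr f; congr rot2; ring.
  - by rewrite -mulmxA !h.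
  - by rewrite -mulmxA h mulmxN h opprK.
split=> // c s cs.
have c1 : -1 <= c <= 1 by apply/andP; split; nra.
have cont : {within `[-1, 1]%classic, continuous (fun t => f (so2_path t) 0 0)}.
  have h : {within `[-1, 1]%classic, continuous (f \o so2_path)}.
    apply: within_comp cf; last exact: so2_path_so.
    exact/continuous_subspaceT/continuous_so2_path.
  apply/within_cvg => x xi; have /within_cvg/(_ x xi) := h.
  exact: cvg_coord.
have [||t ti ft] := @IVT R (fun t => f (so2_path t) 0 0) (-1) 1 c _ cont.
- by lra.
- have -> : so2_path (-1) = rot2 (-1) 0.
    by rewrite /so2_path sqrrN expr1n subrr sqrtr0.
  have -> : so2_path 1 = 1%:M.
    rewrite /so2_path expr1n subrr sqrtr0.
    by apply/matrixP; apply: ord2P; apply: ord2P; rewrite !mxE //= oppr0.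
  rewrite fpi f1 !mxE /= mulr1n.
  by rewrite ge_min le_max; apply/andP; split; apply/orP; [left|right]; lra.
have St := so2_path_so ti.
have [c' [s' [cs' fE]]] := fz _ St.
have c'E : c' = c by rewrite -ft fE !mxE.
have ss : (s' - s) * (s' + s) = 0 by move: cs' cs; rewrite c'E; nra.
move: ss => /eqP; rewrite mulf_eq0 subr_eq0 addr_eq0 => /orP[/eqP s'E|/eqP s'E].
  by exists (so2_path t); rewrite // fE c'E s'E.
exists (so2_path t)^T; first exact: so_tr.
have h : f (so2_path t) *m f (so2_path t)^T = 1%:M.
  by rewrite -fM ?so_mulmxV//; exact: so_tr.
have h' : rz c' s' *m rz c s = 1%:M.
  rewrite rz_mul c'E s'E; apply/matrixP; apply: ord3P; apply: ord3P; rewrite !mxE //=; nra.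
rewrite fE in h.
have S' : SO 3 (rz c' s') by exact: so_rz.
by rewrite -[LHS]mul1mx -[RHS]mul1mx -(so_mulVmx S') -!mulmxA h h'.
Qed.

(** In odd dimension [A^T *m (A - 1%:M) = - (A - 1%:M)^T] makes the determinant of [A - 1%:M] equal
    to its own negative. *)
Lemma so3_axis (A : 'M[R]_3) : SO 3 A -> exists2 u, dot u u = 1 & A *m u = u.
Proof.
move=> [AA dA].
have d0 : \det (A - 1%:M)^T = 0.
  rewrite det_tr; have : \det (A - 1%:M) = - \det (A - 1%:M).
    have E : A^T *m (A - 1%:M) = - (A - 1%:M)^T.
      by rewrite mulmxBr AA mulmx1 linearB /= trmx1 opprB.
    have := congr1 determinant E; rewrite det_mulmx det_tr dA mul1r => e; rewrite [LHS]e.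
    by rewrite -(scaleN1r (A - 1%:M)^T) detZ det_tr; ring.
  lra.
have /det0P[v v0 vA] := introT eqP d0.
have vv : 0 < dot v^T v^T.
  rewrite lt_def; apply/andP; split; last by rewrite /dot -!expr2 !addr_ge0 ?sqr_ge0.
  apply: contra_neq v0; rewrite /dot !mxE -!expr2 => /eqP.
  rewrite !paddr_eq0 ?addr_ge0 ?sqr_ge0// !sqrf_eq0 => /andP[/andP[/eqP h0 /eqP h1] /eqP h2].
  by apply/rowP; apply: ord3P; rewrite mxE.
have Av : A *m v^T = v^T.
  apply/eqP; rewrite -subr_eq0 -{2}(mul1mx v^T) -mulmxBl -[A - _]trmxK -trmx_mul vA trmx0//.
pose k := (Num.sqrt (dot v^T v^T))^-1.
exists (k *: v^T); last by rewrite -scalemxAr Av.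
have -> : dot (k *: v^T) (k *: v^T) = k ^+ 2 * dot v^T v^T by rewrite /dot !mxE; ring.
by rewrite /k exprVn sqr_sqrtr ?ltW// mulVf// gt_eqF.
Qed.

Lemma so3_move2 (u : 'cV[R]_3) : dot u u = 1 -> exists2 A, SO 3 A & A *m e_ R 2 = u.
Proof.
move=> uu; have [v [vv uv]] := orthogonal_unit_exists uu.
have vu : dot v u = 0 by rewrite -uv /dot; ring.
have [A [SA A0 A1]] := so3_frame vv uu vu.
have [P' [SP' P0' P1']] := rx_cyc R.
exists (A *m P'^T); first by apply: so_mul => //; exact: so_tr.
by rewrite -P1' -!mulmxA (mulmxA P'^T) so_mulVmx// mul1mx A1.
Qed.

Lemma halfturn_conj (h : 'M[R]_3) : SO 3 h -> h *m h = 1%:M -> h <> 1%:M ->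
  exists2 A, SO 3 A & A^T *m h *m A = rz (-1) 0.
Proof.
move=> Sh hh h1; have [u uu hu] := so3_axis Sh.
have [A SA Ae] := so3_move2 uu; exists A => //.
have Sg : SO 3 (A^T *m h *m A) by apply: so_mul => //; apply: so_mul => //; exact: so_tr.
have [|c [s [cs gE]]] := so3_stab_e2 Sg.
  by rewrite -!mulmxA Ae hu -Ae mulmxA so_mulVmx// mul1mx.
have gg : rz c s *m rz c s = 1%:M.
  rewrite -gE -!mulmxA (mulmxA A) so_mulmxV// mul1mx (mulmxA h) hh mul1mx.
  exact: so_mulVmx.
have := congr1 (fun M : 'M[R]_3 => M 0 0) gg; have := congr1 (fun M : 'M[R]_3 => M 1 0) gg.
rewrite rz_mul !mxE /= => e1 e0.
have s0 : s = 0 by apply/eqP; rewrite -sqrf_eq0; apply/eqP; move: e0 cs; lra.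
have : (c - 1) * (c + 1) = 0 by move: cs; rewrite s0; lra.
move=> /eqP; rewrite mulf_eq0 subr_eq0 addr_eq0 => /orP[/eqP c1|/eqP c1]; last by rewrite gE c1 s0.
exfalso; apply: h1.
have g1 : A^T *m h *m A = 1%:M.
  by rewrite gE c1 s0; apply/matrixP; apply: ord3P; apply: ord3P; rewrite !mxE //= oppr0.
have : A *m (A^T *m h *m A) *m A^T = 1%:M by rewrite g1 mulmx1 so_mulmxV.
by rewrite !mulmxA so_mulmxV// mul1mx -mulmxA so_mulmxV// mulmx1.
Qed.

Lemma rz_flip (c s : R) : flip R *m (rz c s)^T = rz c s *m flip R.
Proof. by apply/matrixP; apply: ord3P; apply: ord3P; rewrite !mxE !sum3 !mxE /=; ring. Qed.

Lemma rz1 : rz 1 0 = 1%:M :> 'M[R]_3.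
Proof. by apply/matrixP; apply: ord3P; apply: ord3P; rewrite !mxE //= oppr0. Qed.

Lemma rz_comm (c s c' s' : R) : rz c s *m rz c' s' = rz c' s' *m rz c s.
Proof. by rewrite !rz_mul; congr rz; ring. Qed.

(** Distinct commuting half turns have perpendicular axes. Once the axis of [h1] is vertical, [h2]
    reverses it and becomes [rz c s *m flip R], a half turn about a horizontal axis; the rotation by
    half the angle carries the x-axis to that axis. *)
Lemma halfturns_conj (h1 h2 : 'M[R]_3) : SO 3 h1 -> SO 3 h2 -> h1 *m h1 = 1%:M -> h2 *m h2 = 1%:M ->
  h1 *m h2 = h2 *m h1 -> h1 <> 1%:M -> h2 <> 1%:M -> h1 <> h2 ->
  exists2 A, SO 3 A & A^T *m h1 *m A = rz (-1) 0 /\ A^T *m h2 *m A = flip R.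
Proof.
move=> S1 S2 h11 h22 h12 n1 n2 n12.
have [A SA AE] := halfturn_conj S1 h11 n1.
have SAt := so_tr SA.
pose g := A^T *m h2 *m A.
have conjM X Y : (A^T *m X *m A) *m (A^T *m Y *m A) = A^T *m (X *m Y) *m A.
  by rewrite -!mulmxA (mulmxA A A^T) so_mulmxV// mul1mx.
have conjI X Y : A^T *m X *m A = A^T *m Y *m A -> X = Y.
  move=> /(congr1 (fun M => A *m M *m A^T)).
  by rewrite !mulmxA so_mulmxV// !mul1mx -!mulmxA so_mulmxV// !mulmx1.
have Sg : SO 3 g by apply: so_mul => //; exact: so_mul.
have gg : g *m g = 1%:M by rewrite conjM h22 mulmx1 so_mulVmx.
have gD : g *m rz (-1) 0 = rz (-1) 0 *m g by rewrite -AE !conjM h12.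
have cf := so_flip R.
have [ge|ge] := commute_rzpi Sg gD.
  have [c [s [cs gE]]] := so3_stab_e2 Sg ge.
  rewrite gE in gg.
  have := congr1 (fun M : 'M[R]_3 => M 0 0) gg; rewrite rz_mul !mxE /= => e0.
  have s0 : s = 0 by apply/eqP; rewrite -sqrf_eq0; apply/eqP; move: e0 cs; lra.
  have : (c - 1) * (c + 1) = 0 by move: cs; rewrite s0; lra.
  move=> /eqP; rewrite mulf_eq0 subr_eq0 addr_eq0 => /orP[/eqP c1|/eqP c1]; exfalso.
    by apply: n2; apply: conjI; rewrite -/g gE c1 s0 rz1 mulmx1 so_mulVmx.
  by apply: n12; apply: conjI; rewrite -/g gE c1 s0.
have [c [s [cs gE]]] := so3_flip_e2 Sg ge.
have [c' [s' [cs' E]]] := rz_sqrt cs.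
have S' := so_rz cs'.
exists (A *m rz c' s'); first exact: so_mul.
split.
  rewrite trmx_mul !mulmxA -(mulmxA _ A^T) -(mulmxA _ _ A) AE.
  by rewrite -mulmxA rz_comm mulmxA so_mulVmx// mul1mx.
rewrite trmx_mul !mulmxA -(mulmxA _ A^T) -(mulmxA _ _ A) -/g gE E.
rewrite -(mulmxA (rz c' s')) -rz_flip !mulmxA so_mulVmx// mul1mx -mulmxA.
by rewrite so_mulVmx// mulmx1.
Qed.

(** Two commuting half turns have images of the same type by injectivity, so after a conjugation
    both are fixed. Then [circle_hom] applies to the rotations about the z-axis and to those about
    the x-axis, and these generate SO_3. *)
Lemma so3_hom_surj (f : 'M[R]_3 -> 'M[R]_3) :
  {within SO 3, continuous f} -> hom_on (SO 3) f -> (forall A, SO 3 A -> SO 3 (f A)) ->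
  (forall A, SO 3 A -> f A = 1%:M -> A = 1%:M) ->
  forall B, SO 3 B -> exists2 A, SO 3 A & f A = B.
Proof.
move=> cf fM fS fI.
have f1 : f 1%:M = 1%:M.
  have := fM _ _ (so_1 R 3) (so_1 R 3); rewrite mulmx1 => h.
  have := congr1 (mulmx (f 1%:M)^T) h.
  by rewrite mulmxA so_mulVmx ?mul1mx//; apply: fS; exact: so_1.
have Spi : SO 3 (rz (-1 : R) 0) by apply: so_rz; ring.
have Sfl := so_flip R.
have pipi : rz (-1) 0 *m rz (-1) 0 = 1%:M :> 'M[R]_3 by rewrite rz_mul -rz1; congr rz; ring.
have ff : flip R *m flip R = 1%:M.
  by apply/matrixP; apply: ord3P; apply: ord3P; rewrite !mxE !sum3 !mxE /= ?(mulr1n, mulr0n); ring.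
have npi : rz (-1) 0 <> 1%:M :> 'M[R]_3.
  by move=> /matrixP/(_ 0 0); rewrite !mxE /= mulr1n; lra.
have nfl : flip R <> 1%:M by move=> /matrixP/(_ 1 1); rewrite !mxE /= mulr1n; lra.
have npf : rz (-1) 0 *m flip R <> 1%:M.
  by move=> /matrixP/(_ 0 0); rewrite !mxE !sum3 !mxE /= mulr1n; lra.
have pf : rz (-1) 0 *m flip R = flip R *m rz (-1) 0.
  by apply/matrixP; apply: ord3P; apply: ord3P; rewrite !mxE !sum3 !mxE /=; ring.
have [||||||||A SA [A1 A2]] := @halfturns_conj (f (rz (-1) 0)) (f (flip R)).
- exact: fS.
- exact: fS.
- by rewrite -fM// pipi f1.
- by rewrite -fM// ff f1.
- by rewrite -!fM// pf.
- by move=> /(fI _ Spi).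
- by move=> /(fI _ Sfl).
- move=> h; apply: npf; apply: fI; first exact: so_mul.
  by rewrite fM// h -fM// ff f1.
have SAt := so_tr SA.
pose g X := A^T *m f X *m A.
have gM : hom_on (SO 3) g.
  by move=> X Y SX SY; rewrite /g fM// -!mulmxA (mulmxA A A^T) so_mulmxV// mul1mx.
have gS X : SO 3 X -> SO 3 (g X).
  by move=> /fS SX; apply: so_mul => //; exact: so_mul.
have cg : {within SO 3, continuous g}.
  apply/within_cvg => X SX; apply: cvg_mulmx; last exact: cvg_cst.
  apply: cvg_mulmx; first exact: cvg_cst.
  by move/within_cvg : cf => /(_ X SX).
have mz : continuous (fun M : 'M[R]_2 => rz (M 0 0) (M 1 0)).
  move=> M; apply: (@cvg_mx _ (nbhs M)); apply: ord3P; apply: ord3P;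
    under eq_fun do rewrite mxE /=; rewrite mxE /=; try exact: cvg_cst; try exact: coord_continuous.
  by apply: cvgN; exact: coord_continuous.
have mx : continuous (fun M : 'M[R]_2 => rx (M 0 0) (M 1 0)).
  move=> M; apply: (@cvg_mx _ (nbhs M)); apply: ord3P; apply: ord3P;
    under eq_fun do rewrite mxE /=; rewrite mxE /=; try exact: cvg_cst; try exact: coord_continuous.
  by apply: cvgN; exact: coord_continuous.
have zS (M : 'M[R]_2) : SO 2 M -> SO 3 (rz (M 0 0) (M 1 0)).
  by move=> /so2P[c [s [cs ->]]]; rewrite !mxE; exact: so_rz.
have xS (M : 'M[R]_2) : SO 2 M -> SO 3 (rx (M 0 0) (M 1 0)).
  by move=> /so2P[c [s [cs ->]]]; rewrite !mxE; exact: so_rx.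
(* [P] permutes the axes cyclically and carries the z-axis to the x-axis, which brings the second
   circle into the position that [circle_hom] requires. *)
pose P : 'M[R]_3 := mxs 3 3 [:: [:: 0; 0; 1]; [:: 1; 0; 0]; [:: 0; 1; 0]].
have SP : SO 3 P.
  split; last by rewrite det3 !mxE /=; ring.
  by apply/matrixP; apply: ord3P; apply: ord3P; rewrite !mxE !sum3 !mxE /= ?(mulr1n, mulr0n); ring.
have SPt := so_tr SP.
have Prx (c s : R) : rx c s = P *m rz c s *m P^T.
  by apply/matrixP; apply: ord3P; apply: ord3P; rewrite !mxE !sum3 !mxE !sum3 !mxE /=; ring.
have flE : flip R = rx (-1) 0.
  by apply/matrixP; apply: ord3P; apply: ord3P; rewrite !mxE /= ?oppr0.
have imz c s : c ^+ 2 + s ^+ 2 = 1 -> exists2 X, SO 3 X & g X = rz c s.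
  move=> cs; have [||||_ /(_ c s cs)[X SX XE]] := @circle_hom (fun M => g (rz (M 0 0) (M 1 0))).
  - by apply: (within_comp (p := fun M : 'M[R]_2 => rz (M 0 0) (M 1 0))) zS cg; exact: continuous_subspaceT.
  - move=> _ _ /so2P[c1 [s1 [cs1 ->]]] /so2P[c2 [s2 [cs2 ->]]].
    rewrite -gM; [|by rewrite !mxE; exact: so_rz..].
    by congr g; rewrite rz_mul rot2_mul !mxE /=.
  - by move=> M /zS; exact: gS.
  - by rewrite !mxE /= -[RHS]A1.
  by exists (rz (X 0 0) (X 1 0)) => //; exact: zS.
have conjP (X Y : 'M[R]_3) : (P^T *m X *m P) *m (P^T *m Y *m P) = P^T *m (X *m Y) *m P.
  by rewrite -!mulmxA (mulmxA P P^T) so_mulmxV// mul1mx.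
have conjK (Y : 'M[R]_3) : P *m (P^T *m Y *m P) *m P^T = Y.
  by rewrite !mulmxA so_mulmxV// mul1mx -mulmxA so_mulmxV// mulmx1.
have imx c s : c ^+ 2 + s ^+ 2 = 1 -> exists2 X, SO 3 X & g X = rx c s.
  move=> cs; have [||||_ /(_ c s cs)[X SX XE]] := @circle_hom (fun M => P^T *m g (rx (M 0 0) (M 1 0)) *m P).
  - apply/within_cvg => M SM; apply: cvg_mulmx; last exact: cvg_cst.
    apply: cvg_mulmx; first exact: cvg_cst.
    have /within_cvg : {within SO 2, continuous (g \o (fun M : 'M[R]_2 => rx (M 0 0) (M 1 0)))}.
      by apply: within_comp xS cg; exact: continuous_subspaceT.
    exact.
  - move=> _ _ /so2P[c1 [s1 [cs1 ->]]] /so2P[c2 [s2 [cs2 ->]]].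
    rewrite conjP -gM; [|by rewrite !mxE; exact: so_rx..].
    by rewrite rx_mul rot2_mul !mxE /=.
  - by move=> M /xS SM; apply: so_mul => //; apply: so_mul => //; exact: gS.
  - rewrite !mxE /= -flE /g A2 flE Prx !mulmxA so_mulVmx// mul1mx -mulmxA so_mulVmx// mulmx1//.
  exists (rx (X 0 0) (X 1 0)); first exact: xS.
  by rewrite (Prx c s) -XE conjK.
have gsurj : SO 3 `<=` [set B | exists2 X, SO 3 X & g X = B].
  apply: so3_gen => //.
  by move=> _ _ _ _ [X SX <-] [Y SY <-]; exists (X *m Y); [exact: so_mul|rewrite gM].
move=> B SB; have [|X SX XE] := gsurj (A^T *m B *m A).
  by apply: so_mul => //; exact: so_mul.
exists X => //; have := congr1 (fun M => A *m M *m A^T) XE.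
by rewrite /g !mulmxA so_mulmxV// !mul1mx -!mulmxA so_mulmxV// !mulmx1.
Qed.

End Homs.

(** * Linear actions of SO_3 with a fixed vector or covector *)

Section NormalForm.
Variable R : realType.
Local Notation SO n := (@special_orthogonal_group R n).

(** Closed and bounded as a set of vectors: the n columns of an orthogonal matrix are unit vectors,
    so the squared norm is n. *)
Lemma compact_so n : compact (SO n).
Proof.
pose K := [set q : 'rV[R]_(n * n) | SO n (vec_mx q)].
have cv : continuous (vec_mx : 'rV[R]_(n * n) -> 'M[R]_n).
  move=> q; apply: (@cvg_mx _ (nbhs q)) => i j; under eq_fun do rewrite mxE.
  by rewrite mxE; exact: coord_continuous.
have -> : SO n = vec_mx @` K.
  apply/seteqP; split=> [A SA|_ [q Kq <-]//]; exists (mxvec A); rewrite ?mxvecK//.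
  by rewrite /K /= mxvecK.
apply: continuous_compact; first exact: continuous_subspaceT.
apply: (@compact_nrm2 _ _ _ (\sum_(j < n) 1)).
  have -> : K = \bigcap_(ij in [set: 'I_n * 'I_n])
      [set q | ((vec_mx q)^T *m vec_mx q) ij.1 ij.2 = (1%:M : 'M[R]_n) ij.1 ij.2] `&`
      [set q | \det (vec_mx q) = 1].
    apply/seteqP; split=> q.
      by move=> [h d]; split=> // -[i j] _ /=; rewrite h.
    by move=> [h d]; split=> //; apply/matrixP => i j; exact: (h (i, j)).
  apply: closedI.
    apply: closed_bigI => -[i j] _ /=.
    apply: (@preimage_closed _ _ (fun q : 'rV[R]_(n * n) => ((vec_mx q)^T *m vec_mx q) i j) [set r | r = (1%:M : 'M[R]_n) i j]);
      last exact: closed_eq.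
    move=> q _; apply: (@cvg_coord _ (nbhs q) _ _ _ _ (fun q => (vec_mx q)^T *m vec_mx q)
      ((vec_mx q)^T *m vec_mx q)).
    by apply: cvg_mulmx; [apply: cvg_trmx|]; exact: cv.
  apply: (@preimage_closed _ _ (fun q : 'rV[R]_(n * n) => \det (vec_mx q)) [set r | r = 1]);
    last exact: closed_eq.
  by move=> q _; apply: (@cvg_det _ _ (nbhs q) _ _ (fun q => vec_mx q) (vec_mx q)); exact: cv.
move=> q [h _].
rewrite -[q]vec_mxK; set A := vec_mx q in h *.
have E : nrm2 (mxvec A) = \sum_i \sum_j A i j ^+ 2.
  rewrite /nrm2 (reindex _ (curry_mxvec_bij _ _)) pair_bigA /=.
  by apply: eq_bigr => -[i j] _ /=; rewrite mxvecE.
rewrite E exchange_big /=; apply: ler_sum => j _.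
have := congr1 (fun M : 'M[R]_n => M j j) h; rewrite !mxE eqxx mulr1n => <-.
by apply: ler_sum => i _; rewrite [A^T _ _]mxE expr2.
Qed.

Lemma within_compact_bounded m n p q (K : set 'M[R]_(m, n)) (f : 'M[R]_(m, n) -> 'M[R]_(p, q)) :
  compact K -> {within K, continuous f} -> exists c, forall A, K A -> forall i j, `|f A i j| <= c.
Proof.
move=> cK cf.
have h (ij : 'I_p * 'I_q) : exists c, forall A, K A -> `|f A ij.1 ij.2| <= c.
  have : compact ((fun A => f A ij.1 ij.2) @` K).
    apply: continuous_compact => //; apply/within_cvg => A KA.
    by apply: cvg_coord; move/within_cvg : cf; exact.
  move=> /compact_bounded[M [_ hM]].
  by exists (M + 1) => A KA; apply: (hM (M + 1)); [rewrite ltrDl|exists A].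
have [c hc] := choice h.
exists (\sum_ij `|c ij|) => A KA i j.
apply: le_trans (hc (i, j) A KA) _; apply: le_trans (ler_norm _) _.
by rewrite (bigD1 (i, j))//= lerDl sumr_ge0.
Qed.

Lemma affine_mxM (A B : 'M[R]_3) : affine_mx (A *m B) 0 = affine_mx A 0 *m affine_mx B 0.
Proof.
symmetry; apply: etrans (@mulmx_block R 3 1 3 1 3 1 A 0 0 1%:M B 0 0 1%:M) _.
by rewrite !mulmx0 !mul0mx !addr0 add0r mulmx1.
Qed.

Lemma affine_mx1 : affine_mx 1%:M 0 = 1%:M :> 'M[R]_4.
Proof. by rewrite /affine_mx -(@scalar_mx_block _ 3 1). Qed.

Lemma affine_mx_inj (A B : 'M[R]_3) : affine_mx A 0 = affine_mx B 0 -> A = B.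
Proof. by move=> /(@eq_block_mx _ 3 1 3 1)[]. Qed.

(** [e3] represents the origin of affine space and [e3r] is the equation of the plane at infinity; a
    matrix fixing both is a linear map of R^3. *)
Definition e3 : 'cV[R]_4 := delta_mx 3 0.
Definition e3r : 'rV[R]_4 := delta_mx 0 3.

Lemma affine_mxP (M : 'M[R]_4) : e3r *m M = e3r -> M *m e3 = e3 -> exists A, M = affine_mx A 0.
Proof.
rewrite /e3r /e3 -rowE -colE => /rowP hr /colP hc.
exists (ulsubmx (M : 'M[R]_(3 + 1))); rewrite /affine_mx; apply: etrans (esym (@submxK R 3 1 3 1 M)) _.
have l3 i : lshift 1 (i : 'I_3) != 3 :> 'I_4.
  by case: i => -[|[|[|//]]] h; apply/eqP => /(congr1 val).
have r3 (i : 'I_1) : rshift 3 i = 3 :> 'I_4 by rewrite ord1; exact: val_inj.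
congr (@block_mx R 3 1 3 1 _ _ _ _); apply/matrixP => i j.
- by have := hc (lshift 1 i); rewrite !mxE r3 (negbTE (l3 i)).
- by have := hr (lshift 1 j); rewrite !mxE r3 (negbTE (l3 j)) andbF.
- by have := hr (rshift 3 j); rewrite !mxE !r3 !ord1 !eqxx.
Qed.

(** Completion of independent rows to a basis, read off the rank decomposition [mulmx_ebase]. *)
Lemma extend_unitmx m n (X : 'M[R]_(m, m + n)) : row_free X ->
  exists2 E : 'M[R]_(m + n), E \in unitmx & usubmx E = X.
Proof.
move=> /eqP rX.
exists (block_mx (col_ebase X) 0 0 1%:M *m row_ebase X).
  by rewrite unitmx_mul row_ebase_unit andbT unitmxE det_ublock det1 mulr1 -unitmxE col_ebase_unit.
rewrite -[RHS](mulmx_ebase X) rX.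
rewrite -[row_ebase X](@vsubmxK _ m n) mul_block_col mul0mx addr0 col_mxKu.
rewrite -mulmxA pid_mx_row mul_row_col mul1mx mul0mx addr0//.
Qed.

Lemma adapted_frame (w : 'rV[R]_4) (x : 'cV[R]_4) : w *m x = 1%:M ->
  exists2 T, T \in unitmx & w *m T = e3r /\ T *m e3 = x.
Proof.
move=> wx.
have w0 : w != 0.
  by apply: contra_eq_neq wx => ->; rewrite mul0mx eq_sym oner_eq0.
have [|E uE Ew] := @extend_unitmx 1 3 w; first by rewrite /row_free rank_rV w0.
(* The completion has [w] as its row 0, while the frame wants it in the last place. *)
pose U := invmx E *m tperm_mx 0 3.
have uU : U \in unitmx by rewrite unitmx_mul unitmx_inv uE unitmx_perm.
have wU : w *m U = e3r.
  have -> : w = delta_mx 0 0 *m E.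
    rewrite -rowE -Ew; apply/rowP => j; rewrite !mxE; congr (E _ _); exact: val_inj.
  rewrite /U mulmxA mulmxK// -rowE; apply/rowP => j; rewrite !mxE tpermL eq_sym.
  by [].
pose y := invmx U *m x.
have ey : e3r *m y = 1%:M by rewrite -wU mulmxA mulmxK.
have ee : e3r *m e3 = 1%:M by rewrite /e3r /e3 mul_delta_mx; apply/matrixP => i j; rewrite !mxE !ord1.
have h0 : e3r *m (y - e3) = 0 by rewrite mulmxBr ey ee subrr.
have [d dE h0'] : exists2 d, y - e3 = d & e3r *m d = 0 by exists (y - e3).
(* A transvection: [d] lies in the kernel of [e3r], so it leaves [e3r] unchanged, moves [e3] to [y],
   and has the inverse [1%:M - d *m e3r]. *)
pose Y : 'M[R]_4 := 1%:M + d *m e3r.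
have uY : Y \in unitmx.
  have : Y *m (1%:M - d *m e3r) = 1%:M.
    rewrite /Y mulmxBr mulmx1 mulmxDl mul1mx !mulmxA -(mulmxA d) h0' mulmx0 mul0mx addr0.
    by rewrite addrK.
  by move=> /mulmx1_unit[].
exists (U *m Y); first by rewrite unitmx_mul uU.
split.
  by rewrite mulmxA wU mulmxDr mulmx1 mulmxA h0' mul0mx addr0.
rewrite -mulmxA /Y mulmxDl mul1mx -(mulmxA d) ee mulmx1 -dE addrC subrK /y mulmxA mulmxV// mul1mx//.
Qed.

End NormalForm.

Section NormalForm2.
Variable R : realType.
Local Notation SO n := (@special_orthogonal_group R n).

Lemma hom_bounded_group n (F : 'M[R]_3 -> 'M[R]_n) : {within SO 3, continuous F} ->
  hom_on (SO 3) F -> F 1%:M = 1%:M -> exists c, bounded_group [set F A | A in SO 3] c.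
Proof.
move=> cF FM F1; have [c Fc] := within_compact_bounded (@compact_so R 3) cF.
exists c; split.
- by exists 1%:M => //; exact: so_1.
- by move=> _ _ [A SA <-] [B SB <-]; exists (A *m B); [exact: so_mul|exact: FM].
- move=> _ [A SA <-]; exists (F A^T); first by exists A^T => //; exact: so_tr.
  by rewrite -FM ?so_mulVmx//; exact: so_tr.
- by move=> _ [A SA <-]; exact: Fc.
Qed.

(** Of the invariant covector and the invariant vector one is given and [affine_fixpoint] supplies
    the other, so in an adapted frame the action is linear on R^3. The unitary trick makes it
    orthogonal, determinants are 1 on squares, and [so3_hom_surj] shows that all rotations occur. *)
Lemma so3_normal_form (F : 'M[R]_3 -> 'M[R]_4) (w : 'rV[R]_4) (x : 'cV[R]_4) :
  {within SO 3, continuous F} -> hom_on (SO 3) F -> F 1%:M = 1%:M ->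
  (forall A, SO 3 A -> F A = 1%:M -> A = 1%:M) -> w *m x = 1%:M ->
  (forall A, SO 3 A -> w *m F A = w) \/ (forall A, SO 3 A -> F A *m x = x) ->
  exists2 T, T \in unitmx &
    (forall A, SO 3 A -> exists2 B, SO 3 B & invmx T *m F A *m T = affine_mx B 0) /\
    (forall B, SO 3 B -> exists2 A, SO 3 A & invmx T *m F A *m T = affine_mx B 0).
Proof.
move=> cF FM F1 FI wx wFx.
have [c bG] := hom_bounded_group cF FM F1.
have [w' [x' [wx' wF' Fx']]] : exists (w : 'rV[R]_4) (x : 'cV[R]_4), [/\ w *m x = 1%:M,
    forall A, SO 3 A -> w *m F A = w & forall A, SO 3 A -> F A *m x = x].
  case: wFx => [wF|Fx].
    have [||w' [w'x w'F]] := @affine_fixpoint _ _ _ c w^T x^T (bounded_group_tr bG).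
    - by move=> _ [_ [A SA <-] <-]; rewrite -trmx_mul wF.
    - by rewrite -trmx_mul wx trmx1.
    exists w, w'^T; split=> //.
      by rewrite -[w]trmxK -trmx_mul w'x trmx1.
    move=> A SA; rewrite -[F A]trmxK -trmx_mul w'F//.
    by exists (F A) => //; exists A.
  have [||w' [w'x w'F]] := @affine_fixpoint _ _ _ c x w bG.
  - by move=> _ [A SA <-]; exact: Fx.
  - by [].
  by exists w', x; split=> // A SA; apply: w'F; exists A.
move: w' x' wx' wF' Fx' => {w x wx wFx} w x wx wF Fx.
have [T1 uT1 [wT1 T1e]] := adapted_frame wx.
pose M A := invmx T1 *m F A *m T1.
have MM : hom_on (SO 3) M.
  by move=> A B SA SB; rewrite /M FM// -!mulmxA (mulmxA T1) mulmxV// mul1mx.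
pose F3 A : 'M[R]_3 := ulsubmx (M A : 'M[R]_(3 + 1)).
have F3E A : SO 3 A -> M A = affine_mx (F3 A) 0.
  move=> SA; have [||B ME] := @affine_mxP R (M A).
  - by rewrite /M -wT1 !mulmxA -(mulmxA w) mulmxV// mulmx1 wF.
  - by rewrite /M -(mulmxA _ T1) T1e -mulmxA Fx// -T1e mulmxA mulVmx// mul1mx.
  by rewrite ME; congr (affine_mx _ 0); rewrite /F3 ME (@block_mxKul R 3 1 3 1).
have F3M : hom_on (SO 3) F3.
  move=> A B SA SB; apply: affine_mx_inj.
  by rewrite affine_mxM -!F3E ?MM//; exact: so_mul.
have F31 : F3 1%:M = 1%:M.
  apply: affine_mx_inj; rewrite -F3E; last exact: so_1.
  by rewrite affine_mx1 /M F1 mulmx1 mulVmx.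
have cM : {within SO 3, continuous M}.
  apply/within_cvg => A SA; apply: cvg_mulmx; last exact: cvg_cst.
  apply: cvg_mulmx; first exact: cvg_cst.
  by move/within_cvg : cF; exact.
have cF3 : {within SO 3, continuous F3}.
  apply/within_cvg => A SA; apply: cvg_mx => i j.
  under eq_fun do rewrite mxE mxE; rewrite mxE mxE.
  by apply: (@cvg_coord _ _ _ _ _ _ M (M A)); move/within_cvg : cM; exact.
have [c' bG3] := hom_bounded_group cF3 F3M F31.
have [T2 uT2 orth] := unitary_trick bG3.
pose F4 A := invmx T2 *m F3 A *m T2.
have F4M : hom_on (SO 3) F4.
  by move=> A B SA SB; rewrite /F4 F3M// -!mulmxA (mulmxA T2 (invmx T2)) mulmxV// mul1mx.
have cF4 : {within SO 3, continuous F4}.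
  apply/within_cvg => A SA; apply: cvg_mulmx; last exact: cvg_cst.
  apply: cvg_mulmx; first exact: cvg_cst.
  by move/within_cvg : cF3; exact.
have F4O A : SO 3 A -> (F4 A)^T *m F4 A = 1%:M.
  by move=> SA; apply: orth; exists A.
have F4d A : SO 3 A -> \det (F4 A) ^+ 2 = 1.
  by move=> /F4O/(congr1 determinant); rewrite det_mulmx det_tr det1 expr2.
have F4S A : SO 3 A -> SO 3 (F4 A).
  move=> SA; split; first exact: F4O.
  move: A SA; apply: so3_gen => [A B SA SB dA dB|s c0 /rz_sqrt[c1 [s1 [cs1 ->]]]|s c0 /rx_sqrt[c1 [s1 [cs1 ->]]]] /=.
  - by rewrite F4M// det_mulmx dA dB mulr1.
  - have S1 := so_rz cs1; by rewrite F4M// det_mulmx -expr2 F4d.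
  - have S1 := so_rx cs1; by rewrite F4M// det_mulmx -expr2 F4d.
have F4I A : SO 3 A -> F4 A = 1%:M -> A = 1%:M.
  move=> SA h; apply: FI => //.
  have h3 : F3 A = 1%:M.
    have := congr1 (fun X => T2 *m X *m invmx T2) h.
    by rewrite /F4 !mulmxA mulmxV// mul1mx mulmxK// mulmx1 mulmxV.
  have : M A = 1%:M by rewrite F3E// h3 affine_mx1.
  move=> /(congr1 (fun X => T1 *m X *m invmx T1)).
  by rewrite /M !mulmxA mulmxV// mul1mx mulmxK// mulmx1 mulmxV.
have F4surj := so3_hom_surj cF4 F4M F4S F4I.
pose T := T1 *m affine_mx T2 0.
have aV : affine_mx (invmx T2) 0 *m affine_mx T2 0 = 1%:M.
  by rewrite -affine_mxM mulVmx// affine_mx1.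
have [_ ua] := mulmx1_unit aV.
have iT : invmx T = affine_mx (invmx T2) 0 *m invmx T1.
  have uT : T \in unitmx by rewrite unitmx_mul uT1.
  apply: (can_inj (mulKmx uT)); rewrite mulmxV// /T !mulmxA -(mulmxA T1).
  by rewrite (mulmx1C aV) mulmx1 mulmxV.
have TE A : SO 3 A -> invmx T *m F A *m T = affine_mx (F4 A) 0.
  move=> SA; rewrite iT /T !mulmxA -(mulmxA _ (invmx T1)) -(mulmxA _ (invmx T1 *m F A)).
  by rewrite -/(M A) F3E// /F4 !affine_mxM.
exists T; first by rewrite unitmx_mul uT1.
split=> [A SA|B /F4surj[A SA <-]]; last by exists A => //; exact: TE.
by exists (F4 A); [exact: F4S|exact: TE].
Qed.

End NormalForm2.

(** * Topology of the projective group and of the line spaces *)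

Section GL4.
Variable R : realType.
Local Notation gl4 := (gl4 R).
Local Notation pgl4 := (pgl4 R).

Lemma gl4_inj (A B : gl4) : gl4_mx A = gl4_mx B -> A = B.
Proof. exact: val_inj. Qed.

Lemma cvg_gl4 (S : Type) (F : set_system S) (f : S -> gl4) (A : gl4) : Filter F ->
  gl4_mx (f s) @[s --> F] --> gl4_mx A -> f @ F --> A.
Proof.
move=> FF fA U [_ [[C oC <-] CA] CU].
have h : F [set s | C (gl4_mx (f s))] by apply: fA; exact: open_nbhs_nbhs.
change (F (f @^-1` U)).
by apply: filterS h => s Cs; apply: CU.
Qed.

Lemma continuous_gl4_mx : continuous (@gl4_mx R).
Proof. by move=> A; exact: (@initial_continuous _ _ (@gl4_mx R)). Qed.

Lemma cvg_gl4_mx (S : Type) (F : set_system S) (f : S -> gl4) (A : gl4) : Filter F ->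
  f @ F --> A -> gl4_mx (f s) @[s --> F] --> gl4_mx A.
Proof.
by move=> FF fA; exact: (@cvg_comp _ _ _ f (@gl4_mx R) F (nbhs A) _ fA (@continuous_gl4_mx A)).
Qed.

Lemma cvg_gl4_mul (S : Type) (F : set_system S) (f g : S -> gl4) (A B : gl4) : Filter F ->
  f @ F --> A -> g @ F --> B -> gl4_mul (f s) (g s) @[s --> F] --> gl4_mul A B.
Proof.
by move=> FF fA gB; apply: cvg_gl4; apply: cvg_mulmx; exact: cvg_gl4_mx.
Qed.

Lemma gl4_mulA : associative (@gl4_mul R).
Proof. by move=> A B C; apply: gl4_inj; rewrite /= mulmxA. Qed.
Lemma gl4_mul1 : left_id (gl4_one R) (@gl4_mul R).
Proof. by move=> A; apply: gl4_inj; rewrite /= mul1mx. Qed.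
Lemma gl4_mulV (A : gl4) : gl4_mul (gl4_inv A) A = gl4_one R.
Proof. by apply: gl4_inj; rewrite /= mulVmx// gl4_unit. Qed.
Lemma gl4_Vmul (A : gl4) : gl4_mul A (gl4_inv A) = gl4_one R.
Proof. by apply: gl4_inj; rewrite /= mulmxV// gl4_unit. Qed.

(** * Spaces with the quotient topology of an orbit map of GL_4 *)

Section Homogeneous.
Variables (T : topologicalType) (act : gl4 -> T -> T) (t0 : T).
Hypothesis actM : forall A B t, act (gl4_mul A B) t = act A (act B t).
Hypothesis act1 : forall t, act (gl4_one R) t = t.
Hypothesis act_trans : forall t, exists A, act A t0 = t.
Hypothesis openE : forall U : set T, open U <-> open [set A | U (act A t0)].

Lemma actK A t : act (gl4_inv A) (act A t) = t.
Proof. by rewrite -actM gl4_mulV act1. Qed.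

(** The set of matrices carrying [t0] into the image of [V] is the union of the right translates of
    [V] by the stabiliser of [t0], hence open. *)
Lemma open_orbit (V : set gl4) : open V -> open [set act A t0 | A in V].
Proof.
move=> oV; apply/openE.
have -> : [set A | [set act A0 t0 | A0 in V] (act A t0)] =
    \bigcup_(S in [set S | act S t0 = t0]) [set A | V (gl4_mul A S)].
  apply/seteqP; split=> A /=.
    move=> [B VB BA]; exists (gl4_mul (gl4_inv A) B); first by rewrite /= actM BA actK.
    by rewrite /= gl4_mulA gl4_Vmul gl4_mul1.
  move=> [S S0 VS]; exists (gl4_mul A S) => //.
  by rewrite actM S0.
apply: bigcup_open => S _.
have /continuousP : continuous (fun A => gl4_mul A S); last exact.
by move=> A; apply: (@cvg_gl4_mul _ (nbhs A) id (fun=> S)); [exact: cvg_id|exact: cvg_cst].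
Qed.

Lemma continuous_orbit : continuous (act^~ t0).
Proof. by apply/continuousP => U /openE. Qed.

Lemma nbhs_orbit A (V : set gl4) : nbhs A V -> nbhs (act A t0) [set act B t0 | B in V].
Proof.
move=> nAV; have [V' [oV' V'A] V'V] : exists2 V', open_nbhs A V' & V' `<=` V by move: nAV; rewrite nbhsE.
apply: (@filterS _ _ _ [set act B t0 | B in V']).
  by move=> _ [B V'B <-]; exists B => //; exact: V'V.
apply: open_nbhs_nbhs; split; first exact: open_orbit.
by exists A.
Qed.

Lemma cvg_orbit (X : topologicalType) (f : T -> X) A (x : X) :
  f (act B t0) @[B --> A] --> x -> f @ act A t0 --> x.
Proof.
move=> fx W nW; apply: filterS (nbhs_orbit (fx W nW)).
by move=> _ [B /= WB <-].
Qed.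

(** Joint continuity: the point is lifted to a group element, multiplication is continuous there,
    and neighbourhoods are pushed down again because the orbit map is open. *)
Lemma cvg_act (S : Type) (F : set_system S) (f : S -> gl4) (g : S -> T) (A : gl4) (t : T) : Filter F ->
  f @ F --> A -> g @ F --> t -> act (f s) (g s) @[s --> F] --> act A t.
Proof.
move=> FF fA gt; have [B Bt] := act_trans t.
move=> W nW.
have h : nbhs (A, B) [set p : gl4 * gl4 | W (act (gl4_mul p.1 p.2) t0)].
  have : (gl4_mul p.1 p.2) @[p --> (A, B)] --> gl4_mul A B.
    by apply: (@cvg_gl4_mul _ (nbhs (A, B)) fst snd); [exact: cvg_fst|exact: cvg_snd].
  move=> /cvg_comp/(_ (@continuous_orbit (gl4_mul A B))) /=.
  by apply; rewrite actM Bt.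
have [[V1 V2] [nV1 nV2] V12] := h.
have h1 : F [set s | V1 (f s)] by exact: fA.
have h2 : F [set s | [set act C t0 | C in V2] (g s)].
  by apply: gt; rewrite -Bt; exact: nbhs_orbit.
change (F [set s | W (act (f s) (g s))]).
apply: filterS2 h1 h2 => s V1s [C V2C Cg] /=.
by rewrite -Cg -actM; apply: (V12 (f s, C)).
Qed.

Lemma cvg_pact (pact : pgl4 -> T -> T) (S : Type) (F : set_system S) (f : S -> pgl4)
    (g : S -> T) (a : pgl4) (t : T) : Filter F -> (forall A u, pact (pgl A) u = act A u) ->
  (forall A (V : set gl4), nbhs A V -> nbhs (pgl A) [set pgl B | B in V]) ->
  f @ F --> a -> g @ F --> t -> pact (f s) (g s) @[s --> F] --> pact a t.
Proof.
move=> FF pactE nbhs_pgl fa gt W nW.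
have nW' : nbhs (act (pgl_repr a) t) W by rewrite -pactE pgl_reprK.
have := @cvg_act _ (nbhs (pgl_repr a, t)) fst snd (pgl_repr a) t _
  (@cvg_fst _ _ _ _ _) (@cvg_snd _ _ _ _ _) W nW'.
move=> [[V1 V2] [/= nV1 nV2] V12].
have h1 : F [set s | [set pgl B | B in V1] (f s)].
  by apply: fa; rewrite -(pgl_reprK a); exact: nbhs_pgl.
have h2 : F [set s | V2 (g s)] by exact: gt.
change (F [set s | W (pact (f s) (g s))]).
apply: filterS2 h1 h2 => s [B V1B Bf] V2g /=.
by rewrite -Bf pactE; exact: (V12 (B, g s)).
Qed.

End Homogeneous.

Lemma pgl_openE (U : set pgl4) : open U <-> open [set A | U (pgl A * 1)%g].
Proof.
have -> : [set A | U (pgl A * 1)%g] = (@pgl R) @^-1` U.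
  by apply/seteqP; split=> A /=; rewrite mulg1.
by [].
Qed.

Lemma pgl_mulE' (A B : gl4) : pgl (gl4_mul A B) = (pgl A * pgl B)%g.
Proof. by rewrite -pgl_mulE. Qed.

Lemma pgl_oneE : pgl (gl4_one R) = 1%g.
Proof. by []. Qed.

Lemma continuous_pgl : continuous (@pgl R).
Proof.
rewrite (_ : @pgl R = fun A => (pgl A * 1)%g); last by apply/funext => A; rewrite mulg1.
exact: (@continuous_orbit pgl4 (fun A g => (pgl A * g)%g) 1%g pgl_openE).
Qed.

Lemma pgl_actM (A B : gl4) (t : pgl4) : (pgl (gl4_mul A B) * t = pgl A * (pgl B * t))%g.
Proof. by rewrite pgl_mulE' mulgA. Qed.

Lemma pgl_act1 (t : pgl4) : (pgl (gl4_one R) * t = t)%g.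
Proof. by rewrite pgl_oneE mul1g. Qed.

Lemma pgl_trans (g : pgl4) : exists A, (pgl A * 1 = g)%g.
Proof. by exists (pgl_repr g); rewrite mulg1 pgl_reprK. Qed.

Let pact (A : gl4) (g : pgl4) : pgl4 := (pgl A * g)%g.

Lemma nbhs_pgl (A : gl4) (V : set gl4) : nbhs A V -> nbhs (pgl A) [set pgl B | B in V].
Proof.
move=> /(@nbhs_orbit _ pact 1%g pgl_actM pgl_act1 pgl_openE).
rewrite /pact mulg1; apply: filterS => _ [B VB <-].
by exists B => //; rewrite mulg1.
Qed.

Lemma cvg_pgl (X : topologicalType) (f : pgl4 -> X) (A : gl4) (x : X) :
  f (pgl B) @[B --> A] --> x -> f @ pgl A --> x.
Proof.
move=> fx W nW; apply: filterS (nbhs_pgl (fx W nW)).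
by move=> _ [B /= WB <-].
Qed.

Lemma continuous_pgl_mul : continuous (fun p : pgl4 * pgl4 => (p.1 * p.2)%g).
Proof.
move=> [g h] W /= nW.
have nW' : nbhs (pgl (pgl_repr g) * h)%g W by rewrite pgl_reprK.
have := @cvg_act _ pact 1%g pgl_actM pgl_act1 pgl_trans pgl_openE _
  (nbhs (pgl_repr g, h)) fst snd (pgl_repr g) h _ (@cvg_fst _ _ _ _ _) (@cvg_snd _ _ _ _ _) W nW'.
move=> [[V1 V2] [/= nV1 nV2] V12].
exists ([set pgl B | B in V1], V2) => /=.
  by split=> //; rewrite -(pgl_reprK g); exact: nbhs_pgl.
by move=> [_ y] /= [[B V1B <-] V2y]; exact: (V12 (B, y)).
Qed.

Lemma cvg_pgl_mul (S : Type) (F : set_system S) (f g : S -> pgl4) (a b : pgl4) : Filter F ->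
  f @ F --> a -> g @ F --> b -> (f s * g s)%g @[s --> F] --> (a * b)%g.
Proof.
move=> FF fa gb; apply: (@cvg_comp _ _ _ (fun s => (f s, g s)) (fun p => (p.1 * p.2)%g) F (nbhs (a, b))).
  exact: (cvg_pair fa gb).
exact: (@continuous_pgl_mul (a, b)).
Qed.

End GL4.

(** * Bases of lines and oriented lines *)

Section Bases.
Variable R : realType.
Local Notation gl4 := (gl4 R).
Implicit Types (B : 'M[R]_(4, 2)) (l : line R) (m : oline R).

Lemma memv_limg4 q p (B : 'M[R]_(q, p)) v : v \in limg (hom4 B) <-> exists c : 'cV_p, v = B *m c.
Proof.
split=> [/memv_imgP[c _ ->]|[c ->]]; first by exists c; rewrite lfunE.
by apply/memv_imgP; exists c; rewrite ?memvf// lfunE.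
Qed.

Lemma xy_tr : (xy_basis R)^T *m xy_basis R = 1%:M.
Proof.
apply/matrixP; apply: ord2P; apply: ord2P; rewrite !mxE !sum4 !mxE /= ?(mulr1n, mulr0n); ring.
Qed.

Lemma basis_inj B : \dim (limg (hom4 B)) = 2 -> forall v : 'cV_2, B *m v = 0 -> v = 0.
Proof.
move=> dB v Bv.
have := limg_ker_dim (hom4 B) fullv; rewrite dB capfv dimvf /dim /= muln1 => /eqP.
rewrite -[X in _ == X]add0n eqn_add2r dimv_eq0 => /eqP ker0.
have : v \in lker (hom4 B) by rewrite memv_ker lfunE /= Bv.
by rewrite ker0 memv0 => /eqP.
Qed.

Lemma basis_gl4 B : \dim (limg (hom4 B)) = 2 -> exists A : gl4, A *m xy_basis R = B.
Proof.
move=> /basis_inj Bi.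
have [|E uE EB] := @extend_unitmx R 2 2 B^T.
  apply: inj_row_free => v vB; apply: trmx_inj; rewrite trmx0; apply: Bi.
  by rewrite -[LHS]trmxK trmx_mul trmxK vB trmx0.
have uE' : (E^T : 'M[R]_4) \in unitmx by rewrite unitmx_tr.
exists (GL4 uE'); apply/matrixP => i j.
have /matrixP/(_ j i) := EB; rewrite !mxE => <-.
rewrite (bigD1 (lshift 2 j : 'I_4))//= !mxE eqxx mulr1 big1 ?addr0//= => k kj.
rewrite !mxE (_ : (k == j :> nat) = false) ?mulr0//.
by apply/negbTE; apply: contra kj => /eqP kj; apply/eqP/val_inj.
Qed.

Lemma basis_left_inv B : \dim (limg (hom4 B)) = 2 -> exists B' : 'M[R]_(2, 4), B' *m B = 1%:M.
Proof.
move=> /basis_gl4[A <-]; exists ((xy_basis R)^T *m invmx A).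
by rewrite mulmxA mulmxKV ?gl4_unit// xy_tr.
Qed.

Lemma left_inv_basis B (B' : 'M[R]_(2, 4)) : B' *m B = 1%:M -> \dim (limg (hom4 B)) = 2.
Proof.
move=> BB; rewrite limg_dim_eq; first by rewrite dimvf /dim /= muln1.
apply/eqP; rewrite -subv0; apply/subvP => v.
rewrite memv_cap => /andP[_]; rewrite memv_ker lfunE /= => /eqP Bv.
by rewrite memv0 -[v]mul1mx -BB -mulmxA Bv mulmx0.
Qed.

Lemma unit2_left_inv (P P' : 'M[R]_2) : P' *m P = 1%:M -> \det P != 0.
Proof. by move=> /mulmx1_unit[_]; rewrite unitmxE unitfE. Qed.

Lemma limg_mulr B (P : 'M[R]_2) : \det P != 0 -> limg (hom4 (B *m P)) = limg (hom4 B).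
Proof.
move=> dP; have uP : P \in unitmx by rewrite unitmxE unitfE.
apply/vspaceP => v; apply/idP/idP => /memv_limg4[c ->]; apply/memv_limg4.
  by exists (P *m c); rewrite mulmxA.
by exists (invmx P *m c); rewrite -mulmxA mulKVmx.
Qed.

Lemma basis_change B B' : \dim (limg (hom4 B)) = 2 -> limg (hom4 B) = limg (hom4 B') ->
  exists2 P, \det P != 0 & B' = B *m P.
Proof.
move=> dB BB'; have dB' : \dim (limg (hom4 B')) = 2 by rewrite -BB'.
have [L LB] := basis_left_inv dB; have [L' LB'] := basis_left_inv dB'.
have h v : v \in limg (hom4 B) -> B *m (L *m v) = v.
  by move=> /memv_limg4[c ->]; rewrite (mulmxA L) LB mul1mx.
have h' v : v \in limg (hom4 B') -> B' *m (L' *m v) = v.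
  by move=> /memv_limg4[c ->]; rewrite (mulmxA L') LB' mul1mx.
have colE' (X Y : 'M[R]_(4, 2)) : (forall j, col j X = col j Y) -> X = Y.
  by move=> XY; apply/matrixP => i j; have /colP/(_ i) := XY j; rewrite !mxE.
have E : B' = B *m (L *m B').
  apply: colE' => j; rewrite !colE -!mulmxA; apply/esym/h; rewrite BB'.
  by apply/memv_limg4; exists (delta_mx j 0).
have E' : B = B' *m (L' *m B).
  apply: colE' => j; rewrite !colE -!mulmxA; apply/esym/h'; rewrite -BB'.
  by apply/memv_limg4; exists (delta_mx j 0).
exists (L *m B') => //; apply: (@unit2_left_inv _ (L' *m B)).
by rewrite -mulmxA -E LB'.
Qed.

Lemma line_basis l : exists B, limg (hom4 B) = l :> {vspace _}.
Proof.
have [B BE] : exists B : 'M[R]_(4, 2), forall i, col i B = (vbasis l)`_i.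
  exists (\matrix_(i, j) ((vbasis l)`_j) i 0) => i.
  by apply/colP => k; rewrite !mxE.
exists B; apply/vspaceP => v; rewrite -(span_basis (vbasisP l)).
have sz : size (vbasis l) = 2 by rewrite size_tuple line_dim.
have -> : (vbasis l : seq _) = [:: col 0 B; col 1 B].
  apply: (@eq_from_nth _ 0); first by rewrite sz.
  by case=> [|[|i]] /=; rewrite sz ?BE.
rewrite span_cons span_seq1.
apply/idP/idP.
  move=> /memv_limg4[c ->]; apply/memv_addP; exists (c 0 0 *: col 0 B).
    by rewrite memvZ// memv_line.
  exists (c 1 0 *: col 1 B); first by rewrite memvZ// memv_line.
  by apply/colP => i; rewrite !mxE sum2; ring.
move=> /memv_addP[_ /vlineP[a ->] [_ /vlineP[b ->] ->]]; apply/memv_limg4.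
exists (mxs 2 1 [:: [:: a]; [:: b]]).
by apply/colP => i; rewrite !mxE sum2 !mxE /=; ring.
Qed.

Lemma limg_gl4 (A : gl4) B l : limg (hom4 B) = l :> {vspace _} ->
  limg (hom4 (A *m B)) = gl4_line A l :> {vspace _}.
Proof.
move=> BE; rewrite /= -BE -limg_comp; congr (limg _); apply/lfunP => v.
by rewrite comp_lfunE !lfunE /= mulmxA.
Qed.

Lemma gl4_line_trans l : exists A : gl4, gl4_line A (base_line R) = l.
Proof.
have [B BE] := line_basis l.
have [|A AB] := @basis_gl4 B; first by rewrite BE line_dim.
by exists A; apply: line_inj; rewrite -BE -AB; symmetry; exact: limg_gl4.
Qed.

Lemma gl4_lineM (A A' : gl4) l : gl4_line (gl4_mul A A') l = gl4_line A (gl4_line A' l).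
Proof.
have [B BE] := line_basis l.
apply: line_inj; rewrite -(limg_gl4 _ BE) -(limg_gl4 A (limg_gl4 A' BE)) /=.
by rewrite mulmxA.
Qed.

Lemma gl4_line1 l : gl4_line (gl4_one R) l = l.
Proof.
by have [B BE] := line_basis l; apply: line_inj; rewrite -(limg_gl4 _ BE) mul1mx BE.
Qed.

Lemma memv_gl4_line (A : gl4) l v : v \in line_space l -> A *m v \in line_space (gl4_line A l).
Proof.
have [B BE] := line_basis l.
rewrite -(limg_gl4 _ BE) -BE => /memv_limg4[c ->].
by apply/memv_limg4; exists c; rewrite mulmxA.
Qed.

Lemma pos_limg m B : positive_bases m B -> limg (hom4 B) = unoriented m :> {vspace _}.
Proof.
have [B0 B0E ->] := olineP m; move=> [P /= P0 <-].
by rewrite limg_mulr// gt_eqF.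
Qed.

Lemma pos_dim m B : positive_bases m B -> \dim (limg (hom4 B)) = 2.
Proof. by move=> /pos_limg ->; rewrite line_dim. Qed.

Lemma pos_ex m : exists B, positive_bases m B.
Proof.
have [B0 B0E ->] := olineP m; exists B0, 1%:M; last by rewrite mulmx1.
by rewrite /= det1 ltr01.
Qed.

Lemma pos_mulr m B P : positive_bases m B -> 0 < \det P -> positive_bases m (B *m P).
Proof.
have [B0 _ ->] := olineP m; move=> [Q /= Q0 <-] P0.
by exists (Q *m P); rewrite ?mulmxA//= det_mulmx mulr_gt0.
Qed.

Lemma pos_change m B B' : positive_bases m B -> positive_bases m B' ->
  exists2 P, 0 < \det P & B' = B *m P.
Proof.
have [B0 _ ->] := olineP m; move=> [Q /= Q0 <-] [Q' /= Q'0 <-].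
have uQ : Q \in unitmx by rewrite unitmxE unitfE gt_eqF.
exists (invmx Q *m Q'); first by rewrite det_mulmx det_inv mulr_gt0// invr_gt0.
by rewrite -mulmxA mulKVmx.
Qed.

Lemma pos_eq m m' B : positive_bases m B -> positive_bases m' B -> m = m'.
Proof.
move=> mB m'B; apply: oline_inj.
  by apply: line_inj; rewrite -(pos_limg mB) -(pos_limg m'B).
apply/seteqP; split=> B' h.
  by have [P P0 ->] := pos_change mB h; exact: pos_mulr.
by have [P P0 ->] := pos_change m'B h; exact: pos_mulr.
Qed.

Lemma pos_gl4 (A : gl4) m B : positive_bases m B -> positive_bases (gl4_oline A m) (A *m B).
Proof. by move=> mB; exists B. Qed.

Lemma pos_base : positive_bases (base_oline R) (xy_basis R).
Proof. by exists 1%:M; rewrite ?mulmx1//= det1 ltr01. Qed.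

Lemma gl4_oline_trans m : exists A : gl4, gl4_oline A (base_oline R) = m.
Proof.
have [B mB] := pos_ex m; have [A AB] := basis_gl4 (pos_dim mB).
by exists A; apply: pos_eq mB; rewrite -AB; apply: pos_gl4; exact: pos_base.
Qed.

Lemma gl4_olineM (A A' : gl4) m : gl4_oline (gl4_mul A A') m = gl4_oline A (gl4_oline A' m).
Proof.
have [B mB] := pos_ex m.
apply: (pos_eq (pos_gl4 (gl4_mul A A') mB)).
rewrite (_ : gl4_mul A A' *m B = A *m (A' *m B)); last by rewrite mulmxA.
by apply: pos_gl4; exact: pos_gl4.
Qed.

Lemma gl4_oline1 m : gl4_oline (gl4_one R) m = m.
Proof.
by have [B mB] := pos_ex m; apply: (pos_eq (pos_gl4 (gl4_one R) mB)); rewrite mul1mx.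
Qed.

Lemma oline_of_basis B : \dim (limg (hom4 B)) = 2 -> exists m, positive_bases m B.
Proof.
move=> /basis_gl4[A <-]; exists (gl4_oline A (base_oline R)).
by apply: pos_gl4; exact: pos_base.
Qed.

Lemma oline_over l : exists m : oline R, unoriented m = l.
Proof.
have [B BE] := line_basis l.
have [|m mB] := @oline_of_basis B; first by rewrite BE line_dim.
by exists m; apply: line_inj; rewrite -(pos_limg mB).
Qed.

End Bases.

(** * Incidence, Plücker coordinates and separation of lines *)

Section LineTopology.
Variable R : realType.
Local Notation gl4 := (gl4 R).
Local Notation pgl4 := (pgl4 R).
Implicit Types (B : 'M[R]_(4, 2)) (l : line R) (m : oline R) (g h : pgl4).

Lemma line_openE (U : set (line R)) : open U <-> open [set A : gl4 | U (gl4_line A (base_line R))].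
Proof.
have -> : [set A : gl4 | U (gl4_line A (base_line R))] = (@pgl R) @^-1` ((@line_orbit R) @^-1` U).
  by apply/seteqP; split=> A; rewrite /line_orbit /= pgl_lineE.
by [].
Qed.

Lemma oline_openE (U : set (oline R)) : open U <-> open [set A : gl4 | U (gl4_oline A (base_oline R))].
Proof.
have -> : [set A : gl4 | U (gl4_oline A (base_oline R))] = (@pgl R) @^-1` ((@oline_orbit R) @^-1` U).
  by apply/seteqP; split=> A; rewrite /oline_orbit /= pgl_olineE.
by [].
Qed.

Lemma continuous_unoriented : continuous (@unoriented R).
Proof.
apply/continuousP => U /line_openE oU; apply/oline_openE.
exact: oU.
Qed.

Lemma pgl_lineM g h l : pgl_line (g * h)%g l = pgl_line g (pgl_line h l).
Proof.
rewrite -(pgl_reprK g) -(pgl_reprK h) -pgl_mulE' !pgl_lineE; exact: gl4_lineM.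
Qed.

Lemma pgl_line1 l : pgl_line 1%g l = l.
Proof. by rewrite -pgl_oneE pgl_lineE gl4_line1. Qed.

Lemma pgl_olineM g h m : pgl_oline (g * h)%g m = pgl_oline g (pgl_oline h m).
Proof.
rewrite -(pgl_reprK g) -(pgl_reprK h) -pgl_mulE' !pgl_olineE; exact: gl4_olineM.
Qed.

Lemma pgl_oline1 m : pgl_oline 1%g m = m.
Proof. by rewrite -pgl_oneE pgl_olineE gl4_oline1. Qed.

Lemma pgl_lineK g l : pgl_line (g^-1)%g (pgl_line g l) = l.
Proof. by rewrite -pgl_lineM mulVg pgl_line1. Qed.

Lemma pgl_lineVK g l : pgl_line g (pgl_line (g^-1)%g l) = l.
Proof. by rewrite -pgl_lineM mulgV pgl_line1. Qed.

Lemma pgl_olineK g m : pgl_oline (g^-1)%g (pgl_oline g m) = m.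
Proof. by rewrite -pgl_olineM mulVg pgl_oline1. Qed.

Lemma pgl_olineVK g m : pgl_oline g (pgl_oline (g^-1)%g m) = m.
Proof. by rewrite -pgl_olineM mulgV pgl_oline1. Qed.

Lemma unoriented_pgl g m : unoriented (pgl_oline g m) = pgl_line g (unoriented m).
Proof. by []. Qed.

Lemma cvg_pgl_line (S : Type) (F : set_system S) (f : S -> pgl4) (k : S -> line R) g l :
  Filter F -> f @ F --> g -> k @ F --> l -> pgl_line (f s) (k s) @[s --> F] --> pgl_line g l.
Proof.
move=> FF; apply: (@cvg_pact R _ (@gl4_line R) (base_line R)) => //.
- exact: gl4_lineM.
- exact: gl4_line1.
- exact: gl4_line_trans.
- exact: line_openE.
- exact: pgl_lineE.
- exact: nbhs_pgl.
Qed.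

Lemma cvg_pgl_oline (S : Type) (F : set_system S) (f : S -> pgl4) (k : S -> oline R) g m :
  Filter F -> f @ F --> g -> k @ F --> m -> pgl_oline (f s) (k s) @[s --> F] --> pgl_oline g m.
Proof.
move=> FF; apply: (@cvg_pact R _ (@gl4_oline R) (base_oline R)) => //.
- exact: gl4_olineM.
- exact: gl4_oline1.
- exact: gl4_oline_trans.
- exact: oline_openE.
- exact: pgl_olineE.
- exact: nbhs_pgl.
Qed.

Lemma continuous_pgl_line g : continuous (pgl_line g).
Proof. by move=> l; apply: (@cvg_pgl_line _ (nbhs l) (fun=> g) id); [exact: cvg_cst|exact: cvg_id]. Qed.

Lemma continuous_pgl_oline g : continuous (pgl_oline g).
Proof. by move=> l; apply: (@cvg_pgl_oline _ (nbhs l) (fun=> g) id); [exact: cvg_cst|exact: cvg_id]. Qed.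

Lemma memv_gl4_lineE (A : gl4) l v : (v \in line_space (gl4_line A l)) = (invmx A *m v \in line_space l).
Proof.
apply/idP/idP => [h|h].
  by have := memv_gl4_line (gl4_inv A) h; rewrite -gl4_lineM gl4_mulV gl4_line1.
by have := memv_gl4_line A h; rewrite mulKVmx// gl4_unit.
Qed.

Lemma memv_base (v : 'cV[R]_4) : (v \in line_space (base_line R)) = (v 2 0 == 0) && (v 3 0 == 0).
Proof.
apply/idP/idP.
  by move=> /memv_limg4[c ->]; rewrite !mxE !sum2 !mxE /= !mul0r addr0 eqxx.
move=> /andP[/eqP v2 /eqP v3]; apply/memv_limg4.
exists (mxs 2 1 [:: [:: v 0 0]; [:: v 1 0]]).
by apply/colP; apply: ord4P; rewrite !mxE !sum2 !mxE /= ?v2 ?v3; ring.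
Qed.

(** With [l] written as the image of the base line under A, incidence means that the last two
    coordinates of A^-1 v vanish; these depend continuously on A and v together. *)
Lemma near_notin l (v : 'cV[R]_4) : v \notin line_space l ->
  \forall l' \near l & v' \near v, v' \notin line_space l'.
Proof.
have [A <-] := gl4_line_trans l.
rewrite memv_gl4_lineE memv_base => vA.
pose f (p : gl4 * 'cV[R]_4) := invmx p.1 *m p.2.
have cf : f @ nbhs (A, v) --> invmx A *m v.
  apply: (@cvg_mulmx _ _ (nbhs (A, v)) _ _ _ _ (fun p => invmx p.1) snd); last exact: cvg_snd.
  apply: (@cvg_invmx _ _ (nbhs (A, v)) _ _ (fun p => gl4_mx p.1)); last exact: gl4_unit.
  by apply: cvg_gl4_mx; exact: cvg_fst.
have h : nbhs (A, v) [set p : gl4 * 'cV[R]_4 | ~~ ((f p 2 0 == 0) && (f p 3 0 == 0))].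
  move: vA; rewrite negb_and => /orP[v0|v0].
    have : nbhs (A, v) [set p | f p 2 0 != 0].
      apply: (@cvg_coord _ _ _ _ _ _ f _ 2 0 cf [set x | x != 0]).
      by apply: open_nbhs_nbhs; split=> //; exact: open_neq.
    by apply: filterS => p /= p0; rewrite negb_and p0.
  have : nbhs (A, v) [set p | f p 3 0 != 0].
    apply: (@cvg_coord _ _ _ _ _ _ f _ 3 0 cf [set x | x != 0]).
    by apply: open_nbhs_nbhs; split=> //; exact: open_neq.
  by apply: filterS => p /= p0; rewrite negb_and p0 orbT.
have [[V1 V2] [nV1 nV2] V12] := h.
exists ([set gl4_line C (base_line R) | C in V1], V2).
  split=> //=.
  exact: (nbhs_orbit (@gl4_lineM R) (@gl4_line1 R) line_openE nV1).
move=> [_ w] [/= [C V1C <-] V2w].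
by rewrite memv_gl4_lineE memv_base; exact: (V12 (C, w)).
Qed.

(** The tube lemma: a point off every line of the compact set [K] has a neighbourhood that stays off
    all of them at once. Connectedness arguments about points thereby apply to sets of lines. *)
Lemma compact_points_closed (K : set (line R)) : compact K ->
  closed [set v | exists2 l, K l & v \in line_space l].
Proof.
move=> cK v; apply: contraPP => nv.
have h : \forall v' \near v, K `<=` [set l | v' \notin line_space l].
  apply: (iffLR (compact_near_coveringP K) cK _ (nbhs v) (fun v' l => v' \notin line_space l)) => l Kl.
  by apply: near_notin; apply/negP => vl; apply: nv; exists l.
move=> /(_ _ h)[w [[l Kl wl] /(_ _ Kl)]].
by rewrite /= wl.
Qed.

Definition symp2 : 'M[R]_2 := mxs 2 2 [:: [:: 0; 1]; [:: -1; 0]].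

(* The Plücker coordinates of the line spanned by the columns of B. *)
Definition plk B : 'M[R]_4 := B *m symp2 *m B^T.

Lemma plkE B i j : plk B i j = B i 0 * B j 1 - B i 1 * B j 0.
Proof. by rewrite !mxE sum2 !mxE !sum2 !mxE /=; ring. Qed.

Lemma plk_mulr B P : plk (B *m P) = \det P *: plk B.
Proof.
apply/matrixP => i j; rewrite [RHS]mxE !plkE det2 !mxE !sum2; ring.
Qed.

Lemma plk_mull (A : 'M[R]_4) B : plk (A *m B) = A *m plk B *m A^T.
Proof. by rewrite /plk trmx_mul !mulmxA. Qed.

(** The factor [symp2 *m B^T] is onto because [B] has a left inverse. So a line is recovered from
    its Plücker matrix. *)
Lemma limg_plk B : \dim (limg (hom4 B)) = 2 -> limg (hom4 (plk B)) = limg (hom4 B).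
Proof.
move=> /basis_left_inv[L LB]; apply/vspaceP => v; apply/idP/idP => /memv_limg4[c ->]; apply/memv_limg4.
  by exists (symp2 *m B^T *m c); rewrite /plk !mulmxA.
have ss : symp2 *m - symp2 = 1%:M.
  by apply/matrixP; apply: ord2P; apply: ord2P; rewrite !mxE !sum2 !mxE /= ?(mulr1n, mulr0n); ring.
exists (L^T *m (- symp2 *m c)).
by rewrite /plk -!mulmxA (mulmxA B^T) -trmx_mul LB trmx1 mul1mx (mulmxA symp2) ss mul1mx.
Qed.

Lemma cvg_plk (S : Type) (F : set_system S) (f : S -> 'M[R]_(4, 2)) (B : 'M[R]_(4, 2)) :
  Filter F -> f @ F --> B -> plk (f s) @[s --> F] --> plk B.
Proof.
move=> FF fB; apply: (@cvg_mulmx _ _ F _ _ _ _ (fun s => f s *m symp2) (fun s => (f s)^T)); last exact: cvg_trmx.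
by apply: (@cvg_mulmx _ _ F _ _ _ _ f (fun=> symp2)) => //; exact: cvg_cst.
Qed.

Lemma cvg_basis (A : gl4) : C *m xy_basis R @[C --> A] --> A *m xy_basis R.
Proof.
apply: (@cvg_mulmx _ _ (nbhs A) _ _ _ _ (@gl4_mx R) (fun=> xy_basis R)); last exact: cvg_cst.
exact: continuous_gl4_mx.
Qed.

(* Well defined on lines for quadratic phi, as a base change multiplies the
   Plücker matrix by its determinant. *)
Definition plk_le (phi : 'M[R]_4 -> R) : set (line R) :=
  [set l | exists2 B, limg (hom4 B) = l :> {vspace _} & phi (plk B) <= 0].

Lemma plk_leE (phi : 'M[R]_4 -> R) l B : (forall c X, phi (c *: X) = c ^+ 2 * phi X) ->
  limg (hom4 B) = l :> {vspace _} -> plk_le phi l <-> phi (plk B) <= 0.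
Proof.
move=> phiZ BE; split; last by exists B.
move=> [B' B'E]; have [||P P0 ->] := @basis_change R B' B.
- by rewrite B'E line_dim.
- by rewrite BE.
by rewrite plk_mulr phiZ; apply: mulr_ge0_le0; exact: sqr_ge0.
Qed.

Lemma closed_plk_le (phi : 'M[R]_4 -> R) : (forall c X, phi (c *: X) = c ^+ 2 * phi X) ->
  continuous phi -> closed (plk_le phi).
Proof.
move=> phiZ cphi; rewrite -openC; apply/line_openE.
have -> : [set A : gl4 | (~` plk_le phi) (gl4_line A (base_line R))] =
    (fun A : gl4 => phi (plk (A *m xy_basis R))) @^-1` [set r | 0 < r].
  apply/seteqP; split=> A /=; rewrite plk_leE//; [|exact: limg_gl4| |exact: limg_gl4].
    by move=> /negP; rewrite -ltNge.
  by rewrite leNgt => -> .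
have /continuousP : continuous (fun A : gl4 => phi (plk (A *m xy_basis R))).
  move=> A; apply: (@cvg_comp _ _ _ (fun A : gl4 => plk (A *m xy_basis R)) phi (nbhs A) (nbhs (plk (A *m xy_basis R)))); last exact: cphi.
  by apply: cvg_plk; exact: cvg_basis.
by apply; exact: open_gt.
Qed.

Definition plk_norm (X : 'M[R]_4) : R := Num.sqrt (\tr (X *m X^T)).

Lemma tr_mulT n (X : 'M[R]_n) : \tr (X *m X^T) = \sum_i \sum_j X i j ^+ 2.
Proof.
by apply: eq_bigr => i _; rewrite mxE; apply: eq_bigr => j _; rewrite mxE expr2.
Qed.

Lemma tr_mulT_gt0 n (X : 'M[R]_n) : X != 0 -> 0 < \tr (X *m X^T).
Proof.
move=> X0; rewrite lt_def tr_mulT sumr_ge0 ?andbT; last first.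
  by move=> i _; rewrite sumr_ge0// => j _; exact: sqr_ge0.
apply: contra_neq X0 => h; apply/matrixP => i j; rewrite mxE.
have h' := psumr_eq0P (fun i _ => sumr_ge0 _ (fun j _ => sqr_ge0 (X i j))) h.
have /eqP := psumr_eq0P (fun j _ => sqr_ge0 (X i j)) (h' i isT) (i := j) isT.
by rewrite sqrf_eq0 => /eqP.
Qed.

(** A change of positive basis multiplies the Plücker matrix by a positive factor. Dividing by the
    norm removes the factor and keeps the orientation, so this is a continuous injection of the
    oriented lines into a normed space; the Hausdorff property follows. *)
Definition nplk m : 'M[R]_4 :=
  let X := plk (xget 0 (positive_bases m)) in (plk_norm X)^-1 *: X.

Lemma plk_neq0 B : \dim (limg (hom4 B)) = 2 -> plk B != 0.
Proof.
move=> dB; apply/eqP => B0; have := limg_plk dB; rewrite B0.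
have -> : limg (hom4 (0 : 'M[R]_4)) = 0%VS.
  apply/vspaceP => v; rewrite memv0; apply/idP/idP.
    by move=> /memv_limg4[c ->]; rewrite mul0mx.
  by move=> /eqP ->; rewrite mem0v.
by move=> h; move: dB; rewrite -h dimv0.
Qed.

Lemma plk_norm_gt0 B : \dim (limg (hom4 B)) = 2 -> 0 < plk_norm (plk B).
Proof. by move=> dB; rewrite sqrtr_gt0 tr_mulT_gt0// plk_neq0. Qed.

Lemma nplkE m B : positive_bases m B -> nplk m = (plk_norm (plk B))^-1 *: plk B.
Proof.
move=> mB; rewrite /nplk; have mB' : positive_bases m (xget 0 (positive_bases m)).
  by apply: (xgetPex 0); exists B.
have [P P0 ->] := pos_change mB mB'.
have n0 := plk_norm_gt0 (pos_dim mB).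
have -> : plk_norm (plk (B *m P)) = \det P * plk_norm (plk B).
  rewrite plk_mulr /plk_norm linearZ /= -scalemxAl -scalemxAr scalerA linearZ /=.
  by rewrite -expr2 sqrtrM ?sqr_ge0// sqrtr_sqr gtr0_norm.
rewrite plk_mulr scalerA; congr (_ *: _); field.
by rewrite !gt_eqF.
Qed.

Lemma nplk_inj : injective nplk.
Proof.
move=> m m'; have [B mB] := pos_ex m; have [B' m'B] := pos_ex m'.
rewrite (nplkE mB) (nplkE m'B) => h.
have n0 := plk_norm_gt0 (pos_dim mB); have n0' := plk_norm_gt0 (pos_dim m'B).
pose c := plk_norm (plk B') / plk_norm (plk B).
have c0 : 0 < c by rewrite divr_gt0.
have hc : plk B' = c *: plk B.
  have := congr1 (fun X => plk_norm (plk B') *: X) h.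
  by rewrite !scalerA divff ?gt_eqF// scale1r => <-.
have [||P P0 BP] := @basis_change R B B'.
- exact: (pos_dim mB).
- rewrite -(limg_plk (pos_dim mB)) -(limg_plk (pos_dim m'B)) hc.
  apply/vspaceP => v; apply/idP/idP => /memv_limg4[u ->]; apply/memv_limg4.
    by exists (c^-1 *: u); rewrite -scalemxAl -scalemxAr scalerA divff ?gt_eqF// scale1r.
  by exists (c *: u); rewrite -scalemxAl -scalemxAr.
have dP : \det P = c.
  have : (\det P - c) *: plk B = 0 by rewrite scalerBl -plk_mulr -BP hc subrr.
  by move=> /eqP; rewrite scaler_eq0 (negbTE (plk_neq0 (pos_dim mB))) orbF subr_eq0 => /eqP.
by apply: (@pos_eq R _ _ B'); rewrite // BP; apply: pos_mulr; rewrite // dP.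
Qed.

Lemma continuous_nplk : continuous nplk.
Proof.
move=> m; have [A <-] := gl4_oline_trans m.
apply: (cvg_orbit (@gl4_olineM R) (@gl4_oline1 R) oline_openE).
have E (C : gl4) : nplk (gl4_oline C (base_oline R)) =
    (plk_norm (plk (C *m xy_basis R)))^-1 *: plk (C *m xy_basis R).
  by apply: nplkE; apply: pos_gl4; exact: pos_base.
under eq_fun do rewrite E; rewrite E.
have cp : plk (C *m xy_basis R) @[C --> A] --> plk (A *m xy_basis R).
  by apply: cvg_plk; exact: cvg_basis.
apply: (@cvg_scalemx _ _ (nbhs A) _ _ _ (fun C : gl4 => (plk_norm (plk (C *m xy_basis R)))^-1)
  (fun C : gl4 => plk (C *m xy_basis R))) => //; apply: cvgV.
  rewrite gt_eqF// plk_norm_gt0//; apply: (@pos_dim R (gl4_oline A (base_oline R))).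
  by apply: pos_gl4; exact: pos_base.
apply: (@cvg_comp _ _ _ (fun C : gl4 => \tr (plk (C *m xy_basis R) *m (plk (C *m xy_basis R))^T))
  Num.sqrt (nbhs A) (nbhs (\tr (plk (A *m xy_basis R) *m (plk (A *m xy_basis R))^T)))); last exact: sqrt_continuous.
rewrite /mxtrace; apply: cvg_bigsum => i _.
apply: (@cvg_coord _ (nbhs A) _ _ _ _ (fun C : gl4 => plk (C *m xy_basis R) *m (plk (C *m xy_basis R))^T)
  (plk (A *m xy_basis R) *m (plk (A *m xy_basis R))^T)).
by apply: cvg_mulmx => //; exact: cvg_trmx.
Qed.

Lemma hausdorff_oline : hausdorff_space (oline R).
Proof.
move=> m m' mm'; apply: nplk_inj; apply: (@norm_hausdorff R 'M[R]_4).
move=> U V nU nV.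
have [p [Up Vp]] := mm' _ _ (continuous_nplk nU) (continuous_nplk nV).
by exists (nplk p).
Qed.

End LineTopology.

(** * Compact spreads and their orientations *)

Section HyperOrbits.
Variables (R : realType) (T : topologicalType) (act : pgl4 R -> T -> T).
Hypothesis act_cvg : forall (S : Type) (F : set_system S) (f : S -> pgl4 R) (k : S -> T) g t,
  Filter F -> f @ F --> g -> k @ F --> t -> act (f s) (k s) @[s --> F] --> act g t.

Lemma hyper_inj (K K' : hyperspace T) : hyper_set K = hyper_set K' -> K = K'.
Proof.
case: K K' => [K cK] [K' cK'] /= KK'; move: cK; rewrite KK' => cK.
by rewrite (Prop_irrelevance cK cK').
Qed.

(** The family is the image of [Omega] under g |-> g(C), so continuity of this map into the
    hyperspace is what matters. *)
Lemma hyper_orbit_compact (Omega : set (pgl4 R)) (C : set T) : compact Omega -> compact C ->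
  hyper_compact_family [set act g @` C | g in Omega].
Proof.
move=> cO cC.
have cact g : continuous (act g).
  by move=> t; apply: (@act_cvg _ (nbhs t) (fun=> g) id); [exact: cvg_cst|exact: cvg_id].
have cgC g : compact (act g @` C).
  by apply: continuous_compact => //; apply: continuous_subspaceT; exact: cact.
split; first by move=> _ [g _ <-].
pose Phi g := Hyper (cgC g).
have -> : [set K : hyperspace T | [set act g @` C | g in Omega] (hyper_set K)] = Phi @` Omega.
  apply/seteqP; split=> [K [g Og gK]|_ [g Og <-]]; last by exists g.
  by exists g => //; apply: hyper_inj.
apply: continuous_compact => //; apply: continuous_subspaceT => g0 U.
rewrite nbhsE => -[V [oV Vg0] VU].
have [W nW WV] := oV _ Vg0.
(* Compactness of [C] makes the images under [g] and [g0] close for all points of [C]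
   simultaneously. *)
have h : \forall g \near g0, C `<=` [set x | W (act g0 x, act g x)].
  apply: (iffLR (compact_near_coveringP C) cC _ (nbhs g0) (fun g x => W (act g0 x, act g x))) => x Cx.
  have := nW (act g0 x).
  apply: (@cvg_pair _ _ _ (nbhs (x, g0)) (nbhs (act g0 x)) (nbhs (act g0 x)) _ _ _
    (fun p => act g0 p.1) (fun p => act p.2 p.1)).
    apply: (@act_cvg _ (nbhs (x, g0)) (fun=> g0) fst); [exact: cvg_cst|exact: cvg_fst].
  apply: (@act_cvg _ (nbhs (x, g0)) snd fst); [exact: cvg_snd|exact: cvg_fst].
change (nbhs g0 (Phi @^-1` U)); apply: filterS h => g h.
apply: VU; apply: WV; split=> /= [_ [x Cx <-]|_ [x Cx <-]].
  by exists (act g x); [exists x|exact: h].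
by exists (act g0 x); [exists x|exact: h].
Qed.

End HyperOrbits.

(** * Connectedness of a spread and its two sheets *)

Section Spreads.
Variable R : realType.
Local Notation pgl4 := (pgl4 R).
Implicit Types (C K : set (line R)) (S T : set (oline R)) (l m : line R) (g h : pgl4).

Lemma spread_uniq C l m (v : 'cV[R]_4) : compact_spread C -> C l -> C m -> v != 0 ->
  v \in line_space l -> v \in line_space m -> l = m.
Proof.
move=> [_ dC _] Cl Cm v0 vl vm; apply: contra_notP (negP v0) => lm.
by rewrite -memv0 -(dC _ _ Cl Cm lm) memv_cap vl.
Qed.

(** The parameters whose points are covered by [K1], and those covered by [K2], form two nonempty
    closed sets with union the unit interval; so they meet. *)
Lemma segment_connect (K1 K2 : set (line R)) (p : R -> 'cV[R]_4) : compact K1 -> compact K2 ->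
  continuous p ->
  (forall t, `[0, 1]%classic t -> exists2 l, K1 l \/ K2 l & p t \in line_space l) ->
  (exists2 l, K1 l & p 0 \in line_space l) -> (exists2 l, K2 l & p 1 \in line_space l) ->
  exists t, [/\ `[0, 1]%classic t, exists2 l, K1 l & p t \in line_space l &
    exists2 l, K2 l & p t \in line_space l].
Proof.
move=> cK1 cK2 cp p12 p0 p1.
pose E (K : set (line R)) : set R := p @^-1` [set v | exists2 l, K l & v \in line_space l].
have clE K : compact K -> closed (E K).
  move=> cK; apply: preimage_closed; last exact: compact_points_closed.
  by move=> t _; exact: cp.
apply: contrapT => no.
have i0 : `[0, 1]%classic (0 : R) by rewrite /= in_itv /= lexx ler01.
have i1 : `[0, 1]%classic (1 : R) by rewrite /= in_itv /= lexx ler01.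
have B01 : `[0, 1]%classic `&` E K1 = `[0, 1]%classic.
  apply: (@segment_connected R 0 1).
  - by exists 0; split.
  - exists (~` E K2); first by rewrite openC; exact: clE.
    apply/seteqP; split=> t [ti Et]; split=> //.
      by move=> Et2; apply: no; exists t.
    by have [l [Kl|Kl] pl] := p12 t ti; [exists l|exfalso; apply: Et; exists l].
  - by exists (E K1) => //; exact: clE.
have [_ E1] : (`[0, 1]%classic `&` E K1) 1 by rewrite B01.
by apply: no; exists 1; split.
Qed.

Definition seg (v w : 'cV[R]_4) (t : R) : 'cV[R]_4 := (1 - t) *: v + t *: w.

Lemma continuous_seg v w : continuous (seg v w).
Proof.
move=> t; apply: cvgD; apply: cvg_scalemx; try exact: cvg_cst; try exact: cvg_id.
by apply: cvgB; [exact: cvg_cst|exact: cvg_id].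
Qed.

Lemma seg0 v w : seg v w 0 = v.
Proof. by rewrite /seg subr0 scale1r scale0r addr0. Qed.

Lemma seg1 v w : seg v w 1 = w.
Proof. by rewrite /seg subrr scale1r scale0r add0r. Qed.

(* Compact sets of lines cover closed sets of points, so a spread cannot be cut
   in two along a path of points. *)
Lemma spread_segment C (A B : set (line R)) v w l m : compact_spread C -> closed A -> closed B ->
  (forall l, A l \/ B l) -> (forall t, `[0, 1]%classic t -> seg v w t != 0) ->
  C l -> A l -> v \in line_space l -> C m -> B m -> w \in line_space m ->
  exists t n, [/\ `[0, 1]%classic t, C n, A n, B n & seg v w t \in line_space n].
Proof.
move=> sC clA clB AB vw0 Cl Al vl Cm Bm wm; have [cC _ covC] := sC.
have [||||||t [ti [n [Cn An] pn] [n' [Cn' Bn'] pn']]] :=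
    @segment_connect (C `&` A) (C `&` B) (seg v w).
- exact: compact_closedI.
- exact: compact_closedI.
- exact: continuous_seg.
- move=> t /vw0/covC[n Cn pn]; exists n => //.
  by have [An|Bn] := AB n; [left|right].
- by exists l; rewrite ?seg0.
- by exists m; rewrite ?seg1.
have nn' : n = n' by apply: (spread_uniq sC Cn Cn' (vw0 t ti)).
by exists t, n; split; rewrite // nn'.
Qed.

Lemma line_point l : exists2 v, v != 0 & v \in line_space l.
Proof.
exists (vpick l); last exact: memv_pick.
by rewrite vpick0 -dimv_eq0 line_dim.
Qed.

(** A segment joins a point on a line of [K1] to a point on a line of [K2]. At some parameter its
    point lies on lines of both sets, and these coincide because the lines of a spread are
    disjoint. *)
Lemma spread_connected C (K1 K2 : set (line R)) : compact_spread C -> compact K1 -> compact K2 ->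
  C = K1 `|` K2 -> K1 `&` K2 = set0 -> K1 = set0 \/ K2 = set0.
Proof.
move=> sC cK1 cK2 CE K12; have [->|/set0P[l Kl]] := eqVneq K1 set0; first by left.
have [->|/set0P[m Km]] := eqVneq K2 set0; first by right.
exfalso.
have Cl : C l by rewrite CE; left.
have Cm : C m by rewrite CE; right.
have [v v0 vl] := line_point l; have [w w0 wm] := line_point m.
have [_ dC covC] := sC.
have lm : l <> m.
  move=> e; have : (K1 `&` K2) m by split=> //; rewrite -e.
  by rewrite K12.
(* The segment misses the zero vector, as [v] and [w] lie on disjoint lines. *)
have vw0 t : `[0, 1]%classic t -> seg v w t != 0.
  move=> _; apply/eqP => h.
  have tv : t *: w = - ((1 - t) *: v) by apply/eqP; rewrite -addr_eq0 addrC; apply/eqP.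
  have tw0 : t *: w = 0.
    apply/eqP; rewrite -memv0 -(dC _ _ Cl Cm lm) memv_cap; apply/andP.
    by split; [rewrite tv memvN; exact: memvZ|exact: memvZ].
  move: (tw0) => /eqP; rewrite scaler_eq0 (negbTE w0) orbF => /eqP t0.
  by move: h; rewrite t0 seg0; apply/eqP.
have [||||||t [ti [n Kn pn] [n' Kn' pn']]] := @segment_connect K1 K2 (seg v w).
- by [].
- by [].
- exact: continuous_seg.
- by move=> t /vw0/covC[n]; rewrite CE => Kn pn; exists n.
- by exists l; rewrite ?seg0.
- by exists m; rewrite ?seg1.
have nn' : n = n' by apply: (spread_uniq sC _ _ (vw0 t ti)) => //; rewrite CE; [left|right].
have : (K1 `&` K2) n by split=> //; rewrite nn'.
by rewrite K12.
Qed.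

Lemma homeo_compact S C : compact C -> homeomorphism_on S C (@unoriented R) -> compact S.
Proof.
move=> cC [k [bij _ can ck]].
have -> : S = k @` C.
  apply/seteqP; split=> [s Ss|_ [l Cl <-]].
    have [fS _ _] := bij; exists (unoriented s); first exact: fS.
    by apply: can; rewrite inE.
  have [_ _ surj] := bij; have [s Ss <-] := surj l Cl.
  by rewrite can// inE.
exact: continuous_compact.
Qed.

Lemma homeo_inj S C s t : homeomorphism_on S C (@unoriented R) -> S s -> S t ->
  unoriented s = unoriented t -> s = t.
Proof. by move=> [k [[_ inj _] _ _ _]] Ss St; apply: inj; rewrite inE. Qed.

Lemma homeo_surj S C l : homeomorphism_on S C (@unoriented R) -> C l ->
  exists2 s, S s & unoriented s = l.
Proof. by move=> [k [[_ _ surj] _ _ _]] /surj[s Ss <-]; exists s. Qed.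

Lemma homeo_fun S C s : homeomorphism_on S C (@unoriented R) -> S s -> C (unoriented s).
Proof. by move=> [k [[fS _ _] _ _ _]]; exact: fS. Qed.

Lemma sheet_subset_eq S T C : homeomorphism_on S C (@unoriented R) ->
  homeomorphism_on T C (@unoriented R) -> T `<=` S -> T = S.
Proof.
move=> hS hT TS; apply/seteqP; split=> // s Ss.
have [t Tt ts] := homeo_surj hT (homeo_fun hS Ss).
by rewrite (homeo_inj hS Ss (TS _ Tt)).
Qed.

(** The parts of [T] in [S] and in [S'] project to disjoint compact sets covering the connected
    spread [C], so one part is empty. The separation of [oline] enters here: compact sheets must be
    closed. *)
Lemma oriented_sheets C S S' T : compact_spread C -> S `|` S' = @unoriented R @^-1` C ->
  S `&` S' = set0 -> homeomorphism_on S C (@unoriented R) ->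
  homeomorphism_on S' C (@unoriented R) -> homeomorphism_on T C (@unoriented R) ->
  T = S \/ T = S'.
Proof.
move=> sC SS' SI hS hS' hT; have [cC _ _] := sC.
have cS := homeo_compact cC hS; have cS' := homeo_compact cC hS'.
have cT := homeo_compact cC hT.
have cu : forall A, compact A -> compact (@unoriented R @` A).
  move=> A cA; apply: continuous_compact => //; apply: continuous_subspaceT.
  exact: continuous_unoriented.
have TS t : T t -> S t \/ S' t.
  by move=> /(homeo_fun hT) Ct; have : (S `|` S') t by rewrite SS'.
have [||||K0|K0] := @spread_connected C (@unoriented R @` (T `&` S)) (@unoriented R @` (T `&` S')) sC.
- by apply: cu; apply: compact_closedI => //; apply: compact_closed => //; exact: hausdorff_oline.
- by apply: cu; apply: compact_closedI => //; apply: compact_closed => //; exact: hausdorff_oline.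
- apply/seteqP; split=> [l /(homeo_surj hT)[t Tt <-]|l].
    by have [St|St] := TS t Tt; [left|right]; exists t.
  by move=> [[t [Tt _] <-]|[t [Tt _] <-]]; exact: (homeo_fun hT).
- apply/seteqP; split=> // _ [[s [Ts Ss] <-] [t [Tt St] ts]].
  have st := homeo_inj hT Tt Ts ts.
  have : (S `&` S') s by split=> //; rewrite -st.
  by rewrite SI.
- right; apply: sheet_subset_eq hS' hT _ => t Tt.
  have [St|//] := TS t Tt.
  have : (@unoriented R @` (T `&` S)) (unoriented t) by exists t; first split.
  by rewrite K0.
- left; apply: sheet_subset_eq hS hT _ => t Tt.
  have [//|St] := TS t Tt.
  have : (@unoriented R @` (T `&` S')) (unoriented t) by exists t; first split.
  by rewrite K0.
Qed.

Lemma pgl_spreadM g h C : pgl_spread (g * h)%g C = pgl_spread g (pgl_spread h C).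
Proof.
apply/seteqP; split=> [_ [l Cl <-]|_ [_ [l Cl <-] <-]].
  by rewrite pgl_lineM; exists (pgl_line h l) => //; exists l.
by rewrite -pgl_lineM; exists l.
Qed.

Lemma pgl_spread1 C : pgl_spread 1%g C = C.
Proof.
apply/seteqP; split=> [_ [l Cl <-]|l Cl]; first by rewrite pgl_line1.
by exists l; rewrite ?pgl_line1.
Qed.

Lemma pgl_spreadK g C : pgl_spread (g^-1)%g (pgl_spread g C) = C.
Proof. by rewrite -pgl_spreadM mulVg pgl_spread1. Qed.

Lemma pgl_ospreadM g h S : pgl_ospread (g * h)%g S = pgl_ospread g (pgl_ospread h S).
Proof.
apply/seteqP; split=> [_ [l Cl <-]|_ [_ [l Cl <-] <-]].
  by rewrite pgl_olineM; exists (pgl_oline h l) => //; exists l.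
by rewrite -pgl_olineM; exists l.
Qed.

Lemma pgl_ospread1 S : pgl_ospread 1%g S = S.
Proof.
apply/seteqP; split=> [_ [l Cl <-]|l Cl]; first by rewrite pgl_oline1.
by exists l; rewrite ?pgl_oline1.
Qed.

Lemma pgl_ospreadK g S : pgl_ospread (g^-1)%g (pgl_ospread g S) = S.
Proof. by rewrite -pgl_ospreadM mulVg pgl_ospread1. Qed.

Lemma pgl_ospreadVK g S : pgl_ospread g (pgl_ospread (g^-1)%g S) = S.
Proof. by rewrite -pgl_ospreadM mulgV pgl_ospread1. Qed.

Lemma pgl_spreadP g C l : pgl_spread g C l <-> C (pgl_line (g^-1)%g l).
Proof.
split=> [[m Cm <-]|Cl]; first by rewrite pgl_lineK.
by exists (pgl_line (g^-1)%g l) => //; exact: pgl_lineVK.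
Qed.

Lemma pgl_ospreadP g S (m : oline R) : pgl_ospread g S m <-> S (pgl_oline (g^-1)%g m).
Proof.
split=> [[n Sn <-]|Sm]; first by rewrite pgl_olineK.
by exists (pgl_oline (g^-1)%g m) => //; exact: pgl_olineVK.
Qed.

Lemma spread_pgl g C : compact_spread C -> compact_spread (pgl_spread g C).
Proof.
move=> [cC dC covC]; split.
- by apply: continuous_compact => //; apply: continuous_subspaceT; exact: continuous_pgl_line.
- move=> _ _ [l Cl <-] [m Cm <-] lm.
  have lm' : l <> m by move=> e; apply: lm; rewrite e.
  apply/eqP; rewrite -subv0; apply/subvP => v.
  rewrite memv_cap !memv_gl4_lineE => h.
  have /eqP Av : invmx (pgl_repr g) *m v == 0 by rewrite -memv0 -(dC _ _ Cl Cm lm') memv_cap.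
  by rewrite -(mulKVmx (gl4_unit (pgl_repr g)) v) Av mulmx0 mem0v.
- move=> v v0; have [|l Cl vl] := covC (invmx (pgl_repr g) *m v).
    apply: contra_neq v0 => Av.
    by rewrite -(mulKVmx (gl4_unit (pgl_repr g)) v) Av mulmx0.
  by exists (pgl_line g l); [exists l|rewrite memv_gl4_lineE].
Qed.

Lemma homeo_pgl g S C : homeomorphism_on S C (@unoriented R) ->
  homeomorphism_on (pgl_ospread g S) (pgl_spread g C) (@unoriented R).
Proof.
move=> hS; have [k [[fS inj surj] _ can ck]] := hS.
exists (fun l => pgl_oline g (k (pgl_line (g^-1)%g l))); split.
- split.
  + by move=> _ [s Ss <-]; rewrite unoriented_pgl; exists (unoriented s) => //; exact: fS.
  + move=> _ _ /set_mem[s Ss <-] /set_mem[t St <-]; rewrite !unoriented_pgl => h.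
    congr pgl_oline; apply: (homeo_inj hS) => //.
    by rewrite -[LHS](pgl_lineK g) h pgl_lineK.
  + by move=> _ [l /(homeo_surj hS)[s Ss <-] <-]; exists (pgl_oline g s) => //; exists s.
- by apply: continuous_subspaceT; exact: continuous_unoriented.
- move=> _ /set_mem[s Ss <-]; rewrite unoriented_pgl pgl_lineK can//.
  by rewrite inE.
- have h : {within pgl_spread g C, continuous (k \o pgl_line (g^-1)%g)}.
    apply: (@within_comp _ _ _ (pgl_spread g C) C (pgl_line (g^-1)%g) k) => //.
      by apply: continuous_subspaceT; exact: continuous_pgl_line.
    by move=> l /pgl_spreadP.
  apply: (@within_comp _ _ _ (pgl_spread g C) setT (k \o pgl_line (g^-1)%g) (pgl_oline g)) => //.
  by apply: continuous_subspaceT; exact: continuous_pgl_oline.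
Qed.

Lemma oriented_spread_from_pgl g C S : oriented_spread_from C S ->
  oriented_spread_from (pgl_spread g C) (pgl_ospread g S).
Proof.
move=> [sC [S' [SU SI hS hS']]]; split; first exact: spread_pgl.
exists (pgl_ospread g S'); split; [| |exact: homeo_pgl|exact: homeo_pgl].
- apply/seteqP; split=> m.
    move=> [|] /pgl_ospreadP Sm; apply/pgl_spreadP; rewrite -unoriented_pgl.
      have : (S `|` S') (pgl_oline (g^-1)%g m) by left.
      by rewrite SU.
    have : (S `|` S') (pgl_oline (g^-1)%g m) by right.
    by rewrite SU.
  move=> /pgl_spreadP; rewrite -unoriented_pgl => Cm.
  have : (S `|` S') (pgl_oline (g^-1)%g m) by rewrite SU.
  by move=> [Sm|Sm]; [left|right]; apply/pgl_ospreadP.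
- apply/seteqP; split=> // m [/pgl_ospreadP Sm /pgl_ospreadP S'm].
  have : (S `&` S') (pgl_oline (g^-1)%g m) by [].
  by rewrite SI.
Qed.

Lemma oriented_sheets_from C S S' T : compact_spread C -> S `|` S' = @unoriented R @^-1` C ->
  S `&` S' = set0 -> homeomorphism_on S C (@unoriented R) ->
  homeomorphism_on S' C (@unoriented R) -> oriented_spread_from C T -> T = S \/ T = S'.
Proof. by move=> sC SU SI hS hS' [_ [T' [_ _ hT _]]]; exact: (oriented_sheets sC SU SI hS hS' hT). Qed.

(* An involution of the two sheets induced by h disappears in h * h. *)
Lemma ospread_square h C S : pgl_spread h C = C -> oriented_spread_from C S ->
  pgl_ospread (h * h)%g S = S.
Proof.
move=> hC oS; have [sC [S' [SU SI hS hS']]] := oS.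
have oS' : oriented_spread_from C S'.
  by split=> //; exists S; split=> //; rewrite 1?setUC 1?setIC.
have h1 := oriented_spread_from_pgl h oS; rewrite hC in h1.
have h2 := oriented_spread_from_pgl h oS'; rewrite hC in h2.
rewrite pgl_ospreadM.
have [e|e] := oriented_sheets_from sC SU SI hS hS' h1; first by rewrite !e.
have [e'|e'] := oriented_sheets_from sC SU SI hS hS' h2; first by rewrite e.
have SS' : S = S' by rewrite -(pgl_ospreadK h S) -(pgl_ospreadK h S') e e'.
by rewrite e e' -SS'.
Qed.

End Spreads.

(** * Groups isomorphic to the rotation group *)

Section StandardSO3.
Variable R : realType.
Local Notation gl4 := (gl4 R).
Local Notation pgl4 := (pgl4 R).
Local Notation SO n := (@special_orthogonal_group R n).
Implicit Types (A B : 'M[R]_3) (M : 'M[R]_4) (g h : pgl4).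

(** A total map to GL_4, with the identity as its value at singular matrices. *)
Definition mkgl M : gl4 := insubd (gl4_one R) M.

Lemma mkglE M : M \in unitmx -> gl4_mx (mkgl M) = M.
Proof. exact: insubdK. Qed.

Lemma pgl_mkglM M M' : M \in unitmx -> M' \in unitmx ->
  pgl (mkgl (M *m M')) = (pgl (mkgl M) * pgl (mkgl M'))%g.
Proof.
move=> uM uM'; rewrite -pgl_mulE'; congr pgl; apply: gl4_inj => /=.
by rewrite !mkglE// unitmx_mul uM.
Qed.

Lemma pgl_mkgl1 : pgl (mkgl 1%:M) = 1%g.
Proof. by rewrite -pgl_oneE; congr pgl; apply: gl4_inj; rewrite mkglE ?unitmx1. Qed.

Lemma cvg_mkgl (S : Type) (F : set_system S) (f : S -> 'M[R]_4) M : Filter F ->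
  f @ F --> M -> M \in unitmx -> pgl (mkgl (f s)) @[s --> F] --> pgl (mkgl M).
Proof.
move=> FF fM uM.
apply: (@cvg_comp _ _ _ (fun s => mkgl (f s)) (@pgl R) F (nbhs (mkgl M))); last exact: continuous_pgl.
apply: cvg_gl4; rewrite mkglE//.
have h := near_unitmx FF fM uM; apply: cvg_trans fM; apply: near_eq_cvg.
by apply: filterS h => s us; rewrite mkglE.
Qed.

(** The matrix representing [g] normalised by w g x = 1. It is a continuous section of GL_4 -> PGL_4
    over the set where w g x does not vanish. *)
Definition nrepr (w : 'rV[R]_4) (x : 'cV[R]_4) g : 'M[R]_4 :=
  ((w *m pgl_repr g *m x) 0 0)^-1 *: gl4_mx (pgl_repr g).

Lemma nrepr_pgl w x (A : gl4) : nrepr w x (pgl A) = ((w *m A *m x) 0 0)^-1 *: gl4_mx A.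
Proof.
have /pgl_eqP[c c0 cE] := pgl_reprK (pgl A).
rewrite /nrepr cE -scalemxAr -scalemxAl mxE scalerA invfM mulrAC mulVf// mul1r//.
Qed.

Lemma nrepr_mkgl w x M : M \in unitmx -> (w *m M *m x) 0 0 = 1 -> nrepr w x (pgl (mkgl M)) = M.
Proof. by move=> uM wMx; rewrite nrepr_pgl !mkglE// wMx invr1 scale1r. Qed.

Lemma nrepr_unit w x g : (w *m pgl_repr g *m x) 0 0 != 0 -> nrepr w x g \in unitmx.
Proof. by move=> h; rewrite unitmxZ ?gl4_unit// unitfE invr_eq0. Qed.

Lemma pgl_nrepr w x g : (w *m pgl_repr g *m x) 0 0 != 0 -> pgl (mkgl (nrepr w x g)) = g.
Proof.
move=> h; rewrite -[RHS]pgl_reprK; apply/pgl_eqP; exists ((w *m pgl_repr g *m x) 0 0)^-1.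
  by rewrite invr_eq0.
by rewrite mkglE// nrepr_unit.
Qed.

Lemma nrepr_continuous w x g : (w *m pgl_repr g *m x) 0 0 != 0 ->
  {for g, continuous (nrepr w x)}.
Proof.
move=> h; rewrite -[g]pgl_reprK; apply: cvg_pgl; rewrite nrepr_pgl.
under eq_fun do rewrite nrepr_pgl.
apply: (@cvg_scalemx _ _ (nbhs (pgl_repr g)) _ _ _ (fun B : gl4 => ((w *m B *m x) 0 0)^-1) (@gl4_mx R)); last exact: continuous_gl4_mx.
apply: (@cvgV _ _ (nbhs (pgl_repr g)) _ (fun B : gl4 => (w *m B *m x) 0 0)) => //.
apply: (@cvg_coord _ (nbhs (pgl_repr g)) _ _ _ _ (fun B : gl4 => w *m B *m x) (w *m pgl_repr g *m x)).
apply: (@cvg_mulmx _ _ (nbhs (pgl_repr g)) _ _ _ _ (fun B : gl4 => w *m B) (fun=> x)); last exact: cvg_cst.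
apply: (@cvg_mulmx _ _ (nbhs (pgl_repr g)) _ _ _ _ (fun=> w) (@gl4_mx R)); first exact: cvg_cst.
exact: continuous_gl4_mx.
Qed.

Definition so3g A : pgl4 := pgl (mkgl (affine_mx A 0)).
Definition std_SO3 : set pgl4 := [set so3g A | A in SO 3].

Lemma affine_unit A : A \in unitmx -> affine_mx A 0 \in unitmx.
Proof.
move=> uA; have : affine_mx A 0 *m affine_mx (invmx A) 0 = 1%:M.
  by rewrite -affine_mxM mulmxV// affine_mx1.
by move=> /mulmx1_unit[].
Qed.

Lemma so_unit n (A : 'M[R]_n) : SO n A -> A \in unitmx.
Proof. by move=> [_ dA]; rewrite unitmxE dA unitr1. Qed.

Lemma so3_affine_unit A : SO 3 A -> affine_mx A 0 \in unitmx.
Proof. by move=> /so_unit/affine_unit. Qed.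

Lemma so3gM A B : A \in unitmx -> B \in unitmx -> so3g (A *m B) = (so3g A * so3g B)%g.
Proof. by move=> uA uB; rewrite /so3g affine_mxM pgl_mkglM// affine_unit. Qed.

Lemma so3g1 : so3g 1%:M = 1%g.
Proof. by rewrite /so3g affine_mx1 pgl_mkgl1. Qed.

Lemma so3gV A : SO 3 A -> so3g A^T = ((so3g A)^-1)%g.
Proof.
move=> SA; have SAt := so_tr SA.
rewrite -[LHS]mul1g -(mulVg (so3g A)) -mulgA -so3gM ?so_unit//.
by rewrite so_mulmxV// so3g1 mulg1.
Qed.

Lemma e3r_affine (A : 'M[R]_3) (t : 'cV[R]_3) : e3r R *m affine_mx A t = e3r R.
Proof.
have h := @mul_row_block R 1 3 1 3 1 0 1%:M A t 0 1%:M.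
have e : e3r R = @row_mx R 1 3 1 0 1%:M.
  apply/rowP => j; rewrite /e3r mxE [RHS]mxE.
  case: (@splitP 3 1 j) => k jk; rewrite ?mxE.
    by rewrite (_ : j = lshift 1 k) ?mxE; [case: k {jk} => -[|[|[|]]]|exact: val_inj].
  by rewrite (_ : j = 3) ?ord1 ?mxE//; apply: val_inj; rewrite /= jk ord1.
by rewrite e /affine_mx h !mul0mx !add0r !mul1mx.
Qed.

Lemma affine_e3 (A : 'M[R]_3) : affine_mx A 0 *m e3 R = e3 R.
Proof.
have := e3r_affine A^T 0 => /(congr1 trmx); rewrite trmx_mul.
have -> : (e3r R)^T = e3 R by rewrite /e3r /e3 trmx_delta.
by rewrite /affine_mx (@tr_block_mx R 3 1 3 1) trmxK !trmx0 trmx1.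
Qed.

Lemma affine_33 (A : 'M[R]_3) : (e3r R *m affine_mx A 0 *m e3 R) 0 0 = 1.
Proof.
by rewrite e3r_affine /e3r /e3 mul_delta_mx mxE.
Qed.

(** The inverse of [so3g]: the 3 x 3 block of the representative with last diagonal entry 1. Its
    continuity makes [so3g] a homeomorphism onto its image. *)
Definition std_mx g : 'M[R]_3 := ulsubmx (nrepr (e3r R) (e3 R) g : 'M[R]_(3 + 1)).

Lemma std_mxK A : A \in unitmx -> std_mx (so3g A) = A.
Proof.
move=> uA; rewrite /std_mx /so3g nrepr_mkgl ?affine_33 ?affine_unit//.
exact: (@block_mxKul R 3 1 3 1).
Qed.

Lemma so3g_inj A B : A \in unitmx -> B \in unitmx -> so3g A = so3g B -> A = B.
Proof. by move=> uA uB h; rewrite -(std_mxK uA) h std_mxK. Qed.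

Lemma std_mx_continuous A : A \in unitmx -> {for so3g A, continuous std_mx}.
Proof.
move=> uA; have h : {for so3g A, continuous (nrepr (e3r R) (e3 R))}.
  apply: nrepr_continuous.
  have /pgl_eqP[c c0 cE] := pgl_reprK (so3g A).
  by rewrite cE mkglE ?affine_unit// -scalemxAr -scalemxAl mxE affine_33 mulr1.
apply: (@cvg_mx _ (nbhs (so3g A))) => i j.
under eq_fun do rewrite mxE mxE; rewrite mxE mxE.
exact: cvg_coord.
Qed.

Lemma cvg_affine (S : Type) (F : set_system S) (f : S -> 'M[R]_3) A : Filter F ->
  f @ F --> A -> affine_mx (f s) 0 @[s --> F] --> affine_mx A 0.
Proof.
move=> FF fA; apply: cvg_mx => i j.
case: (@splitP 3 1 i) => i' ii'; case: (@splitP 3 1 j) => j' jj'.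
- have -> : i = lshift 1 i' by exact: val_inj.
  have -> : j = lshift 1 j' by exact: val_inj.
  by rewrite /affine_mx (@block_mxEul R 3 1 3 1); under eq_fun do rewrite (@block_mxEul R 3 1 3 1); exact: cvg_coord.
- have -> : i = lshift 1 i' by exact: val_inj.
  have -> : j = rshift 3 j' by exact: val_inj.
  by rewrite /affine_mx (@block_mxEur R 3 1 3 1); under eq_fun do rewrite (@block_mxEur R 3 1 3 1); exact: cvg_cst.
- have -> : i = rshift 3 i' by exact: val_inj.
  have -> : j = lshift 1 j' by exact: val_inj.
  by rewrite /affine_mx (@block_mxEdl R 3 1 3 1); under eq_fun do rewrite (@block_mxEdl R 3 1 3 1); exact: cvg_cst.
- have -> : i = rshift 3 i' by exact: val_inj.
  have -> : j = rshift 3 j' by exact: val_inj.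
  by rewrite /affine_mx (@block_mxEdr R 3 1 3 1); under eq_fun do rewrite (@block_mxEdr R 3 1 3 1); exact: cvg_cst.
Qed.

Lemma cvg_so3g (S : Type) (F : set_system S) (f : S -> 'M[R]_3) A : Filter F ->
  f @ F --> A -> A \in unitmx -> so3g (f s) @[s --> F] --> so3g A.
Proof. by move=> FF fA uA; apply: cvg_mkgl; [exact: cvg_affine|exact: affine_unit]. Qed.

Lemma embed_iso n (G : set 'M[R]_n) (j : 'M[R]_n -> 'M[R]_3) (k : 'M[R]_3 -> 'M[R]_n) :
  continuous j -> continuous k -> (forall A : 'M[R]_n, G A -> SO 3 (j A)) ->
  (forall A : 'M[R]_n, G A -> k (j A) = A) -> (forall A B : 'M[R]_n, G A -> G B -> j (A *m B) = j A *m j B) ->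
  G 1%:M -> (forall A B : 'M[R]_n, G A -> G B -> G (A *m B)) ->
  (forall A : 'M[R]_n, G A -> exists2 B : 'M[R]_n, G B & A *m B = 1%:M) ->
  pgl_subgroup_isog G [set so3g (j A) | A in G].
Proof.
move=> cj ck jS jK jM G1 GM GV.
have ju (A : 'M[R]_n) : G A -> j A \in unitmx by move=> /jS/so_unit.
have j1 : j 1%:M = 1%:M.
  have h := jM _ _ G1 G1; rewrite mulmx1 in h.
  by rewrite -[LHS](mulKmx (ju _ G1)) -h mulVmx// ju.
split; first split.
- by exists 1%:M => //; rewrite j1 so3g1.
- move=> _ _ [A GA <-] [B GB <-]; exists (A *m B); first exact: GM.
  by rewrite jM// so3gM// ju.
- move=> _ [A GA <-]; have [B GB AB] := GV _ GA; exists B => //.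
  rewrite -[LHS]mul1g -(mulVg (so3g (j A))) -mulgA -so3gM ?ju// -jM// AB j1 so3g1.
  by rewrite mulg1.
exists (so3g \o j); split; last by move=> A B GA GB /=; rewrite jM// so3gM// ju.
exists (k \o std_mx); split.
- split; first by move=> A GA; exists A.
    move=> A B /set_mem GA /set_mem GB /= h.
    by rewrite -(jK _ GA) -(jK _ GB); congr k; apply: so3g_inj h; exact: ju.
  by move=> _ [A GA <-]; exists A.
- by apply/within_cvg => A GA; apply: cvg_so3g; [apply: cvg_within_filter; exact: cj|exact: ju].
- by move=> A /set_mem GA /=; rewrite std_mxK ?ju// jK.
- apply/within_cvg => _ [A GA <-].
  apply: (@cvg_comp _ _ _ std_mx k _ (nbhs (std_mx (so3g (j A))))); last exact: ck.
  by apply: cvg_within_filter; apply: std_mx_continuous; exact: ju.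
Qed.

End StandardSO3.

(** * Conjugacy to the standard SO_3 *)

Section Conjugacy.
Variable R : realType.
Local Notation pgl4 := (pgl4 R).
Local Notation SO n := (@special_orthogonal_group R n).
Implicit Types (A B : 'M[R]_3) (M : 'M[R]_4) (g h : pgl4).

Definition conj_std (Omega : set pgl4) : Prop :=
  exists t : pgl4, forall g, Omega g <-> std_SO3 (t^-1 * g * t)%g.

Lemma top_group_iso1 n (G : set 'M[R]_n) (H : set pgl4) f : G 1%:M -> top_group_iso G H f ->
  f 1%:M = 1%g.
Proof.
move=> G1 [_ fM]; have := fM _ _ G1 G1; rewrite mulmx1 => h.
by rewrite -[LHS]mul1g -(mulVg (f 1%:M)) -mulgA -h.
Qed.

Lemma top_group_iso_inj n (G : set 'M[R]_n) (H : set pgl4) f (A B : 'M[R]_n) : top_group_iso G H f ->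
  G A -> G B -> f A = f B -> A = B.
Proof. by move=> [[k [[_ inj _] _ _ _]] _] GA GB; apply: inj; rewrite inE. Qed.

Lemma top_group_iso_fun n (G : set 'M[R]_n) (H : set pgl4) f (A : 'M[R]_n) : top_group_iso G H f ->
  G A -> H (f A).
Proof. by move=> [[k [[fH _ _] _ _ _]] _]; exact: fH. Qed.

Lemma top_group_iso_surj n (G : set 'M[R]_n) (H : set pgl4) f g : top_group_iso G H f ->
  H g -> exists2 A, G A & f A = g.
Proof. by move=> [[k [[_ _ surj] _ _ _]] _] /surj[A GA <-]; exists A. Qed.

Lemma top_group_iso_cont n (G : set 'M[R]_n) (H : set pgl4) f : top_group_iso G H f ->
  {within G, continuous f}.
Proof. by move=> [[k []]]. Qed.

(** A common eigenvector allows a lift from PGL_4 to GL_4: normalising by w g x = 1 turns the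
    eigenvalue into 1, and [so3_normal_form] applies to the lift. *)
Lemma eigen_conj_std (Omega : set pgl4) (f : 'M[R]_3 -> pgl4) (w : 'rV[R]_4) (x : 'cV[R]_4) :
  top_group_iso (SO 3) Omega f -> w *m x = 1%:M ->
  (forall A, SO 3 A -> exists c : R, w *m pgl_repr (f A) = c *: w) \/
  (forall A, SO 3 A -> exists c : R, pgl_repr (f A) *m x = c *: x) ->
  conj_std Omega.
Proof.
move=> iso wx ev.
have [_ fM] := iso.
have x0 : x != 0 by apply: contra_eq_neq wx => ->; rewrite mulmx0 eq_sym oner_eq0.
have w0 : w != 0 by apply: contra_eq_neq wx => ->; rewrite mul0mx eq_sym oner_eq0.
have nz A : SO 3 A -> (w *m pgl_repr (f A) *m x) 0 0 != 0.
  move=> SA; have uA := gl4_unit (pgl_repr (f A)).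
  case: ev => [/(_ A SA)[c cE]|/(_ A SA)[c cE]].
    rewrite cE -scalemxAl wx mxE mxE mulr1n mulr1; apply: contra_neq w0 => c0.
    by rewrite -(mulmxK uA w) cE c0 scale0r mul0mx.
  rewrite -mulmxA cE -scalemxAr wx mxE mxE mulr1n mulr1; apply: contra_neq x0 => c0.
  by rewrite -(mulKmx uA x) cE c0 scale0r mulmx0.
pose F A := nrepr w x (f A).
have wFx A : SO 3 A -> w *m F A *m x = 1%:M.
  move=> SA; rewrite /F /nrepr -scalemxAr -scalemxAl [X in _ *: X]mx11_scalar.
  by rewrite scale_scalar_mx mulVf ?nz.
have evF : (forall A, SO 3 A -> w *m F A = w) \/ (forall A, SO 3 A -> F A *m x = x).
  case: ev => ev; [left|right] => A SA; have [c cE] := ev A SA; have := wFx A SA;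
    have [k ->] : exists k : R, F A = k *: gl4_mx (pgl_repr (f A)) by eexists.
    rewrite -scalemxAr cE scalerA -scalemxAl wx => /matrixP/(_ 0 0).
    by rewrite mxE mxE mulr1n mulr1 => ->; rewrite scale1r.
  rewrite -!mulmxA -scalemxAl cE scalerA -scalemxAr wx => /matrixP/(_ 0 0).
  by rewrite mxE mxE mulr1n mulr1 => ->; rewrite scale1r.
have FE A : SO 3 A -> pgl (mkgl (F A)) = f A by move=> SA; apply: pgl_nrepr; exact: nz.
have uF A : SO 3 A -> F A \in unitmx by move=> SA; apply: nrepr_unit; exact: nz.
(* The two sides agree up to a factor, which the normalisation forces to be 1. *)
have FM : hom_on (SO 3) F.
  move=> A B SA SB.
  have : pgl (mkgl (F (A *m B))) = pgl (mkgl (F A *m F B)).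
    by rewrite pgl_mkglM ?uF// !FE ?fM//; exact: so_mul.
  move=> /pgl_eqP[c c0]; rewrite !mkglE ?unitmx_mul ?uF ?uF//; last exact: so_mul.
  move=> E; suff c1 : c = 1 by rewrite E c1 scale1r.
  have := wFx _ (so_mul SA SB); rewrite E -scalemxAr -scalemxAl.
  have -> : w *m (F A *m F B) *m x = 1%:M.
    case: evF => evF; first by rewrite mulmxA evF// wFx.
    by rewrite -!mulmxA evF// mulmxA wFx.
  by move=> /matrixP/(_ 0 0); rewrite !mxE mulr1n mulr1.
have f1 := top_group_iso1 (so_1 R 3) iso.
have F1 : F 1%:M = 1%:M.
  by rewrite /F f1 -pgl_mkgl1 nrepr_mkgl ?unitmx1// mulmx1 wx mxE.
have FI A : SO 3 A -> F A = 1%:M -> A = 1%:M.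
  move=> SA FA; apply: (top_group_iso_inj iso) => //; first exact: so_1.
  by rewrite f1 -FE// FA pgl_mkgl1.
have cF : {within SO 3, continuous F}.
  apply/within_cvg => A SA.
  apply: (@cvg_comp _ _ _ f (nrepr w x) _ (nbhs (f A))).
    by have /within_cvg := top_group_iso_cont iso; exact.
  by apply: nrepr_continuous; exact: nz.
have [T uT [T1 T2]] := so3_normal_form cF FM F1 FI wx evF.
have uTi : invmx T \in unitmx by rewrite unitmx_inv.
have tV : pgl (mkgl (invmx T)) = ((pgl (mkgl T))^-1)%g.
  by rewrite -[LHS]mulg1 -(mulgV (pgl (mkgl T))) mulgA -pgl_mkglM// mulVmx// pgl_mkgl1 mul1g.
have key A : SO 3 A -> ((pgl (mkgl T))^-1 * f A * pgl (mkgl T))%g = pgl (mkgl (invmx T *m F A *m T)).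
  move=> SA; rewrite -tV -(FE A SA) -!pgl_mkglM ?uF//.
  by rewrite unitmx_mul uTi uF.
exists (pgl (mkgl T)) => g; split.
  move=> /(top_group_iso_surj iso)[A SA <-]; have [B SB E] := T1 A SA.
  by exists B; rewrite // key// E.
move=> [B SB BE]; have [A SA E] := T2 B SB.
have : so3g B = ((pgl (mkgl T))^-1 * f A * pgl (mkgl T))%g by rewrite key// E.
rewrite BE => h.
have -> : g = f A.
  have := congr1 (fun u => pgl (mkgl T) * u * (pgl (mkgl T))^-1)%g h.
  by rewrite !mulgA !mulgV !mul1g -!mulgA !mulgV !mulg1.
exact: (top_group_iso_fun iso).
Qed.

(** Affine maps preserve the plane at infinity, so its equation [e3r] is a common left
    eigenvector. *)
Lemma affine_conj_std (Omega : set pgl4) : affine_SO3 Omega -> conj_std Omega.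
Proof.
move=> [aff [_ [f iso]]]; apply: (eigen_conj_std iso (w := e3r R) (x := e3 R)).
  by rewrite /e3r /e3 mul_delta_mx; apply/matrixP => i j; rewrite !mxE !ord1.
left=> A SA; have [B [Bf [A' [t BE]]]] := aff _ (top_group_iso_fun iso SA).
have /pgl_eqP[c c0 cE] : pgl (pgl_repr (f A)) = pgl B by rewrite pgl_reprK.
by exists c; rewrite cE -scalemxAr BE e3r_affine.
Qed.

Lemma subspace_basis p k (V : {vspace 'cV[R]_p}) : \dim V = k ->
  exists2 B : 'M[R]_(p, k), limg (hom4 B) = V & forall c : 'cV_k, B *m c = 0 -> c = 0.
Proof.
move=> dV.
pose B : 'M[R]_(p, k) := \matrix_(i, j) ((vbasis V)`_j) i 0.
have BE (c : 'cV_k) : B *m c = \sum_(j < k) c j 0 *: (vbasis V)`_j.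
  apply/colP => i; rewrite mxE summxE; apply: eq_bigr => j _.
  by rewrite !mxE mulrC.
have sz : size (vbasis V) = k by rewrite size_tuple.
exists B.
  apply/vspaceP => v; apply/idP/idP => [/memv_limg4[c ->]|vV].
    rewrite BE; apply: memv_suml => j _; apply: memvZ.
    by apply: vbasis_mem; apply: mem_nth; rewrite sz.
  apply/memv_limg4; exists (\col_(j < k) coord (vbasis V) (cast_ord (esym dV) j) v).
  rewrite BE {1}(coord_vbasis vV) (reindex (cast_ord (esym dV))) /=.
    by apply: eq_bigr => j _; rewrite mxE.
  by exists (cast_ord dV) => j _; [exact: cast_ordKV|exact: cast_ordK].
move=> c; rewrite BE => h.
have /freeP fV := basis_free (vbasisP V).
apply/colP => j; rewrite mxE.
have := fV (fun i => c (cast_ord dV i) 0) _ (cast_ord (esym dV) j).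
rewrite cast_ordKV; apply.
rewrite -[RHS]h [RHS](reindex (cast_ord dV)) //.
by exists (cast_ord (esym dV)) => i _; [exact: cast_ordK|exact: cast_ordKV].
Qed.

(** Bases [B] of [V] and [D] of a complement, with the dual bases [L] and [Y]. For an operator M
    preserving [V], the block Y M B vanishes, L M B is the restriction to [V], and Y M D is the
    action on the quotient. *)
Lemma subspace_split k n (V : {vspace 'cV[R]_(k + n)}) : \dim V = k ->
  exists (B : 'M[R]_(k + n, k)) (D : 'M[R]_(k + n, n)) (L : 'M[R]_(k, k + n)) (Y : 'M[R]_(n, k + n)),
  [/\ L *m B = 1%:M, Y *m D = 1%:M, Y *m B = 0, B *m L + D *m Y = 1%:M & V = limg (hom4 B)].
Proof.
move=> /subspace_basis[B BV Binj].
have [|E uE EB] := @extend_unitmx R k n B^T.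
  apply: inj_row_free => v vB; apply: trmx_inj; rewrite trmx0; apply: Binj.
  by rewrite -[LHS]trmxK trmx_mul trmxK vB trmx0.
have uEt : E^T \in unitmx by rewrite unitmx_tr.
have lE : lsubmx E^T = B by rewrite -trmx_usub EB trmxK.
exists B, (rsubmx E^T), (usubmx (invmx E^T)), (dsubmx (invmx E^T)).
have h1 : col_mx (usubmx (invmx E^T)) (dsubmx (invmx E^T)) *m row_mx B (rsubmx E^T) = 1%:M.
  by rewrite -lE hsubmxK vsubmxK mulVmx.
have h2 : row_mx B (rsubmx E^T) *m col_mx (usubmx (invmx E^T)) (dsubmx (invmx E^T)) = 1%:M.
  by rewrite -lE hsubmxK vsubmxK mulmxV.
rewrite mul_row_col in h2.
rewrite mul_col_row scalar_mx_block in h1.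
by have [? ? ? ?] := eq_block_mx h1.
Qed.

Lemma vec4E (a0 a1 a2 a3 : R) :
  ((vec4 [:: a0; a1; a2; a3] 0 0 = a0) * (vec4 [:: a0; a1; a2; a3] 1 0 = a1) *
  (vec4 [:: a0; a1; a2; a3] 2 0 = a2) * (vec4 [:: a0; a1; a2; a3] 3 0 = a3))%type.
Proof. by rewrite !mxE. Qed.

Lemma quat_mul_vec4 (a0 a1 a2 a3 b0 b1 b2 b3 : R) :
  quat_mul (vec4 [:: a0; a1; a2; a3]) (vec4 [:: b0; b1; b2; b3]) =
  vec4 [:: a0 * b0 - a1 * b1 - a2 * b2 - a3 * b3; a0 * b1 + a1 * b0 + a2 * b3 - a3 * b2;
           a0 * b2 - a1 * b3 + a2 * b0 + a3 * b1; a0 * b3 + a1 * b2 - a2 * b1 + a3 * b0].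
Proof. by rewrite /quat_mul !mxE. Qed.

Lemma quat_conj_vec4 (a0 a1 a2 a3 : R) :
  quat_conj (vec4 [:: a0; a1; a2; a3]) = vec4 [:: a0; - a1; - a2; - a3].
Proof. by rewrite /quat_conj !mxE. Qed.

(** The Euler-Rodrigues formula. *)
Lemma spin3_cover_vec4 (a0 a1 a2 a3 : R) : spin3_cover (vec4 [:: a0; a1; a2; a3]) =
  mxs 3 3 [:: [:: a0 ^+ 2 + a1 ^+ 2 - a2 ^+ 2 - a3 ^+ 2; 2 * (a1 * a2 - a0 * a3); 2 * (a1 * a3 + a0 * a2)];
    [:: 2 * (a1 * a2 + a0 * a3); a0 ^+ 2 - a1 ^+ 2 + a2 ^+ 2 - a3 ^+ 2; 2 * (a2 * a3 - a0 * a1)];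
    [:: 2 * (a1 * a3 - a0 * a2); 2 * (a2 * a3 + a0 * a1); a0 ^+ 2 - a1 ^+ 2 - a2 ^+ 2 + a3 ^+ 2]].
Proof.
have d0 : delta_mx (lift 0 0) 0 = vec4 [:: 0; 1; 0; 0] :> 'cV[R]_4.
  by apply/colP; apply: ord4P; rewrite !mxE.
have d1 : delta_mx (lift 0 1) 0 = vec4 [:: 0; 0; 1; 0] :> 'cV[R]_4.
  by apply/colP; apply: ord4P; rewrite !mxE.
have d2 : delta_mx (lift 0 2) 0 = vec4 [:: 0; 0; 0; 1] :> 'cV[R]_4.
  by apply/colP; apply: ord4P; rewrite !mxE.
apply/matrixP => i j; rewrite mxE quat_conj_vec4; move: j i.
apply: ord3P; rewrite ?d0 ?d1 ?d2 !quat_mul_vec4; apply: ord3P; rewrite [LHS]mxE [RHS]mxE /= ?vec4E; ring.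
Qed.

(** Rotations about the z-axis and the x-axis are covered by the quaternions c' + s' k and c' + s' i
    of half the angle, so the covering needs to be inverted only on generators. *)
Lemma so3_eigen_gen (f : 'M[R]_3 -> pgl4) (Omega : set pgl4) (P : pgl4 -> Prop) :
  top_group_iso (SO 3) Omega f -> (forall g h, P g -> P h -> P (g * h)%g) ->
  (forall a, spin3 a -> P (f (spin3_cover a))) -> forall A, SO 3 A -> P (f A).
Proof.
move=> [_ fM] PM Pc.
apply: so3_gen => [A B SA SB PA PB|c s /half_angle[c' [s' [cs' -> ->]]]|c s /half_angle[c' [s' [cs' -> ->]]]] /=.
- by rewrite fM//; exact: PM.
- have -> : rz (c' ^+ 2 - s' ^+ 2) (2 * c' * s') = spin3_cover (vec4 [:: c'; 0; 0; s']).
    rewrite spin3_cover_vec4; apply/matrixP; apply: ord3P; apply: ord3P; rewrite [LHS]mxE [RHS]mxE /=;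
      first [ring | rewrite -[LHS]cs'; ring].
  by apply: Pc; rewrite /spin3 /= sum4 !mxE /= -[RHS]cs'; ring.
- have -> : rx (c' ^+ 2 - s' ^+ 2) (2 * c' * s') = spin3_cover (vec4 [:: c'; s'; 0; 0]).
    rewrite spin3_cover_vec4; apply/matrixP; apply: ord3P; apply: ord3P; rewrite [LHS]mxE [RHS]mxE /=;
      first [ring | rewrite -[LHS]cs'; ring].
  by apply: Pc; rewrite /spin3 /= sum4 !mxE /= -[RHS]cs'; ring.
Qed.

(** By Cayley-Hamilton, X^2 - tr(X) X + 1 = 0; with X^2 = 1 this says tr(X) X = 2, so X is
    scalar. *)
Lemma involution2 (X : 'M[R]_2) : X *m X = 1%:M -> \det X = 1 -> X = 1%:M \/ X = - 1%:M.
Proof.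
move=> XX; rewrite det2.
have E i j := congr1 (fun M : 'M[R]_2 => M i j) XX.
have := E 0 0; have := E 0 1; have := E 1 0; have := E 1 1; rewrite !mxE !sum2 /= ?(mulr1n, mulr0n).
set a := X 0 0; set b := X 0 1; set c := X 1 0; set d := X 1 1 => e11 e10 e01 e00 dX.
have ad : a + d != 0.
  apply/eqP => h; have : a * (a + d) = 2 by lra.
  by rewrite h mulr0; lra.
have b0 : b = 0 by apply/eqP; rewrite -(mulIr_eq0 _ (mulIf ad)); apply/eqP; lra.
have c0 : c = 0 by apply/eqP; rewrite -(mulIr_eq0 _ (mulIf ad)); apply/eqP; lra.
rewrite b0 c0 in e11 e00 dX.
have : (a - 1) * (a + 1) = 0 by lra.
move=> /eqP; rewrite mulf_eq0 subr_eq0 addr_eq0 => /orP[/eqP a1|/eqP a1]; rewrite a1 in dX; [left|right];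
  by apply/matrixP; apply: ord2P; apply: ord2P; rewrite !mxE /= -/a -/b -/c -/d ?b0 ?c0 ?a1 ?mulr1n ?mulr0n ?oppr0 //; lra.
Qed.

(** The quaternion algebra does not embed in the real 2 x 2 matrices. Both matrices have trace 0 and
    determinant 1, and their product has trace 0; this would make a square negative. *)
Lemma no_quaternions2 (X Y : 'M[R]_2) : X *m X = - 1%:M -> Y *m Y = - 1%:M ->
  X *m Y = - (Y *m X) -> False.
Proof.
move=> XX YY XY.
have Ex i j := congr1 (fun M : 'M[R]_2 => M i j) XX.
have Ey i j := congr1 (fun M : 'M[R]_2 => M i j) YY.
have Exy i j := congr1 (fun M : 'M[R]_2 => M i j) XY.
have := Ex 0 0; have := Ex 0 1; have := Ex 1 0; have := Ex 1 1.
have := Ey 0 0; have := Ey 0 1; have := Ey 1 0; have := Ey 1 1.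
have := Exy 0 0; have := Exy 0 1; have := Exy 1 0; have := Exy 1 1.
rewrite !mxE !sum2 /= ?(mulr1n, mulr0n).
set a := X 0 0; set b := X 0 1; set c := X 1 0; set d := X 1 1.
set p := Y 0 0; set q := Y 0 1; set r := Y 1 0; set s := Y 1 1.
move=> z11 z10 z01 z00 y11 y10 y01 y00 x11 x10 x01 x00.
have b0 : b != 0 by apply/eqP => b0; have := sqr_ge0 a; rewrite b0 in x00; lra.
have q0 : q != 0 by apply/eqP => q0; have := sqr_ge0 p; rewrite q0 in y00; lra.
have ad : d = - a.
  have : b * (a + d) = 0 by lra.
  by move=> /eqP; rewrite mulf_eq0 (negbTE b0) /= addrC addr_eq0 => /eqP.
have ps : s = - p.
  have : q * (p + s) = 0 by lra.
  by move=> /eqP; rewrite mulf_eq0 (negbTE q0) /= addrC addr_eq0 => /eqP.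
have h1 : 2 * a * p + b * r + q * c = 0 by lra.
have bc : b * c = - 1 - a ^+ 2 by lra.
have qr : q * r = - 1 - p ^+ 2 by lra.
(* h1 gives (b r + q c)^2 = 4 a^2 p^2, while 4 (b c)(q r) is larger. *)
have k1 : (b * r - q * c) ^+ 2 = (2 * a * p) ^+ 2 - 4 * ((b * c) * (q * r)).
  have -> : (2 * a * p) ^+ 2 = (b * r + q * c) ^+ 2.
    by rewrite -[RHS]sqrrN; congr (_ ^+ 2); lra.
  by ring.
rewrite bc qr in k1.
have := sqr_ge0 (b * r - q * c); rewrite k1.
have := sqr_ge0 a; have := sqr_ge0 p; lra.
Qed.

(** The image of -1 is an involution of determinant 1, hence a sign, and the sign - is excluded by
    [no_quaternions2]. Then the image of j is a sign too, hence central. As j is conjugate to k,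
    both have the same image, and ij = k sends i to the identity. *)
Lemma spin3_plane_trivial (X : 'cV[R]_4 -> 'M[R]_2) :
  (forall a b, spin3 a -> spin3 b -> X (quat_mul a b) = X a *m X b) ->
  X (vec4 [:: 1; 0; 0; 0]) = 1%:M -> X (vec4 [:: 0; 1; 0; 0]) = 1%:M.
Proof.
move=> XM X1.
have sp a0 a1 a2 a3 : a0 ^+ 2 + a1 ^+ 2 + a2 ^+ 2 + a3 ^+ 2 = 1 -> spin3 (vec4 [:: a0; a1; a2; a3]).
  by move=> h; rewrite /spin3 /= sum4 !mxE /=; exact: h.
have s1 : spin3 (vec4 [:: 1; 0; 0; 0] : 'cV[R]_4) by apply: sp; ring.
have sm : spin3 (vec4 [:: -1; 0; 0; 0] : 'cV[R]_4) by apply: sp; ring.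
have si : spin3 (vec4 [:: 0; 1; 0; 0] : 'cV[R]_4) by apply: sp; ring.
have sj : spin3 (vec4 [:: 0; 0; 1; 0] : 'cV[R]_4) by apply: sp; ring.
have sk : spin3 (vec4 [:: 0; 0; 0; 1] : 'cV[R]_4) by apply: sp; ring.
(* The cosine of pi/4, so that t + t i and t + t j are square roots of i and j. The first of them
   also conjugates j to k. *)
pose t : R := Num.sqrt (2^-1).
have tt : t * t = 2^-1 by rewrite -expr2 sqr_sqrtr// invr_ge0.
have sc : spin3 (vec4 [:: t; t; 0; 0] : 'cV[R]_4) by apply: sp; rewrite !expr2 tt; field.
have sc' : spin3 (vec4 [:: t; 0; t; 0] : 'cV[R]_4) by apply: sp; rewrite !expr2 tt; field.
have mulE (a0 a1 a2 a3 b0 b1 b2 b3 c0 c1 c2 c3 : R) :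
    spin3 (vec4 [:: a0; a1; a2; a3]) -> spin3 (vec4 [:: b0; b1; b2; b3]) ->
    a0 * b0 - a1 * b1 - a2 * b2 - a3 * b3 = c0 -> a0 * b1 + a1 * b0 + a2 * b3 - a3 * b2 = c1 ->
    a0 * b2 - a1 * b3 + a2 * b0 + a3 * b1 = c2 -> a0 * b3 + a1 * b2 - a2 * b1 + a3 * b0 = c3 ->
    X (vec4 [:: a0; a1; a2; a3]) *m X (vec4 [:: b0; b1; b2; b3]) = X (vec4 [:: c0; c1; c2; c3]).
  by move=> sa sb <- <- <- <-; rewrite -XM// quat_mul_vec4.
have ii : X (vec4 [:: 0; 1; 0; 0]) *m X (vec4 [:: 0; 1; 0; 0]) = X (vec4 [:: -1; 0; 0; 0]) by apply: mulE => //; ring.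
have jj : X (vec4 [:: 0; 0; 1; 0]) *m X (vec4 [:: 0; 0; 1; 0]) = X (vec4 [:: -1; 0; 0; 0]) by apply: mulE => //; ring.
have mm : X (vec4 [:: -1; 0; 0; 0]) *m X (vec4 [:: -1; 0; 0; 0]) = X (vec4 [:: 1; 0; 0; 0]) by apply: mulE => //; ring.
have ij : X (vec4 [:: 0; 1; 0; 0]) *m X (vec4 [:: 0; 0; 1; 0]) = X (vec4 [:: 0; 0; 0; 1]) by apply: mulE => //; ring.
have cc : X (vec4 [:: t; t; 0; 0]) *m X (vec4 [:: t; t; 0; 0]) = X (vec4 [:: 0; 1; 0; 0]) by apply: mulE => //; rewrite ?tt; field.
have cc' : X (vec4 [:: t; 0; t; 0]) *m X (vec4 [:: t; 0; t; 0]) = X (vec4 [:: 0; 0; 1; 0]) by apply: mulE => //; rewrite ?tt; field.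
have smk : spin3 (vec4 [:: 0; 0; 0; -1] : 'cV[R]_4) by apply: sp; ring.
have ji : X (vec4 [:: 0; 0; 1; 0]) *m X (vec4 [:: 0; 1; 0; 0]) = X (vec4 [:: 0; 0; 0; -1]) by apply: mulE => //; ring.
have mji : X (vec4 [:: -1; 0; 0; 0]) *m (X (vec4 [:: 0; 0; 1; 0]) *m X (vec4 [:: 0; 1; 0; 0])) = X (vec4 [:: 0; 0; 0; 1]).
  by rewrite ji; apply: mulE => //; ring.
have cj : X (vec4 [:: t; t; 0; 0]) *m X (vec4 [:: 0; 0; 1; 0]) = X (vec4 [:: 0; 0; 0; 1]) *m X (vec4 [:: t; t; 0; 0]).
  transitivity (X (vec4 [:: 0; 0; t; t])); first by apply: mulE => //; ring.
  by apply/esym; apply: mulE => //; ring.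
rewrite X1 in mm.
(* The determinant of an eighth root of the identity is 1 or -1, so its square is 1. *)
have dsq Y : Y *m Y *m (Y *m Y) *m (Y *m Y *m (Y *m Y)) = 1%:M :> 'M[R]_2 -> \det (Y *m Y) = 1.
  move=> /(congr1 determinant); rewrite !det_mulmx det1 -!expr2 -!exprM => h.
  apply/eqP; rewrite eq_sym -(@eqrXn2 _ 4)// ?sqr_ge0 ?ler01//.
  by rewrite expr1n -exprM h.
have di : \det (X (vec4 [:: 0; 1; 0; 0])) = 1.
  by rewrite -cc; apply: dsq; rewrite cc ii mm.
have dj : \det (X (vec4 [:: 0; 0; 1; 0])) = 1.
  by rewrite -cc'; apply: dsq; rewrite cc' jj mm.
have dm : \det (X (vec4 [:: -1; 0; 0; 0])) = 1 by rewrite -ii det_mulmx di mulr1.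
have [m1|m1] := involution2 mm dm; last first.
  exfalso; apply: (@no_quaternions2 (X (vec4 [:: 0; 1; 0; 0])) (X (vec4 [:: 0; 0; 1; 0]))).
  - by rewrite ii.
  - by rewrite jj.
  - by rewrite ij -mji m1 mulNmx mul1mx.
have uj : X (vec4 [:: 0; 0; 1; 0]) \in unitmx by rewrite unitmxE dj unitr1.
have uc : X (vec4 [:: t; t; 0; 0]) \in unitmx.
  rewrite unitmxE unitfE; apply/eqP => h; move: di; rewrite -cc det_mulmx h mul0r => /eqP.
  by rewrite eq_sym oner_eq0.
have jk : X (vec4 [:: 0; 0; 0; 1]) = X (vec4 [:: 0; 0; 1; 0]).
  apply: (can_inj (mulmxK uc)); rewrite -cj.
  by have [->|->] := involution2 (etrans jj m1) dj; rewrite ?mulNmx ?mulmxN mulmx1 mul1mx.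
by apply: (can_inj (mulmxK uj)); rewrite ij jk mul1mx.
Qed.

End Conjugacy.

(** * Reducible groups and the subgroups SO_2 and O_2 *)

Section Reducible.
Variable R : realType.
Local Notation gl4 := (gl4 R).
Local Notation pgl4 := (pgl4 R).
Local Notation SO n := (@special_orthogonal_group R n).
Implicit Types (A B : 'M[R]_3) (g h : pgl4).

Lemma mulmx_col0 m n (M : 'M[R]_(m, n)) : (forall c : 'cV_n, M *m c = 0) -> M = 0.
Proof.
move=> h; apply/matrixP => i j; have /colP/(_ i) := h (delta_mx j 0).
by rewrite -colE !mxE.
Qed.

Lemma pgl_repr_mul g h : exists c : R, gl4_mx (pgl_repr (g * h)%g) = c *: (pgl_repr g *m pgl_repr h).
Proof.
have /pgl_eqP[c c0 cE] : pgl (pgl_repr (g * h)%g) = pgl (gl4_mul (pgl_repr g) (pgl_repr h)).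
  by rewrite pgl_mulE' !pgl_reprK.
by exists c.
Qed.

Lemma pgl_repr_pgl (A : gl4) : exists c : R, gl4_mx (pgl_repr (pgl A)) = c *: gl4_mx A.
Proof. by have /pgl_eqP[c c0 cE] := pgl_reprK (pgl A); exists c. Qed.

(** The quaternion i acts trivially on [V] and on the quotient, so it acts as 1 + N with N^2 = 0.
    Since i^4 = 1, also 1 + 4N = 1 and N = 0. But i covers the half turn [flip R], which is not the
    identity. *)
Lemma spin3_plane_free (rho : 'cV[R]_4 -> gl4) (f : 'M[R]_3 -> pgl4) (Omega : set pgl4)
    (V : {vspace 'cV[R]_4}) : top_group_iso (SO 3) Omega f -> spin_lift f rho ->
  (forall a, spin3 a -> (hom4 (rho a) @: V <= V)%VS) -> \dim V = 2 -> False.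
Proof.
move=> iso [crho rhoM rhof] rV dV.
have [B [D [L [Y [LB YD YB BLDY VE]]]]] := @subspace_split R 2 2 V dV.
have sp a0 a1 a2 a3 : a0 ^+ 2 + a1 ^+ 2 + a2 ^+ 2 + a3 ^+ 2 = 1 -> spin3 (vec4 [:: a0; a1; a2; a3] : 'cV[R]_4).
  by move=> h; rewrite /spin3 /= sum4 !mxE /=; exact: h.
pose one : 'cV[R]_4 := vec4 [:: 1; 0; 0; 0].
pose qi : 'cV[R]_4 := vec4 [:: 0; 1; 0; 0].
pose qm : 'cV[R]_4 := vec4 [:: -1; 0; 0; 0].
have s1 : spin3 one by apply: sp; ring.
have si : spin3 qi by apply: sp; ring.
have sm : spin3 qm by apply: sp; ring.
have vE (a0 a1 a2 a3 b0 b1 b2 b3 : R) : a0 = b0 -> a1 = b1 -> a2 = b2 -> a3 = b3 ->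
   vec4 [:: a0; a1; a2; a3] = vec4 [:: b0; b1; b2; b3] by move=> -> -> -> ->.
have e11 : quat_mul one one = one by rewrite quat_mul_vec4; apply: vE; ring.
have eii : quat_mul qi qi = qm by rewrite quat_mul_vec4; apply: vE; ring.
have emm : quat_mul qm qm = one by rewrite quat_mul_vec4; apply: vE; ring.
have rho1 : gl4_mx (rho one) = 1%:M.
  have h : rho one *m rho one = rho one by rewrite -[in RHS]e11 rhoM.
  by rewrite -[LHS](mulKmx (gl4_unit (rho one))) h mulVmx// gl4_unit.
have YrB a : spin3 a -> Y *m rho a *m B = 0.
  move=> sa; apply: mulmx_col0 => c.
  have /memv_limg4[c' E] : rho a *m (B *m c) \in limg (hom4 B).
    rewrite -VE; apply: (subvP (rV a sa)).
    have -> : rho a *m (B *m c) = hom4 (rho a) (B *m c) by rewrite lfunE.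
    by apply: memv_img; rewrite VE; apply/memv_limg4; exists c.
  by rewrite -!mulmxA E mulmxA YB mul0mx.
have rB a : spin3 a -> rho a *m B = B *m (L *m rho a *m B).
  move=> sa; rewrite -[LHS]mul1mx -BLDY mulmxDl -[D *m Y *m _]mulmxA.
  by rewrite (mulmxA Y) YrB// mulmx0 addr0 !mulmxA.
have rY a : spin3 a -> Y *m rho a = (Y *m rho a *m D) *m Y.
  by move=> sa; rewrite -[LHS]mulmx1 -BLDY mulmxDr !mulmxA YrB// mul0mx add0r.
have Xi : L *m rho qi *m B = 1%:M.
  apply: (@spin3_plane_trivial R (fun a => L *m rho a *m B)) => [a b sa sb|].
    by rewrite rhoM//= -!mulmxA; congr (_ *m (_ *m _)); rewrite [LHS]rB// !mulmxA.
  by rewrite rho1 mulmx1 LB.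
have Zi : Y *m rho qi *m D = 1%:M.
  apply: (@spin3_plane_trivial R (fun a => Y *m rho a *m D)) => [a b sa sb|].
    by rewrite rhoM//= (mulmxA Y (rho a)) [in LHS](rY a sa) -!mulmxA.
  by rewrite rho1 mulmx1 YD.
have [N ri] : exists N, gl4_mx (rho qi) = 1%:M + N.
  by exists (gl4_mx (rho qi) - 1%:M); rewrite addrC subrK.
have NB : N *m B = 0.
  by apply: (addrI B); rewrite addr0 -{1}[B]mul1mx -mulmxDl -ri rB// Xi mulmx1.
have YN : Y *m N = 0.
  by apply: (addrI Y); rewrite addr0 -{1}[Y]mulmx1 -mulmxDr -ri rY// Zi mul1mx.
have NN : N *m N = 0.
  by rewrite -{2}[N]mul1mx -BLDY mulmxDl mulmxDr -!mulmxA YN !mulmx0 addr0 (mulmxA N B) NB mul0mx.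
have rm : gl4_mx (rho qm) = 1%:M + (N + N).
  by rewrite -eii rhoM//= ri mulmxDl mul1mx mulmxDr mulmx1 NN addr0 addrA.
have N4 : 1%:M + ((N + N) + (N + N)) = 1%:M.
  have E : (N + N) *m (N + N) = 0 by rewrite mulmxDl !mulmxDr !NN !addr0.
  rewrite -[RHS]rho1 -emm rhoM//= rm mulmxDl mul1mx [(N + N) *m _]mulmxDr mulmx1 E addr0.
  by rewrite addrA.
have N0 : N = 0.
  have h : (N + N) + (N + N) = 0 by apply: (addrI (1%:M : 'M[R]_4)); rewrite N4 addr0.
  by apply/matrixP => i j; have /matrixP/(_ i j) := h; rewrite !mxE; lra.
have h1 : f (spin3_cover qi) = f 1%:M.
  rewrite -rhof// (top_group_iso1 (so_1 R 3) iso) -pgl_oneE; congr pgl; apply: gl4_inj.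
  by rewrite ri N0 addr0.
have SOi : SO 3 (spin3_cover qi).
  have -> : spin3_cover qi = flip R.
    rewrite spin3_cover_vec4; apply/matrixP; apply: ord3P; apply: ord3P; rewrite !mxE /=; ring.
  exact: so_flip.
have := top_group_iso_inj iso SOi (so_1 R 3) h1.
rewrite spin3_cover_vec4 => /matrixP/(_ 1 1); rewrite !mxE /= mulr1n; lra.
Qed.

(** An invariant line provides a common eigenvector and an invariant hyperplane a common left
    eigenvector; dimension 2 does not occur. *)
Lemma reducible_conj_std (Omega : set pgl4) : reducible_SO3 Omega -> conj_std Omega.
Proof.
move=> [_ [f [rho [iso lift [V [dV rV]]]]]].
have [crho rhoM rhof] := lift.
have : \dim V = 1 \/ \dim V = 2 \/ \dim V = 3.
  by move: (\dim V) dV => [|[|[|[|k]]]] //; [left|right; left|right; right].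
move=> [d1|[d2|d3]]; last 2 first.
- by have := spin3_plane_free iso lift rV d2.
- have [B [D [L [Y [LB YD YB BLDY VE]]]]] := @subspace_split R 3 1 V d3.
  apply: (eigen_conj_std iso YD); left.
  apply: (so3_eigen_gen (P := fun g => exists c : R, Y *m pgl_repr g = c *: Y) iso).
    move=> g h [c cE] [d dE]; have [k kE] := pgl_repr_mul g h; exists (k * (c * d)).
    by rewrite kE -scalemxAr mulmxA cE -scalemxAl dE !scalerA mulrA.
  move=> a sa; rewrite -rhof//; have [k kE] := pgl_repr_pgl (rho a).
  have YrB : Y *m rho a *m B = 0.
    apply: mulmx_col0 => c.
    have /memv_limg4[c' E] : rho a *m (B *m c) \in limg (hom4 B).
      rewrite -VE; apply: (subvP (rV a sa)).
      have -> : rho a *m (B *m c) = hom4 (rho a) (B *m c) by rewrite lfunE.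
      by apply: memv_img; rewrite VE; apply/memv_limg4; exists c.
    by rewrite -!mulmxA E mulmxA YB mul0mx.
  exists (k * (Y *m rho a *m D) 0 0); rewrite kE -scalemxAr -scalerA; congr (_ *: _).
  rewrite -[LHS]mulmx1 -BLDY mulmxDr !mulmxA YrB mul0mx add0r.
  by rewrite [X in X *m _]mx11_scalar mul_scalar_mx.
have [B [D [L [Y [LB YD YB BLDY VE]]]]] := @subspace_split R 1 3 V d1.
apply: (eigen_conj_std iso LB); right.
apply: (so3_eigen_gen (P := fun g => exists c : R, pgl_repr g *m B = c *: B) iso).
  move=> g h [c cE] [d dE]; have [k kE] := pgl_repr_mul g h; exists (k * (d * c)).
  by rewrite kE -scalemxAl -mulmxA dE -scalemxAr cE !scalerA mulrA.
move=> a sa; rewrite -rhof//; have [k kE] := pgl_repr_pgl (rho a).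
have /memv_limg4[c' E] : rho a *m B \in limg (hom4 B).
  rewrite -VE; apply: (subvP (rV a sa)).
  have -> : rho a *m B = hom4 (rho a) B by rewrite lfunE.
  by apply: memv_img; rewrite VE; apply/memv_limg4; exists 1%:M; rewrite mulmx1.
exists (k * c' 0 0); rewrite kE -scalemxAl -scalerA; congr (_ *: _).
by rewrite E [c' in LHS]mx11_scalar mul_mx_scalar.
Qed.

Lemma iso_compact (Omega : set pgl4) : pgl_subgroup_isog (SO 3) Omega -> compact Omega.
Proof.
move=> [_ [f iso]].
have -> : Omega = f @` SO 3.
  apply/seteqP; split=> [g /(top_group_iso_surj iso)[A SA <-]|_ [A SA <-]]; first by exists A.
  exact: (top_group_iso_fun iso).
by apply: continuous_compact; [exact: (top_group_iso_cont iso)|exact: compact_so].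
Qed.

Section Circle.
Variables (n : nat) (G : set 'M[R]_n) (H : set pgl4) (f : 'M[R]_n -> pgl4) (e : 'M[R]_2 -> 'M[R]_n).

(* Applied with G = SO_2 or O_2, and e the inclusion of SO_2. *)
Lemma circle_in_std : H `<=` @std_SO3 R -> top_group_iso G H f -> G 1%:M ->
  (forall M, SO 2 M -> G (e M)) -> (forall M N, SO 2 M -> SO 2 N -> e (M *m N) = e M *m e N) ->
  continuous e -> e (rot2 (-1) 0) <> 1%:M ->
  exists2 A, SO 3 A & (forall M, SO 2 M -> exists c s, c ^+ 2 + s ^+ 2 = 1 /\
      f (e M) = so3g (A *m rz c s *m A^T)) /\
    (forall c s, c ^+ 2 + s ^+ 2 = 1 -> H (so3g (A *m rz c s *m A^T))) /\
    f (e (rot2 (-1) 0)) = so3g (A *m rz (-1) 0 *m A^T).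
Proof.
move=> Hstd iso G1 eG eM ce epi.
have [_ fM] := iso.
have Spi : SO 2 (rot2 (-1 : R) 0) by apply/so2P; exists (-1), 0; split=> //; ring.
pose psi M := std_mx (f (e M)).
have psiP M : SO 2 M -> SO 3 (psi M) /\ f (e M) = so3g (psi M).
  move=> SM; have [B SB BE] := Hstd _ (top_group_iso_fun iso (eG _ SM)).
  by rewrite /psi -BE std_mxK// so_unit.
have psiS M : SO 2 M -> SO 3 (psi M) by move=> /psiP[].
have psiE M : SO 2 M -> f (e M) = so3g (psi M) by move=> /psiP[].
have psiM : hom_on (SO 2) psi.
  move=> M N SM SN; apply: so3g_inj.
  - by apply: so_unit; apply: psiS; exact: so_mul.
  - by rewrite unitmx_mul !so_unit//; exact: psiS.
  - rewrite so3gM; [|by apply/so_unit/psiS..].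
    by rewrite -!psiE ?eM ?fM//; [exact: eG|exact: eG|exact: so_mul].
have cpsi : {within SO 2, continuous psi}.
  apply/within_cvg => M SM.
  apply: (@cvg_comp _ _ _ (fun M => f (e M)) (@std_mx R) _ (nbhs (f (e M)))).
    have /within_cvg cf : {within SO 2, continuous (f \o e)}.
      apply: within_comp eG (top_group_iso_cont iso).
      exact: continuous_subspaceT.
    exact: cf.
  have hz := std_mx_continuous (so_unit (psiS M SM)).
  by rewrite -(psiE M SM) in hz; exact: hz.
have pipi : rot2 (-1) 0 *m rot2 (-1) 0 = 1%:M :> 'M[R]_2.
  by apply/matrixP; apply: ord2P; apply: ord2P; rewrite !mxE !sum2 !mxE /= ?(mulr1n, mulr0n); ring.
have e1 : e 1%:M = 1%:M.
  have h := eM _ _ (so_1 R 2) (so_1 R 2); rewrite mulmx1 in h.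
  have G1' := eG _ (so_1 R 2).
  apply: (top_group_iso_inj iso G1' G1).
  rewrite (top_group_iso1 G1 iso).
  have h' : f (e 1%:M) = (f (e 1%:M) * f (e 1%:M))%g by rewrite -(fM _ _ G1' G1') -h.
  by rewrite -[LHS]mul1g -(mulVg (f (e 1%:M))) -mulgA -h'.
have psi1 : psi 1%:M = 1%:M.
  by rewrite /psi e1 (top_group_iso1 G1 iso) -so3g1 std_mxK// unitmx1.
have [||A SA AE] := @halfturn_conj R (psi (rot2 (-1) 0)) (psiS _ Spi).
- by rewrite -psiM// pipi psi1.
- move=> h; apply: epi; apply: (top_group_iso_inj iso (eG _ Spi) G1).
  by rewrite psiE// h so3g1 (top_group_iso1 G1 iso).
have SAt := so_tr SA.
pose psi' M := A^T *m psi M *m A.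
have psi'E M : SO 2 M -> psi M = A *m psi' M *m A^T.
  by move=> SM; rewrite /psi' !mulmxA so_mulmxV// mul1mx -mulmxA so_mulmxV// mulmx1.
have [||||C1 C2] := @circle_hom R psi'.
- apply/within_cvg => M SM; apply: cvg_mulmx; last exact: cvg_cst.
  apply: cvg_mulmx; first exact: cvg_cst.
  by move/within_cvg : cpsi; exact.
- by move=> M N SM SN; rewrite /psi' psiM// -!mulmxA (mulmxA A A^T) so_mulmxV// mul1mx.
- by move=> M SM; apply: so_mul => //; apply: so_mul => //; exact: psiS.
- exact: AE.
exists A => //; split; last split.
- by move=> M SM; have [c [s [cs E]]] := C1 M SM; exists c, s; rewrite psiE// psi'E// E.
- move=> c s cs; have [M SM E] := C2 c s cs; rewrite -E -psi'E// -psiE//.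
  by apply: (top_group_iso_fun iso); exact: eG.
- by rewrite psiE// psi'E// /psi' AE.
Qed.

End Circle.

Lemma SO2_in_std (H : set pgl4) : H `<=` @std_SO3 R -> pgl_subgroup_isog (SO 2) H ->
  exists2 A, SO 3 A & forall c s, c ^+ 2 + s ^+ 2 = 1 -> H (so3g (A *m rz c s *m A^T)).
Proof.
move=> Hstd [_ [f iso]].
have [||||A SA [_ [h _]]] := @circle_in_std 2 (SO 2) H f id Hstd iso (so_1 R 2).
- by [].
- by [].
- by move=> M; exact: cvg_id.
- by move=> /matrixP/(_ 0 0); rewrite !mxE /= mulr1n; lra.
by exists A.
Qed.

(** The reflection [s0] commutes with the half turn, so its image preserves or reverses the axis of
    the circle. If it fixed the axis pointwise, it would commute with the whole circle, which fails
    for [rot2 0 1]. So it reverses the axis and differs from the conjugate of [flip R] by a rotation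
    about that axis. *)
Lemma O2_in_std (H : set pgl4) : H `<=` @std_SO3 R -> pgl_subgroup_isog (@orthogonal_group R 2) H ->
  exists2 A, SO 3 A & (forall c s, c ^+ 2 + s ^+ 2 = 1 -> H (so3g (A *m rz c s *m A^T))) /\
    H (so3g (A *m flip R *m A^T)).
Proof.
move=> Hstd [[H1 HM HV] [f iso]].
have [_ fM] := iso.
have O1 : @orthogonal_group R 2 1%:M by rewrite /orthogonal_group /= trmx1 mulmx1.
have [||||A SA [h0 [h hpi]]] := @circle_in_std 2 (@orthogonal_group R 2) H f id Hstd iso O1.
- by move=> M [].
- by [].
- by move=> M; exact: cvg_id.
- by move=> /matrixP/(_ 0 0); rewrite !mxE /= mulr1n; lra.
have SAt := so_tr SA.
exists A => //; split=> //.
pose s0 : 'M[R]_2 := mxs 2 2 [:: [:: 1; 0]; [:: 0; -1]].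
have Os : @orthogonal_group R 2 s0.
  by apply/matrixP; apply: ord2P; apply: ord2P; rewrite !mxE !sum2 !mxE /= ?(mulr1n, mulr0n); ring.
have Sr (c s : R) : c ^+ 2 + s ^+ 2 = 1 -> SO 2 (rot2 c s) by move=> cs; apply/so2P; exists c, s.
have Or (c s : R) : c ^+ 2 + s ^+ 2 = 1 -> @orthogonal_group R 2 (rot2 c s) by move=> /Sr[].
have [B SB BE] := Hstd _ (top_group_iso_fun iso Os).
pose g := A^T *m B *m A.
have Sg : SO 3 g by apply: so_mul => //; exact: so_mul.
have BE' : B = A *m g *m A^T.
  by rewrite /g !mulmxA so_mulmxV// mul1mx -mulmxA so_mulmxV// mulmx1.
have conjM X Y : (A *m X *m A^T) *m (A *m Y *m A^T) = A *m (X *m Y) *m A^T.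
  by rewrite -!mulmxA (mulmxA A^T A) so_mulVmx// mul1mx.
have conjI X Y : A *m X *m A^T = A *m Y *m A^T -> X = Y.
  move=> /(congr1 (fun M => A^T *m M *m A)).
  by rewrite !mulmxA so_mulVmx// !mul1mx -!mulmxA so_mulVmx// !mulmx1.
have comm (c s : R) (M : 'M[R]_2) : c ^+ 2 + s ^+ 2 = 1 -> @orthogonal_group R 2 M ->
    f M = so3g (A *m rz c s *m A^T) -> M *m s0 = s0 *m M -> rz c s *m g = g *m rz c s.
  move=> cs OM fME Ms; apply: conjI; rewrite -(conjM (rz c s) g) -(conjM g (rz c s)) -BE'.
  have SX : SO 3 (A *m rz c s *m A^T) by apply: so_mul => //; apply: so_mul => //; exact: so_rz.
  apply: so3g_inj; first by rewrite unitmx_mul (so_unit SX) (so_unit SB).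
    by rewrite unitmx_mul (so_unit SX) (so_unit SB).
  rewrite (so3gM (so_unit SX) (so_unit SB)) (so3gM (so_unit SB) (so_unit SX)) -fME BE.
  by rewrite -!fM// Ms.
have Spi : @orthogonal_group R 2 (rot2 (-1) 0) by apply: Or; ring.
have gz : g *m rz (-1) 0 = rz (-1) 0 *m g.
  apply/esym; apply: (comm _ _ (rot2 (-1) 0)) => //; first by ring.
  by apply/matrixP; apply: ord2P; apply: ord2P; rewrite !mxE !sum2 !mxE /=; ring.
have [ge|ge] := commute_rzpi Sg gz.
  exfalso; have [c [s [cs gE]]] := so3_stab_e2 Sg ge.
  have cs01 : (0 : R) ^+ 2 + 1 ^+ 2 = 1 by ring.
  have [c' [s' [cs' E]]] := h0 _ (Sr 0 1 cs01).
  have hc : f (rot2 0 1 *m s0) = f (s0 *m rot2 0 1).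
    have SX c1 s1 : c1 ^+ 2 + s1 ^+ 2 = 1 -> A *m rz c1 s1 *m A^T \in unitmx.
      by move=> cs1; apply: so_unit; apply: so_mul => //; apply: so_mul => //; exact: so_rz.
    have BE1 : B = A *m rz c s *m A^T by rewrite -gE.
    have Or01 := Or _ _ cs01; have U1 := SX _ _ cs'; have U2 := SX _ _ cs.
    rewrite (fM _ _ Or01 Os) (fM _ _ Os Or01) E -BE BE1 -(so3gM U1 U2) -(so3gM U2 U1).
    by rewrite (conjM (rz c' s')) (conjM (rz c s)) rz_comm.
  have := top_group_iso_inj iso _ _ hc.
  move=> /(_ _ _)/matrixP h'.
  have : (rot2 0 1 *m s0) 1 0 = (s0 *m rot2 0 1) 1 0 :> R.
    apply: h'; rewrite /orthogonal_group /=.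
      by apply/matrixP; apply: ord2P; apply: ord2P; rewrite !mxE !sum2 !mxE /= !sum2 !mxE /= ?(mulr1n, mulr0n); ring.
    by apply/matrixP; apply: ord2P; apply: ord2P; rewrite !mxE !sum2 !mxE /= !sum2 !mxE /= ?(mulr1n, mulr0n); ring.
  by rewrite !mxE !sum2 !mxE /=; lra.
have [c [s [cs gE]]] := so3_flip_e2 Sg ge.
have cs' : c ^+ 2 + (- s) ^+ 2 = 1 by rewrite sqrrN.
have -> : A *m flip R *m A^T = (A *m rz c (- s) *m A^T) *m B.
  rewrite BE' conjM; congr (A *m _ *m _).
  rewrite gE mulmxA rz_mul (_ : rz _ _ = 1%:M) ?mul1mx//.
  by rewrite -rz1; congr rz; rewrite -?cs; ring.
have SX : SO 3 (A *m rz c (- s) *m A^T) by apply: so_mul => //; apply: so_mul => //; exact: so_rz.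
rewrite (so3gM (so_unit SX) (so_unit SB)); apply: HM; first exact: h.
by rewrite BE; exact: (top_group_iso_fun iso).
Qed.

End Reducible.

(** * Lines up to rotation *)

Section NormalForms.
Variable R : realType.
Local Notation pgl4 := (pgl4 R).
Local Notation SO n := (@special_orthogonal_group R n).
Local Notation e_ := (e_ R).
Implicit Types (A B : 'M[R]_3) (p q : 'cV[R]_3) (l : line R) (m : oline R) (g h : pgl4).

(** Homogeneous coordinates: the affine point p/a for nonzero [a], and the point at infinity in
    direction [p] for [a] = 0. *)
Definition pt p (a : R) : 'cV[R]_4 := vec4 [:: p 0 0; p 1 0; p 2 0; a].
Definition bas p (a : R) q (b : R) : 'M[R]_(4, 2) :=
  mxs 4 2 [:: [:: p 0 0; q 0 0]; [:: p 1 0; q 1 0]; [:: p 2 0; q 2 0]; [:: a; b]].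

Lemma affineE A : affine_mx A 0 = mxs 4 4 [:: [:: A 0 0; A 0 1; A 0 2; 0];
  [:: A 1 0; A 1 1; A 1 2; 0]; [:: A 2 0; A 2 1; A 2 2; 0]; [:: 0; 0; 0; 1]].
Proof.
have l0 : (0 : 'I_4) = lshift 1 (0 : 'I_3) by exact: val_inj.
have l1 : (1 : 'I_4) = lshift 1 (1 : 'I_3) by exact: val_inj.
have l2 : (2 : 'I_4) = lshift 1 (2 : 'I_3) by exact: val_inj.
have l3 : (3 : 'I_4) = rshift 3 (0 : 'I_1) by exact: val_inj.
apply/matrixP; apply: ord4P; apply: ord4P; rewrite [RHS]mxE /= /affine_mx ?l3 ?l2 ?l1 ?l0;
  by rewrite ?(@block_mxEul R 3 1 3 1) ?(@block_mxEur R 3 1 3 1) ?(@block_mxEdl R 3 1 3 1)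
    ?(@block_mxEdr R 3 1 3 1) ?mxE.
Qed.

Lemma affine_pt A p a : affine_mx A 0 *m pt p a = pt (A *m p) a.
Proof. by rewrite affineE; apply/colP; apply: ord4P; rewrite !mxE !sum4 !mxE /= ?sum3; ring. Qed.

Lemma affine_bas A p a q b : affine_mx A 0 *m bas p a q b = bas (A *m p) a (A *m q) b.
Proof.
by rewrite affineE; apply/matrixP; apply: ord4P; apply: ord2P; rewrite !mxE !sum4 !mxE /= ?sum3; ring.
Qed.

Lemma bas_mul p a q b (x y z t : R) : bas p a q b *m mxs 2 2 [:: [:: x; y]; [:: z; t]] =
  bas (x *: p + z *: q) (x * a + z * b) (y *: p + t *: q) (y * a + t * b).
Proof.
by apply/matrixP; apply: ord4P; apply: ord2P; rewrite !mxE !sum2 !mxE /=; ring.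
Qed.

Lemma bas_col p a q b (s t : R) : bas p a q b *m mxs 2 1 [:: [:: s]; [:: t]] =
  pt (s *: p + t *: q) (s * a + t * b).
Proof. by apply/colP; apply: ord4P; rewrite !mxE !sum2 !mxE /=; ring. Qed.

Lemma basE (M : 'M[R]_(4, 2)) : exists p a q b, M = bas p a q b.
Proof.
exists (mxs 3 1 [:: [:: M 0 0]; [:: M 1 0]; [:: M 2 0]]), (M 3 0),
  (mxs 3 1 [:: [:: M 0 1]; [:: M 1 1]; [:: M 2 1]]), (M 3 1).
by apply/matrixP; apply: ord4P; apply: ord2P; rewrite !mxE.
Qed.

Lemma bas_inj p a q b p' a' q' b' : bas p a q b = bas p' a' q' b' -> [/\ p = p', a = a', q = q' & b = b'].
Proof.
move=> /matrixP h; split.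
- by apply: colP'; [have := h 0 0|have := h 1 0|have := h 2 0]; rewrite !mxE.
- by have := h 3 0; rewrite !mxE.
- by apply: colP'; [have := h 0 1|have := h 1 1|have := h 2 1]; rewrite !mxE.
- by have := h 3 1; rewrite !mxE.
Qed.

Lemma mem_bas p a q b v : v \in limg (hom4 (bas p a q b)) <->
  exists s t : R, v = pt (s *: p + t *: q) (s * a + t * b).
Proof.
rewrite memv_limg4; split=> [[c ->]|[s [t ->]]].
  exists (c 0 0), (c 1 0); rewrite -bas_col; congr (_ *m _).
  by apply/colP; apply: ord2P; rewrite !mxE.
by exists (mxs 2 1 [:: [:: s]; [:: t]]); rewrite bas_col.
Qed.

(** The line with foot (d, 0, 0) and direction [e_ 1], at distance |d| from the origin. *)
Definition Nd (d : R) : 'M[R]_(4, 2) := bas (d *: e_ 0) 1 (e_ 1) 0.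

Lemma xyE : xy_basis R = bas (e_ 0) 0 (e_ 1) 0.
Proof. by apply/matrixP; apply: ord4P; apply: ord2P; rewrite !mxE. Qed.

(** Representatives for the lines up to rotation: one line at infinity and one affine line for each
    distance from the origin. *)
Definition kind (K : 'M[R]_(4, 2)) : Prop := K = xy_basis R \/ exists2 d, 0 <= d & K = Nd d.

Definition refl2 : 'M[R]_2 := mxs 2 2 [:: [:: 1; 0]; [:: 0; -1]].

Lemma flip_e0 : flip R *m e_ 0 = e_ 0.
Proof. by rewrite mul_e; apply: colP'; rewrite !mxE. Qed.
Lemma flip_e1 : flip R *m e_ 1 = - e_ 1.
Proof. by rewrite mul_e; apply: colP'; rewrite !mxE /= ?oppr0. Qed.
Lemma flip_e2 : flip R *m e_ 2 = - e_ 2.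
Proof. by rewrite mul_e; apply: colP'; rewrite !mxE /= ?oppr0. Qed.

(** [refl2] has determinant -1: the half turn about the x-axis maps each representative to itself
    and reverses its orientation. *)
Lemma flip_kind K : kind K -> affine_mx (flip R) 0 *m K = K *m refl2.
Proof.
move=> [->|[d d0 ->]]; rewrite ?xyE /Nd affine_bas /refl2 bas_mul ?(linearZ d) /= ?flip_e0 ?flip_e1;
  by rewrite -?scalemxAr ?flip_e0 !(scale1r, scale0r, scaleN1r, addr0, add0r, mul1r, mul0r, mulr0, mulr1).
Qed.

Lemma dot_ge0 p : 0 <= dot p p.
Proof. by rewrite /dot -!expr2 !addr_ge0 ?sqr_ge0. Qed.

Lemma dot_eq0 p : dot p p = 0 -> p = 0.
Proof.
rewrite /dot -!expr2 => /eqP; rewrite !paddr_eq0 ?addr_ge0 ?sqr_ge0// !sqrf_eq0.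
by move=> /andP[/andP[/eqP h0 /eqP h1] /eqP h2]; apply: colP'; rewrite ?h0 ?h1 ?h2 mxE.
Qed.

Lemma dot_gt0 p : p != 0 -> 0 < dot p p.
Proof. by move=> p0; rewrite lt_def dot_ge0 andbT; apply: contra_neq p0; exact: dot_eq0. Qed.

Lemma dotZ (a : R) p q : dot (a *: p) q = a * dot p q.
Proof. by rewrite /dot !mxE; ring. Qed.
Lemma dotC p q : dot p q = dot q p.
Proof. by rewrite /dot; ring. Qed.
Lemma dotD p p' q : dot (p + p') q = dot p q + dot p' q.
Proof. by rewrite /dot !mxE; ring. Qed.

Lemma normalize p : p != 0 -> exists2 k : R, 0 < k & dot (k *: p) (k *: p) = 1.
Proof.
move=> p0; have h := dot_gt0 p0; exists (Num.sqrt (dot p p))^-1.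
  by rewrite invr_gt0 sqrtr_gt0.
rewrite dotZ dotC dotZ mulrA -expr2 exprVn sqr_sqrtr ?ltW// mulVf// gt_eqF//.
Qed.

Lemma det_mxs2 (x y z t : R) : \det (mxs 2 2 [:: [:: x; y]; [:: z; t]]) = x * t - y * z.
Proof. by rewrite det2 !mxE. Qed.

(** A line at infinity is treated by Gram-Schmidt. For an affine line a base change produces a unit
    direction and the foot of the perpendicular from the origin, and a rotation moves this
    orthogonal pair to the axes. Positive determinants keep track of orientation. *)
Lemma normal_form (M : 'M[R]_(4, 2)) : \dim (limg (hom4 M)) = 2 ->
  exists K A P, [/\ kind K, SO 3 A, 0 < \det P & M *m P = affine_mx A 0 *m K].
Proof.
have [p [a [q [b ->]]]] := basE M => /basis_inj inj.
have inj' (s t : R) : s *: p + t *: q = 0 -> s * a + t * b = 0 -> s = 0 /\ t = 0.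
  move=> h1 h2; have /colP h : mxs 2 1 [:: [:: s]; [:: t]] = 0 :> 'cV_2.
    apply: inj; rewrite bas_col h1 h2; apply/colP; apply: ord4P; rewrite !mxE //.
  by have := h 0; have := h 1; rewrite !mxE.
have [/eqP ab|ab] := eqVneq (a ^+ 2 + b ^+ 2) 0.
  have [a0 b0] : a = 0 /\ b = 0.
    by move: ab; rewrite paddr_eq0 ?sqr_ge0// !sqrf_eq0 => /andP[/eqP -> /eqP ->].
  have p0 : p != 0.
    apply/eqP => p0; have [||/eqP] := inj' 1 0.
    - by rewrite p0 scaler0 scale0r addr0.
    - by rewrite a0 mulr0 mul0r addr0.
    - by rewrite oner_eq0.
  have [k k0 kp] := normalize p0.
  set u := k *: p in kp.
  pose q' := q - dot q u *: u.
  have q'0 : q' != 0.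
    apply/eqP => h; have [||_ /eqP] := inj' (- (dot q u * k)) 1.
    - by rewrite scale1r scaleNr -scalerA -/u addrC.
    - by rewrite a0 b0 !mulr0 addr0.
    - by rewrite oner_eq0.
  have [k' k'0 kq] := normalize q'0.
  have uq : dot u (k' *: q') = 0.
    by rewrite dotC dotZ /q' dotD -scaleNr dotZ kp mulr1 subrr mulr0.
  have [A [SA A0 A1]] := so3_frame kp kq uq.
  exists (xy_basis R), A, (mxs 2 2 [:: [:: k; - (k' * dot q u * k)]; [:: 0; k']]); split=> //.
  - by left.
  - by rewrite det_mxs2 mulr0 subr0 mulr_gt0.
  rewrite bas_mul xyE affine_bas A0 A1 a0 b0; congr bas; rewrite ?(mulr0, scale0r, addr0)//.
  rewrite /q' scalerBr addrC scaleNr; congr (_ - _).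
  by rewrite /u !scalerA !mulrA.
have n0 : 0 < a ^+ 2 + b ^+ 2 by rewrite lt_def ab addr_ge0 ?sqr_ge0.
set n := a ^+ 2 + b ^+ 2 in ab n0.
pose p1 := (a / n) *: p + (b / n) *: q.
pose q1 := - b *: p + a *: q.
have q10 : q1 != 0.
  apply/eqP => h; have [|/eqP] := inj' (- b) a h; first by ring.
  by rewrite oppr_eq0 => /eqP b0 a0; move: n0; rewrite /n a0 b0 expr0n /= addr0 ltxx.
have [k k0 kq] := normalize q10.
set u := k *: q1 in kq.
pose p2 := p1 - dot p1 u *: u.
have p2u : dot p2 u = 0 by rewrite /p2 dotD -scaleNr dotZ kq mulr1 subrr.
pose d := Num.sqrt (dot p2 p2).
have dd : d ^+ 2 = dot p2 p2 by rewrite sqr_sqrtr// dot_ge0.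
have [A [SA Ad A1]] : exists A, [/\ SO 3 A, d *: (A *m e_ 0) = p2 & A *m e_ 1 = u].
  have [d0|d0] := eqVneq d 0.
    have p20 : p2 = 0 by apply: dot_eq0; rewrite -dd d0 expr0n.
    have [v [vv uv]] := orthogonal_unit_exists kq; rewrite dotC in uv.
    by have [A [SA _ A1]] := so3_frame vv kq uv; exists A; rewrite d0 scale0r p20.
  have h1 : dot (d^-1 *: p2) (d^-1 *: p2) = 1.
    by rewrite dotZ dotC dotZ -dd; field.
  have h2 : dot (d^-1 *: p2) u = 0 by rewrite dotZ p2u mulr0.
  have [A [SA A0 A1]] := so3_frame h1 kq h2; exists A; split=> //.
  by rewrite A0 scalerA divff// scale1r.
(* The first factor, of determinant 1, turns the last coordinates into 1 and 0, giving an affine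
   point and a direction. The second slides the point to the foot and normalises the direction. *)
exists (Nd d), A, (mxs 2 2 [:: [:: a / n; - b]; [:: b / n; a]] *m mxs 2 2 [:: [:: 1; 0]; [:: - (dot p1 u * k); k]]); split=> //.
- by right; exists d; rewrite // sqrtr_ge0.
- rewrite det_mulmx !det_mxs2 mul0r subr0 mul1r mulr_gt0//.
  by rewrite (_ : _ - _ = 1) ?ltr01// /n; field; rewrite -/n.
rewrite mulmxA !bas_mul /Nd affine_bas -scalemxAr Ad A1 -/p1 -/q1; congr bas.
- by rewrite scale1r /p2 /u scaleNr scalerA.
- by rewrite /n; field; rewrite -/n.
- by rewrite scale0r add0r.
- by ring.
Qed.

Lemma oline_normal_form m : exists K A, [/\ kind K, SO 3 A & positive_bases m (affine_mx A 0 *m K)].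
Proof.
have [M mM] := pos_ex m; have [K [A [P [kK SA P0 E]]]] := normal_form (pos_dim mM).
by exists K, A; split=> //; rewrite -E; exact: pos_mulr.
Qed.

Lemma line_normal_form l : exists K A, [/\ kind K, SO 3 A & limg (hom4 (affine_mx A 0 *m K)) = l :> {vspace _}].
Proof.
have [m <-] := oline_over l; have [K [A [kK SA mK]]] := oline_normal_form m.
by exists K, A; split=> //; exact: pos_limg.
Qed.

Lemma pos_or m (M : 'M[R]_(4, 2)) : limg (hom4 M) = unoriented m :> {vspace _} ->
  positive_bases m M \/ positive_bases m (M *m refl2).
Proof.
move=> ME; have [M' mM'] := pos_ex m.
have [||P P0 E] := @basis_change R M' M.
- exact: (pos_dim mM').
- by rewrite ME (pos_limg mM').
have [P1|P1] := ltP 0 (\det P); first by left; rewrite E; exact: pos_mulr.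
right; rewrite E -mulmxA; apply: pos_mulr => //.
rewrite det_mulmx det_mxs2 mulr0 subr0 mul1r mulrN1 oppr_gt0 lt_def eq_sym P0.
by [].
Qed.

Lemma so3g_line A l (M : 'M[R]_(4, 2)) : SO 3 A -> limg (hom4 M) = l :> {vspace _} ->
  limg (hom4 (affine_mx A 0 *m M)) = pgl_line (so3g A) l :> {vspace _}.
Proof.
move=> SA ME; rewrite /so3g pgl_lineE -(limg_gl4 _ ME) mkglE//.
exact: so3_affine_unit.
Qed.

Lemma so3g_pos A m M : SO 3 A -> positive_bases m M ->
  positive_bases (pgl_oline (so3g A) m) (affine_mx A 0 *m M).
Proof.
move=> SA mM; rewrite /so3g pgl_olineE.
have := pos_gl4 (mkgl (affine_mx A 0)) mM; rewrite mkglE//.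
exact: so3_affine_unit.
Qed.

Lemma memv_so3g A l p a : SO 3 A -> pt p a \in line_space l ->
  pt (A *m p) a \in line_space (pgl_line (so3g A) l).
Proof.
move=> SA; have [M ME] := line_basis l; rewrite -(so3g_line SA ME) -ME => /memv_limg4[c E].
by apply/memv_limg4; exists c; rewrite -mulmxA -E affine_pt.
Qed.

Lemma ptE (v : 'cV[R]_4) : exists p a, v = pt p a.
Proof.
exists (mxs 3 1 [:: [:: v 0 0]; [:: v 1 0]; [:: v 2 0]]), (v 3 0).
by apply/colP; apply: ord4P; rewrite !mxE.
Qed.

Lemma pt_eq0 p a : pt p a = 0 -> p = 0 /\ a = 0.
Proof.
move=> /colP h; split; last by have := h 3; rewrite !mxE.
by apply: colP'; [have := h 0|have := h 1|have := h 2]; rewrite !mxE.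
Qed.

(** [B] preserves the xy-plane and hence its orthogonal complement, the z-axis, on which it acts by
    1 or -1. As [B] has determinant 1, this sign is that of [P]. *)
Lemma stab_xy B P : SO 3 B -> affine_mx B 0 *m xy_basis R = xy_basis R *m P ->
  (B *m e_ 2 = e_ 2 \/ B *m e_ 2 = - e_ 2) /\ (0 < \det P -> B *m e_ 2 = e_ 2).
Proof.
move=> SB; have [BB dB] := SB.
have -> : P = mxs 2 2 [:: [:: P 0 0; P 0 1]; [:: P 1 0; P 1 1]].
  by apply/matrixP; apply: ord2P; apply: ord2P; rewrite !mxE.
rewrite xyE affine_bas bas_mul det_mxs2; set x := P 0 0; set y := P 0 1; set z := P 1 0; set t := P 1 1.
rewrite !mul_e => /bas_inj[/colP h0 _ /colP h1 _].
have := h0 0; have := h0 1; have := h0 2; have := h1 0; have := h1 1; have := h1 2.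
rewrite !mxE /= !(mulr0, mulr1, addr0, add0r) => B21 B11 B01 B20 B10 B00.
have E i j := congr1 (fun M : 'M[R]_3 => M i j) (so_mulmxV SB).
have := E 2 2; have := E 2 0; have := E 2 1; rewrite !mxE !sum3 !mxE /= B20 B21 => e21 e20 e22.
have {}e22 : (B 2 2 - 1) * (B 2 2 + 1) = 0 by lra.
have n : B 2 2 != 0.
  by apply/eqP => n; move: e22; rewrite n sub0r add0r mulr1 => /eqP; rewrite oppr_eq0 oner_eq0.
have b0 : B 0 2 = 0.
  by apply/eqP; rewrite -(mulrI_eq0 _ (mulfI n)); apply/eqP; lra.
have b1 : B 1 2 = 0.
  by apply/eqP; rewrite -(mulrI_eq0 _ (mulfI n)); apply/eqP; lra.
have colE : col 2 B = B 2 2 *: e_ 2 by apply: colP'; rewrite !mxE ?b0 ?b1 /= ?mulr0 ?mulr1.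
rewrite colE; move: e22 => /eqP; rewrite mulf_eq0 subr_eq0 addr_eq0 => /orP[/eqP ->|/eqP e].
  by rewrite scale1r; split=> //; left.
rewrite e scaleN1r; split; first by right.
rewrite det3 B21 B11 B01 B20 B10 B00 b0 b1 e in dB => dP.
have dE : x * t - y * z = -1 by lra.
by move: dP; rewrite dE oppr_gt0 ltr10.
Qed.

(** The foot is the point nearest to the origin, hence fixed. The direction is fixed up to a sign,
    which is the determinant of [P]. *)
Lemma stab_Nd (d : R) B P : SO 3 B -> affine_mx B 0 *m Nd d = Nd d *m P ->
  [/\ B *m (d *: e_ 0) = d *: e_ 0, B *m e_ 1 = e_ 1 \/ B *m e_ 1 = - e_ 1 &
     0 < \det P -> B *m e_ 1 = e_ 1].
Proof.
move=> SB; have [BB dB] := SB.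
have -> : P = mxs 2 2 [:: [:: P 0 0; P 0 1]; [:: P 1 0; P 1 1]].
  by apply/matrixP; apply: ord2P; apply: ord2P; rewrite !mxE.
rewrite /Nd affine_bas bas_mul det_mxs2; set x := P 0 0; set y := P 0 1; set z := P 1 0; set t := P 1 1.
move=> /bas_inj[h0 x1 h1 y0].
have {}x1 : x = 1 by lra.
have {}y0 : y = 0 by lra.
rewrite x1 scale1r in h0; rewrite y0 scale0r add0r in h1.
have tt : (t - 1) * (t + 1) = 0.
  have := so3_dot (e_ 1) (e_ 1) SB; rewrite h1 /dot !mxE /=; lra.
have z0 : z = 0.
  have := so3_dot (d *: e_ 0) (d *: e_ 0) SB; rewrite h0 /dot !mxE /= => h.
  by apply/eqP; rewrite -sqrf_eq0; apply/eqP; lra.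
rewrite z0 scale0r addr0 in h0; rewrite h0 h1.
split=> //.
  move: tt => /eqP; rewrite mulf_eq0 subr_eq0 addr_eq0 => /orP[/eqP ->|/eqP ->].
    by left; rewrite scale1r.
  by right; rewrite scaleN1r.
rewrite x1 y0 mul0r subr0 mul1r => t0.
move: tt => /eqP; rewrite mulf_eq0 subr_eq0 addr_eq0 => /orP[/eqP ->|/eqP t1].
  by rewrite scale1r.
by move: t0; rewrite t1 oppr_gt0 ltr10.
Qed.

End NormalForms.

(** * Spreads invariant under rotations about an axis *)

Section AxialSpreads.
Variable R : realType.
Local Notation pgl4 := (pgl4 R).
Local Notation SO n := (@special_orthogonal_group R n).
Local Notation e_ := (e_ R).
Implicit Types (A B : 'M[R]_3) (p q : 'cV[R]_3) (l : line R) (m : oline R) (g h : pgl4).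

Lemma line_eq_sub l l' : (forall v, v \in line_space l -> v \in line_space l') -> l = l'.
Proof.
move=> h; apply: line_inj; apply/eqP; rewrite eqEdim !line_dim leqnn andbT.
by apply/subvP.
Qed.

Lemma zaxisE : z_axis R = limg (hom4 (bas (e_ 2) 0 0 1)).
Proof.
apply/vspaceP => v; rewrite /z_axis span_cons span_seq1; apply/idP/idP.
  move=> /memv_addP[_ /vlineP[a ->] [_ /vlineP[b ->] ->]]; apply/mem_bas; exists a, b.
  by apply/colP; apply: ord4P; rewrite !mxE /=; ring.
move=> /mem_bas[s [t ->]]; apply/memv_addP.
exists (s *: vec4 [:: 0; 0; 1; 0]); first by rewrite memvZ// memv_line.
exists (t *: vec4 [:: 0; 0; 0; 1]); first by rewrite memvZ// memv_line.
by apply/colP; apply: ord4P; rewrite !mxE /=; ring.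
Qed.

Lemma zaxis_dim : \dim (z_axis R) = 2.
Proof.
rewrite zaxisE; apply: (@left_inv_basis _ _ (mxs 2 4 [:: [:: 0; 0; 1; 0]; [:: 0; 0; 0; 1]])).
by apply/matrixP; apply: ord2P; apply: ord2P; rewrite !mxE !sum4 !mxE /= ?(mulr1n, mulr0n); ring.
Qed.

Definition zline : line R := Line zaxis_dim.

Lemma mem_zline p (a : R) : pt p a \in line_space zline <-> p 0 0 = 0 /\ p 1 0 = 0.
Proof.
rewrite /= zaxisE mem_bas; split=> [[s [t /colP h]]|[p0 p1]].
  have := h 0; have := h 1; rewrite !mxE /= => -> ->.
  by split; ring.
exists (p 2 0), a; apply/colP; apply: ord4P; rewrite !mxE /= ?p0 ?p1; ring.
Qed.

Lemma mem_vline p (a : R) : pt p a \in line_space (base_line R) <-> p 2 0 = 0 /\ a = 0.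
Proof.
rewrite memv_base !mxE /=; split; first by move=> /andP[/eqP -> /eqP ->].
by move=> [-> ->]; rewrite eqxx.
Qed.

Lemma xy_infinityE : line_space (base_line R) = xy_infinity R.
Proof.
apply/vspaceP => v; rewrite /xy_infinity span_cons span_seq1; have [p [a ->]] := ptE v.
apply/idP/idP.
  move=> /mem_vline[p2 a0]; apply/memv_addP.
  exists (p 0 0 *: vec4 [:: 1; 0; 0; 0]); first by rewrite memvZ// memv_line.
  exists (p 1 0 *: vec4 [:: 0; 1; 0; 0]); first by rewrite memvZ// memv_line.
  by apply/colP; apply: ord4P; rewrite !mxE /= ?p2 ?a0; ring.
move=> /memv_addP[_ /vlineP[x ->] [_ /vlineP[y ->] E]].
apply/mem_vline; have /colP h := E; have := h 2; have := h 3; rewrite !mxE /= => -> ->.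
by split; ring.
Qed.

Lemma affine_Nd A (d : R) : affine_mx A 0 *m Nd d = bas (d *: (A *m e_ 0)) 1 (A *m e_ 1) 0.
Proof. by rewrite /Nd affine_bas -scalemxAr. Qed.

Lemma affine_xy A : affine_mx A 0 *m xy_basis R = bas (A *m e_ 0) 0 (A *m e_ 1) 0.
Proof. by rewrite xyE affine_bas. Qed.

Lemma mem_Nd A (d : R) l p (a : R) : limg (hom4 (affine_mx A 0 *m Nd d)) = l :> {vspace _} ->
  pt p a \in line_space l <-> exists t : R, p = a *: (d *: (A *m e_ 0)) + t *: (A *m e_ 1).
Proof.
move=> <-; rewrite affine_Nd mem_bas; split=> [[s [t E]]|[t ->]].
  have /colP h := E; have a_s : a = s by have := h 3; rewrite !mxE /= => ->; ring.
  by exists t; apply: colP'; [have := h 0|have := h 1|have := h 2]; rewrite !mxE /= a_s.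
by exists a, t; apply/colP; apply: ord4P; rewrite !mxE /=; ring.
Qed.

Lemma mem_xy A l p (a : R) : limg (hom4 (affine_mx A 0 *m xy_basis R)) = l :> {vspace _} ->
  pt p a \in line_space l <-> a = 0 /\ exists s t : R, p = s *: (A *m e_ 0) + t *: (A *m e_ 1).
Proof.
move=> <-; rewrite affine_xy mem_bas; split=> [[s [t E]]|[-> [s [t ->]]]].
  have /colP h := E; split; first by have := h 3; rewrite !mxE /= => ->; ring.
  by exists s, t; apply: colP'; [have := h 0|have := h 1|have := h 2]; rewrite !mxE /=.
by exists s, t; apply/colP; apply: ord4P; rewrite !mxE /=; ring.
Qed.

Lemma pt_neq0 p (a : R) : p != 0 \/ a != 0 -> pt p a != 0.
Proof.
move=> h; apply/eqP => /pt_eq0[p0 a0]; move: h; rewrite p0 a0 !eqxx.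
by case.
Qed.

Lemma so3_dot1 A i : SO 3 A -> dot (A *m e_ i) (A *m e_ i) = 1.
Proof.
move=> SA; rewrite so3_dot//; move: i; apply: ord3P; rewrite /dot !mxE /=; ring.
Qed.

Lemma so3_dot01 A : SO 3 A -> dot (A *m e_ 0) (A *m e_ 1) = 0.
Proof. by move=> SA; rewrite so3_dot// /dot !mxE /=; ring. Qed.

(** The complex number c + i s is the quotient of a' + i b' by a + i b; if both vanish, any rotation
    will do. *)
Lemma plane_rotation (a b a' b' : R) : a ^+ 2 + b ^+ 2 = a' ^+ 2 + b' ^+ 2 ->
  exists c s, [/\ c ^+ 2 + s ^+ 2 = 1, c * a - s * b = a' & s * a + c * b = b'].
Proof.
have [/eqP|n0] := eqVneq (a ^+ 2 + b ^+ 2) 0.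
  rewrite paddr_eq0 ?sqr_ge0// !sqrf_eq0 => /andP[/eqP -> /eqP ->] /eqP.
  rewrite expr0n /= addr0 eq_sym paddr_eq0 ?sqr_ge0// !sqrf_eq0 => /andP[/eqP -> /eqP ->].
  by exists 1, 0; split; ring.
move=> ab; have n0' : a' ^+ 2 + b' ^+ 2 != 0 by rewrite -ab.
exists ((a * a' + b * b') / (a ^+ 2 + b ^+ 2)), ((a * b' - b * a') / (a ^+ 2 + b ^+ 2)).
split; [|by field..].
have -> : 1 = (a ^+ 2 + b ^+ 2) * (a' ^+ 2 + b' ^+ 2) / (a ^+ 2 + b ^+ 2) ^+ 2.
  by rewrite -ab; field.
by field.
Qed.

Lemma rz_mulE (c s : R) p : rz c s *m p = mxs 3 1 [:: [:: c * p 0 0 - s * p 1 0];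
  [:: s * p 0 0 + c * p 1 0]; [:: p 2 0]].
Proof. by apply: colP'; rewrite !mxE !sum3 !mxE /=; ring. Qed.

Section Axial.
Variable C : set (line R).
Hypothesis sC : compact_spread C.
Hypothesis invC : forall c s : R, c ^+ 2 + s ^+ 2 = 1 -> pgl_spread (so3g (rz c s)) C = C.

Lemma axial_line (c s : R) l : c ^+ 2 + s ^+ 2 = 1 -> C l -> C (pgl_line (so3g (rz c s)) l).
Proof. by move=> cs Cl; rewrite -(invC cs); exists l. Qed.

Lemma spread_pt l l' p (a : R) : C l -> C l' -> p != 0 \/ a != 0 -> pt p a \in line_space l ->
  pt p a \in line_space l' -> l = l'.
Proof. by move=> Cl Cl' h0 h1 h2; exact: (spread_uniq sC Cl Cl' (pt_neq0 h0) h1 h2). Qed.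

(** The quarter turn about the z-axis fixes the origin and hence the spread line through it. The
    direction of this line is a real eigenvector of the quarter turn, and only vertical vectors are
    such. *)
Lemma line_origin l : C l -> pt 0 1 \in line_space l -> l = zline.
Proof.
move=> Cl ol; have [K [A [[->|[d d0 ->]] SA lE]]] := line_normal_form l.
  by move: ol => /(mem_xy _ _ lE)[/eqP]; rewrite oner_eq0.
have cs : (0 : R) ^+ 2 + 1 ^+ 2 = 1 by ring.
have gl : pgl_line (so3g (rz 0 1)) l = l.
  apply: (@spread_pt _ _ 0 1); [exact: axial_line|by []|by right; rewrite oner_eq0| |by []].
  by have := memv_so3g (so_rz cs) ol; rewrite mulmx0.
set u := A *m e_ 1.
have uu : dot u u = 1 by exact: so3_dot1.
have ul : pt u 0 \in line_space l.
  by apply/(mem_Nd _ _ lE); exists 1; rewrite scale0r scale1r add0r.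
have := memv_so3g (so_rz cs) ul; rewrite gl => /(mem_Nd _ _ lE)[t].
rewrite scale0r add0r -/u rz_mulE => /colP h.
have [h0 h1] : - u 1 0 = t * u 0 0 /\ u 0 0 = t * u 1 0.
  by split; [have := h 0|have := h 1]; rewrite [RHS]mxE mxE /= => <-; ring.
have u0 : u 0 0 = 0.
  have h2 : u 0 0 * (1 + t ^+ 2) = 0 by rewrite mulrDr mulr1 expr2 mulrCA mulrA -h0 mulNr -?mulrN; rewrite {1}h1; ring.
  by apply/eqP; move/eqP : h2; rewrite mulf_eq0 (gt_eqF (ltr_wpDr (sqr_ge0 t) ltr01)) orbF.
have u1 : u 1 0 = 0 by rewrite -[LHS]opprK h0 u0 mulr0 oppr0.
have [t' ht'] := iffLR (mem_Nd _ _ lE) ol.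
have d00 : d = 0.
  have := congr1 (fun v => dot v (A *m e_ 0)) ht'.
  rewrite dotD !dotZ so3_dot1// [dot (A *m e_ 1) _]dotC so3_dot01//.
  have -> : dot 0 (A *m e_ 0) = 0 by rewrite /dot ![(0 : 'cV_3) _ _]mxE; ring.
  by lra.
apply: line_eq_sub => v; have [p [a ->]] := ptE v => /(mem_Nd _ _ lE)[t'' ->].
rewrite d00 scale0r scaler0 add0r -/u; clearbody u.
by apply/mem_zline; rewrite !mxE u0 u1; split; ring.
Qed.

Lemma zline_in : C zline.
Proof.
have [_ _ covC] := sC; have [|l Cl ol] := covC (pt 0 1); first by apply: pt_neq0; right; exact: oner_neq0.
by rewrite -(line_origin Cl ol).
Qed.

Lemma e0_neq0 : e_ 0 != 0.
Proof. by apply/eqP => /colP/(_ 0); rewrite !mxE /= => /eqP; rewrite oner_eq0. Qed.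

(** The spread line through the point at infinity of the x-axis is invariant under the half turn. It
    contains the mean of each of its vectors and the image, which is the component along the z-axis.
    As the line is disjoint from the z-axis, these components vanish. *)
Lemma vline_in : C (base_line R).
Proof.
have [_ _ covC] := sC; have [|l Cl el] := covC (pt (e_ 0) 0); first by apply: pt_neq0; left; exact: e0_neq0.
suff <- : l = base_line R by [].
have cs : (-1 : R) ^+ 2 + 0 ^+ 2 = 1 by ring.
have hl : pgl_line (so3g (rz (-1) 0)) l = l.
  apply: (@spread_pt _ _ (rz (-1) 0 *m e_ 0) 0); [exact: axial_line|by []| | |].
  - left; apply/eqP => h; have /eqP := e0_neq0; apply.
    by rewrite -[LHS]mul1mx -(so_mulVmx (so_rz cs)) -mulmxA h mulmx0.
  - exact: memv_so3g (so_rz cs) el.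
  - have -> : pt (rz (-1) 0 *m e_ 0) 0 = - pt (e_ 0) 0.
      by rewrite rz_mulE; apply/colP; apply: ord4P; rewrite !mxE /=; ring.
    by rewrite memvN.
apply: line_eq_sub => v; have [p [a ->]] := ptE v => pl.
have := memv_so3g (so_rz cs) pl; rewrite hl => pl'.
have sl : pt (mxs 3 1 [:: [:: 0]; [:: 0]; [:: p 2 0]]) a \in line_space l.
  have -> : pt (mxs 3 1 [:: [:: 0]; [:: 0]; [:: p 2 0]]) a = 2^-1 *: (pt p a + pt (rz (-1) 0 *m p) a).
    by rewrite rz_mulE; apply/colP; apply: ord4P; rewrite !mxE /=; field.
  by apply: memvZ; exact: memvD.
have [h0|hn] := eqVneq (pt (mxs 3 1 [:: [:: 0]; [:: 0]; [:: p 2 0]]) a) 0.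
  have [/colP h a0] := pt_eq0 h0.
  by apply/mem_vline; split=> //; have := h 2; rewrite !mxE.
exfalso.
have lz : l = zline.
  apply: (spread_uniq sC Cl zline_in hn sl).
  by apply/mem_zline; rewrite !mxE.
by move: el; rewrite lz => /mem_zline[/eqP]; rewrite !mxE /= oner_eq0.
Qed.

(** Two lines in the plane at infinity meet, so a spread contains at most one. *)
Lemma line_infinity A l : SO 3 A -> C l ->
  limg (hom4 (affine_mx A 0 *m xy_basis R)) = l :> {vspace _} -> l = base_line R.
Proof.
move=> SA Cl lE.
set u := A *m e_ 0; set v := A *m e_ 1.
(* The horizontal direction in the span of [u] and [v], that is, the intersection with the line at
   infinity of the xy-plane. If this combination vanishes, [v] itself is horizontal. *)
pose w := v 2 0 *: u - u 2 0 *: v.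
have wl : pt w 0 \in line_space l.
  by apply/(mem_xy _ _ lE); split=> //; exists (v 2 0), (- u 2 0); rewrite scaleNr.
have wV : pt w 0 \in line_space (base_line R).
  by apply/mem_vline; rewrite !mxE; split=> //; ring.
have [w0|w0] := eqVneq w 0; last first.
  by apply: (spread_pt Cl vline_in _ wl wV); left.
have uu : dot u u = 1 by exact: so3_dot1.
have uv : dot u v = 0 by exact: so3_dot01.
have v2 : v 2 0 = 0.
  have := congr1 (fun x => dot x u) w0; rewrite /w dotD -scaleNr !dotZ uu [dot v u]dotC uv /dot !mxE; lra.
have ul : pt v 0 \in line_space l.
  by apply/(mem_xy _ _ lE); split=> //; exists 0, 1; rewrite scale0r scale1r add0r.
apply: (@spread_pt _ _ v 0) => //; first exact: vline_in.
  left; apply/eqP => h; have := so3_dot1 1 SA; rewrite -/v h /dot !mxE !mul0r !addr0 => /eqP.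
  by rewrite eq_sym oner_eq0.
by apply/mem_vline.
Qed.

Lemma line_distance0 A l : C l ->
  limg (hom4 (affine_mx A 0 *m Nd 0)) = l :> {vspace _} -> l = zline.
Proof.
move=> Cl lE; apply: line_origin => //.
by apply/(mem_Nd _ _ lE); exists 0; rewrite !scale0r scaler0 addr0.
Qed.

(* The points of l and l' at parameters t, t' from their feet have the same norm
   when t^2 = t'^2, and a choice of signs also makes their heights agree; a
   rotation then carries one point, hence one line, to the other. *)
Lemma same_distance_rotate A A' (d : R) l l' : SO 3 A -> SO 3 A' -> 0 < d -> C l -> C l' ->
  limg (hom4 (affine_mx A 0 *m Nd d)) = l :> {vspace _} ->
  limg (hom4 (affine_mx A' 0 *m Nd d)) = l' :> {vspace _} ->
  exists c s : R, c ^+ 2 + s ^+ 2 = 1 /\ pgl_line (so3g (rz c s)) l = l'.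
Proof.
move=> SA SA' d0 Cl Cl' lE lE'.
set p := d *: (A *m e_ 0); set u := A *m e_ 1.
set p' := d *: (A' *m e_ 0); set u' := A' *m e_ 1.
have uu : dot u u = 1 by exact: so3_dot1.
have uu' : dot u' u' = 1 by exact: so3_dot1.
have pu : dot p u = 0 by rewrite dotZ so3_dot01// mulr0.
have pu' : dot p' u' = 0 by rewrite dotZ so3_dot01// mulr0.
have pp : dot p p = d ^+ 2 by rewrite dotZ dotC dotZ so3_dot1// mulr1 expr2.
have pp' : dot p' p' = d ^+ 2 by rewrite dotZ dotC dotZ so3_dot1// mulr1 expr2.
(* A horizontal direction would be a common point with the line at infinity of the xy-plane, which
   belongs to [C]. *)
have u2 : u 2 0 != 0.
  apply/eqP => u2.
  have ul : pt u 0 \in line_space l.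
    by apply/(mem_Nd _ _ lE); exists 1; rewrite scale0r scale1r add0r.
  have lV : l = base_line R.
    apply: (@spread_pt _ _ u 0) => //; first exact: vline_in.
      left; apply/eqP => h; move: uu; rewrite h /dot !mxE !mul0r !addr0 => /eqP.
      by rewrite eq_sym oner_eq0.
    by apply/mem_vline.
  have : pt p 1 \in line_space l.
    by apply/(mem_Nd _ _ lE); exists 0; rewrite scale0r scale1r addr0.
  by rewrite lV => /mem_vline[_ /eqP]; rewrite oner_eq0.
have [t [t' [tt hz]]] : exists t t' : R, t ^+ 2 = t' ^+ 2 /\ p 2 0 + t * u 2 0 = p' 2 0 + t' * u' 2 0.
  have [e|ne] := eqVneq (u 2 0) (u' 2 0).
    have n : u 2 0 + u' 2 0 != 0 by rewrite -e -mulr2n mulrn_eq0.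
    exists ((p' 2 0 - p 2 0) / (u 2 0 + u' 2 0)), (- ((p' 2 0 - p 2 0) / (u 2 0 + u' 2 0))).
    by split; [rewrite sqrrN|field].
  have n : u 2 0 - u' 2 0 != 0 by rewrite subr_eq0.
  exists ((p' 2 0 - p 2 0) / (u 2 0 - u' 2 0)), ((p' 2 0 - p 2 0) / (u 2 0 - u' 2 0)).
  by split=> //; field.
pose x := p + t *: u; pose x' := p' + t' *: u'.
have xx : dot x x = dot x' x'.
  have -> : dot x x = dot p p + 2 * t * dot p u + t ^+ 2 * dot u u by rewrite /dot /x !mxE; ring.
  have -> : dot x' x' = dot p' p' + 2 * t' * dot p' u' + t' ^+ 2 * dot u' u' by rewrite /dot /x' !mxE; ring.
  by rewrite pp pp' pu pu' uu uu' tt; ring.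
have x2 : x 2 0 = x' 2 0 by rewrite !mxE; move: hz; rewrite !mxE.
have [|c [s [cs ha hb]]] := @plane_rotation (x 0 0) (x 1 0) (x' 0 0) (x' 1 0).
  by move: xx; rewrite /dot x2; lra.
exists c, s; split=> //.
have xl : pt x 1 \in line_space l by apply/(mem_Nd _ _ lE); exists t; rewrite scale1r.
have xl' : pt x' 1 \in line_space l' by apply/(mem_Nd _ _ lE'); exists t'; rewrite scale1r.
apply: (@spread_pt _ _ x' 1) => //; [exact: axial_line|by right; exact: oner_neq0|].
have -> : x' = rz c s *m x.
  by rewrite rz_mulE ha hb x2; clearbody x'; apply: colP'; rewrite mxE.
exact: memv_so3g (so_rz cs) xl.
Qed.

End Axial.
End AxialSpreads.

(** * Distances of the lines of an axial spread *)

Section OrbitsOfAxialSpreads.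
Variable R : realType.
Local Notation pgl4 := (pgl4 R).
Local Notation SO n := (@special_orthogonal_group R n).
Local Notation e_ := (e_ R).
Implicit Types (A B : 'M[R]_3) (p q : 'cV[R]_3) (l : line R) (m : oline R) (g h : pgl4).

(* On the Plücker matrix X of a line at distance d' from the origin this is a
   positive multiple of d'^2 - d^2. *)
Definition dist_form (d : R) (X : 'M[R]_4) : R :=
  \tr (X *m X^T) - 2 * (1 + d ^+ 2) * ((X *m e3 R)^T *m (X *m e3 R)) 0 0.

Lemma dist_formZ d c X : dist_form d (c *: X) = c ^+ 2 * dist_form d X.
Proof.
rewrite /dist_form -!scalemxAl.
have -> : (c *: X)^T = c *: X^T by rewrite linearZ.
have -> : (c *: (X *m e3 R))^T = c *: (X *m e3 R)^T by rewrite linearZ.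
have -> : (X *m (c *: X^T)) = c *: (X *m X^T) by rewrite scalemxAr.
rewrite -!scalemxAl -!scalemxAr.
have sc (z : R) (Y : 'M[R]_1) : (z *: Y) 0 0 = z * Y 0 0 by rewrite mxE.
by rewrite !mxtraceZ !sc; ring.
Qed.

Lemma dist_form_continuous d : continuous (dist_form d).
Proof.
move=> X; have cT : (Y^T) @[Y --> X] --> X^T by exact: (@cvg_trmx _ _ (nbhs X) _ _ _ id X).
have cXT : Y *m Y^T @[Y --> X] --> X *m X^T.
  exact: (@cvg_mulmx _ _ (nbhs X) _ _ _ _ id (fun Y : 'M[R]_4 => Y^T)).
have c : Y *m e3 R @[Y --> X] --> X *m e3 R.
  by apply: (@cvg_mulmx _ _ (nbhs X) _ _ _ _ id (fun=> e3 R)) => //; exact: cvg_cst.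
have cc : (Y *m e3 R)^T *m (Y *m e3 R) @[Y --> X] --> (X *m e3 R)^T *m (X *m e3 R).
  apply: (@cvg_mulmx _ _ (nbhs X) _ _ _ _ (fun Y : 'M[R]_4 => (Y *m e3 R)^T) (fun Y : 'M[R]_4 => Y *m e3 R)) => //.
  exact: (@cvg_trmx _ _ (nbhs X) _ _ _ (fun Y : 'M[R]_4 => Y *m e3 R)).
apply: (@cvgB _ _ _ (nbhs X) _ (fun Y : 'M[R]_4 => \tr (Y *m Y^T))).
  apply: cvg_bigsum => i _.
  exact: (@cvg_coord _ (nbhs X) _ _ _ _ (fun Y : 'M[R]_4 => Y *m Y^T)).
apply: (@cvgM _ _ (nbhs X)); first exact: cvg_cst.
exact: (@cvg_coord _ (nbhs X) _ _ _ _ (fun Y : 'M[R]_4 => (Y *m e3 R)^T *m (Y *m e3 R))).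
Qed.

Lemma dist_form_affine d A X : SO 3 A ->
  dist_form d (affine_mx A 0 *m X *m (affine_mx A 0)^T) = dist_form d X.
Proof.
move=> SA; set M := affine_mx A 0.
have MM : M^T *m M = 1%:M.
  have -> : M^T = affine_mx A^T 0.
    by rewrite /M !affineE; apply/matrixP; apply: ord4P; apply: ord4P; rewrite !mxE.
  by rewrite -affine_mxM so_mulVmx// affine_mx1.
have Me : M^T *m e3 R = e3 R.
  by rewrite -[X in M^T *m X](affine_e3 A) mulmxA MM mul1mx.
rewrite /dist_form; congr (_ - _ * _).
  rewrite !trmx_mul trmxK !mulmxA. rewrite -(mulmxA (M *m X)) MM mulmx1.
  by rewrite -!mulmxA mxtrace_mulC -!mulmxA MM mulmx1.
by rewrite -!mulmxA Me trmx_mul !mulmxA -(mulmxA _ M^T) MM mulmx1.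
Qed.

Lemma dist_form_Nd d A d' : SO 3 A -> dist_form d (plk (affine_mx A 0 *m Nd d')) = 2 * (d' ^+ 2 - d ^+ 2).
Proof.
move=> SA; rewrite plk_mull dist_form_affine//.
have -> : plk (Nd d') = mxs 4 4 [:: [:: 0; d'; 0; 0]; [:: - d'; 0; 0; -1]; [:: 0; 0; 0; 0]; [:: 0; 1; 0; 0]].
  by apply/matrixP; apply: ord4P; apply: ord4P; rewrite plkE !mxE /=; ring.
rewrite /dist_form tr_mulT; do 6! rewrite ?sum4.
by rewrite !mxE !sum4 !mxE !sum4 !mxE /=; ring.
Qed.

Lemma dist_form_xy d A : SO 3 A -> dist_form d (plk (affine_mx A 0 *m xy_basis R)) = 2.
Proof.
move=> SA; rewrite plk_mull dist_form_affine// xyE.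
have -> : plk (bas (e_ 0) 0 (e_ 1) 0) = mxs 4 4 [:: [:: 0; 1; 0; 0]; [:: -1; 0; 0; 0]; [:: 0; 0; 0; 0]; [:: 0; 0; 0; 0]].
  by apply/matrixP; apply: ord4P; apply: ord4P; rewrite plkE !mxE /=; ring.
rewrite /dist_form tr_mulT; do 6! rewrite ?sum4.
by rewrite !mxE !sum4 !mxE !sum4 !mxE /=; ring.
Qed.

Lemma zline_Nd : exists A, [/\ SO 3 A, A *m e_ 1 = e_ 2 &
  limg (hom4 (affine_mx A 0 *m Nd 0)) = zline R :> {vspace _}].
Proof.
have [|||A [SA _ A1]] := @so3_frame R (e_ 0) (e_ 2); try by rewrite /dot !mxE /=; ring.
exists A; split=> //; rewrite affine_Nd scale0r A1 /= zaxisE.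
apply/vspaceP => v; apply/idP/idP => /mem_bas[s [t ->]]; apply/mem_bas; exists t, s;
  by apply/colP; apply: ord4P; rewrite !mxE /=; ring.
Qed.

Lemma xy_base_line : limg (hom4 (affine_mx 1%:M 0 *m xy_basis R)) = base_line R :> {vspace _}.
Proof. by rewrite affine_mx1 mul1mx. Qed.

Lemma seg_neq0 p (t : R) : p != 0 -> seg (pt 0 1) (pt p 0) t != 0.
Proof.
move=> p0; apply/eqP => h.
have := congr1 (fun v : 'cV[R]_4 => v 3 0) h; rewrite /seg !mxE /= => h3.
have t1 : t = 1 by lra.
have [i] : exists i, p i 0 != 0.
  apply/existsP; apply: contraNT p0; rewrite negb_exists => /forallP p0.
  by apply/eqP/colP => i; rewrite mxE; apply/eqP; rewrite -[_ == _]negbK p0.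
have := congr1 (fun v : 'cV[R]_4 => v (widen_ord (isT : 3 <= 4)%N i) 0) h.
rewrite t1 /seg subrr scale0r scale1r add0r; move: i; apply: ord3P; rewrite !mxE /= => ->; by rewrite eqxx.
Qed.

Section Axial.
Variable C : set (line R).
Hypothesis sC : compact_spread C.
Hypothesis invC : forall c s : R, c ^+ 2 + s ^+ 2 = 1 -> pgl_spread (so3g (rz c s)) C = C.

(** The path of points runs from the origin, on the z-axis, to a point at infinity, on the line at
    infinity of the xy-plane. The form [dist_form d] is nonpositive on the first line and positive
    on the second, so it vanishes on a spread line met on the way; that line has distance [d]. *)
Lemma kind_line K : kind K -> exists l A, [/\ C l, SO 3 A &
  limg (hom4 (affine_mx A 0 *m K)) = l :> {vspace _}].
Proof.
move=> [->|[d d0 ->]].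
  exists (base_line R), 1%:M; split; [exact: vline_in|exact: so_1|exact: xy_base_line].
have [A0 [SA0 _ zE]] := zline_Nd.
have := d0; rewrite le_eqVlt => /predU1P[<-|dgt].
  by exists (zline R), A0; split=> //; exact: zline_in.
have phiZ := @dist_formZ d.
have nphiZ c X : - dist_form d (c *: X) = c ^+ 2 * - dist_form d X by rewrite phiZ mulrN.
have cA : closed (plk_le (dist_form d)) by apply: closed_plk_le; last exact: dist_form_continuous.
have cB : closed (plk_le (fun X => - dist_form d X)).
  apply: closed_plk_le => // X; apply: (@cvgN _ _ _ (nbhs X)); exact: dist_form_continuous.
have tot l : plk_le (dist_form d) l \/ plk_le (fun X => - dist_form d X) l.
  have [M ME] := line_basis l.
  case: (leP (dist_form d (plk M)) 0) => h; [left|right]; exists M => //.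
  by rewrite oppr_le0 ltW.
have sn t : `[0, 1]%classic t -> seg (pt 0 1) (pt (e_ 0) 0) t != 0.
  by move=> _; apply: seg_neq0; exact: e0_neq0.
have Az : plk_le (dist_form d) (zline R).
  exists (affine_mx A0 0 *m Nd 0) => //; rewrite dist_form_Nd//; have := sqr_ge0 d; lra.
have Bv : plk_le (fun X => - dist_form d X) (base_line R).
  by exists (affine_mx 1%:M 0 *m xy_basis R); rewrite ?xy_base_line// dist_form_xy ?oppr_le0//; exact: so_1.
have [||t [n [_ Cn An Bn _]]] := spread_segment sC cA cB tot sn (zline_in sC invC) Az _ (vline_in sC invC) Bv.
- by apply/mem_zline; rewrite !mxE.
- by apply/mem_vline; rewrite !mxE.
have [K0 [A [kK SA nE]]] := line_normal_form n.
have h0 : dist_form d (plk (affine_mx A 0 *m K0)) = 0.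
  apply/eqP; rewrite eq_le; apply/andP; split; first exact/(plk_leE phiZ nE).
  by rewrite -oppr_le0; exact/(plk_leE nphiZ nE).
exists n, A; split=> //; case: kK h0 nE => [->|[d' d'0 ->]].
  by rewrite dist_form_xy// => /eqP; rewrite pnatr_eq0.
rewrite dist_form_Nd// => /eqP; rewrite mulf_eq0 pnatr_eq0 /= subr_eq0 eqrXn2// => /eqP ->.
by [].
Qed.

End Axial.

End OrbitsOfAxialSpreads.

(** * Rotated copies of an axial spread *)

Section OrbitPartitions.
Variable R : realType.
Local Notation pgl4 := (pgl4 R).
Local Notation SO n := (@special_orthogonal_group R n).
Local Notation e_ := (e_ R).
Implicit Types (A B : 'M[R]_3) (p q : 'cV[R]_3) (l : line R) (m : oline R) (g h : pgl4).

Lemma so_trK n A (M : 'M[R]_(3, n)) : SO 3 A -> A^T *m (A *m M) = M.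
Proof. by move=> SA; rewrite mulmxA so_mulVmx// mul1mx. Qed.

Lemma so_trVK n A (M : 'M[R]_(3, n)) : SO 3 A -> A *m (A^T *m M) = M.
Proof. by move=> SA; rewrite mulmxA so_mulmxV// mul1mx. Qed.

Lemma affine_trK A (M : 'M[R]_(4, 2)) : SO 3 A -> affine_mx A^T 0 *m (affine_mx A 0 *m M) = M.
Proof. by move=> SA; rewrite mulmxA -affine_mxM so_mulVmx// affine_mx1 mul1mx. Qed.

Lemma fix_pos m (K : 'M[R]_(4, 2)) A B : SO 3 A -> SO 3 B -> positive_bases m (affine_mx A 0 *m K) ->
  pgl_oline (so3g B) m = m ->
  exists2 P, 0 < \det P & affine_mx (A^T *m B *m A) 0 *m K = K *m P.
Proof.
move=> SA SB mK Bm; have := so3g_pos SB mK; rewrite Bm => mBK.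
have [P P0 E] := pos_change mK mBK; exists P => //.
by rewrite !affine_mxM -!mulmxA E -mulmxA affine_trK.
Qed.

Lemma fix_line l (K : 'M[R]_(4, 2)) A B : SO 3 A -> SO 3 B -> limg (hom4 (affine_mx A 0 *m K)) = l :> {vspace _} ->
  pgl_line (so3g B) l = l ->
  exists P : 'M[R]_2, affine_mx (A^T *m B *m A) 0 *m K = K *m P.
Proof.
move=> SA SB lK Bl; have := so3g_line SB lK; rewrite Bl -lK => /esym E.
have dB : \dim (limg (hom4 (affine_mx A 0 *m K))) = 2 by rewrite lK line_dim.
have [P P0 EP] := basis_change dB E; exists P.
by rewrite !affine_mxM -!mulmxA EP -mulmxA affine_trK.
Qed.

(** The two orientations of a representative differ by the half turn [flip R], so the orientation
    can be absorbed into the rotation. *)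
Lemma pos_kind m K A : kind K -> SO 3 A ->
  limg (hom4 (affine_mx A 0 *m K)) = unoriented m :> {vspace _} ->
  exists B, [/\ SO 3 B, B = A \/ B = A *m flip R & positive_bases m (affine_mx B 0 *m K)].
Proof.
move=> kK SA /pos_or[mK|mK]; first by exists A; split=> //; left.
exists (A *m flip R); split; [exact/so_mul/so_flip|by right|].
by rewrite affine_mxM -mulmxA flip_kind// mulmxA.
Qed.

Section Axial.
Variable C : set (line R).
Hypothesis sC : compact_spread C.
Hypothesis invC : forall c s : R, c ^+ 2 + s ^+ 2 = 1 -> pgl_spread (so3g (rz c s)) C = C.

Lemma spread_orbit_cover l : exists2 A, SO 3 A & pgl_spread (so3g A) C l.
Proof.
have [K [A [kK SA lE]]] := line_normal_form l.
have [l' [A' [Cl' SA' lE']]] := kind_line sC invC kK.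
have SAA : SO 3 (A *m A'^T) by apply: so_mul => //; exact: so_tr.
exists (A *m A'^T) => //; exists l' => //.
apply: line_inj; rewrite -(so3g_line SAA lE') -lE.
by rewrite affine_mxM -mulmxA affine_trK.
Qed.

Section Oriented.
Variable S : set (oline R).
Hypothesis SC : oriented_spread_from C S.

Lemma ospread_homeo : homeomorphism_on S C (@unoriented R).
Proof. by have [_ [S' []]] := SC. Qed.

(** Such a rotation is the square of another one that preserves [C], so it cannot exchange the two
    sheets. *)
Lemma ospread_rz (c s : R) : c ^+ 2 + s ^+ 2 = 1 -> pgl_ospread (so3g (rz c s)) S = S.
Proof.
move=> /rz_sqrt[c' [s' [cs ->]]]; rewrite so3gM ?(so_unit (so_rz cs))//.
by apply: (ospread_square _ SC); exact: invC.
Qed.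

Lemma ospread_orbit_cover m : exists2 A, SO 3 A & pgl_ospread (so3g A) S m.
Proof.
have [K [A [kK SA mK]]] := oline_normal_form m.
have [l [A' [Cl SA' lE]]] := kind_line sC invC kK.
have [s Ss sl] := homeo_surj ospread_homeo Cl.
rewrite -sl in lE; have [B [SB _ sK]] := pos_kind kK SA' lE.
have SAB : SO 3 (A *m B^T) by apply: so_mul => //; exact: so_tr.
exists (A *m B^T) => //; exists s => //.
apply: (pos_eq (so3g_pos SAB sK)).
by rewrite affine_mxM -mulmxA affine_trK.
Qed.

(* The distance of a line from the origin is an SO_3 invariant, so a line of S
   and its image in S differ by a rotation about the z-axis. *)
Lemma ospread_return m A : SO 3 A -> S m -> S (pgl_oline (so3g A) m) -> pgl_ospread (so3g A) S = S.
Proof.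
move=> SA Sm SAm.
have Cl := homeo_fun ospread_homeo Sm; have := homeo_fun ospread_homeo SAm.
rewrite unoriented_pgl => Cl'.
have [K [B [kK SB mK]]] := oline_normal_form m.
have lE := pos_limg mK; have lE' := so3g_line SA lE.
have SAB : SO 3 (A *m B) by exact: so_mul.
rewrite mulmxA -affine_mxM in lE'.
have fixed : pgl_line (so3g A) (unoriented m) = unoriented m -> pgl_oline (so3g A) m = m.
  by move=> e; apply: (homeo_inj ospread_homeo) => //; rewrite unoriented_pgl.
have axis : A *m e_ 2 = e_ 2 -> pgl_ospread (so3g A) S = S.
  by move=> /(so3_stab_e2 SA)[c [s [cs ->]]]; exact: ospread_rz.
have axis' B1 : SO 3 B1 -> (B1 = 1%:M \/ B1 = 1%:M *m flip R) ->
    (B1^T *m A *m B1) *m e_ 2 = e_ 2 -> A *m e_ 2 = e_ 2.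
  move=> SB1 hB; rewrite -mulmxA -mulmxA => /(congr1 (fun x => B1 *m x)); rewrite so_trVK//.
  case: hB => ->; rewrite ?mul1mx// flip_e2 mulmxN => /eqP.
  by rewrite eqr_opp => /eqP.
(* The line at infinity and the line through the origin are unique in [C], so [A] fixes the line
   [m], and also its orientation, as [S] contains only one of the two. This forces [A] to fix
   [e_ 2]. *)
case: kK mK lE lE' => [->|[d d0 ->]] mK lE lE'.
  have lV := line_infinity sC invC SB Cl lE; have lV' := line_infinity sC invC SAB Cl' lE'.
  have Am := fixed (etrans lV' (esym lV)).
  have [|B1 [SB1 hB mB]] := @pos_kind m (xy_basis R) 1%:M (or_introl (erefl _)) (so_1 _ _).
    by rewrite lV; exact: xy_base_line.
  have [P P0 E] := fix_pos SB1 SA mB Am; apply: axis; apply: (axis' _ SB1 hB).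
  have SE : SO 3 (B1^T *m A *m B1) := so_mul (so_mul (so_tr SB1) SA) SB1.
  exact: (stab_xy SE E).2 P0.
have := d0; rewrite le_eqVlt => /predU1P[d00|dgt].
  rewrite -d00 in mK lE lE' *.
  have lV := line_distance0 sC invC Cl lE; have lV' := line_distance0 sC invC Cl' lE'.
  have Am := fixed (etrans lV' (esym lV)).
  have [A0 [SA0 A01 zE]] := zline_Nd R.
  have [||B1 [SB1 hB mB]] := @pos_kind m (Nd 0) A0 _ SA0; first by right; exists 0.
    by rewrite lV.
  have [P P0 E] := fix_pos SB1 SA mB Am; apply: axis.
  have SE : SO 3 (B1^T *m A *m B1) := so_mul (so_mul (so_tr SB1) SA) SB1.
  have [_ _ /(_ P0)] := stab_Nd SE E.
  rewrite -mulmxA -mulmxA => /(congr1 (fun x => B1 *m x)); rewrite so_trVK//.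
  case: hB => ->; rewrite -?mulmxA ?flip_e1 ?mulmxN A01// => /eqP.
  by rewrite ?mulmxN eqr_opp => /eqP.
(* At positive distance, a rotation about the z-axis takes [m] to the same image as [A]. The
   quotient of the two fixes an oriented line with trivial stabiliser, so they are equal. *)
have [c [s [cs Rl]]] := same_distance_rotate sC invC SB SAB dgt Cl Cl' lE lE'.
have Srz := so_rz cs.
have RS : S (pgl_oline (so3g (rz c s)) m) by rewrite -(ospread_rz cs); exists m.
have Rm : pgl_oline (so3g (rz c s)) m = pgl_oline (so3g A) m.
  by apply: (homeo_inj ospread_homeo) => //; rewrite !unoriented_pgl.
have SRA : SO 3 ((rz c s)^T *m A) by apply: so_mul => //; exact: so_tr.
have fixR : pgl_oline (so3g ((rz c s)^T *m A)) m = m.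
  by rewrite (so3gM (so_unit (so_tr Srz)) (so_unit SA)) pgl_olineM -Rm so3gV// pgl_olineK.
have [P P0 E] := fix_pos SB SRA mK fixR.
have SE : SO 3 (B^T *m ((rz c s)^T *m A) *m B) := so_mul (so_mul (so_tr SB) SRA) SB.
have [E0 _ /(_ P0) E1] := stab_Nd SE E.
have {}E0 : B^T *m ((rz c s)^T *m A) *m B *m e_ 0 = e_ 0.
  by move: E0; rewrite -scalemxAr => /(scalerI (lt0r_neq0 dgt)).
have {}E1 := so3_fix01 SE E0 E1.
suff -> : A = rz c s by exact: ospread_rz.
have := congr1 (fun X => rz c s *m (B *m X *m B^T)) E1.
by rewrite mulmx1 so_mulmxV// mulmx1 -!mulmxA so_mulmxV// mulmx1 so_trVK// so_trVK.
Qed.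

End Oriented.

Section Flip.
Hypothesis flipC : pgl_spread (so3g (flip R)) C = C.

Lemma spread_axis A : SO 3 A -> A *m e_ 2 = e_ 2 \/ A *m e_ 2 = - e_ 2 -> pgl_spread (so3g A) C = C.
Proof.
move=> SA [/(so3_stab_e2 SA)[c [s [cs ->]]]|/(so3_flip_e2 SA)[c [s [cs ->]]]]; first exact: invC.
by rewrite so3gM ?so_unit//; [rewrite pgl_spreadM flipC invC|exact: so_rz|exact: so_flip].
Qed.

(** [flip R] carries [l] to a line of [C] at the same distance, and a rotation about the z-axis
    brings it back. The composite fixes the foot of [l] but reverses heights. *)
Lemma foot_horizontal A d l : SO 3 A -> 0 < d -> C l ->
  limg (hom4 (affine_mx A 0 *m Nd d)) = l :> {vspace _} -> (A *m e_ 0) 2 0 = 0.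
Proof.
move=> SA d0 Cl lE; have SF := so_flip R.
have Cl' : C (pgl_line (so3g (flip R)) l) by rewrite -flipC; exists l.
have SFA : SO 3 (flip R *m A) by exact: so_mul.
have lE' := so3g_line SF lE; rewrite mulmxA -affine_mxM in lE'.
have [c [s [cs Rl]]] := same_distance_rotate sC invC SA SFA d0 Cl Cl' lE lE'.
have Srz := so_rz cs.
have SRF : SO 3 ((rz c s)^T *m flip R) by apply: so_mul => //; exact: so_tr.
have fixR : pgl_line (so3g ((rz c s)^T *m flip R)) l = l.
  by rewrite (so3gM (so_unit (so_tr Srz)) (so_unit SF)) pgl_lineM -Rl so3gV// pgl_lineK.
have [P E] := fix_line SA SRF lE fixR.
have SE : SO 3 (A^T *m ((rz c s)^T *m flip R) *m A) := so_mul (so_mul (so_tr SA) SRF) SA.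
have [E0 _ _] := stab_Nd SE E.
move: E0; rewrite -scalemxAr => /(scalerI (lt0r_neq0 d0)) /(congr1 (fun X => rz c s *m (A *m X))).
rewrite -!mulmxA so_trVK// so_trVK// => /colP/(_ 2).
by rewrite rz_mulE mxE sum3 [X in _ = X]mxE !mxE /=; lra.
Qed.

(** As in the oriented case, except that the stabiliser of an unoriented line also contains the half
    turn about the axis through its foot. That axis is horizontal by [foot_horizontal], so the half
    turn reverses the z-axis and preserves [C]. *)
Lemma spread_return l A : SO 3 A -> C l -> C (pgl_line (so3g A) l) -> pgl_spread (so3g A) C = C.
Proof.
move=> SA Cl Cl'.
have [K [B [kK SB lE]]] := line_normal_form l.
have lE' := so3g_line SA lE.
have SAB : SO 3 (A *m B) by exact: so_mul.
rewrite mulmxA -affine_mxM in lE'.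
case: kK lE lE' => [->|[d d0 ->]] lE lE'.
  have lV := line_infinity sC invC SB Cl lE; have lV' := line_infinity sC invC SAB Cl' lE'.
  have Al : pgl_line (so3g A) (base_line R) = base_line R by rewrite -{1}lV lV'.
  have [P] := fix_line (so_1 _ _) SA (xy_base_line R) Al.
  by rewrite trmx1 mul1mx mulmx1 => /(stab_xy SA)[/(spread_axis SA)].
have := d0; rewrite le_eqVlt => /predU1P[d00|dgt].
  rewrite -d00 in lE lE' *.
  have lV := line_distance0 sC invC Cl lE; have lV' := line_distance0 sC invC Cl' lE'.
  have Al : pgl_line (so3g A) (zline R) = zline R by rewrite -{1}lV lV'.
  have [A0 [SA0 A01 zE]] := zline_Nd R.
  have [P E] := fix_line SA0 SA zE Al.
  have SE : SO 3 (A0^T *m A *m A0) := so_mul (so_mul (so_tr SA0) SA) SA0.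
  have [_ h _] := stab_Nd SE E; apply: spread_axis => //.
  by case: h => /(congr1 (fun x => A0 *m x)); rewrite -!mulmxA so_trVK// ?mulmxN A01; [left|right].
have [c [s [cs Rl]]] := same_distance_rotate sC invC SB SAB dgt Cl Cl' lE lE'.
have Srz := so_rz cs.
have SRA : SO 3 ((rz c s)^T *m A) by apply: so_mul => //; exact: so_tr.
have fixR : pgl_line (so3g ((rz c s)^T *m A)) l = l.
  by rewrite (so3gM (so_unit (so_tr Srz)) (so_unit SA)) pgl_lineM -Rl so3gV// pgl_lineK.
have [P E] := fix_line SB SRA lE fixR.
have SE : SO 3 (B^T *m ((rz c s)^T *m A) *m B) := so_mul (so_mul (so_tr SB) SRA) SB.
have [E0 E1 _] := stab_Nd SE E.
have {}E0 : B^T *m ((rz c s)^T *m A) *m B *m e_ 0 = e_ 0.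
  by move: E0; rewrite -scalemxAr => /(scalerI (lt0r_neq0 dgt)).
have AE X : B^T *m ((rz c s)^T *m A) *m B = X -> A = rz c s *m (B *m X *m B^T).
  by move=> <-; rewrite -!mulmxA so_mulmxV// mulmx1 so_trVK// so_trVK.
case: E1 => E1; first by have := AE _ (so3_fix01 SE E0 E1); rewrite mulmx1 so_mulmxV// mulmx1 => ->; exact: invC.
have SF := so_flip R.
have ff : flip R *m flip R = 1%:M.
  by apply/matrixP; apply: ord3P; apply: ord3P; rewrite !mxE !sum3 !mxE /= ?(mulr1n, mulr0n); ring.
have /AE -> : B^T *m ((rz c s)^T *m A) *m B = flip R.
  have : flip R *m (B^T *m ((rz c s)^T *m A) *m B) = 1%:M.
    apply: so3_fix01; first exact: so_mul.
      by rewrite -mulmxA E0 flip_e0.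
    by rewrite -mulmxA E1 mulmxN flip_e1 opprK.
  by move=> /(congr1 (fun X => flip R *m X)); rewrite mulmxA ff mul1mx mulmx1.
have SH : SO 3 (B *m flip R *m B^T) by apply: so_mul; [exact: so_mul|exact: so_tr].
rewrite so3gM ?so_unit// pgl_spreadM spread_axis ?invC//; right.
(* A half turn about a unit vector u is 2 u u^T - 1, which sends [e_ 2] to its negative when u is
   horizontal. *)
have flipE : flip R = 2 *: (e_ 0 *m (e_ 0)^T) - 1%:M.
  by apply/matrixP; apply: ord3P; apply: ord3P; rewrite !mxE big_ord1 !mxE /= ?(mulr1n, mulr0n); ring.
have u2 := foot_horizontal SB dgt Cl lE.
rewrite flipE mulmxBr mulmx1 mulmxBl so_mulmxV// mulmxBl mul1mx.
suff -> : B *m (2 *: (e_ 0 *m (e_ 0)^T)) *m B^T *m e_ 2 = 0 by rewrite sub0r.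
rewrite -scalemxAr -!scalemxAl mulmxA -(mulmxA (B *m e_ 0)) -trmx_mul -mulmxA.
have -> : (B *m e_ 0)^T *m e_ 2 = 0.
  move: (B *m e_ 0) u2 => u u2.
  by apply/matrixP => i j; rewrite !ord1 !mxE sum3 !mxE u2 /=; ring.
by rewrite mulmx0 scaler0.
Qed.

End Flip.
End Axial.
End OrbitPartitions.

(** * Reguli of an axial spread *)

Section RotationalForm.
Variable R : realType.
Local Notation pgl4 := (pgl4 R).
Local Notation e_ := (e_ R).
Implicit Types (A B : 'M[R]_3) (p q : 'cV[R]_3) (l : line R) (m : oline R) (g h : pgl4).

Definition col3 (x y z : R) : 'cV[R]_3 := mxs 3 1 [:: [:: x]; [:: y]; [:: z]].

Definition screw (r a b : R) : 'M[R]_(4, 2) := bas (col3 r 0 b) 1 (col3 0 1 a) 0.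

Lemma screw_lineE (r a b : R) : screw_line r a b = limg (hom4 (screw r a b)).
Proof.
apply/vspaceP => v; rewrite /screw_line span_cons span_seq1; apply/idP/idP.
  move=> /memv_addP[_ /vlineP[s ->] [_ /vlineP[t ->] ->]]; apply/mem_bas; exists s, t.
  by apply/colP; apply: ord4P; rewrite !mxE /=; ring.
move=> /mem_bas[s [t ->]]; apply/memv_addP.
exists (s *: vec4 [:: r; 0; b; 1]); first by rewrite memvZ// memv_line.
exists (t *: vec4 [:: 0; 1; a; 0]); first by rewrite memvZ// memv_line.
by apply/colP; apply: ord4P; rewrite !mxE /=; ring.
Qed.

Lemma z_rotationE (c s : R) : z_rotation (rot2 c s) = affine_mx (rz c s) 0.
Proof.
have l0 : (0 : 'I_4) = lshift 2 (0 : 'I_2) by exact: val_inj.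
have l1 : (1 : 'I_4) = lshift 2 (1 : 'I_2) by exact: val_inj.
have l2 : (2 : 'I_4) = rshift 2 (0 : 'I_2) by exact: val_inj.
have l3 : (3 : 'I_4) = rshift 2 (1 : 'I_2) by exact: val_inj.
rewrite affineE; apply/matrixP; apply: ord4P; apply: ord4P; rewrite [RHS]mxE /= /z_rotation ?l3 ?l2 ?l1 ?l0;
  by rewrite ?(@block_mxEul R 2 2 2 2) ?(@block_mxEur R 2 2 2 2) ?(@block_mxEdl R 2 2 2 2)
    ?(@block_mxEdr R 2 2 2 2) ?mxE /= ?mulr1n ?mulr0n.
Qed.

Lemma affine_screw (c s r a b : R) : affine_mx (rz c s) 0 *m screw r a b =
  bas (col3 (r * c) (r * s) b) 1 (col3 (- s) c a) 0.
Proof. by rewrite /screw affine_bas; congr bas; rewrite rz_mulE; apply: colP'; rewrite !mxE /=; ring. Qed.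

Lemma regulusP (r a b : R) l : regulus r a b l <-> exists c s : R, c ^+ 2 + s ^+ 2 = 1 /\
  limg (hom4 (affine_mx (rz c s) 0 *m screw r a b)) = l :> {vspace _}.
Proof.
have E c s : (hom4 (z_rotation (rot2 c s)) @: screw_line r a b)%VS =
    limg (hom4 (affine_mx (rz c s) 0 *m screw r a b)).
  by rewrite z_rotationE screw_lineE -limg_comp; congr (limg _); apply/lfunP => v; rewrite comp_lfunE !lfunE /= mulmxA.
split.
  by move=> [A /so2P[c [s [cs ->]]] ->]; exists c, s; rewrite E.
by move=> [c [s [cs lE]]]; exists (rot2 c s); [apply/so2P; exists c, s|rewrite E lE].
Qed.

Lemma mem_screw (r a b c s : R) l p (w : R) :
  limg (hom4 (affine_mx (rz c s) 0 *m screw r a b)) = l :> {vspace _} ->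
  pt p w \in line_space l <-> exists t : R, p = w *: col3 (r * c) (r * s) b + t *: col3 (- s) c a.
Proof.
move=> <-; rewrite affine_screw mem_bas; split=> [[x [t E]]|[t ->]].
  have /colP h := E; have w_x : w = x by have := h 3; rewrite !mxE /= => ->; ring.
  by exists t; apply: colP'; [have := h 0|have := h 1|have := h 2]; rewrite !mxE /= w_x.
by exists w, t; apply/colP; apply: ord4P; rewrite !mxE /=; ring.
Qed.

Lemma screw_uniq (c s r a b r' a' b' : R) l : c ^+ 2 + s ^+ 2 = 1 -> 0 < r -> 0 < r' ->
  limg (hom4 (affine_mx (rz c s) 0 *m screw r a b)) = l :> {vspace _} ->
  limg (hom4 (affine_mx (rz 1 0) 0 *m screw r' a' b')) = l :> {vspace _} ->
  [/\ r = r', a = a' & b = b'].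
Proof.
move=> cs r0 r0' E E'.
have : pt (col3 (- s) c a) 0 \in line_space l.
  by apply/(mem_screw _ _ E); exists 1; rewrite scale0r scale1r add0r.
move=> /(mem_screw _ _ E')[z /colP hz].
have : pt (col3 (r * c) (r * s) b) 1 \in line_space l.
  by apply/(mem_screw _ _ E); exists 0; rewrite scale0r scale1r addr0.
move=> /(mem_screw _ _ E')[t /colP ht].
have := hz 0; have := hz 1; have := hz 2; have := ht 0; have := ht 1; have := ht 2.
rewrite !mxE /= => t2 t1 t0 z2 z1 z0.
have s0 : s = 0 by lra.
have c1 : c = 1.
  have : c ^+ 2 = 1 by rewrite -cs s0; ring.
  move=> /eqP; rewrite sqrf_eq1 => /predU1P[//|/eqP c1]; move: t0; rewrite c1; lra.
rewrite s0 c1 in t1 t0 z1; split; first by lra.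
  have z_1 : z = 1 by lra.
  by rewrite z2 z_1; ring.
have t00 : t = 0 by lra.
by rewrite t2 t00; ring.
Qed.

Lemma regulus_uniq r a b r' a' b' l : 0 < r -> 0 < r' -> regulus r a b l -> regulus r' a' b' l ->
  [/\ r = r', a = a' & b = b'].
Proof.
move=> r0 r0' /regulusP[c [s [cs E]]] /regulusP[c' [s' [cs' E']]].
have S1 := so_tr (so_rz cs').
have rzT (x y : R) : (rz x y)^T = rz x (- y).
  by apply/matrixP; apply: ord3P; apply: ord3P; rewrite !mxE /= ?opprK.
have e1 := so3g_line S1 E; have e2 := so3g_line S1 E'.
rewrite mulmxA -affine_mxM rzT rz_mul in e1; rewrite mulmxA -affine_mxM rzT rz_mul in e2.
apply: screw_uniq e1 _ => //; first by rewrite -[RHS](mulr1 1) -{1}cs -cs'; ring.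
have h1 : c' * c' - - s' * s' = 1 by rewrite -cs'; ring.
have h2 : - s' * c' + c' * s' = 0 by ring.
by rewrite h1 h2 in e2.
Qed.

(** The reflection in the xy-plane interchanges right-screwed and left-screwed reguli. It has
    determinant -1 on R^3 but still acts as a collineation. *)
Definition refl3 : 'M[R]_3 := mxs 3 3 [:: [:: 1; 0; 0]; [:: 0; 1; 0]; [:: 0; 0; -1]].

Lemma refl3K : refl3 *m refl3 = 1%:M.
Proof.
by apply/matrixP; apply: ord3P; apply: ord3P; rewrite !mxE !sum3 !mxE /= ?(mulr1n, mulr0n); ring.
Qed.

Lemma refl3_unit : refl3 \in unitmx.
Proof. by case: (mulmx1_unit refl3K). Qed.

Lemma refl3_line l (M : 'M[R]_(4, 2)) : limg (hom4 M) = l :> {vspace _} ->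
  limg (hom4 (affine_mx refl3 0 *m M)) = pgl_line (so3g refl3) l :> {vspace _}.
Proof.
move=> ME; rewrite /so3g pgl_lineE /= mkglE; last exact/affine_unit/refl3_unit.
by rewrite -ME -limg_comp; congr (limg _); apply/lfunP => v; rewrite comp_lfunE !lfunE /= mulmxA.
Qed.

Lemma refl3_regulus r a b l : regulus r a b l -> regulus r (- a) (- b) (pgl_line (so3g refl3) l).
Proof.
move=> /regulusP[c [s [cs E]]]; apply/regulusP; exists c, s; split=> //.
rewrite -(refl3_line E) !affine_screw affine_bas; congr (limg (hom4 (bas _ _ _ _)));
  by apply: colP'; rewrite !mxE ?sum3 !mxE /=; ring.
Qed.

Lemma refl3_gK : (so3g refl3 * so3g refl3 = 1)%g.
Proof. by rewrite -so3gM ?refl3_unit// refl3K so3g1. Qed.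

Lemma refl3_zline : pgl_line (so3g refl3) (zline R) = zline R.
Proof.
have zE : limg (hom4 (bas (e_ 2) 0 0 1)) = zline R :> {vspace _} by rewrite -zaxisE.
apply: line_inj; rewrite -(refl3_line zE) affine_bas mulmx0 -zE.
have -> : refl3 *m e_ 2 = - e_ 2 by apply: colP'; rewrite !mxE sum3 !mxE /=; ring.
apply/vspaceP => v; apply/idP/idP => /mem_bas[s [t ->]]; apply/mem_bas; exists (- s), t;
  by apply/colP; apply: ord4P; rewrite !mxE /=; ring.
Qed.

Lemma refl3_vline : pgl_line (so3g refl3) (base_line R) = base_line R.
Proof.
have vE : limg (hom4 (xy_basis R)) = base_line R :> {vspace _} by [].
apply: line_inj; rewrite -(refl3_line vE) -vE xyE affine_bas.
by congr (limg (hom4 (bas _ _ _ _))); apply: colP'; rewrite !mxE sum3 !mxE /=; ring.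
Qed.

Lemma rotational_formP (a b : R -> R) l : rotational_form a b l <->
  [\/ l = zline R, l = base_line R | exists2 r, 0 < r & regulus r (a r) (b r) l].
Proof.
split=> [[[h|h]|[r r0 h]]|[->|->|[r r0 h]]].
- by apply: Or31; exact: line_inj.
- by apply: Or32; apply: line_inj; rewrite xy_infinityE.
- by apply: Or33; exists r.
- by left; left.
- by left; right; rewrite xy_infinityE.
- by right; exists r.
Qed.

Lemma refl3_form a b : pgl_spread (so3g refl3) (rotational_form a b) =
  rotational_form (fun r => - a r) (fun r => - b r).
Proof.
have sub (a' b' : R -> R) l : rotational_form a' b' l ->
    rotational_form (fun r => - a' r) (fun r => - b' r) (pgl_line (so3g refl3) l).
  move=> /rotational_formP[->|->|[r r0 h]]; apply/rotational_formP.
  - by apply: Or31; exact: refl3_zline.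
  - by apply: Or32; exact: refl3_vline.
  - by apply: Or33; exists r => //; exact: refl3_regulus.
apply/seteqP; split=> [_ [l Cl <-]|l Cl]; first exact: sub.
exists (pgl_line (so3g refl3) l); last by rewrite -pgl_lineM refl3_gK pgl_line1.
have := sub _ _ _ Cl; congr (rotational_form _ _ _); apply/funext => r; exact: opprK.
Qed.

Lemma plk_screw (c s r a b : R) : c ^+ 2 + s ^+ 2 = 1 ->
  let X := plk (affine_mx (rz c s) 0 *m screw r a b) in
  [/\ X 0 1 = r, X 0 3 = s, X 1 3 = - c & X 2 3 = - a].
Proof. move=> cs X; rewrite /X affine_screw !plkE !mxE /=; split; try ring; by rewrite -[RHS]mulr1 -cs; ring. Qed.

Section Axial.
Variable C : set (line R).
Hypothesis sC : compact_spread C.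
Hypothesis invC : forall c s : R, c ^+ 2 + s ^+ 2 = 1 -> pgl_spread (so3g (rz c s)) C = C.

(** [l] misses the line at infinity of the xy-plane, so its direction is not horizontal and [a] is
    nonzero. It misses the z-axis, so its direction is not vertical and its point nearest to that
    axis has positive radius [r]. *)
Lemma axial_regulus l : C l -> l <> zline R -> l <> base_line R ->
  exists r a b, [/\ 0 < r, a != 0 & regulus r a b l].
Proof.
move=> Cl nZ nV; have zC := zline_in sC invC; have vC := vline_in sC invC.
have meetZ p (w : R) : p != 0 \/ w != 0 -> pt p w \in line_space l -> p 0 0 = 0 -> p 1 0 = 0 -> False.
  by move=> n pl p0 p1; apply: nZ; apply: (spread_pt sC Cl zC n pl); exact/mem_zline.
have meetV p : p != 0 -> pt p 0 \in line_space l -> p 2 0 = 0 -> False.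
  by move=> n pl p2; apply: nV; apply: (spread_pt sC Cl vC (or_introl n) pl); exact/mem_vline.
have [K [A [[->|[d d0 ->]] SA lE]]] := line_normal_form l.
  by case: nV; exact: (line_infinity sC invC SA Cl lE).
have uu := so3_dot1 1 SA.
rewrite affine_Nd in lE.
move: (d *: (A *m e_ 0)) (A *m e_ 1) uu lE => p u uu lE.
have u0 : u != 0.
  by apply/eqP => h; move: uu; rewrite h /dot !mxE !mul0r !addr0 => /eqP; rewrite eq_sym oner_eq0.
have ul (t w : R) : pt (w *: p + t *: u) w \in line_space l.
  by rewrite -lE; apply/mem_bas; exists w, t; congr pt; ring.
have u0l : pt u 0 \in line_space l by have := ul 1 0; rewrite scale0r scale1r add0r.
have u2 : u 2 0 != 0 by apply/eqP; exact: meetV.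
have uh : u 0 0 ^+ 2 + u 1 0 ^+ 2 != 0.
  rewrite paddr_eq0 ?sqr_ge0// !sqrf_eq0; apply/negP => /andP[/eqP h0 /eqP h1].
  exact: (meetZ _ _ (or_introl u0) u0l h0 h1).
(* The parameter of the point of [l] nearest to the z-axis, where the horizontal parts of point and
   direction are orthogonal. *)
pose t := - (p 0 0 * u 0 0 + p 1 0 * u 1 0) / (u 0 0 ^+ 2 + u 1 0 ^+ 2).
have [x xE] : exists x, x = p + t *: u by exists (p + t *: u).
have xl : pt x 1 \in line_space l by have := ul t 1; rewrite scale1r -xE.
have xu : x 0 0 * u 0 0 + x 1 0 * u 1 0 = 0 by rewrite xE !mxE /t; field.
have xh : 0 < x 0 0 ^+ 2 + x 1 0 ^+ 2.
  rewrite lt_neqAle addr_ge0 ?sqr_ge0// andbT eq_sym paddr_eq0 ?sqr_ge0// !sqrf_eq0.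
  apply/negP => /andP[/eqP h0 /eqP h1].
  exact: (meetZ _ _ (or_intror (oner_neq0 _)) xl h0 h1).
have [r r0 rr] : exists2 r : R, 0 < r & r ^+ 2 = x 0 0 ^+ 2 + x 1 0 ^+ 2.
  by exists (Num.sqrt (x 0 0 ^+ 2 + x 1 0 ^+ 2)); rewrite ?sqrtr_gt0// sqr_sqrtr// ltW.
have rn := lt0r_neq0 r0.
pose c := x 0 0 / r; pose s := x 1 0 / r.
have cs : c ^+ 2 + s ^+ 2 = 1 by rewrite !exprMn -mulrDl -rr -exprMn divff// expr1n.
pose k := (c * u 1 0 - s * u 0 0).
have kE0 : u 0 0 = - (k * s).
  have : c * u 0 0 + s * u 1 0 = 0.
    by rewrite /c /s -[RHS](mul0r r^-1) -xu; ring.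
  move=> h; rewrite /k -[LHS]mulr1 -cs.
  have -> : u 0 0 * (c ^+ 2 + s ^+ 2) = c * (c * u 0 0 + s * u 1 0) - (c * u 1 0 - s * u 0 0) * s by ring.
  by rewrite h; ring.
have kE1 : u 1 0 = k * c.
  have : c * u 0 0 + s * u 1 0 = 0.
    by rewrite /c /s -[RHS](mul0r r^-1) -xu; ring.
  move=> h; rewrite /k -[LHS]mulr1 -cs.
  have -> : u 1 0 * (c ^+ 2 + s ^+ 2) = s * (c * u 0 0 + s * u 1 0) + (c * u 1 0 - s * u 0 0) * c by ring.
  by rewrite h; ring.
have kn : k != 0 by apply: contraNneq uh => k0; rewrite kE0 kE1 k0 !mul0r oppr0 expr0n addr0.
exists r, (u 2 0 / k), (x 2 0); split=> //; first by rewrite mulf_neq0// invr_eq0.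
apply/regulusP; exists c, s; split=> //.
have dP : \det (mxs 2 2 [:: [:: 1; 0]; [:: t; k^-1]]) != 0 by rewrite det_mxs2 !(mul1r, mul0r) subr0 invr_eq0.
rewrite -lE -(limg_mulr (bas p 1 u 0) dP) bas_mul affine_screw scale1r -xE scale0r add0r !(mul1r, mulr0, mul0r, addr0).
congr (limg (hom4 (bas _ _ _ _))); apply: colP'; rewrite !mxE /= ?kE0 ?kE1 /c /s; by field; rewrite ?rn ?kn.
Qed.

(** The argument of [same_distance_rotate] with the z-axis in place of the origin: parameters with
    equal squares are chosen such that the heights agree, and both points then have squared distance
    r^2 + t^2 from the axis. *)
Lemma axial_regulus_rotate r a b a' b' l l' : C l -> C l' -> a != 0 ->
  regulus r a b l -> regulus r a' b' l' ->
  exists c s : R, c ^+ 2 + s ^+ 2 = 1 /\ pgl_line (so3g (rz c s)) l = l'.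
Proof.
move=> Cl Cl' a0 /regulusP[c [s [cs E]]] /regulusP[c' [s' [cs' E']]].
have [t [t' [tt hz]]] : exists t t' : R, t ^+ 2 = t' ^+ 2 /\ b + t * a = b' + t' * a'.
  have [e|ne] := eqVneq a a'.
    exists ((b' - b) / (2 * a)), (- ((b' - b) / (2 * a))); rewrite -e sqrrN; split=> //.
    by field.
  have n : a - a' != 0 by rewrite subr_eq0.
  by exists ((b' - b) / (a - a')), ((b' - b) / (a - a')); split=> //; field.
have xl : pt (1 *: col3 (r * c) (r * s) b + t *: col3 (- s) c a) 1 \in line_space l.
  by apply/(mem_screw _ _ E); exists t.
have xl' : pt (1 *: col3 (r * c') (r * s') b' + t' *: col3 (- s') c' a') 1 \in line_space l'.
  by apply/(mem_screw _ _ E'); exists t'.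
have [|x [y [xy hx hy]]] := @plane_rotation R (r * c - t * s) (r * s + t * c) (r * c' - t' * s') (r * s' + t' * c').
  have -> : (r * c - t * s) ^+ 2 + (r * s + t * c) ^+ 2 = (r ^+ 2 + t ^+ 2) * (c ^+ 2 + s ^+ 2) by ring.
  have -> : (r * c' - t' * s') ^+ 2 + (r * s' + t' * c') ^+ 2 = (r ^+ 2 + t' ^+ 2) * (c' ^+ 2 + s' ^+ 2) by ring.
  by rewrite cs cs' tt.
exists x, y; split=> //.
have h1 : (1 : R) != 0 by exact: oner_neq0.
have Cxl := axial_line invC xy Cl.
apply: (spread_pt sC Cxl Cl' (or_intror h1) _ xl').
suff <- : rz x y *m (1 *: col3 (r * c) (r * s) b + t *: col3 (- s) c a) =
    1 *: col3 (r * c') (r * s') b' + t' *: col3 (- s') c' a' by exact: (memv_so3g (so_rz xy) xl).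
rewrite rz_mulE; apply: colP'; rewrite !mxE /=.
- by transitivity (r * c' - t' * s'); [rewrite -hx; ring|ring].
- by transitivity (r * s' + t' * c'); [rewrite -hy; ring|ring].
- by rewrite !mul1r.
Qed.

Lemma axial_regulus_same r a b a' b' l l' : C l -> C l' -> a != 0 ->
  regulus r a b l -> regulus r a' b' l' -> regulus r a b l'.
Proof.
move=> Cl Cl' a0 h h'; have [x [y [xy <-]]] := axial_regulus_rotate Cl Cl' a0 h h'.
move/regulusP: h => [c [s [cs E]]]; apply/regulusP.
exists (x * c - y * s), (y * c + x * s); split.
  by rewrite -[RHS](mulr1 1) -{1}xy -cs; ring.
by rewrite -rz_mul affine_mxM -mulmxA; apply: so3g_line => //; exact: so_rz.
Qed.

Lemma axial_screw r a b l : C l -> regulus r a b l ->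
  exists2 l', C l' & limg (hom4 (affine_mx (rz 1 0) 0 *m screw r a b)) = l' :> {vspace _}.
Proof.
move=> Cl /regulusP[c [s [cs E]]].
have ncs : c ^+ 2 + (- s) ^+ 2 = 1 by rewrite sqrrN.
exists (pgl_line (so3g (rz c (- s))) l); first exact: axial_line.
rewrite -(so3g_line (so_rz ncs) E) mulmxA -affine_mxM rz_mul.
have -> : c * c - - s * s = 1 by rewrite -cs; ring.
by have -> : - s * c + c * s = 0 by ring.
Qed.

(** An intermediate value principle: the two closed sets of lines where the quadratic [phi] is
    nonpositive and nonnegative cover all lines, so [spread_segment] yields a spread line in
    both. *)
Lemma plk_form (phi : 'M[R]_4 -> R) l v w (m : line R) : C l -> plk_le phi l -> v \in line_space l ->
  C m -> plk_le (fun X => - phi X) m -> w \in line_space m ->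
  (forall c X, phi (c *: X) = c ^+ 2 * phi X) -> continuous phi ->
  (forall t, `[0, 1]%classic t -> seg v w t != 0) ->
  exists t n, [/\ `[0, 1]%classic t, C n, seg v w t \in line_space n &
    forall M, limg (hom4 M) = n :> {vspace _} -> phi (plk M) = 0].
Proof.
move=> Cl Al vl Cm Bm wm phiZ cphi sn.
have nphiZ c X : - phi (c *: X) = c ^+ 2 * - phi X by rewrite phiZ mulrN.
have cA : closed (plk_le phi) by exact: closed_plk_le.
have cB : closed (plk_le (fun X => - phi X)).
  by apply: closed_plk_le => // X; apply: (@cvgN _ _ _ (nbhs X)); exact: cphi.
have tot k : plk_le phi k \/ plk_le (fun X => - phi X) k.
  have [M ME] := line_basis k.
  by case: (leP (phi (plk M)) 0) => h; [left|right]; exists M => //; rewrite oppr_le0 ltW.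
have [t [k [t01 Ck Ak Bk sk]]] := spread_segment sC cA cB tot sn Cl Al vl Cm Bm wm.
exists t, k; split=> // M ME; apply/eqP; rewrite eq_le; apply/andP; split.
  exact/(plk_leE phiZ ME).
by rewrite -oppr_le0; exact/(plk_leE nphiZ ME).
Qed.

(** The spread line through a point at distance [r0 / 2] from the z-axis has radius at most
    [r0 / 2], while the form [phi] is positive on the line at infinity. Between them [phi] vanishes,
    and there the radius is [r0]. *)
Lemma axial_radius r0 : 0 < r0 -> exists a b l, [/\ C l, a != 0 & regulus r0 a b l].
Proof.
move=> r0p; have vC := vline_in sC invC.
(* On a screw line of radius r this is a positive multiple of r^2 - r0^2. *)
pose phi (X : 'M[R]_4) := X 0 1 ^+ 2 - r0 ^+ 2 * (X 0 3 ^+ 2 + X 1 3 ^+ 2).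
have phiZ c X : phi (c *: X) = c ^+ 2 * phi X by rewrite /phi !mxE; ring.
have cphi : continuous phi.
  move=> X; have cc (i j : 'I_4) : (Y : 'M[R]_4) i j @[Y --> X] --> X i j.
    exact: (@cvg_coord _ (nbhs X) _ _ _ _ id).
  have c2 (i j : 'I_4) : (Y : 'M[R]_4) i j ^+ 2 @[Y --> X] --> X i j ^+ 2.
    by apply: (@cvgM _ _ (nbhs X)).
  apply: (@cvgB _ _ _ (nbhs X)) => //; apply: (@cvgM _ _ (nbhs X)); first exact: cvg_cst.
  exact: (@cvgD _ _ _ (nbhs X)).
have phi_screw c s r a b : c ^+ 2 + s ^+ 2 = 1 ->
    phi (plk (affine_mx (rz c s) 0 *m screw r a b)) = r ^+ 2 - r0 ^+ 2.
  by move=> cs; have [h1 h2 h3 h4] := plk_screw r a b cs; rewrite /phi h1 h2 h3 sqrrN addrC -[s ^+ 2 + _]addrC cs; ring.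
have not_axis l p (w : R) : pt p w \in line_space l -> p 0 0 != 0 -> l <> zline R.
  by move=> pl p0 lZ; move: pl p0; rewrite lZ => /mem_zline[-> _]; rewrite eqxx.
pose x0 := col3 (r0 / 2) 0 0.
have r20 : 0 < r0 / 2 by rewrite divr_gt0.
have [_ _ covC] := sC.
have [|l Cl vl] := covC (pt x0 1); first by apply: pt_neq0; right; exact: oner_neq0.
have [||r [a [b [rp an reg]]]] := axial_regulus Cl.
- by apply: not_axis vl _; rewrite mxE /= gt_eqF.
- by move=> lV; move: vl; rewrite lV => /mem_vline[_ /eqP]; rewrite oner_eq0.
have [c [s [cs E]]] := iffLR (regulusP _ _ _ _) reg.
have Al : plk_le phi l.
  exists (affine_mx (rz c s) 0 *m screw r a b) => //; rewrite phi_screw//.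
  have [t /colP ht] := iffLR (mem_screw _ _ E) vl.
  have := ht 0; have := ht 1; rewrite !mxE /= => h1 h0.
  have : (r0 / 2) ^+ 2 = (r ^+ 2 + t ^+ 2) * (c ^+ 2 + s ^+ 2).
    transitivity ((r0 / 2) ^+ 2 + 0 ^+ 2); first by ring.
    by rewrite h0 h1; ring.
  rewrite cs => h; have := sqr_ge0 t; have := sqr_ge0 r0; nra.
have Bv : plk_le (fun X => - phi X) (base_line R).
  exists (xy_basis R) => //; rewrite xyE /phi !plkE !mxE /=; lra.
have [||t [n [t01 Cn sn nphi]]] := plk_form (w := pt (e_ 0) 0) Cl Al vl vC Bv _ phiZ cphi.
- by apply/mem_vline; rewrite !mxE.
- move=> t /=; rewrite in_itv /= => /andP[t0 t1]; apply/eqP => /(congr1 (fun v : 'cV[R]_4 => v 0 0)).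
  rewrite /seg !mxE /= => h; have : 0 <= (1 - t) * (r0 / 2) by apply: mulr_ge0; lra.
  move=> h'; have t00 : t = 0 by lra.
  have e : r0 / 2 = 0 by rewrite t00 in h; lra.
  by move: r20; rewrite e ltxx.
have sE : seg (pt x0 1) (pt (e_ 0) 0) t = pt (col3 ((1 - t) * (r0 / 2) + t) 0 0) (1 - t).
  by apply/colP; apply: ord4P; rewrite /seg !mxE /=; ring.
have [||r' [a' [b' [rp' an' reg']]]] := axial_regulus Cn.
- rewrite sE in sn; apply: not_axis sn _; rewrite mxE /=.
  move: t01 => /=; rewrite in_itv /= => /andP[t0 t1]; rewrite gt_eqF//.
  have [->|tn] := eqVneq t 0; first by rewrite subr0 mul1r addr0.
  by apply: ltr_wpDl; [apply: mulr_ge0; lra|rewrite lt_def tn].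
- move=> nV; have := nphi (xy_basis R); rewrite nV => /(_ (erefl _)).
  by rewrite xyE /phi !plkE !mxE /=; lra.
exists a', b', n; split=> //.
have [c' [s' [cs' E']]] := iffLR (regulusP _ _ _ _) reg'.
have := nphi _ E'; rewrite phi_screw// => /eqP; rewrite subr_eq0 eqrXn2 ?ltW// => /eqP <-.
exact: reg'.
Qed.

(** With opposite signs of [a] and [a'], the form [psi] would vanish on a spread line meeting a
    segment that avoids the z-axis and the plane at infinity; but r and a are both nonzero on such a
    line. *)
Lemma axial_sign r a b r' a' b' l l' : C l -> C l' -> regulus r a b l -> regulus r' a' b' l' ->
  0 < r -> 0 < r' -> 0 < a -> 0 <= a'.
Proof.
move=> Cl Cl' reg reg' rp rp' ap; rewrite leNgt; apply/negP => an'.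
have [k Ck kE] := axial_screw Cl reg; have [k' Ck' kE'] := axial_screw Cl' reg'.
(* On a screw line this is a positive multiple of - r a. *)
pose psi (X : 'M[R]_4) := X 0 1 * X 2 3.
have psiZ c X : psi (c *: X) = c ^+ 2 * psi X by rewrite /psi !mxE; ring.
have cpsi : continuous psi.
  move=> X; have cc (i j : 'I_4) : (Y : 'M[R]_4) i j @[Y --> X] --> X i j.
    exact: (@cvg_coord _ (nbhs X) _ _ _ _ id).
  exact: (@cvgM _ _ (nbhs X)).
have psi_screw c s x y z : c ^+ 2 + s ^+ 2 = 1 ->
    psi (plk (affine_mx (rz c s) 0 *m screw x y z)) = - (x * y).
  by move=> cs; have [h1 h2 h3 h4] := plk_screw x y z cs; rewrite /psi h1 h4; ring.
have cs1 : (1 : R) ^+ 2 + 0 ^+ 2 = 1 by ring.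
have Ak : plk_le psi k.
  by exists (affine_mx (rz 1 0) 0 *m screw r a b) => //; rewrite psi_screw// oppr_le0 mulr_ge0 ?ltW.
have Bk : plk_le (fun X => - psi X) k'.
  by exists (affine_mx (rz 1 0) 0 *m screw r' a' b') => //; rewrite psi_screw// opprK; nra.
have vk : pt (col3 r 0 b) 1 \in line_space k.
  by apply/(mem_screw _ _ kE); exists 0; apply: colP'; rewrite !mxE /=; ring.
have wk : pt (col3 r' 0 b') 1 \in line_space k'.
  by apply/(mem_screw _ _ kE'); exists 0; apply: colP'; rewrite !mxE /=; ring.
have sE t : seg (pt (col3 r 0 b) 1) (pt (col3 r' 0 b') 1) t =
    pt (col3 ((1 - t) * r + t * r') 0 ((1 - t) * b + t * b')) 1.
  by apply/colP; apply: ord4P; rewrite /seg !mxE /=; ring.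
have h1 : (1 : R) != 0 by exact: oner_neq0.
have [|t [n [t01 Cn sn nphi]]] := plk_form Ck Ak vk Ck' Bk wk psiZ cpsi.
  by move=> t _; rewrite sE; apply: pt_neq0; right.
rewrite sE in sn; have [||x [y [z [xp yn reg'']]]] := axial_regulus Cn.
- move=> nZ; move: sn; rewrite nZ => /mem_zline[]; rewrite mxE /= => h0 _.
  move: t01 => /=; rewrite in_itv /= => /andP[t0 t1].
  have [e|e] := eqVneq t 0; first by move: h0; rewrite e; lra.
  have tp : 0 < t by rewrite lt_def e.
  by nra.
- by move=> nV; move: sn; rewrite nV => /mem_vline[_ /eqP]; rewrite (negbTE h1).
have [c [s [cs E]]] := iffLR (regulusP _ _ _ _) reg''.
have := nphi _ E; rewrite psi_screw// => /eqP; rewrite oppr_eq0 mulf_eq0 (gt_eqF xp) (negbTE yn).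
by [].
Qed.

(** The functions are chosen radius by radius, which determines them because lines of equal radius
    form one orbit of rotations. The sign of [a] is compared with that at radius 1. *)
Lemma axial_form : exists a b : R -> R,
  ((forall r, 0 < r -> 0 < a r) \/ (forall r, 0 < r -> a r < 0)) /\ C = rotational_form a b.
Proof.
have ex (r : R) : exists ab : R * R, 0 < r ->
    exists l, [/\ C l, ab.1 != 0 & regulus r ab.1 ab.2 l].
  have [r0|r0] := ltP 0 r; last by exists (0, 0).
  by have [a [b [l ?]]] := axial_radius r0; exists (a, b) => _; exists l.
have [ab abP] := choice ex.
exists (fun r => (ab r).1), (fun r => (ab r).2); split.
  have [l1 [Cl1 an1 reg1]] := abP 1 ltr01.
  have [a1|a1] := ltP 0 (ab 1).1; [left|right] => r r0; have [l [Cl an reg]] := abP r r0.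
    by rewrite lt_def an; exact: axial_sign Cl1 Cl reg1 reg ltr01 r0 a1.
  rewrite ltNge; apply/negP => h; have a0 : 0 < (ab r).1 by rewrite lt_def an.
  have := axial_sign Cl Cl1 reg reg1 r0 ltr01 a0; rewrite leNgt => /negP; apply.
  by rewrite lt_neqAle an1.
apply/seteqP; split=> [l Cl|l].
  apply/rotational_formP; have [->|nZ] := pselect (l = zline R); first exact: Or31.
  have [->|nV] := pselect (l = base_line R); first exact: Or32.
  have [r [a [b [r0 an reg]]]] := axial_regulus Cl nZ nV.
  have [l' [Cl' an' reg']] := abP r r0.
  by apply: Or33; exists r => //; exact: axial_regulus_same Cl' Cl an' reg' reg.
move=> /rotational_formP[->|->|[r r0 reg]]; [exact: zline_in|exact: vline_in|].
have [l' [Cl' an' /regulusP[c' [s' [cs' E']]]]] := abP r r0.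
move/regulusP: reg => [c [s [cs E]]].
have S1 := so_rz cs; have S2 := so_rz cs'.
have -> : l = pgl_line (so3g (rz c s)) (pgl_line ((so3g (rz c' s'))^-1)%g l').
  rewrite -so3gV//; apply: line_inj; rewrite -E.
  rewrite -(so3g_line S1 (so3g_line (so_tr S2) E')).
  by rewrite affine_trK.
apply: axial_line => //.
by rewrite -(invC cs') in Cl'; move: Cl' => [k Ck <-]; rewrite pgl_lineK.
Qed.

End Axial.

Lemma axial_SO2_rotational C : compact_spread C ->
  (forall c s : R, c ^+ 2 + s ^+ 2 = 1 -> pgl_spread (so3g (rz c s)) C = C) -> SO2_rotational C.
Proof.
move=> sC invC; split=> //; have [a [b [[ap|an] CE]]] := axial_form sC invC.
  by exists a, b; split; rewrite -?CE//; exists 1%g; rewrite pgl_spread1.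
exists (fun r => - a r), (fun r => - b r); split.
- by move=> r r0; rewrite oppr_gt0 an.
- by rewrite -refl3_form -CE; exact: spread_pgl.
- by exists (so3g refl3); rewrite CE refl3_form.
Qed.

(** [flip R] keeps the radius and [a] of a regulus and negates [b]; as [C] has only one regulus of
    each radius, [b] = 0. *)
Lemma axial_O2_rotational C : compact_spread C ->
  (forall c s : R, c ^+ 2 + s ^+ 2 = 1 -> pgl_spread (so3g (rz c s)) C = C) ->
  pgl_spread (so3g (flip R)) C = C -> O2_rotational C.
Proof.
move=> sC invC flipC; split=> //; have [a [b [ab CE]]] := axial_form sC invC.
have b0 r : 0 < r -> b r = 0.
  move=> r0; have an : a r != 0 by case: ab => h; rewrite ?(gt_eqF (h _ r0))// (lt_eqF (h _ r0)).
  have cs1 : (1 : R) ^+ 2 + 0 ^+ 2 = 1 by ring.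
  have [l lE] : exists l, limg (hom4 (affine_mx (rz 1 0) 0 *m screw r (a r) (b r))) = l :> {vspace _}.
    have dim2 : \dim (limg (hom4 (affine_mx (rz 1 0) 0 *m screw r (a r) (b r)))) = 2.
      apply: (@left_inv_basis _ _ (mxs 2 4 [:: [:: 0; 0; 0; 1]; [:: 0; 1; 0; 0]])).
      rewrite affine_screw; apply/matrixP; apply: ord2P; apply: ord2P;
        by rewrite !mxE !sum4 !mxE /= ?(mulr1n, mulr0n); ring.
    by exists (Line dim2).
  have reg : regulus r (a r) (b r) l by apply/regulusP; exists 1, 0.
  have Cl : C l by rewrite CE; apply/rotational_formP; apply: Or33; exists r.
  have Cl' : C (pgl_line (so3g (flip R)) l) by rewrite -flipC; exists l.
  have reg' : regulus r (a r) (- b r) (pgl_line (so3g (flip R)) l).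
    apply/regulusP; exists 1, 0; split=> //; rewrite -(so3g_line (so_flip R) lE) !affine_screw affine_bas.
    have dP : \det (mxs 2 2 [:: [:: 1; 0]; [:: 0; -1]]) != 0 :> R by rewrite det_mxs2 mul1r mul0r subr0 oppr_eq0 oner_neq0.
    rewrite -[RHS](limg_mulr _ dP) bas_mul; congr (limg (hom4 (bas _ _ _ _))); try ring;
      by apply: colP'; rewrite !mxE !sum3 !mxE /=; ring.
  have h := axial_regulus_same sC invC Cl Cl' an reg reg'.
  have [_ _ ->] := regulus_uniq r0 r0 h reg'.
  have [_ _] := regulus_uniq r0 r0 h reg'; lra.
case: ab => h.
  by exists a, b, 0; split; rewrite -?CE//; exists 1%g; rewrite pgl_spread1.
exists (fun r => - a r), (fun r => - b r), 0; split.
- by move=> r r0; rewrite oppr_gt0 h.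
- by move=> r r0; rewrite b0// oppr0.
- by rewrite -refl3_form -CE; exact: spread_pgl.
- by exists (so3g refl3); rewrite CE refl3_form.
Qed.

End RotationalForm.

(** * Parallelisms *)

Section Parallelisms.
Variable R : realType.
Local Notation pgl4 := (pgl4 R).
Local Notation SO n := (@special_orthogonal_group R n).
Local Notation e_ := (e_ R).
Local Notation std := (@std_SO3 R).
Implicit Types (A B : 'M[R]_3) (p q : 'cV[R]_3) (l : line R) (m : oline R) (g h t : pgl4).
Implicit Types (Omega H : set pgl4) (C : set (line R)) (S : set (oline R)).

Lemma conjK t g : (t^-1 * (t * g * t^-1) * t = g)%g.
Proof. by rewrite !mulgA mulVg mul1g -mulgA mulVg mulg1. Qed.

Lemma conjVK t g : (t * (t^-1 * g * t) * t^-1 = g)%g.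
Proof. by rewrite !mulgA mulgV mul1g -mulgA mulgV mulg1. Qed.

Lemma isog_conj n (G : set 'M[R]_n) H t : pgl_subgroup_isog G H ->
  pgl_subgroup_isog G [set (t^-1 * h * t)%g | h in H].
Proof.
have cM x h : ((t^-1 * x * t) * (t^-1 * h * t) = t^-1 * (x * h) * t)%g.
  by rewrite -!mulgA (mulgA t) mulgV mul1g.
have cc x y h : (x * k * y)%g @[k --> h] --> (x * h * y)%g.
  apply: (@cvg_pgl_mul _ _ (nbhs h) (fun k => (x * k)%g) (fun=> y)); last exact: cvg_cst.
  by apply: (@cvg_pgl_mul _ _ (nbhs h) (fun=> x) id); first exact: cvg_cst.
move=> [[H1 HM HV] [f [[k [[fH finj fsurj] cf fK ck]] fM]]]; split; first split.
- by exists 1%g => //; rewrite mulg1 mulVg.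
- by move=> _ _ [x Hx <-] [y Hy <-]; exists (x * y)%g; [exact: HM|rewrite cM].
- by move=> _ [x Hx <-]; exists (x^-1)%g; [exact: HV|rewrite !invgM invgK mulgA].
exists (fun X : 'M[R]_n => (t^-1 * f X * t)%g); split; last by move=> A B GA GB; rewrite fM// cM.
exists (fun h => k (t * h * t^-1)%g); split.
- split; first by move=> A GA; exists (f A) => //; exact: fH.
    move=> A B GA GB /= /(congr1 (fun h => t * h * t^-1)%g); rewrite !conjVK.
    exact: finj.
  by move=> _ [h Hh <-]; have [A GA <-] := fsurj h Hh; exists A.
- apply/within_cvg => A GA; move/within_cvg : cf => /(_ A GA) cf.
  exact: (@cvg_comp _ _ _ f (fun h => t^-1 * h * t)%g _ (nbhs (f A)) (nbhs (t^-1 * f A * t)%g) cf (cc _ _ _)).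
- by move=> A GA; rewrite conjVK fK.
apply: (within_comp (A := H) (f := k)) => //; last by move=> _ [h Hh <-]; rewrite conjVK.
by apply/within_cvg => h _; apply: cvg_within_filter; exact: cc.
Qed.

Lemma stdM g h : std g -> std h -> std (g * h)%g.
Proof.
move=> [A SA <-] [B SB <-]; exists (A *m B); first exact: so_mul.
by rewrite so3gM// so_unit.
Qed.

Lemma stdV g : std g -> std (g^-1)%g.
Proof. by move=> [A SA <-]; exists A^T; [exact: so_tr|rewrite so3gV]. Qed.

Lemma std_rz (c s : R) : c ^+ 2 + s ^+ 2 = 1 -> std (so3g (rz c s)).
Proof. by move=> cs; exists (rz c s) => //; exact: so_rz. Qed.

Lemma std_affine : affine_SO3 std.
Proof.
split.
  move=> _ [A SA <-]; exists (mkgl (affine_mx A 0)); split=> //; exists A, 0.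
  by rewrite mkglE//; exact: so3_affine_unit.
have -> : std = [set so3g (id A) | A in SO 3] by [].
apply: (@embed_iso R 3 (SO 3) id id) => //; try by move=> A; exact: cvg_id.
- exact: so_1.
- by move=> A B; exact: so_mul.
- by move=> A SA; exists A^T; [exact: so_tr|exact: so_mulmxV].
Qed.

Definition std_conj Omega t := forall g, Omega g <-> std (t^-1 * g * t)%g.

Lemma std_conj_so3g Omega t A : SO 3 A -> std_conj Omega t -> std_conj Omega (t * so3g A)%g.
Proof.
move=> SA h g; have sA : std (so3g A) by exists A.
have -> : ((t * so3g A)^-1 * g * (t * so3g A) = (so3g A)^-1 * (t^-1 * g * t) * so3g A)%g.
  by rewrite invgM !mulgA.
split=> [/h k|k]; first by apply: stdM => //; apply: stdM => //; exact: stdV.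
by apply/h; rewrite -(conjVK (so3g A) (_ * t)%g); apply: stdM; [exact: stdM|exact: stdV].
Qed.

Definition axial C := forall c s : R, c ^+ 2 + s ^+ 2 = 1 -> pgl_spread (so3g (rz c s)) C = C.

Lemma conj_axial (H : set pgl4) Omega t C A : std_conj Omega t -> SO 3 A ->
  (forall g, H g -> pgl_spread g C = C) -> forall B, SO 3 B ->
  [set (t^-1 * h * t)%g | h in H] (so3g (A *m B *m A^T)) ->
  pgl_spread (so3g B) (pgl_spread ((t * so3g A)^-1)%g C) = pgl_spread ((t * so3g A)^-1)%g C.
Proof.
move=> tO SA HC B SB [h Hh hE].
have SAt := so_tr SA.
have {}hE : (t^-1 * h * t = so3g A * so3g B * (so3g A)^-1)%g.
  by rewrite hE !so3gM ?so3gV ?so_unit//; exact: so_mul.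
rewrite -pgl_spreadM -{2}(HC h Hh) -pgl_spreadM; congr (pgl_spread _ C).
rewrite invgM -(conjVK t h) hE.
by rewrite !mulgA -(mulgA _ (t^-1)%g t) mulVg mulg1 mulVg mul1g.
Qed.

Lemma SO2_axial Omega C t : std_conj Omega t -> SO2_admissible Omega C ->
  exists k, std_conj Omega k /\ axial (pgl_spread (k^-1)%g C).
Proof.
move=> tO [H [HO iH HC]].
have [|A SA hA] := SO2_in_std _ (isog_conj t iH); first by move=> _ [h /HO/tO ? <-].
exists (t * so3g A)%g; split; first exact: std_conj_so3g.
move=> c s cs; apply: (conj_axial tO SA HC (so_rz cs)); exact: hA.
Qed.

Lemma O2_axial Omega C t : std_conj Omega t -> O2_admissible Omega C ->
  exists k, [/\ std_conj Omega k, axial (pgl_spread (k^-1)%g C) &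
    pgl_spread (so3g (flip R)) (pgl_spread (k^-1)%g C) = pgl_spread (k^-1)%g C].
Proof.
move=> tO [H [HO iH HC]].
have [|A SA [hA fA]] := O2_in_std _ (isog_conj t iH); first by move=> _ [h /HO/tO ? <-].
exists (t * so3g A)%g; split; first exact: std_conj_so3g.
  by move=> c s cs; apply: (conj_axial tO SA HC (so_rz cs)); exact: hA.
exact: (conj_axial tO SA HC (so_flip R)).
Qed.

(** * Partitions into group translates *)

Section Orbits.
Variables (T : Type) (act : pgl4 -> T -> T).
Hypothesis actM : forall g h x, act (g * h)%g x = act g (act h x).
Hypothesis act1 : forall x, act 1%g x = x.

(** If g c = h d with c and d in [C], then g^-1 h brings d back into [C] and so preserves [C]; the
    two translates coincide. *)
Lemma orbit_partition Omega (C : set T) : pgl_subgroup Omega ->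
  (forall x, exists2 g, Omega g & (act g @` C) x) ->
  (forall x g, Omega g -> C x -> C (act g x) -> act g @` C = C) ->
  trivIset [set act g @` C | g in Omega] id /\ \bigcup_(D in [set act g @` C | g in Omega]) D = setT.
Proof.
move=> [one mul inv] cover ret; split.
  move=> _ _ [g Og <-] [h Oh <-] [x [[c Cc cx] [d Cd dx]]].
  have gh : act (g^-1 * h)%g d = c by rewrite actM dx -cx -actM mulVg act1.
  have E : act (g^-1 * h)%g @` C = C.
    by apply: (ret d) => //; [apply: mul => //; exact: inv|rewrite gh].
  rewrite /= -[in LHS]E image_comp; apply/seteqP.
  by split=> _ [y Cy <-]; exists y => //=; rewrite -actM mulgA mulgV mul1g.
apply/seteqP; split=> // x _; have [g Og gx] := cover x.
by exists (act g @` C) => //; exists g.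
Qed.

Lemma conj_orbit_partition Omega k (C : set T) : pgl_subgroup Omega -> std_conj Omega k ->
  let C1 := act (k^-1)%g @` C in
  (forall x, exists2 A, SO 3 A & (act (so3g A) @` C1) x) ->
  (forall x A, SO 3 A -> C1 x -> C1 (act (so3g A) x) -> act (so3g A) @` C1 = C1) ->
  trivIset [set act g @` C | g in Omega] id /\ \bigcup_(D in [set act g @` C | g in Omega]) D = setT.
Proof.
move=> gO kO C1 cover ret.
have kC1 : act k @` C1 = C.
  rewrite /C1 image_comp; apply/seteqP; split=> [_ [y Cy <-]|y Cy].
    by rewrite /= -actM mulgV act1.
  by exists y => //=; rewrite -actM mulgV act1.
have actC g A : so3g A = (k^-1 * g * k)%g -> act g @` C = act k @` (act (so3g A) @` C1).
  move=> gA; have E y : act g y = act k (act (so3g A) (act (k^-1)%g y)).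
    by rewrite -!actM gA -!mulgA mulgV mulg1 mulgA mulgV mul1g.
  by rewrite !image_comp; apply/seteqP; split=> _ [y Cy <-]; exists y => //=; rewrite E.
apply: orbit_partition => // x.
  have [A SA Ax] := cover (act (k^-1)%g x); exists (k * so3g A * k^-1)%g.
    by apply/kO; rewrite conjK; exists A.
  rewrite (actC _ A) ?conjK//; exists (act (k^-1)%g x) => //.
  by rewrite -actM mulgV act1.
move=> g Og Cx Cgx; have [A SA gA] := iffLR (kO g) Og.
rewrite (actC _ _ gA) (ret (act (k^-1)%g x)) //; first by exists x.
exists (act g x) => //; rewrite gA -!actM; congr act.
by rewrite -!mulgA mulgV mulg1.
Qed.

Lemma conj_parallelism Omega t (P : set (set T)) : std_conj Omega t -> trivIset P id ->
  \bigcup_(D in P) D = setT ->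
  (forall g, Omega g -> [set act g @` D | D in P] = P) ->
  let P1 := [set act (t^-1)%g @` D | D in P] in
  [/\ forall x, exists2 D, P1 D & D x,
      forall D E x, P1 D -> P1 E -> D x -> E x -> D = E &
      forall g D, std g -> P1 D -> P1 (act g @` D)].
Proof.
move=> tO triv cov inv P1; split.
- move=> x; have : (\bigcup_(D in P) D) (act t x) by rewrite cov.
  move=> [D PD Dx]; exists (act (t^-1)%g @` D); first by exists D.
  by exists (act t x) => //; rewrite -actM mulVg act1.
- move=> _ _ _ [D PD <-] [E PE <-] [x Dx <-] [y Ey /(congr1 (act t))].
  rewrite -!actM mulgV !act1 => yx; rewrite yx in Ey.
  by rewrite (triv D E)//; exists x.
- move=> g _ sg [D PD <-]; have Og : Omega (t * g * t^-1)%g by apply/tO; rewrite conjK.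
  exists (act (t * g * t^-1)%g @` D).
    by rewrite -(inv _ Og); exists D.
  rewrite !image_comp; apply/seteqP.
  by split=> _ [y Dy <-]; exists y => //=; rewrite -!actM !mulgA mulVg mul1g.
Qed.

(** An element of any member lies in some translate of [D]; the translate is itself a member, and
    members sharing an element coincide. *)
Lemma orbit_of_member (P : set (set T)) D : P D ->
  (forall E, P E -> E !=set0) ->
  (forall E F x, P E -> P F -> E x -> F x -> E = F) ->
  (forall g E, std g -> P E -> P (act g @` E)) ->
  (forall x, exists2 A, SO 3 A & (act (so3g A) @` D) x) ->
  P = [set act g @` D | g in std].
Proof.
move=> PD ne uniq stab cover; apply/seteqP; split=> [E PE|_ [g sg <-]]; last exact: stab.
have [x Ex] := ne E PE; have [A SA Dx] := cover x; have sA : std (so3g A) by exists A.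
by exists (so3g A) => //; apply: (uniq _ _ x) => //; exact: stab.
Qed.

End Orbits.

Lemma ordinary_example_parallelism (P : set (set (line R))) :
  ordinary_example P -> topological_parallelism P.
Proof.
move=> [C [ Omega [[sC _] aO admO ->]]].
have [t tO] := affine_conj_std aO; have [k [kO ax fl]] := O2_axial tO admO.
have [_ iO] := aO; have sC1 := spread_pgl (k^-1)%g sC.
have [triv cov] := @conj_orbit_partition _ (@pgl_line R) (@pgl_lineM R) (@pgl_line1 R) _ _ C iO.1 kO
  (spread_orbit_cover sC1 ax) (fun l A => @spread_return _ _ sC1 ax fl l A).
split=> //; first by move=> _ [g _ <-]; exact: spread_pgl.
apply: hyper_orbit_compact (iso_compact iO) _; last by case: sC.
exact: cvg_pgl_line.
Qed.

Lemma oriented_example_parallelism (P : set (set (oline R))) :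
  oriented_example P -> oriented_topological_parallelism P.
Proof.
move=> [C [S [ Omega [[_ SC] aO admO _ ->]]]].
have [t tO] := affine_conj_std aO; have [k [kO ax]] := SO2_axial tO admO.
have [_ iO] := aO; have [sC _] := SC; have sC1 := spread_pgl (k^-1)%g sC.
have SC1 := oriented_spread_from_pgl (k^-1)%g SC.
have [triv cov] := @conj_orbit_partition _ (@pgl_oline R) (@pgl_olineM R) (@pgl_oline1 R) _ _ S iO.1 kO
  (ospread_orbit_cover sC1 ax SC1) (fun m A => @ospread_return _ _ sC1 ax _ SC1 m A).
split=> //.
  by move=> _ [g _ <-]; exists (pgl_spread g C); exact: oriented_spread_from_pgl.
apply: hyper_orbit_compact (iso_compact iO) _; first exact: cvg_pgl_oline.
by apply: homeo_compact (ospread_homeo SC); case: sC.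
Qed.

Lemma zline_basis : limg (hom4 (bas (e_ 2) 0 0 1)) = zline R :> {vspace _}.
Proof. by rewrite -zaxisE. Qed.

Lemma so3_zline A : SO 3 A -> A *m e_ 2 = e_ 2 \/ A *m e_ 2 = - e_ 2 ->
  pgl_line (so3g A) (zline R) = zline R.
Proof.
move=> SA Ae; apply: line_inj; rewrite -(so3g_line SA zline_basis) affine_bas mulmx0 -zline_basis.
case: Ae => -> //; apply/vspaceP => v.
by apply/idP/idP => /mem_bas[s [t ->]]; apply/mem_bas; exists (- s), t;
  apply/colP; apply: ord4P; rewrite !mxE /=; ring.
Qed.

Lemma rz_e2 (c s : R) : rz c s *m e_ 2 = e_ 2.
Proof. by rewrite rz_mulE; apply: colP'; rewrite !mxE /=; ring. Qed.

(* The determinant in the last entry makes this an embedding of O_2 into SO_3. *)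
Definition o2_mx (M : 'M[R]_2) : 'M[R]_3 :=
  mxs 3 3 [:: [:: M 0 0; M 0 1; 0]; [:: M 1 0; M 1 1; 0]; [:: 0; 0; M 0 0 * M 1 1 - M 0 1 * M 1 0]].

Definition ul2_mx (A : 'M[R]_3) : 'M[R]_2 := mxs 2 2 [:: [:: A 0 0; A 0 1]; [:: A 1 0; A 1 1]].

Lemma o2_mx_continuous : continuous o2_mx.
Proof.
move=> M; have cc (i j : 'I_2) : (X : 'M[R]_2) i j @[X --> M] --> M i j.
  exact: (@cvg_coord _ (nbhs M) _ _ _ _ id).
apply: (@cvg_mx _ (nbhs M)); apply: ord3P; apply: ord3P;
  under eq_fun do rewrite mxE /=; rewrite mxE /=; try exact: cc; try exact: cvg_cst.
by apply: (@cvgB _ _ _ (nbhs M)); apply: (@cvgM _ _ (nbhs M)).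
Qed.

Lemma ul2_mx_continuous : continuous ul2_mx.
Proof.
move=> M; have cc (i j : 'I_3) : (X : 'M[R]_3) i j @[X --> M] --> M i j.
  exact: (@cvg_coord _ (nbhs M) _ _ _ _ id).
by apply: (@cvg_mx _ (nbhs M)); apply: ord2P; apply: ord2P;
  under eq_fun do rewrite mxE /=; rewrite mxE /=; exact: cc.
Qed.

Lemma o2_mxK (M : 'M[R]_2) : ul2_mx (o2_mx M) = M.
Proof. by apply/matrixP; apply: ord2P; apply: ord2P; rewrite !mxE. Qed.

Lemma o2_mxM (M N : 'M[R]_2) : o2_mx (M *m N) = o2_mx M *m o2_mx N.
Proof.
by apply/matrixP; apply: ord3P; apply: ord3P; rewrite !mxE !sum3 !sum2 !mxE /=; ring.
Qed.

Lemma so_o2_mx (M : 'M[R]_2) : @orthogonal_group R 2 M -> SO 3 (o2_mx M).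
Proof.
move=> MM; have dd : (M 0 0 * M 1 1 - M 0 1 * M 1 0) ^+ 2 = 1.
  by have := congr1 (fun X => \det X) MM; rewrite /= det_mulmx det_tr det1 det2 expr2.
split; last by rewrite det3 !mxE /= -[RHS]dd; ring.
have -> : (o2_mx M)^T = o2_mx M^T.
  by apply/matrixP; apply: ord3P; apply: ord3P; rewrite !mxE //=; ring.
rewrite -o2_mxM MM.
by apply/matrixP; apply: ord3P; apply: ord3P; rewrite !mxE /= ?(mulr1n, mulr0n); ring.
Qed.

Lemma o2_mx_e2 (M : 'M[R]_2) : @orthogonal_group R 2 M ->
  o2_mx M *m e_ 2 = e_ 2 \/ o2_mx M *m e_ 2 = - e_ 2.
Proof.
move=> MM; have /eqP : (M 0 0 * M 1 1 - M 0 1 * M 1 0) ^+ 2 = 1.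
  by have := congr1 (fun X => \det X) MM; rewrite /= det_mulmx det_tr det1 det2 expr2.
by rewrite sqrf_eq1 => /predU1P[d|/eqP d]; [left|right]; apply: colP'; rewrite !mxE !sum3 !mxE /= ?d; ring.
Qed.

Lemma o2_iso : pgl_subgroup_isog (@orthogonal_group R 2) [set so3g (o2_mx M) | M in @orthogonal_group R 2].
Proof.
apply: (@embed_iso R 2 _ o2_mx ul2_mx).
- exact: o2_mx_continuous.
- exact: ul2_mx_continuous.
- exact: so_o2_mx.
- by move=> M _; exact: o2_mxK.
- by move=> M N _ _; exact: o2_mxM.
- by rewrite /orthogonal_group /= trmx1 mulmx1.
- by move=> M N MM NN; rewrite /orthogonal_group /= trmx_mul mulmxA -(mulmxA N^T) MM mulmx1.
- move=> M MM; exists M^T; last exact: mulmx1C.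
  by rewrite /orthogonal_group /= trmxK; exact: mulmx1C.
Qed.

Lemma so2_iso : pgl_subgroup_isog (SO 2) [set so3g (o2_mx M) | M in SO 2].
Proof.
apply: (@embed_iso R 2 _ o2_mx ul2_mx).
- exact: o2_mx_continuous.
- exact: ul2_mx_continuous.
- by move=> M [MM _]; exact: so_o2_mx.
- by move=> M _; exact: o2_mxK.
- by move=> M N _ _; exact: o2_mxM.
- exact: so_1.
- by move=> M N; exact: so_mul.
- by move=> M SM; exists M^T; [exact: so_tr|exact: so_mulmxV].
Qed.

Lemma axial_O2_admissible C : axial C -> pgl_spread (so3g (flip R)) C = C -> O2_admissible std C.
Proof.
move=> ax fl; exists [set so3g (o2_mx M) | M in @orthogonal_group R 2]; split; last 1 first.
- move=> _ [M MM <-]; apply: spread_axis => //; [exact: so_o2_mx|exact: o2_mx_e2].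
- by move=> _ [M MM <-]; exists (o2_mx M) => //; exact: so_o2_mx.
- exact: o2_iso.
Qed.

Lemma axial_SO2_admissible C : axial C -> SO2_admissible std C.
Proof.
move=> ax; exists [set so3g (o2_mx M) | M in SO 2]; split; last 1 first.
- move=> _ [_ /so2P[c [s [cs ->]]] <-].
  have -> : o2_mx (rot2 c s) = rz c s.
    apply/matrixP; apply: ord3P; apply: ord3P; rewrite !mxE //=.
    by rewrite -[RHS]cs; ring.
  exact: ax.
- by move=> _ [M [MM _] <-]; exists (o2_mx M) => //; exact: so_o2_mx.
- exact: so2_iso.
Qed.

Lemma reducible_parallelism (P : set (set (line R))) :
  topological_parallelism P -> admits_reducible_SO3 P ->
  exists2 Q, ordinary_example Q & parallelism_iso P Q.
Proof.
move=> [spP triv cov _] [ Omega redO inv]; have [t tO] := reducible_conj_std redO.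
exists (pgl_parallelism (t^-1)%g P); last by exists (t^-1)%g.
have [covP uniqP stabP] := @conj_parallelism _ (@pgl_line R) (@pgl_lineM R) (@pgl_line1 R) _ _ P tO triv cov inv.
have [C PC Cz] := covP (zline R).
have spP1 D : pgl_parallelism (t^-1)%g P D -> compact_spread D.
  by move=> [E /spP sE <-]; exact: spread_pgl.
have sC := spP1 _ PC.
have stabC A : SO 3 A -> A *m e_ 2 = e_ 2 \/ A *m e_ 2 = - e_ 2 -> pgl_spread (so3g A) C = C.
  move=> SA Ae; apply: (uniqP _ _ (zline R)) => //; first by apply: stabP => //; exists A.
  by exists (zline R) => //; exact: so3_zline.
have ax : axial C by move=> c s cs; apply: stabC; [exact: so_rz|left; exact: rz_e2].
have fl : pgl_spread (so3g (flip R)) C = C by apply: stabC; [exact: so_flip|right; exact: flip_e2].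
exists C, std; split.
- exact: axial_O2_rotational.
- exact: std_affine.
- exact: axial_O2_admissible.
- apply: (orbit_of_member PC) uniqP stabP (spread_orbit_cover sC ax) => D /spP1[_ _ covD].
  by have [|l Dl _] := covD (pt 0 1); [apply: pt_neq0; right; exact: oner_neq0|exists l].
Qed.

Lemma ospread_stab_spread g C S : oriented_spread_from C S -> pgl_ospread g S = S -> pgl_spread g C = C.
Proof.
move=> SC gS; have hS := ospread_homeo SC.
suff sub h : pgl_ospread h S = S -> pgl_spread h C `<=` C.
  apply/seteqP; split; first exact: sub.
  move=> l Cl; exists (pgl_line (g^-1)%g l); last exact: pgl_lineVK.
  apply: (sub (g^-1)%g); last by exists l.
  by rewrite -{1}gS pgl_ospreadK.
move=> hSS _ [l Cl <-]; have [m Sm <-] := homeo_surj hS Cl.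
by rewrite -unoriented_pgl; apply: (homeo_fun hS); rewrite -hSS; exists m.
Qed.

Lemma zline_pos m : unoriented m = zline R -> exists B, [/\ SO 3 B,
  B *m e_ 1 = e_ 2 \/ B *m e_ 1 = - e_ 2 & positive_bases m (affine_mx B 0 *m Nd 0)].
Proof.
move=> mz; have [A0 [SA0 A01 zE]] := zline_Nd R; rewrite -mz in zE.
have [|B [SB hB mB]] := @pos_kind R m (Nd 0) A0 _ SA0 zE; first by right; exists 0.
exists B; split=> //; case: hB => ->; first by left.
by right; rewrite -mulmxA flip_e1 mulmxN A01.
Qed.

Lemma rz_ozline (c s : R) m : c ^+ 2 + s ^+ 2 = 1 -> unoriented m = zline R ->
  pgl_oline (so3g (rz c s)) m = m.
Proof.
move=> cs mz; have [B [SB hB mB]] := zline_pos mz.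
apply: (pos_eq (so3g_pos (so_rz cs) mB)); rewrite mulmxA -affine_mxM.
have -> : affine_mx (rz c s *m B) 0 *m Nd 0 = affine_mx B 0 *m Nd 0; last exact: mB.
rewrite !affine_Nd !scale0r; congr bas.
by rewrite -mulmxA; case: hB => ->; rewrite ?mulmxN rz_e2.
Qed.

Lemma flip_ozline A m : SO 3 A -> A *m e_ 2 = - e_ 2 -> unoriented m = zline R ->
  pgl_oline (so3g A) m <> m.
Proof.
move=> SA Ae mz Am; have [B [SB hB mB]] := zline_pos mz.
have [P P0 E] := fix_pos SB SA mB Am.
have SE : SO 3 (B^T *m A *m B) := so_mul (so_mul (so_tr SB) SA) SB.
have [_ _ /(_ P0)] := stab_Nd SE E.
rewrite -mulmxA -mulmxA => /(congr1 (fun x => B *m x)); rewrite so_trVK//.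
have ne : - e_ 2 <> e_ 2.
  move=> /colP/(_ 2); rewrite !mxE /= => h; have : (1 : R) = 0 by lra.
  by move=> /eqP; rewrite oner_eq0.
by case: hB => ->; rewrite ?mulmxN Ae => // /oppr_inj.
Qed.

(** The group O_2 from admissibility might a priori have another axis. Its quarter turn fixes the
    origin and preserves [C], hence the z-axis, the only spread line through the origin. So [e_ 2]
    is an eigenvector of a quarter turn, which puts the axis of O_2 on the z-axis, and the conjugate
    of [flip R] reverses it. *)
Lemma reversing_symmetry C : compact_spread C -> axial C -> O2_admissible std C ->
  exists A, [/\ SO 3 A, A *m e_ 2 = - e_ 2 & pgl_spread (so3g A) C = C].
Proof.
move=> sC ax [H [Hstd iH HC]]; have [A SA [hA fA]] := O2_in_std Hstd iH.
have SAt := so_tr SA.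
have cs : (0 : R) ^+ 2 + 1 ^+ 2 = 1 by ring.
have SQ : SO 3 (A *m rz 0 1 *m A^T) by apply: so_mul => //; apply: so_mul => //; exact: so_rz.
have Qz : pgl_line (so3g (A *m rz 0 1 *m A^T)) (zline R) = zline R.
  apply: (line_origin sC ax); first by rewrite -(HC _ (hA _ _ cs)); exists (zline R) => //; exact: zline_in.
  by rewrite -[X in pt X 1](mulmx0 _ (A *m rz 0 1 *m A^T)); apply: memv_so3g => //; apply/mem_zline; rewrite !mxE.
have e2z : pt (e_ 2) 0 \in line_space (zline R) by apply/mem_zline; rewrite !mxE.
have := memv_so3g SQ e2z; rewrite Qz => /mem_zline[q0 q1].
have [v vE] : exists v, v = A^T *m e_ 2 by exists (A^T *m e_ 2).
have Av : A *m v = e_ 2 by rewrite vE so_trVK.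
have [z zE] : exists z : R, A *m rz 0 1 *m A^T *m e_ 2 = z *: e_ 2.
  move: (A *m rz 0 1 *m A^T *m e_ 2) q0 q1 => q q0 q1; exists (q 2 0).
  by apply: colP'; rewrite !mxE /= ?q0 ?q1; ring.
have rv : rz 0 1 *m v = z *: v.
  have := congr1 (fun x => A^T *m x) zE; rewrite -!mulmxA so_trK// -vE => ->.
  by rewrite -scalemxAr -vE.
have {rv} [h0 h1] : - v 1 0 = z * v 0 0 /\ v 0 0 = z * v 1 0.
  move/colP: rv => h; split; [have := h 0|have := h 1]; rewrite [RHS]mxE rz_mulE mxE /= => <-; ring.
have v0 : v 0 0 = 0.
  have h2 : v 0 0 * (1 + z ^+ 2) = 0.
    by rewrite mulrDr mulr1 expr2 mulrCA mulrA [z * _ * _]mulrC -h0 mulrN -h1 subrr.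
  by apply/eqP; move/eqP : h2; rewrite mulf_eq0 (gt_eqF (ltr_wpDr (sqr_ge0 z) ltr01)) orbF.
have v1 : v 1 0 = 0 by rewrite -[LHS]opprK h0 v0 mulr0 oppr0.
exists (A *m flip R *m A^T); split.
- by apply: so_mul => //; apply: so_mul => //; exact: so_flip.
- have fv : flip R *m v = - v.
    by apply: colP'; rewrite !mxE sum3 !mxE /= ?v0 ?v1; ring.
  by rewrite -mulmxA -vE -mulmxA fv mulmxN Av.
- exact: HC.
Qed.

(** The given symmetry of [C] reverses the z-axis, hence cannot preserve [S], and exchanges the two
    sheets. The orbit of [S] therefore contains both orientations of every translate of [C]. *)
Lemma oriented_cover_orbit C S A : axial C -> oriented_spread_from C S ->
  SO 3 A -> A *m e_ 2 = - e_ 2 -> pgl_spread (so3g A) C = C ->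
  oriented_cover (spread_orbit std C) = ospread_orbit std S.
Proof.
move=> ax SC SA Ae AC; have hS := ospread_homeo SC; have sA : std (so3g A) by exists A.
have [sC [S' [SS' dS h1 h2]]] := SC.
have ne : pgl_ospread (so3g A) S <> S.
  move=> AS; have [m Sm mz] := homeo_surj hS (zline_in sC ax).
  apply: (flip_ozline SA Ae mz); apply: (homeo_inj hS) => //; first by rewrite -AS; exists m.
  by rewrite unoriented_pgl mz so3_zline//; right.
have sheets T : oriented_spread_from C T -> T = S \/ T = pgl_ospread (so3g A) S.
  have sheet T' : oriented_spread_from C T' -> T' = S \/ T' = S'.
    exact: oriented_sheets_from sC SS' dS h1 h2.
  have := oriented_spread_from_pgl (so3g A) SC; rewrite AC => /sheet[//|->]; exact: sheet.
apply/seteqP; split=> [T [_ [g sg <-] gT]|_ [g sg <-]]; last first.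
  by exists (pgl_spread g C); [exists g|exact: oriented_spread_from_pgl].
have := oriented_spread_from_pgl (g^-1)%g gT; rewrite pgl_spreadK => /sheets h.
rewrite -(pgl_ospreadVK g T); case: h => ->; first by exists g.
by exists (g * so3g A)%g; [exact: stdM|rewrite pgl_ospreadM].
Qed.

Lemma reducible_oriented_parallelism (P : set (set (oline R))) :
  oriented_topological_parallelism P -> oriented_admits_reducible_SO3 P ->
  (exists2 Q, oriented_example Q & oparallelism_iso P Q) \/
  (exists2 Q, ordinary_example Q & oparallelism_iso P (oriented_cover Q)).
Proof.
move=> [spP triv cov _] [ Omega redO inv]; have [t tO] := reducible_conj_std redO.
have [covP uniqP stabP] :=
  @conj_parallelism _ (@pgl_oline R) (@pgl_olineM R) (@pgl_oline1 R) _ _ P tO triv cov inv.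
have [m mz] := oline_over (zline R).
have [S PS Sm] := covP m.
have spP1 D : pgl_oparallelism (t^-1)%g P D -> exists C, oriented_spread_from C D.
  by move=> [E /spP[C CE] <-]; exists (pgl_spread (t^-1)%g C); exact: oriented_spread_from_pgl.
have [C SC] := spP1 _ PS; have [sC _] := SC.
have ax : axial C.
  move=> c s cs; apply: (ospread_stab_spread SC); apply: (uniqP _ _ m) => //.
    by apply: stabP => //; exact: std_rz.
  by exists m => //; exact: rz_ozline.
have PE : pgl_oparallelism (t^-1)%g P = ospread_orbit std S.
  apply: (orbit_of_member PS) uniqP stabP (ospread_orbit_cover sC ax SC) => D /spP1[C' DC'].
  have [sC' _] := DC'; have [_ _ covC] := sC'.
  have [|l Cl _] := covC (pt 0 1); first by apply: pt_neq0; right; exact: oner_neq0.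
  by have [x Dx _] := homeo_surj (ospread_homeo DC') Cl; exists x.
(* The first case is the one excluded from the oriented examples. *)
have [[rot adm]|not_both] := pselect (O2_rotational C /\ O2_admissible std C).
  right; have [A [SA Ae AC]] := reversing_symmetry sC ax adm.
  exists (spread_orbit std C); first by exists C, std; split=> //; exact: std_affine.
  by exists (t^-1)%g; rewrite PE (oriented_cover_orbit ax SC SA Ae AC).
left; exists (ospread_orbit std S); last by exists (t^-1)%g.
exists C, S, std; split=> //.
- by split=> //; exact: axial_SO2_rotational.
- exact: std_affine.
- exact: axial_SO2_admissible.
- by apply/not_andP.
Qed.

End Parallelisms.

Theorem theorem5p5 (R : realType) :
  [/\ forall P : set (set (line R)),
        ordinary_example P -> topological_parallelism P,
      forall P : set (set (oline R)),
        oriented_example P -> oriented_topological_parallelism P,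
      forall P : set (set (line R)),
        topological_parallelism P -> admits_reducible_SO3 P ->
        exists2 Q, ordinary_example Q & parallelism_iso P Q
    & forall P : set (set (oline R)),
        oriented_topological_parallelism P -> oriented_admits_reducible_SO3 P ->
        (exists2 Q, oriented_example Q & oparallelism_iso P Q) \/
        (exists2 Q, ordinary_example Q & oparallelism_iso P (oriented_cover Q))].
Proof.
split.
- exact: ordinary_example_parallelism.
- exact: oriented_example_parallelism.
- exact: reducible_parallelism.
- exact: reducible_oriented_parallelism.
Qed.
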